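(* Let $\mathbf{S}_0\in H^{5/2}(\mathbb{S};\mathbb{S}^2)$ and, for odd $N\in2\mathbb{N}+1$, let $\mathbf{S}_{N,0}:\mathbb{S}_N\to\mathbb{S}^2$ be its sampling $\mathbf{S}_{N,0}(z_k)=\mathbf{S}_0(z_k)$, $z_k=e^{2\pi i k/N}$. Let $\mathbf{S}_N:[0,\infty)\times\mathbb{S}_N\to\mathbb{S}^2$ be the unique global solution of $\partial_t\mathbf{S}_N=\mathbf{S}_N\times|\nabla|_N\mathbf{S}_N$ with $\mathbf{S}_N|_{t=0}=\mathbf{S}_{N,0}$, and let $\widetilde{\mathbf{S}}_N(t)$ be its trigonometric interpolation. Then there is a time $T_*=T_*(\|\mathbf{S}_0\|_{H^{5/2}})>0$ such that the following holds. For any $T>0$ and $\varepsilon>0$, any limiting weak solution of (HWM) on $[0,T]$ obtained as a weak-$*$ limit in $L^\infty([0,T];H^{1/2}(\mathbb{S}))\cap W^{1,\infty}([0,T];H^{-1/2-\varepsilon}(\mathbb{S}))$ of a subsequence of $(\widetilde{\mathbf{S}}_N)_N$ as $N\to\infty$ coincides, up to time $T_*$ (i.e. on $[0,T]\cap[0,T_* )$), with the unique strong solution $\mathbf{S}\in C^0([0,T_* );H^{5/2})$ of (HWM) with initial datum $\mathbf{S}(0)=\mathbf{S}_0$. Furthermore, for any compact interval $I\subset[0,T_* )$, we have $$\sup_{t\in I}\|\widetilde{\mathbf{S}}_N(t)-\mathbf{S}(t)\|_{H^{1/2}}\le\frac{C}{N}$$ with some constant $C=C(I,\|\mathbf{S}_0\|_{H^{5/2}})>0$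 (independent of $N$).
   Context: $\mathbb{S}=\{z\in\mathbb{C}:|z|=1\}\simeq\mathbb{T}=\mathbb{R}/2\pi\mathbb{Z}$ via $x\mapsto e^{ix}$; $\mathbb{S}^2\subset\mathbb{R}^3$ is the standard unit two-sphere; $\times$ is the cross product in $\mathbb{R}^3$. $|\nabla|=\sqrt{-\Delta}$ is the Fourier multiplier $|\nabla|z^k=|k|z^k$ on $\mathbb{S}$, and $H^s=H^s(\mathbb{S})$ are the usual $L^2$-based Sobolev spaces; $H^s(\mathbb{S};\mathbb{S}^2)$ denotes maps in $H^s(\mathbb{S};\mathbb{R}^3)$ with values in $\mathbb{S}^2$. The half-wave maps equation is $$\text{(HWM)}\qquad\partial_t\mathbf{S}=\mathbf{S}\times|\nabla|\mathbf{S}.$$ Lattice: $N=2n+1$, $\mathbb{S}_N=\{z_0,\dots,z_{N-1}\}$, $z_k=e^{2\pi i k/N}$. For functions $f$ on $\mathbb{S}_N$ (componentwise for vector-valued functions), $$(|\nabla|_Nf)(z_k)=\frac{2}{N}\sum_{\ell=0,\,\ell\ne k}^{N-1}\frac{f(z_k)-f(z_\ell)}{|z_k-z_\ell|^2} .$$ Trigonometric interpolation: $\widetilde f(z)=\sum_{k=-n}^nc_kz^k$ with $c_k=\frac1N\sum_{j=0}^{N-1}f(z_j)\overline{z_j}^{\,k}$, the unique trigonometric polynomial of degree at most $n$ agreeing with $f$ on $\mathbb{S}_N$ (componentwise for vector-valued $f$). Weak solution: let $\mathbf{S}_0\in H^{1/2}(\mathbb{S};\mathbb{S}^2)$ and $T>0$.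 A map $\mathbf{S}:[0,T]\times\mathbb{S}\to\mathbb{S}^2$ is a weak solution of (HWM) with initial datum $\mathbf{S}_0$ if: (i) $\mathbf{S}\in L^\infty([0,T];H^{1/2}(\mathbb{S}))$ and $\partial_t\mathbf{S}\in L^\infty([0,T];H^{-1/2}(\mathbb{S}))$; (ii) for every $\boldsymbol\phi\in H^{1/2}(\mathbb{S};\mathbb{R}^3)$, $\langle\boldsymbol\phi,\partial_t\mathbf{S}(t)\rangle=\langle|\nabla|^{1/2}\mathbf{S}(t),|\nabla|^{1/2}(\boldsymbol\phi\times\mathbf{S}(t))\rangle$ for a.e. $t\in[0,T]$ (the right-hand side being understood, where needed, as the continuous extension in $\boldsymbol\phi\in H^{1/2}$ from smooth $\boldsymbol\phi$); (iii) $\mathbf{S}(0,x)=\mathbf{S}_0(x)$ for a.e. $x\in\mathbb{S}$. For data as in the theorem, $\sup_N\|\widetilde{\mathbf{S}}_{N,0}\|_{H^{1/2}}<\infty$, and for each $T,\varepsilon>0$ the sequence $(\widetilde{\mathbf{S}}_N)$ has subsequences converging weakly-$*$ in $L^\infty([0,T];H^{1/2}(\mathbb{S}))\cap W^{1,\infty}([0,T];H^{-1/2-\varepsilon}(\mathbb{S}))$ to a weak solution of (HWM) with values in $\mathbb{S}^2$; these are the limiting solutions referred to in the claim. *)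

(* Defs.v *)
From HB Require Import structures.
From mathcomp Require Import all_boot all_order all_algebra.
From mathcomp Require Import all_classical all_reals all_analysis.
From mathcomp.real_closed Require Import complex.

Set Implicit Arguments.
Unset Strict Implicit.
Unset Printing Implicit Defensive.

Import Order.TTheory GRing.Theory Num.Theory numFieldNormedType.Exports.

Local Open Scope classical_set_scope.
Local Open Scope ring_scope.
Local Open Scope complex_scope.

Section HalfWaveMaps.
Context {R : realType}.

Definition circle := {z : R[i] | `|z| == 1}.

Lemma expi_subproof (x : R) : `|cos x +i* sin x| == 1 :> R[i].
Proof. by rewrite normc_def /= cos2Dsin2 sqrtr1. Qed.

(* e^{ix}; this identifies R / 2 pi Z with the circle. *)
Definition expi (x : R) : circle :=
  exist (fun z : R[i] => `|z| == 1) (cos x +i* sin x) (expi_subproof x).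

Definition toC (u : 'rV[R]_3) : 'rV[R[i]]_3 := map_mx (real_complex R) u.

Definition sphere (u : 'rV[R]_3) : Prop := \sum_(j < 3) u 0 j ^+ 2 = 1.

Definition cross (u v : 'rV[R]_3) : 'rV[R]_3 :=
  \row_j (u 0 (j + 1) * v 0 (j + 2) - u 0 (j + 2) * v 0 (j + 1)).

Definition integralC (D : set R) (g : R -> R[i]) : R[i] :=
  (\int[lebesgue_measure]_(x in D) complex.Re (g x)) +i*
  (\int[lebesgue_measure]_(x in D) complex.Im (g x)).

(* A vector-valued distribution on the circle is identified with its family of
   Fourier coefficients. *)
Definition coefs := int -> 'rV[R[i]]_3.

(* Normalised measure dx / (2 pi); the kernel conj(e^{ix})^k is e^{-ikx}. *)
Definition fourierC (f : circle -> 'rV[R[i]]_3) : coefs := fun k =>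
  \row_j (((2 * pi)^-1)%:C *
    integralC `[0, 2 * pi]
      (fun x => f (expi x) 0 j * ((val (expi x))^* ) ^ k)).

Definition fourier (f : circle -> 'rV[R]_3) : coefs :=
  fourierC (fun z => toC (f z)).

(* The H^s norm, with weights (1 + k^2)^s; it is +oo outside H^s. *)
Definition Hnorm (s : R) (c : coefs) : \bar R :=
  ((\esum_(k in [set: int])
     ((1 + (k%:~R : R) ^+ 2) `^ s *
      \sum_(j < 3) Normc.normc (c k 0 j) ^+ 2)%:E) `^ 2^-1)%E.

(* Characterises the coefficients of R^3-valued distributions. *)
Definition real_coefs (c : coefs) : Prop :=
  forall k j, c (- k) 0 j = (c k 0 j)^*.

Definition in_L2 (f : circle -> 'rV[R]_3) : Prop :=
  forall j : 'I_3,
    measurable_fun [set: R] (fun x => f (expi x) 0 j) /\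
    (\int[lebesgue_measure]_(x in `[0%R, (2 * pi)%R : R])
       ((f (expi x) 0 j) ^+ 2)%:E < +oo)%E.

Definition in_H (s : R) (f : circle -> 'rV[R]_3) : Prop :=
  in_L2 f /\ (Hnorm s (fourier f) < +oo)%E.

(* Elements of H^s(S; S^2) for s > 1/2, through their continuous
   representatives, so that pointwise sampling makes sense. *)
Definition in_HS2 (s : R) (f : circle -> 'rV[R]_3) : Prop :=
  [/\ continuous (fun x : R => f (expi x)), forall z, sphere (f z) & in_H s f].

Definition smooth (f : circle -> 'rV[R]_3) : Prop :=
  forall (m : nat) (x : R), derivable (derive1n m (fun y => f (expi y))) x 1.

Definition absgrad (s : R) (c : coefs) : coefs := fun k =>
  ((`|k|%N%:R : R) `^ s)%:C *: c k.

(* The real L^2 pairing for the normalised measure dx / (2 pi), extended to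
   H^s x H^{-s}; the series over Z is absolutely convergent there and is
   summed symmetrically. *)
Definition pairing (a b : coefs) : R :=
  lim ((fun n : nat => \sum_(i < n.*2.+1)
          \sum_(j < 3) complex.Re ((a (i%:Z - n%:Z) 0 j)^* *
                                   b (i%:Z - n%:Z) 0 j)) @ \oo).

Definition node (n : nat) (k : 'I_n.*2.+1) : circle :=
  expi (2 * pi * k%:R / (n.*2.+1)%:R).

Definition lattice_absgrad (n : nat) (f : 'I_n.*2.+1 -> 'rV[R]_3) :
    'I_n.*2.+1 -> 'rV[R]_3 := fun k =>
  (2 / (n.*2.+1)%:R) *: \sum_(l < n.*2.+1 | l != k)
    (Normc.normc (val (node k) - val (node l)) ^- 2 *: (f k - f l)).

(* C^3-valued by type; for R^3-valued data its values are real. *)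
Definition interp (n : nat) (f : 'I_n.*2.+1 -> 'rV[R]_3) (z : circle) :
    'rV[R[i]]_3 :=
  let c (k : int) := ((n.*2.+1)%:R)^-1 *:
    \sum_(j < n.*2.+1) (((val (node j))^* ) ^ k *: toC (f j)) in
  \sum_(i < n.*2.+1) (val z ^ (i%:Z - n%:Z) *: c (i%:Z - n%:Z)).

(* [l] is the derivative at [t] of [f] restricted to [D] (one-sided at an
   endpoint of an interval). *)
Definition has_deriv_on (D : set R) (f : R -> 'rV[R]_3) (t : R)
    (l : 'rV[R]_3) : Prop :=
  h^-1 *: (f (t + h) - f t) @[h --> within [set h | D (t + h)] 0^'] --> l.

Definition lattice_solution (n : nat) (F0 : 'I_n.*2.+1 -> 'rV[R]_3)
    (F : R -> 'I_n.*2.+1 -> 'rV[R]_3) : Prop :=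
  [/\ forall t k, 0 <= t -> sphere (F t k),
      forall k, F 0 k = F0 k &
      forall t k, 0 <= t ->
        has_deriv_on `[0, +oo[ (fun s => F s k) t
          (cross (F t k) (lattice_absgrad (F t) k))].

(* The H^{5/2}-continuity in time makes both sides of the equation continuous
   in time with values in H^{3/2}, in which space the time derivative is
   taken; [g] is the function |nabla| S(t). *)
Definition strong_solution (T : R) (S0 : circle -> 'rV[R]_3)
    (S : R -> circle -> 'rV[R]_3) : Prop :=
  [/\ forall t, 0 <= t < T -> in_HS2 (5 / 2) (S t),
      forall t, 0 <= t < T ->
        Hnorm (5 / 2) (fun k => fourier (S s) k - fourier (S t) k)
          @[s --> within `[0, T[ (nbhs t)] --> (0 : \bar R)%E,
      forall t, 0 <= t < T ->
        exists g : circle -> 'rV[R]_3,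
          [/\ in_L2 g, fourier g = absgrad 1 (fourier (S t)) &
           Hnorm (3 / 2) (fun k =>
               (h^-1)%:C *: (fourier (S (t + h)) k - fourier (S t) k)
               - fourier (fun z => cross (S t z) (g z)) k)
             @[h --> within [set h | 0 <= t + h < T] 0^'] --> (0 : \bar R)%E] &
      forall z, S 0 z = S0 z].

(* By Pettis' theorem, measurability of the Fourier coefficients is strong
   measurability into the separable space H^s. *)
Definition measurable_in_time (T : R) (u : R -> coefs) : Prop :=
  forall (k : int) (j : 'I_3),
    measurable_fun `[0, T] (fun t => complex.Re (u t k 0 j)) /\
    measurable_fun `[0, T] (fun t => complex.Im (u t k 0 j)).

Definition in_Linfty (T s : R) (u : R -> coefs) : Prop :=
  measurable_in_time T u /\
  exists M : R, {ae lebesgue_measure, forall t, t \in `[0, T] ->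
    real_coefs (u t) /\ (Hnorm s (u t) <= M%:E)%E}.

Definition in_L1 (T s : R) (g : R -> coefs) : Prop :=
  [/\ measurable_in_time T g,
      forall t, t \in `[0, T] -> real_coefs (g t) /\ (Hnorm s (g t) < +oo)%E &
      (\int[lebesgue_measure]_(t in `[0%R, T]) Hnorm s (g t) < +oo)%E].

(* Integral form of: [du] is the weak time derivative of [u], and [u] is the
   representative which is continuous in time with values in distributions. *)
Definition time_derivative (T : R) (u du : R -> coefs) : Prop :=
  forall t, t \in `[0, T] -> forall (k : int) (j : 'I_3),
    u t k 0 j = u 0 k 0 j + integralC `[0, t] (fun s => du s k 0 j).

(* Weak-* convergence in L^oo([0, T]; H^s), the dual of L^1([0, T]; H^{-s}). *)
Definition weakstar_Linfty (T s : R) (u_ : nat -> R -> coefs) (u : R -> coefs) :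
    Prop :=
  [/\ forall i, in_Linfty T s (u_ i),
      in_Linfty T s u &
      forall g, in_L1 T (- s) g ->
        (\int[lebesgue_measure]_(t in `[0, T]) pairing (g t) (u_ i t))
          @[i --> \oo] -->
        \int[lebesgue_measure]_(t in `[0, T]) pairing (g t) (u t)].

Definition weakstar_W1infty (T s : R) (u_ : nat -> R -> coefs)
    (u : R -> coefs) : Prop :=
  weakstar_Linfty T s u_ u /\
  exists (du_ : nat -> R -> coefs) (du : R -> coefs),
    [/\ forall i, time_derivative T (u_ i) (du_ i),
        time_derivative T u du &
        weakstar_Linfty T s du_ du].

(* < |nabla|^{1/2} f, |nabla|^{1/2} (psi x f) > *)
Definition hwm_form (f psi : circle -> 'rV[R]_3) : R :=
  pairing (absgrad 2^-1 (fourier f))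
          (absgrad 2^-1 (fourier (fun z => cross (psi z) (f z)))).

(* [l] is the value at [phi] of the H^{1/2}-continuous extension of the
   functional [B], originally defined on smooth functions. *)
Definition extension_value (B : (circle -> 'rV[R]_3) -> R)
    (phi : circle -> 'rV[R]_3) (l : R) : Prop :=
  forall e : R, 0 < e -> exists2 d : R, 0 < d &
    forall psi, smooth psi ->
      (Hnorm 2^-1 (fun k => (fourier psi k - fourier phi k)%R) < d%:E)%E ->
      `|B psi - l| < e.

Definition weak_solution (T : R) (S0 : circle -> 'rV[R]_3)
    (S : R -> circle -> 'rV[R]_3) : Prop :=
  [/\ forall t, t \in `[0, T] -> (forall z, sphere (S t z)) /\ in_L2 (S t),
      in_Linfty T 2^-1 (fun t => fourier (S t)),
      exists dS : R -> coefs,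
        [/\ time_derivative T (fun t => fourier (S t)) dS,
            in_Linfty T (- 2^-1) dS &
            forall phi, in_H 2^-1 phi ->
              {ae lebesgue_measure, forall t, t \in `[0, T] ->
                extension_value (hwm_form (S t)) phi
                  (pairing (fourier phi) (dS t))}] &
      {ae lebesgue_measure, forall x : R, S 0 (expi x) = S0 (expi x)}].

End HalfWaveMaps.

Arguments circle : clear implicits.
Arguments coefs : clear implicits.

(* Main.v *)
(* Strong solution.  On Fourier coefficients the equation reads c_k' = sum_{m+l=k} |l| c_m x c_l.
   The flux of sum |k| v(k) |c_k|^2 is a sum over p + q + r = 0 of determinants, which are
   antisymmetric in p and r; this trades the weight for its commutator |p||r| (v(p) - v(r)) and, for
   v(k) = k^4, closes the H^{5/2} estimate, because sum |k|^{3/2} |c_k| is controlled by H^{5/2}.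
   Hence the Galerkin truncations stay bounded in H^{5/2} on a time interval depending only on the
   norm of the datum.  The same antisymmetry at the L^2 level makes them a Cauchy sequence, and makes
   them converge to any given strong solution, which gives existence and uniqueness at once.

   Convergence of the lattice.  |nabla|_N is diagonal in e^{ijx}, with eigenvalue |j| - j^2/N for
   |j| <= N/2.  Let s be the sampled strong solution and D = S_N - s; then
   D' = S_N x |nabla|_N D + D x |nabla|_N s + s x (|nabla|_N s - |nabla| s).  Antisymmetry bounds the
   first two terms in the energy |D|^2 + <D, |nabla|_N D> by the oscillation of s and of |nabla|_N s,
   the last one is a consistency error of squared size O(1/N), and Gronwall's lemma gives D.
   Aliasing and truncation errors of the interpolation are of the same order.

   Weak limits.  Weak-* convergence of the time derivatives, tested on single modes over [0, tau],
   gives convergence of every coefficient at every time; the error bound then identifies the limit. *)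

Require Import Defs.
From HB Require Import structures.
From mathcomp Require Import all_boot all_order all_algebra.
From mathcomp Require Import all_classical all_reals all_analysis.
From mathcomp.real_closed Require Import complex.
From mathcomp Require Import measurable_realfun ring lra zify.

Set Implicit Arguments.
Unset Strict Implicit.
Unset Printing Implicit Defensive.

Import Order.TTheory GRing.Theory Num.Theory numFieldNormedType.Exports.

Local Open Scope classical_set_scope.
Local Open Scope ring_scope.
Local Open Scope complex_scope.

(** * Calculus on a compact interval *)

(** The equation loses one derivative, so no plain contraction argument closes: each estimate has to
    win the derivative back from the antisymmetry of the triple product. For this reason bounds are
    proved on finite frequency windows, where antisymmetry is algebra on finite sums, and are then
    passed to the limit. The truncations do not take values in the sphere. The constraint is
    recovered in the limit, because a truncation changes |S|^2 only through the modes that it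
    discards. A limit that is merely bounded in H^{5/2} is only weakly continuous in time. Strong
    continuity comes from cut-off energies whose variation is bounded uniformly in the cutoff, which
    forbids a sudden appearance of energy at high frequency. On the lattice the deviation j^2/N of
    the eigenvalues costs one more derivative and gains 1/N. Energies are sums over N nodes, so a
    pointwise accuracy 1/N reads as a squared energy of order 1/N; the factor 1/N of the discrete
    transform then gives the rate 1/N in H^{1/2}. All constants are explicit functions of a bound on
    the H^{5/2} energy, so that lifespan and rate depend on the datum through its norm only. *)

Section Calculus.
Context {R : realType}.

(** Continuity up to the endpoints and a derivative inside are what the mean value theorem consumes.
    Nothing is claimed outside [0, T], so functions defined by integrals or by limits on [0, T]
    qualify. *)
Definition D1 (T : R) (f df : R -> R) : Prop :=
  {within `[0, T], continuous f} /\
  forall t : R, 0 < t < T -> is_derive t 1 f (df t).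

Lemma D1_cst T (a : R) : D1 T (fun=> a) (fun=> 0).
Proof. by split=> [|t _]; [exact: cst_continuous|exact: is_derive_cst]. Qed.

Lemma D1_add T f df g dg : D1 T f df -> D1 T g dg ->
  D1 T (fun t => f t + g t) (fun t => df t + dg t).
Proof.
move=> [cf hf] [cg hg]; split=> [x|t tT]; first by apply: cvgD; [exact: cf|exact: cg].
by have := hf _ tT; have := hg _ tT => ? ?; apply: is_deriveD.
Qed.

Lemma D1_mul T f df g dg : D1 T f df -> D1 T g dg ->
  D1 T (fun t => f t * g t) (fun t => df t * g t + f t * dg t).
Proof.
move=> [cf hf] [cg hg]; split=> [x|t tT]; first by apply: cvgM; [exact: cf|exact: cg].
have := hf _ tT; have := hg _ tT => ? ?.
apply: (is_derive_eq (is_deriveM (f := f) (g := g) _ _)).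
by rewrite addrC [_ *: _]mulrC [X in _ + X]/GRing.scale /=.
Qed.

Lemma D1_ext T f df g dg : (forall t : R, f t = g t) ->
  (forall t : R, 0 < t < T -> df t = dg t) -> D1 T f df -> D1 T g dg.
Proof.
move=> /funext -> e [cf hf]; split=> // t tT.
by rewrite -e//; exact: hf.
Qed.

Lemma D1_scale T (a : R) f df : D1 T f df ->
  D1 T (fun t => a * f t) (fun t => a * df t).
Proof.
move=> hf; apply: D1_ext (D1_mul (D1_cst T a) hf) => //= t _.
by rewrite mul0r add0r.
Qed.

Lemma D1_opp T f df : D1 T f df -> D1 T (fun t => - f t) (fun t => - df t).
Proof.
move=> hf; apply: D1_ext (D1_scale (-1) hf) => //= t; by rewrite mulN1r.
Qed.

Lemma D1_sub T f df g dg : D1 T f df -> D1 T g dg ->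
  D1 T (fun t => f t - g t) (fun t => df t - dg t).
Proof. by move=> hf hg; exact: D1_add (D1_opp hg). Qed.

Lemma D1_sum T (I : Type) (r : seq I) (P : pred I) (f df : I -> R -> R) :
  (forall i, P i -> D1 T (f i) (df i)) ->
  D1 T (fun t => \sum_(i <- r | P i) f i t) (fun t => \sum_(i <- r | P i) df i t).
Proof.
move=> h; elim: r => [|i r IH].
  by apply: D1_ext (D1_cst T 0) => [t|t _]; rewrite big_nil.
have [Pi|Pi] := boolP (P i).
  by apply: D1_ext (D1_add (h i Pi) IH) => [t|t _]; rewrite big_cons Pi.
by apply: D1_ext IH => [t|t _]; rewrite big_cons (negbTE Pi).
Qed.

Lemma D1_sqr T f df : D1 T f df -> D1 T (fun t => f t ^+ 2) (fun t => 2 * f t * df t).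
Proof.
by move=> hf; apply: D1_ext (D1_mul hf hf) => [t|t _]; rewrite ?expr2//; ring.
Qed.

Lemma D1_id T : D1 T id (fun=> 1).
Proof. by split=> [|t _]; [apply: continuous_subspaceT => x; exact: cvg_id|exact: is_derive_id]. Qed.

Lemma D1_glob T (f df : R -> R) : (forall t : R, is_derive t 1 f (df t)) -> D1 T f df.
Proof.
move=> h; split=> // ; apply: continuous_subspaceT => t.
by apply/differentiable_continuous/derivable1_diffP; have [] := h t.
Qed.

Lemma D1_expR T (a : R) : D1 T (fun t => expR (a * t)) (fun t => a * expR (a * t)).
Proof.
apply: D1_glob => t.
have h : is_derive t (1:R) (fun t : R => a * t) a.
  by apply: is_derive_eq; rewrite [_ *: _]mulr1.
by apply: (is_derive_eq (is_derive1_comp (is_derive_expR _) h)); rewrite mulrC.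
Qed.

Lemma D1_sub_T T T' f df : T' <= T -> D1 T f df -> D1 T' f df.
Proof.
move=> TT [cf hf]; split.
  apply: continuous_subspaceW cf => x /=; rewrite !in_itv/= => /andP[-> h] /=.
  exact: le_trans TT.
by move=> t /andP[t0 tT]; apply: hf; rewrite t0/=; exact: lt_le_trans TT.
Qed.

Lemma D1_nincr T f df : D1 T f df -> (forall t : R, 0 < t < T -> df t <= 0) ->
  forall s t : R, 0 <= s -> s <= t -> t <= T -> f t <= f s.
Proof.
move=> [cf hf] h s t s0 st tT.
apply: (@ler0_derive1_nincr R f 0 T) => // x; rewrite in_itv/= => xT.
  by have [] := hf _ xT.
by rewrite derive1E; have [_ ->] := hf _ xT; exact: h.
Qed.

Lemma D1_le T f df g dg : D1 T f df -> D1 T g dg ->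
  (forall t : R, 0 < t < T -> df t <= dg t) ->
  forall s t : R, 0 <= s -> s <= t -> t <= T -> f t - f s <= g t - g s.
Proof.
move=> hf hg h s t s0 st tT.
have := D1_nincr (D1_sub hf hg) _ s0 st tT.
have {}h u : 0 < u < T -> df u - dg u <= 0 by move=> /h; rewrite subr_le0.
by move=> /(_ h); lra.
Qed.

Lemma D1_dom T f df g dg : D1 T f df -> D1 T g dg ->
  (forall t : R, 0 < t < T -> `|df t| <= dg t) ->
  forall s t : R, 0 <= s -> s <= t -> t <= T -> `|f t - f s| <= g t - g s.
Proof.
move=> hf hg h s t s0 st tT.
rewrite ler_norml; apply/andP; split.
  have := D1_le (D1_opp hf) hg _ s0 st tT.
  have h' u : 0 < u < T -> - df u <= dg u.
    by move=> /h; apply: le_trans; rewrite -normrN ler_norm.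
  by move=> /(_ h'); lra.
apply: (D1_le hf hg) => // u /h; apply: le_trans; exact: ler_norm.
Qed.

Lemma D1_lip T f df (L : R) : D1 T f df -> (forall t : R, 0 < t < T -> `|df t| <= L) ->
  forall s t : R, 0 <= s -> s <= t -> t <= T -> `|f t - f s| <= L * (t - s).
Proof.
move=> hf h s t s0 st tT.
have -> : L * (t - s) = L * id t - L * id s by rewrite mulrBr.
by apply: (D1_dom hf (D1_scale L (D1_id T))) => // u /h; rewrite mulr1.
Qed.

Lemma lip_continuous T (phi : R -> R) (M : R) :
  (forall s t : R, 0 <= s -> s <= t -> `|phi t - phi s| <= M * (t - s)) ->
  {within `[0, T], continuous phi}.
Proof.
move=> h; apply/subspace_continuousP => x; rewrite /= in_itv/= => /andP[x0 xT].
have M0 : 0 <= M by have := h 0 1 (lexx 0) ler01; rewrite subr0 mulr1; apply: le_trans.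
apply/cvgrPdist_le => e e0; near=> y.
have y0 : 0 <= y.
  have : y \in `[0, T] by near: y; apply: withinT.
  by rewrite in_itv/= => /andP[].
have ey : (M + 1) * `|x - y| <= e.
  rewrite -ler_pdivlMl ?ltr_pwDr// mulrC.
  near: y; apply/nbhs_ballP; exists (e / (M + 1)) => /=.
    by rewrite divr_gt0// ltr_pwDr.
  by move=> z; rewrite /ball /= => /ltW.
apply: le_trans ey; have [xy|yx] := leP x y.
  rewrite distrC; apply: le_trans (h _ _ x0 xy) _.
  by rewrite -[`|x - y|]normrN opprB ger0_norm ?subr_ge0// ler_wpM2r ?subr_ge0// lerDl.
apply: le_trans (h _ _ y0 (ltW yx)) _.
have xy0 : 0 <= x - y by rewrite subr_ge0 ltW.
by rewrite ger0_norm// ler_wpM2r// lerDl.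
Unshelve. all: by end_near. Qed.

(** Quantitative completeness: the Cauchy modulus survives as the rate of convergence. *)
Lemma cauchy_rate (u e : nat -> R) : e @ \oo --> 0 ->
  (forall m n, (m <= n)%N -> `|u n - u m| <= e m) ->
  u @ \oo --> lim (u @ \oo) /\ forall n, `|lim (u @ \oo) - u n| <= e n.
Proof.
move=> e0 h.
have cu : cvg (u @ \oo).
  apply/cauchy_cvgP/cauchy_exP => eps eps0.
  have [N _ hN] : \forall n \near \oo, `|0 - e n| < eps by move/cvgrPdist_lt : e0; exact.
  exists (u N), N => // n /= Nn; rewrite /ball /= distrC.
  have eN : 0 <= e N := le_trans (normr_ge0 _) (h _ _ (leqnn N)).
  apply: le_lt_trans (h _ _ Nn) _.
  by have := hN N (leqnn N); rewrite sub0r normrN ger0_norm.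
split=> // n.
have : `|u m - u n| @[m --> \oo] --> `|lim (u @ \oo) - u n|.
  by apply: cvg_norm; apply: cvgB => //; exact: cvg_cst.
move=> /cvgr_to_le; apply; near=> m; apply: h; near: m; exact: nbhs_infty_ge.
Unshelve. all: by end_near. Qed.

Lemma geo_cvg0 (A : R) : (fun k : nat => A * 2^-1 ^+ k) @ \oo --> 0.
Proof.
rewrite -[X in _ --> X](mulr0 A); apply: cvgM; first exact: cvg_cst.
by apply: cvg_expr; rewrite ger0_norm ?invr_ge0// invf_lt1// ltr1n.
Qed.

Lemma cvg0_le0 (a : R) (e : nat -> R) : e @ \oo --> 0 -> (forall k, a <= e k) -> a <= 0.
Proof. by move=> e0 h; apply: (cvgr_to_ge e0); near=> k. Unshelve. all: by end_near. Qed.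

Lemma geo_cauchy (u : nat -> R) (A : R) :
  (forall k, `|u k.+1 - u k| <= A * 2^-1 ^+ k) ->
  u @ \oo --> lim (u @ \oo) /\ forall n, `|lim (u @ \oo) - u n| <= 2 * A * 2^-1 ^+ n.
Proof.
move=> h; apply: cauchy_rate; first exact: geo_cvg0.
move=> m n mn.
have A0 : 0 <= A by have := h 0; rewrite expr0 mulr1; apply: le_trans.
(* The geometric partial sum is kept exact so that the induction on [n - m] closes. *)
apply: (@le_trans _ _ (2 * A * (2^-1 ^+ m - 2^-1 ^+ n))); last first.
  by rewrite ler_wpM2l ?mulr_ge0// gerBl exprn_ge0// invr_ge0.
rewrite -(subnK mn); elim: (n - m)%N => [|k IH]; first by rewrite add0n !subrr normr0 mulr0.
rewrite addSn -[u _ - u m](subrKA (u (k + m)%N)).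
apply: le_trans (ler_normD _ _) _; have := h (k + m)%N.
rewrite exprS; set z := 2^-1 ^+ (k + m) in IH *; move=> h'.
have := lerD h' IH; lra.
Qed.

Lemma int_D1 (phi : R -> R) : (forall T, {within `[0, T], continuous phi}) ->
  forall T, D1 T (fun t => \int[lebesgue_measure]_(s in `[0, t]) phi s) phi.
Proof.
(* [T] may be negative; [|T|] provides an interval on which to integrate. *)
move=> c T; apply: (@D1_sub_T `|T|); first exact: ler_norm.
have iT U : lebesgue_measure.-integrable `[0, U] (EFin \o phi).
  by apply: continuous_compact_integrable => //; exact: segment_compact.
split; first exact: (@parameterized_integral_continuous R 0 `|T| phi).
move=> t /andP[t0 tT].
have T0 : 0 < `|T| := lt_trans t0 tT.
have ct : {for t, continuous phi}.
  by have /(continuous_within_itvP _ T0)[+ _ _] := c `|T|; apply; rewrite in_itv/= t0.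
have [d e] := @continuous_FTC1_closed R phi 0 t `|T| tT (iT _) t0 ct.
by rewrite derive1E in e; exact: (DeriveDef d e).
Qed.

Lemma ler_sum_card (I : finType) (F : I -> R) (a : R) : (forall j, F j <= a) ->
  \sum_j F j <= #|I|%:R * a.
Proof. by move=> h; rewrite mulr_natl -sumr_const; apply: ler_sum => j _. Qed.

(** Picard iteration contracts in a norm weighted by a growing exponential, hence converges on the
    whole half-line at once, without gluing local solutions. *)
Lemma picard (I : finType) (g : (I -> R) -> I -> R) (x0 : I -> R) (L K : R) :
  0 <= L -> (forall x y i, `|g x i - g y i| <= L * \sum_j `|x j - y j|) ->
  (forall x i, `|g x i| <= K) ->
  exists x : R -> I -> R, (forall i, x 0 i = x0 i) /\
    forall T i, D1 T (fun t => x t i) (fun t => g (x t) i).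
Proof.
move=> L0 gL gK.
have [noI|[i0]] : (#|I| = 0)%N \/ inhabited I.
  by case: (pickP (fun _ : I => true)) => [i _|/eq_card0 ->]; [right|left].
  have abs (i : I) : False by have /card0_eq/(_ i) := noI; rewrite inE.
  by exists (fun _ => x0); split=> // T i; have := abs i.
have K0 : 0 <= K := le_trans (normr_ge0 _) (gK x0 i0).
(* The weight exp(2 La t) grows at twice the Lipschitz rate of the field, so that each iteration
   halves the distance. The added 1 gives [t <= La * t], which starts the induction. *)
pose La := L * #|I|%:R + 1.
have La0 : 0 < La by rewrite ltr_pwDr// mulr_ge0.
(* A class of curves stable under [J] and under pointwise limits, on which the integrands are
   continuous. *)
pose Kl (x : R -> I -> R) := forall i (s t : R), 0 <= s -> s <= t ->
  `|x t i - x s i| <= K * (t - s).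
pose J (x : R -> I -> R) t i :=
  x0 i + \int[lebesgue_measure]_(s in `[0, t]) g (x s) i.
have gc x : Kl x -> forall i T, {within `[0, T], continuous (fun s => g (x s) i)}.
  move=> hx i T; apply: (@lip_continuous _ _ (L * (#|I|%:R * K))) => s t s0 st.
  apply: le_trans (gL _ _ _) _; rewrite -!mulrA ler_wpM2l//.
  by apply: ler_sum_card => j; exact: hx.
have JD x : Kl x -> forall i T, D1 T (fun t => J x t i) (fun t => g (x t) i).
  move=> hx i T; apply: D1_ext (D1_add (D1_cst T (x0 i)) (int_D1 (gc _ hx i) T)) => // t _.
  by rewrite add0r.
have J0 x i : J x 0 i = x0 i by rewrite /J set_itv1 Rintegral_set1 addr0.
have KJ x : Kl x -> Kl (J x).
  by move=> hx i s t s0 st; apply: (D1_lip (JD x hx i t)).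
pose X k := iter k J (fun _ => x0).
have KX k : Kl (X k).
  elim: k => [|k IH]; last exact: KJ.
  by move=> i s t s0 st; rewrite subrr normr0 mulr_ge0// subr_ge0.
pose E t := expR (2 * La * t).
have DE T : D1 T E (fun t => 2 * La * E t) by exact: D1_expR.
have E0 : E 0 = 1 by rewrite /E mulr0 expR0.
have E_ge0 t : 0 <= E t by exact: expR_ge0.
have Jdiff x y (a : R) : 0 <= a -> Kl x -> Kl y ->
    (forall t i, 0 <= t -> `|x t i - y t i| <= a * E t) ->
    forall t i, 0 <= t -> `|J x t i - J y t i| <= a / 2 * E t.
  move=> a0 hx hy hxy t i t0.
  have hd := D1_sub (JD x hx i t) (JD y hy i t).
  have := D1_dom hd (D1_scale (a / 2) (DE t)) _ (lexx 0) t0 (lexx t).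
  rewrite !J0 subrr subr0 E0 mulr1 => H; apply: le_trans (H _) _; last first.
    by rewrite gerBl divr_ge0.
  move=> s /andP[s0 _]; apply: le_trans (gL _ _ _) _.
  apply: (@le_trans _ _ (L * (#|I|%:R * (a * E s)))).
    rewrite ler_wpM2l//.
    by apply: ler_sum_card => j; exact: hxy (ltW s0).
  rewrite mulrA (_ : a / 2 * _ = La * (a * E s)); last by field.
  by rewrite ler_wpM2r ?mulr_ge0// lerDl.
have step k : forall t i, 0 <= t -> `|X k.+1 t i - X k t i| <= K * 2^-1 ^+ k * E t.
  elim: k => [|k IH] t i t0.
    rewrite expr0 mulr1 /=; have := KX 1%N i 0 t (lexx 0) t0.
    rewrite /= J0 subr0 => h; apply: le_trans h _; rewrite ler_wpM2l//.
    apply: le_trans (expR_ge1Dx _); apply: (@le_trans _ _ (La * t)).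
      by rewrite ler_peMl// lerDr mulr_ge0.
    by rewrite -mulrA; have : 0 <= La * t by [rewrite mulr_ge0// ltW]; lra.
  have := Jdiff _ _ (K * 2^-1 ^+ k) _ (KX k.+1) (KX k) IH t i t0.
  rewrite exprS mulrCA [2^-1 * _]mulrC; apply.
  by rewrite mulr_ge0// exprn_ge0// invr_ge0.
pose x t i := lim (X k t i @[k --> \oo]).
have xX t i : 0 <= t -> X k t i @[k --> \oo] --> x t i /\
    forall k, `|x t i - X k t i| <= 2 * (K * E t) * 2^-1 ^+ k.
  by move=> t0; apply: geo_cauchy => k; rewrite mulrAC; exact: step.
have Kx : Kl x.
  move=> i s t s0 st; have [h1 _] := xX t i (le_trans s0 st); have [h2 _] := xX s i s0.
  have : `|X k t i - X k s i| @[k --> \oo] --> `|x t i - x s i|.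
    by apply: cvg_norm; exact: cvgB.
  by move=> /cvgr_to_le; apply; near=> k; exact: KX.
have xJ t i : 0 <= t -> x t i = J x t i.
  move=> t0; apply/eqP; rewrite -subr_eq0 -normr_le0.
  apply: (cvg0_le0 (geo_cvg0 (2 * (K * E t)))) => k.
  have [_ /(_ k.+1) h] := xX t i t0.
  have a0 : 0 <= 2 * K * 2^-1 ^+ k by rewrite !mulr_ge0// exprn_ge0// invr_ge0.
  have := Jdiff _ _ _ a0 Kx (KX k) _ t i t0.
  have H : forall (t : R) i, 0 <= t -> `|x t i - X k t i| <= 2 * K * 2^-1 ^+ k * E t.
    by move=> u j u0; have [_ /(_ k)] := xX u j u0; rewrite -!mulrA [E u * _]mulrC.
  move=> /(_ H) h2; rewrite -[x t i - _](subrKA (X k.+1 t i)).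
  apply: le_trans (ler_normD _ _) _; have := lerD h h2.
  rewrite distrC exprS; rewrite -[J x t i - _]opprB normrN distrC [`|x t i - _|]distrC.
  rewrite [`|X k.+1 t i - J x t i|]distrC; move=> h3; apply: le_trans h3 _.
  by rewrite le_eqVlt; apply/orP; left; apply/eqP; field.
(* The solution returned is [J x]: it is differentiable by the fundamental theorem, and it equals
   [x] at nonnegative times. *)
exists (J x); split=> // T i; apply: D1_ext (JD x Kx i T) => // t /andP[t0 _].
by congr (g _ i); apply/funext => j; rewrite xJ// ltW.
Unshelve. all: by end_near. Qed.

(** The function E e^{-at} - bt is nonincreasing, because e^{-at} <= 1 at nonnegative times; this is
    where the term linear in [t] comes from. *)
Lemma gronwall T E dE (a b : R) : 0 <= a -> 0 <= b -> D1 T E dE ->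
  (forall t : R, 0 < t < T -> dE t <= a * E t + b) ->
  forall t : R, 0 <= t <= T -> E t <= (E 0 + b * t) * expR (a * t).
Proof.
move=> a0 b0 hE h t /andP[t0 tT].
have h1 := D1_sub (D1_mul hE (D1_expR T (- a))) (D1_scale b (D1_id T)).
have := D1_nincr h1 _ (lexx 0) t0 tT; rewrite mulr0 mulr0 expR0 mulr1 subr0.
have aux u : 0 < u < T ->
    dE u * expR (- a * u) + E u * (- a * expR (- a * u)) - b <= 0.
  move=> uT; have e1 : expR (- a * u) <= 1.
    rewrite -expR0 ler_expR mulNr oppr_le0 mulr_ge0//.
    by case/andP: uT => /ltW.
  have := h _ uT; have := expR_gt0 (- a * u); set e := expR _ in e1 * => e0 hu.
  have : dE u * e <= (a * E u + b) * e by rewrite ler_wpM2r// ltW.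
  have : b * e <= b * 1 by rewrite ler_wpM2l.
  nra.
move=> /(_ (fun u => aux u)) h2.
have := expR_gt0 (a * t); set e := expR (a * t) => e0.
have ee : expR (- a * t) * e = 1 by rewrite -expRD mulNr addNr expR0.
have h3 : E t * expR (- a * t) <= E 0 + b * t by rewrite /= in h2; lra.
have := ler_wpM2r (ltW e0) h3; by rewrite -mulrA ee mulr1.
Qed.

Lemma is_derive_inv (f : R -> R) (t df : R) : f t != 0 -> is_derive t 1 f df ->
  is_derive t 1 (fun x => (f x)^-1) (- (f t) ^- 2 * df).
Proof.
move=> f0 h.
have h' := is_deriveV f0 h; refine (is_derive_eq h' _) => //.
Qed.

(** The function -1/(1 + y) grows at rate at most [C], so that [1 + y] at most doubles as long as C
    t stays below half of 1/(1 + y(0)). *)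
Lemma riccati T y dy (C : R) : 0 <= C -> D1 T y dy -> (forall t : R, 0 <= t <= T -> 0 <= y t) ->
  (forall t : R, 0 < t < T -> dy t <= C * (1 + y t) ^+ 2) ->
  forall t : R, 0 <= t <= T -> 2 * C * (1 + y 0) * t <= 1 -> 1 + y t <= 2 * (1 + y 0).
Proof.
move=> C0 hy y0 h t /andP[t0 tT] ht.
have h1y := D1_add (D1_cst T 1) hy.
have hi : D1 T (fun t => - (1 + y t)^-1) (fun t => (1 + y t) ^- 2 * dy t).
  split.
    have [/subspace_continuousP cy _] := h1y.
    apply/subspace_continuousP => x xT; apply: cvgN; apply: cvgV; last exact: cy.
    by move: xT; rewrite /= in_itv/= => /y0 ?; rewrite gt_eqF// ltr_pwDl.
  move=> u uT; have [_ /(_ _ uT) hu] := h1y.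
  have n0 : 1 + y u != 0.
    rewrite gt_eqF// ltr_pwDl// y0//; case/andP: uT => *; apply/andP; split; exact: ltW.
  have h'' := is_deriveN (is_derive_inv (f := fun t => 1 + y t) n0 hu); refine (is_derive_eq h'' _).
  by rewrite add0r mulNr opprK.
have := D1_le hi (D1_scale C (D1_id T)) _ (lexx 0) t0 tT.
have aux u : 0 < u < T -> (1 + y u) ^- 2 * dy u <= C * 1.
  move=> uT; rewrite mulr1 mulrC ler_pdivrMr ?h// exprn_gt0// ltr_pwDl//.
  by apply: y0; case/andP: uT => *; apply/andP; split; exact: ltW.
move=> /(_ aux) /=; rewrite mulr0 subr0 opprK.
have yt : 0 <= y t by apply: y0; rewrite t0.
have yz : 0 <= y 0 by apply: y0; rewrite lexx (le_trans t0).
set p := 1 + y t; set q := 1 + y 0.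
have p0 : 0 < p by rewrite /p; lra.
have q0 : 0 < q by rewrite /q; lra.
move=> h2; have h3 : q^-1 - p^-1 <= C * t by lra.
have := ler_wpM2l (ltW (mulr_gt0 p0 q0)) h3.
rewrite mulrBr -[p * q / q]mulrA mulfV ?gt_eqF// mulr1.
rewrite [p * q]mulrC -[q * p / p]mulrA mulfV ?gt_eqF// mulr1 => h4.
have h5 : p * (2 * C * q * t) <= p * 1 by rewrite ler_wpM2l// ltW.
nra.
Qed.

End Calculus.

(** * Complex three-vectors *)

Section Vectors.
Context {R : realType}.
Local Notation C := R[i].
Local Notation V := 'rV[R[i]]_3.
Local Notation nc := (@Normc.normc R).
Implicit Types (z w : C) (a b c d : V).

Lemma nc_sqr z : nc z ^+ 2 = complex.Re z ^+ 2 + complex.Im z ^+ 2.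
Proof. by case: z => x y; rewrite /Normc.normc /= sqr_sqrtr// addr_ge0 ?sqr_ge0. Qed.

Lemma nc_ge0 z : 0 <= nc z.
Proof. by case: z => x y; rewrite /Normc.normc /= sqrtr_ge0. Qed.

Lemma nc_real (x : R) : nc x%:C = `|x|.
Proof. by rewrite /Normc.normc /= expr0n/= addr0 sqrtr_sqr. Qed.

Lemma nc_conj z : nc z^* = nc z.
Proof. by case: z => x y; rewrite /Normc.normc /= sqrrN. Qed.

Lemma le_ncB z w : nc (z - w) <= nc z + nc w.
Proof. by rewrite -[nc w]normcN; exact: le_normcD. Qed.

Lemma nc_sum (I : Type) (r : seq I) (P : pred I) (F : I -> C) :
  nc (\sum_(i <- r | P i) F i) <= \sum_(i <- r | P i) nc (F i).
Proof.
elim/big_rec2 : _ => [|i y x _ h]; first by rewrite Normc.normc0.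
exact: le_trans (le_normcD _ _) (lerD (lexx _) h).
Qed.

Lemma Re_le_nc z : `|complex.Re z| <= nc z.
Proof.
case: z => x y; rewrite /Normc.normc /= -sqrtr_sqr ler_wsqrtr//.
by rewrite lerDl sqr_ge0.
Qed.

Lemma Im_le_nc z : `|complex.Im z| <= nc z.
Proof.
case: z => x y; rewrite /Normc.normc /= -sqrtr_sqr ler_wsqrtr//.
by rewrite lerDr sqr_ge0.
Qed.

Lemma nc_le_ReIm z : nc z <= `|complex.Re z| + `|complex.Im z|.
Proof.
rewrite -(ler_pXn2r (n := 2))// ?nnegrE ?nc_ge0 ?addr_ge0//.
rewrite nc_sqr -[complex.Re z ^+ 2]real_normK ?num_real// -[complex.Im z ^+ 2]real_normK ?num_real//.
rewrite sqrrD lerD2r lerDl mulrn_wge0// mulr_ge0//.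
Qed.

Lemma Re_add z w : complex.Re (z + w) = complex.Re z + complex.Re w.
Proof. by case: z; case: w. Qed.

Lemma Im_add z w : complex.Im (z + w) = complex.Im z + complex.Im w.
Proof. by case: z; case: w. Qed.

Lemma Re_opp z : complex.Re (- z) = - complex.Re z.
Proof. by case: z. Qed.

Lemma Im_opp z : complex.Im (- z) = - complex.Im z.
Proof. by case: z. Qed.

Lemma Re_sum (I : Type) (r : seq I) (P : pred I) (F : I -> C) :
  complex.Re (\sum_(i <- r | P i) F i) = \sum_(i <- r | P i) complex.Re (F i).
Proof. by elim/big_rec2 : _ => // i y x _ <-; rewrite Re_add. Qed.

Lemma Im_sum (I : Type) (r : seq I) (P : pred I) (F : I -> C) :
  complex.Im (\sum_(i <- r | P i) F i) = \sum_(i <- r | P i) complex.Im (F i).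
Proof. by elim/big_rec2 : _ => // i y x _ <-; rewrite Im_add. Qed.

Lemma Re_scale (x : R) z : complex.Re (x%:C * z) = x * complex.Re z.
Proof. by case: z => u v /=; rewrite mul0r subr0. Qed.

Lemma Im_scale (x : R) z : complex.Im (x%:C * z) = x * complex.Im z.
Proof. by case: z => u v /=; rewrite mul0r addr0. Qed.

Lemma sum3 (M : nmodType) (F : 'I_3 -> M) : \sum_(j < 3) F j = F 0 + F 1 + F 2.
Proof.
rewrite !big_ord_recr big_ord0 /= add0r.
by congr (F _ + F _ + F _); apply: val_inj.
Qed.

Lemma I3D : ((0 + 1 : 'I_3) = 1) * (((0 + 2 : 'I_3) = 2) * (((1 + 2 : 'I_3) = 0) *
  (((2 + 1 : 'I_3) = 0) * (((2 + 2 : 'I_3) = 1) * ((1 + 1 : 'I_3) = 2))))).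
Proof. by do !split; apply: val_inj. Qed.

Lemma rowP3 (T : Type) (u v : 'rV[T]_3) : u 0 0 = v 0 0 -> u 0 1 = v 0 1 -> u 0 2 = v 0 2 ->
  u = v.
Proof.
move=> h0 h1 h2; apply/rowP => -[[|[|[|//]]] Hi].
- by rewrite (_ : Ordinal Hi = 0)//; apply: val_inj.
- by rewrite (_ : Ordinal Hi = 1)//; apply: val_inj.
- by rewrite (_ : Ordinal Hi = 2)//; apply: val_inj.
Qed.

(** The l^1 norm of the components is submultiplicative for cross products; the squared Euclidean
    norm [sqv] is the one differentiated in energies. They are compared at the cost of a factor
    3. *)
Definition nv a : R := \sum_(j < 3) nc (a 0 j).
Definition sqv a : R := \sum_(j < 3) nc (a 0 j) ^+ 2.
Definition crossC a b : V :=
  \row_j (a 0 (j + 1) * b 0 (j + 2) - a 0 (j + 2) * b 0 (j + 1)).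
(** Bilinear, without conjugation, so that [trip] is the determinant and stays antisymmetric on
    complex coefficients. *)
Definition dotv a b : C := \sum_(j < 3) a 0 j * b 0 j.
Definition trip a b c : C := dotv a (crossC b c).
Definition conjv a : V := map_mx (fun z : C => z^*) a.
Definition rdot a b : R := \sum_(j < 3)
  (complex.Re (a 0 j) * complex.Re (b 0 j) + complex.Im (a 0 j) * complex.Im (b 0 j)).

Lemma nv_ge0 a : 0 <= nv a.
Proof. by apply: sumr_ge0 => j _; exact: nc_ge0. Qed.

Lemma nv0 : nv 0 = 0.
Proof. by rewrite /nv big1// => j _; rewrite mxE Normc.normc0. Qed.

Lemma nvD a b : nv (a + b) <= nv a + nv b.
Proof. by rewrite /nv -big_split/=; apply: ler_sum => j _; rewrite mxE le_normcD. Qed.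

Lemma nvN a : nv (- a) = nv a.
Proof. by apply: eq_bigr => j _; rewrite mxE normcN. Qed.

Lemma nvB a b : nv (a - b) <= nv a + nv b.
Proof. by rewrite -[nv b]nvN nvD. Qed.

Lemma nvBC a b : nv (a - b) = nv (b - a).
Proof. by rewrite -nvN opprB. Qed.

Lemma nvZ z a : nv (z *: a) = nc z * nv a.
Proof. by rewrite /nv mulr_sumr; apply: eq_bigr => j _; rewrite mxE Normc.normcM. Qed.

Lemma nv_conj a : nv (conjv a) = nv a.
Proof. by apply: eq_bigr => j _; rewrite mxE nc_conj. Qed.

Lemma nv_sum (I : Type) (r : seq I) (P : pred I) (F : I -> V) :
  nv (\sum_(i <- r | P i) F i) <= \sum_(i <- r | P i) nv (F i).
Proof.
elim/big_rec2 : _ => [|i y x _ h]; first by rewrite nv0.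
exact: le_trans (nvD _ _) (lerD (lexx _) h).
Qed.

Lemma sqv_ge0 a : 0 <= sqv a.
Proof. by apply: sumr_ge0 => j _; rewrite sqr_ge0. Qed.

Lemma nv_sqv a : nv a ^+ 2 <= 3 * sqv a.
Proof.
rewrite /nv /sqv !sum3; set x := nc _; set y := nc _; set z := nc _.
have := sqr_ge0 (x - y); have := sqr_ge0 (x - z); have := sqr_ge0 (y - z); lra.
Qed.

Lemma sqv_nv a : sqv a <= nv a ^+ 2.
Proof.
rewrite /nv /sqv !sum3; have := nc_ge0 (a 0 0); have := nc_ge0 (a 0 1); have := nc_ge0 (a 0 2).
set x := nc _; set y := nc _; set z := nc _ => hx hy hz.
have := mulr_ge0 hx hy; have := mulr_ge0 hy hz; have := mulr_ge0 hx hz; lra.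
Qed.

Lemma nc_le_nv a j : nc (a 0 j) <= nv a.
Proof. by rewrite /nv (bigD1 j)//= lerDl sumr_ge0// => i _; exact: nc_ge0. Qed.

Lemma nv_cross a b : nv (crossC a b) <= nv a * nv b.
Proof.
rewrite /nv !sum3 !mxE !I3D.
have h (x y z w : C) : nc (x * y - z * w) <= nc x * nc y + nc z * nc w.
  by apply: le_trans (le_ncB _ _) _; rewrite !Normc.normcM.
apply: le_trans (lerD (lerD (h _ _ _ _) (h _ _ _ _)) (h _ _ _ _)) _.
have := nc_ge0 (a 0 0); have := nc_ge0 (a 0 1); have := nc_ge0 (a 0 2).
have := nc_ge0 (b 0 0); have := nc_ge0 (b 0 1); have := nc_ge0 (b 0 2).
set a0 := nc (a 0 0); set a1 := nc (a 0 1); set a2 := nc (a 0 2).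
set b0 := nc (b 0 0); set b1 := nc (b 0 1); set b2 := nc (b 0 2) => *.
have h0 : 0 <= a0 * b0 by apply: mulr_ge0.
have h1 : 0 <= a1 * b1 by apply: mulr_ge0.
have h2 : 0 <= a2 * b2 by apply: mulr_ge0.
lra.
Qed.

Lemma nc_dotv a b : nc (dotv a b) <= nv a * nv b.
Proof.
apply: le_trans (nc_sum _ _ _) _; rewrite {1}/nv mulr_suml; apply: ler_sum => j _; rewrite Normc.normcM ler_wpM2l ?nc_ge0//.
exact: nc_le_nv.
Qed.

Lemma nc_trip a b c : nc (trip a b c) <= nv a * nv b * nv c.
Proof.
apply: le_trans (nc_dotv _ _) _; rewrite -mulrA ler_wpM2l ?nv_ge0//.
exact: nv_cross.
Qed.

Lemma crossCDl a b c : crossC (a + b) c = crossC a c + crossC b c.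
Proof. by apply/rowP => j; rewrite !mxE; ring. Qed.

Lemma crossCDr a b c : crossC c (a + b) = crossC c a + crossC c b.
Proof. by apply/rowP => j; rewrite !mxE; ring. Qed.

Lemma crossCZl z a b : crossC (z *: a) b = z *: crossC a b.
Proof. by apply/rowP => j; rewrite !mxE; ring. Qed.

Lemma crossCZr z a b : crossC a (z *: b) = z *: crossC a b.
Proof. by apply/rowP => j; rewrite !mxE; ring. Qed.

Lemma crossCNl a b : crossC (- a) b = - crossC a b.
Proof. by apply/rowP => j; rewrite !mxE; ring. Qed.

Lemma crossCNr a b : crossC a (- b) = - crossC a b.
Proof. by apply/rowP => j; rewrite !mxE; ring. Qed.

Lemma crossC0l a : crossC 0 a = 0.
Proof. by apply/rowP => j; rewrite !mxE; ring. Qed.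

Lemma crossC0r a : crossC a 0 = 0.
Proof. by apply/rowP => j; rewrite !mxE; ring. Qed.

Lemma crossC_suml (I : Type) (r : seq I) (P : pred I) (F : I -> V) a :
  crossC (\sum_(i <- r | P i) F i) a = \sum_(i <- r | P i) crossC (F i) a.
Proof. by elim/big_rec2 : _ => [|i y x _ <-]; rewrite ?crossC0l// crossCDl. Qed.

Lemma crossC_sumr (I : Type) (r : seq I) (P : pred I) (F : I -> V) a :
  crossC a (\sum_(i <- r | P i) F i) = \sum_(i <- r | P i) crossC a (F i).
Proof. by elim/big_rec2 : _ => [|i y x _ <-]; rewrite ?crossC0r// crossCDr. Qed.

Lemma toC_cross (u v : 'rV[R]_3) : toC (cross u v) = crossC (toC u) (toC v).
Proof. by apply/rowP => j; rewrite !mxE rmorphB !rmorphM. Qed.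

Lemma conjv_cross a b : conjv (crossC a b) = crossC (conjv a) (conjv b).
Proof. by apply/rowP => j; rewrite !mxE rmorphB !rmorphM. Qed.

Lemma dotvDr a b c : dotv a (b + c) = dotv a b + dotv a c.
Proof. by rewrite /dotv -big_split/=; apply: eq_bigr => j _; rewrite mxE mulrDr. Qed.

Lemma dotv0r a : dotv a 0 = 0.
Proof. by rewrite /dotv big1// => j _; rewrite mxE mulr0. Qed.

Lemma dotvZr z a b : dotv a (z *: b) = z * dotv a b.
Proof. by rewrite /dotv mulr_sumr; apply: eq_bigr => j _; rewrite mxE mulrCA. Qed.

Lemma dotv_sumr (I : Type) (r : seq I) (P : pred I) (F : I -> V) a :
  dotv a (\sum_(i <- r | P i) F i) = \sum_(i <- r | P i) dotv a (F i).
Proof. by elim/big_rec2 : _ => [|i y x _ <-]; rewrite ?dotv0r// dotvDr. Qed.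

Lemma trip_swap12 a b c : trip b a c = - trip a b c.
Proof. by rewrite /trip /dotv !sum3 !mxE !I3D; ring. Qed.

Lemma trip_swap13 a b c : trip c b a = - trip a b c.
Proof. by rewrite /trip /dotv !sum3 !mxE !I3D; ring. Qed.

Lemma tripZ3 z a b c : trip a b (z *: c) = z * trip a b c.
Proof. by rewrite /trip crossCZr dotvZr. Qed.

Lemma rdotE a b : rdot a b = complex.Re (dotv (conjv a) b).
Proof.
rewrite /rdot /dotv Re_sum; apply: eq_bigr => j _; rewrite mxE.
by case: (a 0 j) => x y; case: (b 0 j) => u v /=; ring.
Qed.

Lemma sqv_rdot a : sqv a = rdot a a.
Proof. by apply: eq_bigr => j _; rewrite nc_sqr !expr2. Qed.

Lemma rdotDr a b c : rdot a (b + c) = rdot a b + rdot a c.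
Proof. by rewrite !rdotE dotvDr Re_add. Qed.

Lemma rdotC a b : rdot a b = rdot b a.
Proof. by apply: eq_bigr => j _; rewrite mulrC [X in _ + X]mulrC. Qed.

Lemma rdot_sumr (I : Type) (r : seq I) (P : pred I) (F : I -> V) a :
  rdot a (\sum_(i <- r | P i) F i) = \sum_(i <- r | P i) rdot a (F i).
Proof. by rewrite rdotE dotv_sumr Re_sum; apply: eq_bigr => i _; rewrite rdotE. Qed.

Lemma rdot_le a b : `|rdot a b| <= nv a * nv b.
Proof.
by rewrite rdotE; apply: le_trans (Re_le_nc _) _; rewrite -[nv a]nv_conj nc_dotv.
Qed.

Lemma rdot_sqv a b : 2 * rdot a b <= sqv a + sqv b.
Proof.
rewrite /rdot /sqv mulr_sumr -big_split/=; apply: ler_sum => j _.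
rewrite !nc_sqr; case: (a 0 j) => x y; case: (b 0 j) => u v /=.
have := sqr_ge0 (x - u); have := sqr_ge0 (y - v); lra.
Qed.

Definition DV (T : R) (f df : R -> V) : Prop := forall j,
  D1 T (fun t => complex.Re (f t 0 j)) (fun t => complex.Re (df t 0 j)) /\
  D1 T (fun t => complex.Im (f t 0 j)) (fun t => complex.Im (df t 0 j)).

Lemma DV_sub T f df g dg : DV T f df -> DV T g dg ->
  DV T (fun t => f t - g t) (fun t => df t - dg t).
Proof.
move=> hf hg j; have [h1 h2] := hf j; have [h3 h4] := hg j.
split.
  by apply: D1_ext (D1_sub h1 h3) => [t|t _]; rewrite !mxE Re_add Re_opp.
by apply: D1_ext (D1_sub h2 h4) => [t|t _]; rewrite !mxE Im_add Im_opp.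
Qed.

Lemma DV_rdot T f df a : DV T f df ->
  D1 T (fun t => rdot a (f t)) (fun t => rdot a (df t)).
Proof.
by move=> h; apply: D1_sum => j _; have [h1 h2] := h j; apply: D1_add; apply: D1_scale.
Qed.

Lemma DV_sqv T f df : DV T f df ->
  D1 T (fun t => sqv (f t)) (fun t => 2 * rdot (f t) (df t)).
Proof.
move=> h.
have : D1 T (fun t => \sum_(j < 3) (complex.Re (f t 0 j) ^+ 2 + complex.Im (f t 0 j) ^+ 2))
   (fun t => \sum_(j < 3) (2 * complex.Re (f t 0 j) * complex.Re (df t 0 j) +
      2 * complex.Im (f t 0 j) * complex.Im (df t 0 j))).
  by apply: D1_sum => j _; have [h1 h2] := h j; apply: D1_add; apply: D1_sqr.
apply: D1_ext => t; first by apply: eq_bigr => j _; rewrite nc_sqr.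
by move=> _; rewrite mulr_sumr; apply: eq_bigr => j _; rewrite mulrDr !mulrA.
Qed.

End Vectors.

(** * Convolutions on frequency windows *)

Section Windows.
Context {R : realType}.
Local Notation C := R[i].
Local Notation V := 'rV[R[i]]_3.
Local Notation nc := (@Normc.normc R).

Definition win (n : nat) : seq int := [seq i%:Z - n%:Z | i <- iota 0 n.*2.+1].

Lemma win_uniq n : uniq (win n).
Proof. by rewrite map_inj_uniq ?iota_uniq// => i j; lia. Qed.

Lemma mem_win n (k : int) : (k \in win n) = (`|k| <= n)%N.
Proof.
apply/mapP/idP => [[j]|h]; first by rewrite mem_iota => h ->; lia.
by exists (absz (k + n%:Z)); rewrite ?mem_iota; lia.
Qed.

Lemma win_ord (M : nmodType) n (F : int -> M) :
  \sum_(k <- win n) F k = \sum_(i < n.*2.+1) F (i%:Z - n%:Z).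
Proof. by rewrite big_map -{1}[n.*2.+1]subn0 -/(index_iota _ _) big_mkord. Qed.

Lemma win_opp (M : nmodType) n (F : int -> M) :
  \sum_(k <- win n) F (- k) = \sum_(k <- win n) F k.
Proof.
rewrite -(big_map -%R xpredT F); apply: perm_big; apply: uniq_perm.
- by rewrite map_inj_uniq ?win_uniq//; exact: oppr_inj.
- exact: win_uniq.
move=> k; rewrite mem_win; apply/mapP/idP => [[l]|h]; first by rewrite mem_win; lia.
by exists (- k); rewrite ?mem_win; lia.
Qed.

Lemma win_sub (M : nmodType) n m (F : int -> M) : (n <= m)%N ->
  \sum_(k <- win m | (`|k| <= n)%N) F k = \sum_(k <- win n) F k.
Proof.
move=> nm; rewrite -big_filter; apply: perm_big; apply: uniq_perm.
- by rewrite filter_uniq// win_uniq.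
- exact: win_uniq.
by move=> k; rewrite mem_filter !mem_win; lia.
Qed.

Lemma win_supp (M : nmodType) n m (F : int -> M) : (n <= m)%N ->
  (forall k : int, (n < `|k|)%N -> F k = 0) ->
  \sum_(k <- win m) F k = \sum_(k <- win n) F k.
Proof.
move=> nm h; rewrite -(win_sub _ nm) [RHS]big_mkcond; apply: eq_bigr => k _.
by case: leqP => // /h.
Qed.

Lemma win_split (M : nmodType) n m (F : int -> M) : (n <= m)%N ->
  \sum_(k <- win m) F k =
  \sum_(k <- win n) F k + \sum_(k <- win m | (n < `|k|)%N) F k.
Proof.
move=> nm; rewrite (bigID (fun k : int => (`|k| <= n)%N))/= win_sub//; congr (_ + _).
by apply: eq_bigl => k; rewrite -ltnNge.
Qed.

Lemma win_mono n m (F : int -> R) : (n <= m)%N -> (forall k, 0 <= F k) ->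
  \sum_(k <- win n) F k <= \sum_(k <- win m) F k.
Proof. by move=> nm h; rewrite (win_split _ nm) lerDl sumr_ge0. Qed.

Lemma win_recr (M : nmodType) n (F : int -> M) :
  \sum_(k <- win n.+1) F k = \sum_(k <- win n) F k + (F n.+1%:Z + F (- n.+1%:Z)).
Proof.
rewrite (win_split _ (leqnSn n)); congr (_ + _).
rewrite -big_filter.
have -> : \sum_(i <- [seq i <- win n.+1 | (n < `|i|)%N]) F i = \sum_(i <- [:: n.+1%:Z; - n.+1%:Z]) F i.
  apply: perm_big; apply: uniq_perm; first by rewrite filter_uniq// win_uniq.
    by apply/andP; split=> //; rewrite mem_seq1; lia.
  by move=> k; rewrite mem_filter mem_win !inE; lia.
by rewrite !big_cons big_nil addr0.
Qed.

Lemma ler_sum_seq (I : eqType) (r : seq I) (F G : I -> R) :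
  (forall i, i \in r -> F i <= G i) -> \sum_(i <- r) F i <= \sum_(i <- r) G i.
Proof. by move=> h; rewrite big_seq [leRHS]big_seq; apply: ler_sum. Qed.

Lemma sum_if_eq (r : seq int) (k : int) (x : R) : uniq r -> 0 <= x ->
  \sum_(i <- r) (if i == k then x else 0) <= x.
Proof.
move=> ur x0; rewrite -big_mkcond /=; have [kr|kr] := boolP (k \in r).
  rewrite -big_filter (_ : [seq i <- r | i == k] = [:: k]) ?big_seq1//.
  by rewrite filter_pred1_uniq.
rewrite big1_seq// => i /andP[/eqP -> kr']; by rewrite kr' in kr.
Qed.

Lemma sum_if_eqM (M : nmodType) (r : seq int) (k : int) (F : int -> M) : uniq r -> k \in r ->
  \sum_(i <- r) (if i == k then F i else 0) = F k.
Proof.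
move=> ur kr; rewrite -big_mkcond /= -big_filter filter_pred1_uniq//.
by rewrite big_seq1.
Qed.

Definition az (k : int) : R := `|k|%N%:R.

Lemma az_ge0 k : 0 <= az k. Proof. exact: ler0n. Qed.
Lemma azN k : az (- k) = az k. Proof. by rewrite /az abszN. Qed.
Lemma az0 : az 0 = 0. Proof. by []. Qed.
Lemma az_ge1 k : k != 0 -> 1 <= az k.
Proof. by move=> k0; rewrite /az ler1n absz_gt0. Qed.
Lemma azD k l : az (k + l) <= az k + az l.
Proof. by rewrite /az -natrD ler_nat; lia. Qed.

Lemma az_norm k : az k = `|k%:~R|.
Proof. by rewrite /az -intr_norm -abszE pmulrn. Qed.

Lemma az_tri p q r : p + q + r = 0 ->
  [/\ az p <= az q + az r, az q <= az p + az r & az r <= az p + az q].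
Proof. by move=> h; split; rewrite /az -natrD ler_nat; lia. Qed.

(* |k|^{3/2}, the weight controlling both the l^1 norm of |nabla| c and its tails. *)
Definition hw (k : int) : R := az k * Num.sqrt (az k).

Lemma hw_ge0 k : 0 <= hw k. Proof. by rewrite mulr_ge0 ?az_ge0 ?sqrtr_ge0. Qed.

Lemma az_le_hw k : az k <= hw k.
Proof.
have [->|k0] := eqVneq k 0; first by rewrite /hw az0 mul0r.
rewrite /hw ler_peMr ?az_ge0// -sqrtr1 ler_wsqrtr//; exact: az_ge1.
Qed.

Lemma az_tail n k : (n < `|k|)%N -> az k <= (Num.sqrt n.+1%:R)^-1 * hw k.
Proof.
move=> nk; rewrite /hw mulrCA ler_peMr ?az_ge0// mulrC ler_pdivlMr ?sqrtr_gt0// mul1r.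
by rewrite ler_wsqrtr// ler_nat.
Qed.

Lemma one_tail n k : (n < `|k|)%N -> 1 <= (Num.sqrt n.+1%:R)^-1 * hw k.
Proof. by move=> nk; apply: le_trans (az_tail nk); rewrite /az ler1n; lia. Qed.

(** Since [0^-1 = 0], the zero mode contributes nothing. The induction carries the sharper bound 4 -
    2/n, which absorbs the next two terms by telescoping. *)
Lemma sum_invsq n : \sum_(k <- win n) (az k) ^- 2 <= 4.
Proof.
case: n => [|n]; first by rewrite win_ord big_ord1 /= subrr az0 expr0n invr0; lra.
suff : \sum_(k <- win n.+1) (az k) ^- 2 <= 4 - 2 / n.+1%:R.
  by move/le_trans; apply; rewrite gerBl divr_ge0.
elim: n => [|n IH].
  rewrite win_recr win_ord big_ord1 /= subrr az0 expr0n invr0 azN /az absz_nat.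
  by rewrite expr1n invr1; lra.
rewrite win_recr azN; apply: le_trans (lerD IH (lexx _)) _; rewrite /az absz_nat.
have h0 : 0 < n.+1%:R :> R by rewrite ltr0n.
rewrite -[n.+2]addn1 natrD; set x := n.+1%:R in h0 *.
have h1 : 0 < x + 1 by lra.
rewrite -subr_ge0.
have -> : 4 - 2 / (x + 1%:R) - (4 - 2 / x + ((x + 1%:R) ^- 2 + (x + 1%:R) ^- 2)) =
   2 / (x * (x + 1) ^+ 2) by field; rewrite !gt_eqF.
by rewrite divr_ge0// mulr_ge0 ?sqr_ge0 ?ltW.
Qed.

(** Arithmetic-geometric mean of |k|^{5/2} x and |k|^{-1}. The surplus |k|^{-2} is summable, which
    is how H^{5/2} controls the l^1 norm with weight |k|^{3/2}. *)
Lemma hw_amgm k (x : R) : 0 <= x -> hw k * x <= 2^-1 * (az k ^+ 5 * x ^+ 2 + (az k) ^- 2).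
Proof.
move=> x0; have [->|k0] := eqVneq k 0.
  by rewrite /hw az0 !mul0r expr0n/= mul0r expr0n invr0 add0r mulr0.
have a1 := az_ge1 k0; have a0 : 0 < az k by lra.
have s2 : Num.sqrt (az k) ^+ 2 = az k by rewrite sqr_sqrtr// ltW.
rewrite /hw; set a := az k in a1 a0 s2 *; set s := Num.sqrt a in s2 *.
have h := sqr_ge0 (a ^+ 2 * s * x - a^-1).
have e : (a ^+ 2 * s * x - a^-1) ^+ 2 = a ^+ 5 * x ^+ 2 + a ^- 2 - 2 * (a * s * x).
  have -> : a ^+ 5 = a ^+ 4 * s ^+ 2 by rewrite s2; ring.
  by field; rewrite gt_eqF.
by rewrite e in h; lra.
Qed.

Lemma hw_sum n (c : int -> V) : \sum_(k <- win n) hw k * nv (c k) <=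
  2 + 2 * \sum_(k <- win n) az k ^+ 5 * sqv (c k).
Proof.
apply: (@le_trans _ _ (\sum_(k <- win n)
    (2^-1 * (az k) ^- 2 + 2 * (az k ^+ 5 * sqv (c k))))).
  apply: ler_sum => k _; apply: le_trans (hw_amgm _ (nv_ge0 _)) _.
  have := ler_wpM2l (exprn_ge0 5 (az_ge0 k)) (nv_sqv (c k)).
  have := mulr_ge0 (exprn_ge0 5 (az_ge0 k)) (sqv_ge0 (c k)); lra.
rewrite big_split/= -!mulr_sumr lerD2r.
by have := sum_invsq n; lra.
Qed.

(** The constraint p + q + r = 0 is the Fourier side of integrating a product of three functions; in
    this form the three slots are interchangeable. *)
Definition S3 (M : nmodType) n (G : int -> int -> int -> M) : M :=
  \sum_(p <- win n) \sum_(q <- win n) \sum_(r <- win n)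
    (if p + q + r == 0 then G p q r else 0).

Lemma S3_swap12 (M : nmodType) n (G : int -> int -> int -> M) :
  S3 n G = S3 n (fun p q r => G q p r).
Proof.
rewrite /S3 exchange_big; apply: eq_bigr => p _; apply: eq_bigr => q _.
by apply: eq_bigr => r _; rewrite [q + p]addrC.
Qed.

Lemma S3_swap23 (M : nmodType) n (G : int -> int -> int -> M) :
  S3 n G = S3 n (fun p q r => G p r q).
Proof.
rewrite /S3; apply: eq_bigr => p _; rewrite exchange_big; apply: eq_bigr => q _.
by apply: eq_bigr => r _; rewrite [p + r + q]addrAC.
Qed.

Lemma S3_swap13 (M : nmodType) n (G : int -> int -> int -> M) :
  S3 n G = S3 n (fun p q r => G r q p).
Proof. by rewrite S3_swap12 S3_swap23 S3_swap12. Qed.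

Lemma eq_S3 (M : nmodType) n (G H : int -> int -> int -> M) :
  (forall p q r, p + q + r = 0 -> G p q r = H p q r) -> S3 n G = S3 n H.
Proof.
move=> h; do 3 (apply: eq_bigr => ? _).
by case: ifP => // /eqP /h.
Qed.

Lemma ler_S3 n (G H : int -> int -> int -> R) :
  (forall p q r, p + q + r = 0 -> G p q r <= H p q r) -> S3 n G <= S3 n H.
Proof.
move=> h; do 3 (apply: ler_sum => ? _).
by case: ifP => // /eqP /h.
Qed.

Lemma S3D (M : nmodType) n (G H : int -> int -> int -> M) :
  S3 n (fun p q r => G p q r + H p q r) = S3 n G + S3 n H.
Proof.
rewrite /S3 -big_split; apply: eq_bigr => p _; rewrite -big_split; apply: eq_bigr => q _.
by rewrite -big_split; apply: eq_bigr => r _ /=; case: ifP => //; rewrite addr0.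
Qed.

Lemma S3M n (a : R) (G : int -> int -> int -> R) :
  S3 n (fun p q r => a * G p q r) = a * S3 n G.
Proof.
rewrite /S3 mulr_sumr; apply: eq_bigr => p _; rewrite mulr_sumr; apply: eq_bigr => q _.
by rewrite mulr_sumr; apply: eq_bigr => r _; case: ifP => //; rewrite mulr0.
Qed.

Lemma S3N (M : zmodType) n (G : int -> int -> int -> M) :
  S3 n (fun p q r => - G p q r) = - S3 n G.
Proof.
rewrite /S3 -sumrN; apply: eq_bigr => p _; rewrite -sumrN; apply: eq_bigr => q _.
by rewrite -sumrN; apply: eq_bigr => r _; case: ifP => //; rewrite oppr0.
Qed.

Lemma Re_S3 n (G : int -> int -> int -> C) :
  complex.Re (S3 n G) = S3 n (fun p q r => complex.Re (G p q r)).
Proof.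
rewrite /S3 Re_sum; apply: eq_bigr => p _; rewrite Re_sum; apply: eq_bigr => q _.
by rewrite Re_sum; apply: eq_bigr => r _; case: ifP.
Qed.

Lemma norm_S3 n (G : int -> int -> int -> R) :
  `|S3 n G| <= S3 n (fun p q r => `|G p q r|).
Proof.
rewrite /S3; apply: le_trans (ler_norm_sum _ _ _) _; apply: ler_sum => p _.
apply: le_trans (ler_norm_sum _ _ _) _; apply: ler_sum => q _.
apply: le_trans (ler_norm_sum _ _ _) _; apply: ler_sum => r _.
by case: ifP; rewrite ?normr0.
Qed.

Lemma S3_le12 n (a b : int -> R) : (forall k, 0 <= a k) -> (forall k, 0 <= b k) ->
  S3 n (fun p q r => a p * b q) <= (\sum_(k <- win n) a k) * \sum_(k <- win n) b k.
Proof.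
move=> a0 b0; rewrite /S3 mulr_suml; apply: ler_sum => p _.
rewrite mulr_sumr; apply: ler_sum => q _.
have -> : \sum_(r <- win n) (if p + q + r == 0 then a p * b q else 0) =
   \sum_(r <- win n) (if r == - (p + q) then a p * b q else 0).
  by apply: eq_bigr => r _; rewrite addrC addr_eq0.
by apply: sum_if_eq; rewrite ?win_uniq ?mulr_ge0.
Qed.

Lemma S3_le13 n (a b : int -> R) : (forall k, 0 <= a k) -> (forall k, 0 <= b k) ->
  S3 n (fun p q r => a p * b r) <= (\sum_(k <- win n) a k) * \sum_(k <- win n) b k.
Proof. by move=> a0 b0; rewrite S3_swap23; exact: S3_le12. Qed.

Lemma S3_le23 n (a b : int -> R) : (forall k, 0 <= a k) -> (forall k, 0 <= b k) ->
  S3 n (fun p q r => a q * b r) <= (\sum_(k <- win n) a k) * \sum_(k <- win n) b k.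
Proof. by move=> a0 b0; rewrite S3_swap12; exact: S3_le13. Qed.

(** The output frequency [k] is not restricted: over |k| <= 2n these are all coefficients of the
    product of two polynomials of degree n. *)
Definition cv n (a b : int -> V) (k : int) : V :=
  \sum_(m <- win n) \sum_(l <- win n) (if m + l == k then crossC (a m) (b l) else 0).

(** Pairing with the coefficient at -k turns the convolution constraint m + l = k into the symmetric
    one of [S3]. *)
Lemma sum_cv n (d a b : int -> V) (w : int -> C) : (forall k, w (- k) = w k) ->
  \sum_(k <- win n) w k * dotv (d (- k)) (cv n a b k) =
  S3 n (fun p q r => w p * trip (d p) (a q) (b r)).
Proof.
move=> we; rewrite -win_opp /S3; apply: eq_bigr => p _.
rewrite opprK we dotv_sumr mulr_sumr; apply: eq_bigr => q _.
rewrite dotv_sumr mulr_sumr; apply: eq_bigr => r _.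
rewrite -addrA addrC addr_eq0; case: ifP => _ //.
by rewrite dotv0r mulr0.
Qed.

Definition rcoefs (c : int -> V) : Prop := forall k, c (- k) = conjv (c k).

Lemma rdot_cv n (d a b : int -> V) (w : int -> R) : rcoefs d -> (forall k, w (- k) = w k) ->
  \sum_(k <- win n) w k * rdot (d k) (cv n a b k) =
  S3 n (fun p q r => w p * complex.Re (trip (d p) (a q) (b r))).
Proof.
move=> rd we; transitivity (complex.Re (\sum_(k <- win n) (w k)%:C * dotv (d (- k)) (cv n a b k))).
  by rewrite Re_sum; apply: eq_bigr => k _; rewrite Re_scale rdotE rd.
rewrite sum_cv; last by move=> k; rewrite we.
by rewrite Re_S3; apply: eq_S3 => p q r _; rewrite Re_scale.
Qed.

Definition ag (c : int -> V) : int -> V := fun k => (az k)%:C *: c k.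

Lemma rcoefs_ag c : rcoefs c -> rcoefs (ag c).
Proof.
move=> rc k; rewrite /ag azN rc; apply/rowP => j; rewrite !mxE rmorphM.
by congr (_ * _); rewrite -[RHS]/((az k)%:C^*) conjc_real.
Qed.

Lemma nv_ag c k : nv (ag c k) = az k * nv (c k).
Proof. by rewrite /ag nvZ nc_real ger0_norm ?az_ge0. Qed.

Lemma Re_trip_le (a b c : V) : `|complex.Re (trip a b c)| <= nv a * nv b * nv c.
Proof. exact: le_trans (Re_le_nc _) (nc_trip _ _ _). Qed.

(* The determinant form is antisymmetric, so a weight on its first slot can be
   traded for a commutator of weights. *)
Lemma S3_anti13 n (a b : int -> V) (u v : int -> R) :
  S3 n (fun p q r => u p * v r * complex.Re (trip (a p) (b q) (a r))) =
  2^-1 * S3 n (fun p q r => (u p * v r - u r * v p) * complex.Re (trip (a p) (b q) (a r))).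
Proof.
set X := LHS; have e : X = S3 n (fun p q r => - (u r * v p * complex.Re (trip (a p) (b q) (a r)))).
  rewrite /X S3_swap13; apply: eq_S3 => p q r _.
  by rewrite trip_swap13 Re_opp mulrN.
have -> : S3 n (fun p q r => (u p * v r - u r * v p) * complex.Re (trip (a p) (b q) (a r))) = X + X.
  rewrite {2}e /X -S3D; apply: eq_S3 => p q r _; ring.
by field.
Qed.

(** Exchanging the first two slots flips the determinant and leaves the weight in place. This is the
    orthogonality of a and a x b on the Fourier side. *)
Lemma S3_anti12 n (a b : int -> V) (v : int -> R) :
  S3 n (fun p q r => v r * complex.Re (trip (a p) (a q) (b r))) = 0.
Proof.
set X := LHS; have e : X = - X.
  rewrite {1}/X S3_swap12 -S3N; apply: eq_S3 => p q r _.
  by rewrite trip_swap12 Re_opp mulrN.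
by have := e; lra.
Qed.

(** By the triangle inequality x^4 - z^4 <= 4 x^3 y, and [x] is at most twice the larger of [y] and
    [z]. The fifth powers go to the two largest frequencies, and a single power falls on the
    smallest. *)
Lemma weight_commutator_aux (x y z a b c : R) :
  0 <= x -> 0 <= y -> 0 <= z -> 0 <= a -> 0 <= b -> 0 <= c ->
  z <= x -> x <= y + z ->
  x * z * (x ^+ 4 - z ^+ 4) * (a * b * c) <=
  16 * ((x ^+ 5 * a ^+ 2 + z ^+ 5 * c ^+ 2) * (y * b) +
        (x ^+ 5 * a ^+ 2 + y ^+ 5 * b ^+ 2) * (z * c)).
Proof.
move=> x0 y0 z0 a0 b0 c0 zx xyz.
(* Expand u^3 (u p - w q)^2 >= 0 and use u^3 <= 8 w^3; this is the source of the constant 16. *)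
have key (u w p q : R) : 0 <= u -> 0 <= w -> u <= 2 * w ->
    4 * (u ^+ 4 * w * p * q) <= 16 * (u ^+ 5 * p ^+ 2 + w ^+ 5 * q ^+ 2).
  move=> u0 w0 uw.
  have h1 : 0 <= u ^+ 3 * (u * p - w * q) ^+ 2 by rewrite mulr_ge0 ?sqr_ge0 ?exprn_ge0.
  have h2 : u ^+ 3 <= 8 * w ^+ 3.
    have -> : 8 * w ^+ 3 = (2 * w) ^+ 3 by ring.
    by rewrite ler_pXn2r// nnegrE mulr_ge0.
  have h3 : u ^+ 3 * (w ^+ 2 * q ^+ 2) <= 8 * w ^+ 3 * (w ^+ 2 * q ^+ 2).
    by rewrite ler_wpM2r// mulr_ge0 ?sqr_ge0.
  have h4 : 0 <= u ^+ 5 * p ^+ 2 by rewrite mulr_ge0 ?sqr_ge0 ?exprn_ge0.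
  have e1 : u ^+ 3 * (u * p - w * q) ^+ 2 =
    u ^+ 5 * p ^+ 2 - 2 * (u ^+ 4 * w * p * q) + u ^+ 3 * (w ^+ 2 * q ^+ 2) by ring.
  have e2 : 8 * w ^+ 3 * (w ^+ 2 * q ^+ 2) = 8 * (w ^+ 5 * q ^+ 2) by ring.
  have h5 : 0 <= w ^+ 5 * q ^+ 2 by rewrite mulr_ge0 ?sqr_ge0 ?exprn_ge0.
  rewrite e1 in h1; rewrite e2 in h3; lra.
have h0 : x ^+ 4 - z ^+ 4 <= 4 * x ^+ 3 * y.
  have -> : x ^+ 4 - z ^+ 4 = (x - z) * ((x + z) * (x ^+ 2 + z ^+ 2)) by ring.
  have xz2 : z ^+ 2 <= x ^+ 2 by rewrite ler_pXn2r// nnegrE.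
  have -> : 4 * x ^+ 3 * y = y * ((2 * x) * (2 * x ^+ 2)) by ring.
  apply: ler_pM.
  - by rewrite subr_ge0.
  - by rewrite mulr_ge0 ?addr_ge0 ?sqr_ge0.
  - by lra.
  - by apply: ler_pM; rewrite ?addr_ge0 ?sqr_ge0//; lra.
have p5 (u w : R) : 0 <= u -> 0 <= u ^+ 5 * w ^+ 2.
  by move=> ?; rewrite mulr_ge0 ?sqr_ge0 ?exprn_ge0.
have zc := mulr_ge0 z0 c0; have yb := mulr_ge0 y0 b0.
apply: (@le_trans _ _ (x * z * (4 * x ^+ 3 * y) * (a * b * c))).
  by rewrite ler_wpM2r ?mulr_ge0// ler_wpM2l ?mulr_ge0.
have [yz|zy] := leP y z.
  have -> : x * z * (4 * x ^+ 3 * y) * (a * b * c) = 4 * (x ^+ 4 * z * a * c) * (y * b) by ring.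
  have x2z : x <= 2 * z by lra.
  apply: le_trans (ler_wpM2r yb (key _ _ a c x0 z0 x2z)) _.
  have := mulr_ge0 (addr_ge0 (p5 x a x0) (p5 y b y0)) zc; lra.
have -> : x * z * (4 * x ^+ 3 * y) * (a * b * c) = 4 * (x ^+ 4 * y * a * b) * (z * c) by ring.
have x2y : x <= 2 * y by lra.
apply: le_trans (ler_wpM2r zc (key _ _ a b x0 y0 x2y)) _.
have := mulr_ge0 (addr_ge0 (p5 x a x0) (p5 z c z0)) yb; lra.
Qed.

Lemma weight_commutator (x y z a b c : R) :
  0 <= x -> 0 <= y -> 0 <= z -> 0 <= a -> 0 <= b -> 0 <= c ->
  x <= y + z -> z <= x + y ->
  x * z * `|x ^+ 4 - z ^+ 4| * (a * b * c) <=
  16 * ((x ^+ 5 * a ^+ 2 + z ^+ 5 * c ^+ 2) * (y * b) +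
        (x ^+ 5 * a ^+ 2 + y ^+ 5 * b ^+ 2) * (z * c) +
        (y ^+ 5 * b ^+ 2 + z ^+ 5 * c ^+ 2) * (x * a)).
Proof.
move=> x0 y0 z0 a0 b0 c0 xyz zxy.
have p5 (u w : R) : 0 <= u -> 0 <= u ^+ 5 * w ^+ 2.
  by move=> ?; rewrite mulr_ge0 ?sqr_ge0 ?exprn_ge0.
have [zx|/ltW xz] := leP z x.
  rewrite ger0_norm ?subr_ge0 ?ler_pXn2r ?nnegrE//.
  apply: le_trans (weight_commutator_aux x0 y0 z0 a0 b0 c0 zx xyz) _.
  by rewrite ler_wpM2l// lerDl mulr_ge0 ?addr_ge0 ?p5// mulr_ge0.
rewrite distrC ger0_norm ?subr_ge0 ?ler_pXn2r ?nnegrE//.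
have zxy' : z <= y + x by lra.
have := weight_commutator_aux z0 y0 x0 c0 b0 a0 xz zxy'.
have h : 0 <= (x ^+ 5 * a ^+ 2 + y ^+ 5 * b ^+ 2) * (z * c).
  by rewrite mulr_ge0 ?addr_ge0 ?p5// mulr_ge0.
rewrite [z * x]mulrC [c * b * a]mulrC [c * b]mulrC [a * (b * c)]mulrA.
by move/le_trans; apply; rewrite ler_wpM2l//; lra.
Qed.

Lemma energy_flux n (c : int -> V) (v : int -> R) :
  (forall p r, `|v p - v r| <= `|az p ^+ 4 - az r ^+ 4|) ->
  `|S3 n (fun p q r => az p * v p * az r * complex.Re (trip (c p) (c q) (c r)))| <=
  48 * (\sum_(k <- win n) az k ^+ 5 * nv (c k) ^+ 2) * \sum_(k <- win n) az k * nv (c k).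
Proof.
move=> hv; rewrite (S3_anti13 _ _ _ (fun p => az p * v p) az) normrM ger0_norm ?invr_ge0//.
set A := \sum_(k <- win n) az k ^+ 5 * _; set B := \sum_(k <- win n) az k * nv _.
pose f k := az k ^+ 5 * nv (c k) ^+ 2; pose g k := az k * nv (c k).
have f0 k : 0 <= f k by rewrite mulr_ge0 ?exprn_ge0 ?az_ge0 ?nv_ge0.
have g0 k : 0 <= g k by rewrite mulr_ge0 ?az_ge0 ?nv_ge0.
suff : S3 n (fun p q r => `|(az p * v p * az r - az r * v r * az p) *
    complex.Re (trip (c p) (c q) (c r))|) <= 16 * (6 * (A * B)).
  by have := norm_S3 n (fun p q r => (az p * v p * az r - az r * v r * az p) *
    complex.Re (trip (c p) (c q) (c r))); lra.
apply: (@le_trans _ _ (S3 n (fun p q r => 16 * ((f p * g q + f r * g q) +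
    (f p * g r + f q * g r) + (f q * g p + f r * g p))))).
  apply: ler_S3 => p q r pqr; have [h1 h2 h3] := az_tri pqr.
  have := weight_commutator (az_ge0 p) (az_ge0 q) (az_ge0 r) (nv_ge0 (c p)) (nv_ge0 (c q))
    (nv_ge0 (c r)) h1 h3.
  rewrite -/(f p) -/(f q) -/(f r) -/(g p) -/(g q) -/(g r) -!mulrDl.
  apply: le_trans; rewrite normrM.
  have -> : az p * v p * az r - az r * v r * az p = az p * az r * (v p - v r) by ring.
  rewrite normrM ger0_norm ?mulr_ge0 ?az_ge0//.
  apply: ler_pM; rewrite ?mulr_ge0 ?az_ge0 ?normr_ge0//.
    by rewrite ler_wpM2l ?mulr_ge0 ?az_ge0.
  exact: Re_trip_le.
rewrite S3M !S3D ler_wpM2l//.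
have h1 := S3_le12 n f0 g0; have h2 := S3_le13 n f0 g0; have h3 := S3_le23 n f0 g0.
have h4 := S3_le12 n g0 f0; have h5 := S3_le13 n g0 f0; have h6 := S3_le23 n g0 f0.
have e (F G : int -> int -> int -> R) : F = G -> S3 n F = S3 n G by move=> ->.
have mC (x y : int -> R) (i j : int -> int -> int -> int) :
  (fun p q r => x (i p q r) * y (j p q r)) = (fun p q r => y (j p q r) * x (i p q r)).
  by apply/funext => p; apply/funext => q; apply/funext => r; rewrite mulrC.
rewrite (e _ _ (mC f g (fun _ _ r => r) (fun _ q _ => q))).
rewrite (e _ _ (mC f g (fun _ q _ => q) (fun p _ _ => p))).
rewrite (e _ _ (mC f g (fun _ _ r => r) (fun p _ _ => p))).
rewrite -/A -/B in h1 h2 h3 h4 h5 h6; rewrite [B * A]mulrC in h4 h5 h6; lra.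
Qed.

(** The convolution inequality for l^1. The list [r] is free, so that it also bounds a single
    coefficient. *)
Lemma cv_sum_le n (r : seq int) (a b : int -> V) : uniq r ->
  \sum_(k <- r) nv (cv n a b k) <=
  (\sum_(k <- win n) nv (a k)) * \sum_(k <- win n) nv (b k).
Proof.
move=> ur; apply: (@le_trans _ _ (\sum_(k <- r) \sum_(m <- win n) \sum_(l <- win n)
    (if k == m + l then nv (a m) * nv (b l) else 0))).
  apply: ler_sum => k _; apply: le_trans (nv_sum _ _ _) _; apply: ler_sum => m _.
  apply: le_trans (nv_sum _ _ _) _; apply: ler_sum => l _.
  by rewrite eq_sym; case: ifP => _; rewrite ?nv0// nv_cross.
rewrite exchange_big mulr_suml; apply: ler_sum => m _.
rewrite exchange_big mulr_sumr; apply: ler_sum => l _.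
by apply: sum_if_eq; rewrite ?mulr_ge0 ?nv_ge0.
Qed.

Lemma cvBl n (a a' b : int -> V) k : cv n (fun k => a k - a' k) b k = cv n a b k - cv n a' b k.
Proof.
rewrite /cv -sumrB; apply: eq_bigr => m _; rewrite -sumrB; apply: eq_bigr => l _ /=.
by case: ifP; rewrite ?subr0// crossCDl crossCNl.
Qed.

Lemma cvBr n (a b b' : int -> V) k : cv n a (fun k => b k - b' k) k = cv n a b k - cv n a b' k.
Proof.
rewrite /cv -sumrB; apply: eq_bigr => m _; rewrite -sumrB; apply: eq_bigr => l _ /=.
by case: ifP; rewrite ?subr0// crossCDr crossCNr.
Qed.

Lemma cvB n (a a' b b' : int -> V) k : cv n a b k - cv n a' b' k =
  cv n (fun k => a k - a' k) b k + cv n a' (fun k => b k - b' k) k.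
Proof. by rewrite cvBl cvBr subrKA. Qed.

Definition tr n (a : int -> V) : int -> V := fun k => if (`|k| <= n)%N then a k else 0.

(** Trades the size of the window for truncated arguments, so that convolutions on two different
    windows can be subtracted by bilinearity. *)
Lemma cv_tr n m (a b : int -> V) k : (n <= m)%N -> cv m (tr n a) (tr n b) k = cv n a b k.
Proof.
move=> nm; rewrite /cv (win_supp nm); last first.
  by move=> i hi; rewrite big1// => l _; rewrite /tr leqNgt hi /= crossC0l if_same.
rewrite big_seq [RHS]big_seq; apply: eq_bigr => i; rewrite mem_win => hi.
rewrite (win_supp nm); last first.
  by move=> l hl; rewrite /tr [(`|l| <= n)%N]leqNgt hl /= crossC0r if_same.
rewrite big_seq [RHS]big_seq; apply: eq_bigr => l; rewrite mem_win => hl.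
by rewrite /tr hi hl.
Qed.

Lemma rcoefs_cv n a b : rcoefs a -> rcoefs b -> rcoefs (cv n a b).
Proof.
move=> ra rb k; rewrite /cv -win_opp /conjv raddf_sum; apply: eq_bigr => m _.
rewrite -win_opp raddf_sum; apply: eq_bigr => l _.
rewrite -opprD eqr_opp; case: ifP => _; last by rewrite raddf0.
by rewrite ra rb -conjv_cross.
Qed.

End Windows.

(** * Galerkin approximations *)

Section GalerkinODE.
Context {R : realType}.
Local Notation C := R[i].
Local Notation V := 'rV[R[i]]_3.
Local Notation nc := (@Normc.normc R).

Lemma halfC : (2^-1 : C) = (2^-1)%:C.
Proof. by rewrite rmorphV ?unitfE ?pnatr_eq0// rmorph_nat. Qed.

Lemma conjv0 : conjv (0 : V) = 0. Proof. exact: raddf0. Qed.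

Lemma conjvK (a : V) : conjv (conjv a) = a.
Proof. by apply/rowP => j; rewrite !mxE conjcK. Qed.

Section Quadratic.
Variable I : finType.
Implicit Types x y : I -> R.
Let d x y : R := \sum_i `|x i - y i|.
Let s x : R := \sum_i `|x i|.
Let Q x : R := \sum_i x i ^+ 2.

(** [lip1] and [lip2] are Lipschitz stand-ins for being linear and being quadratic. They are closed
    under the operations that build the Galerkin field, and they are all that the normalisation
    below uses of it. *)
Definition lip1 (f : (I -> R) -> C) := exists2 K : R, 0 <= K &
  f (fun=> 0) = 0 /\ forall x y, nc (f x - f y) <= K * d x y.
Definition lip2 (f : (I -> R) -> C) := exists2 K : R, 0 <= K &
  f (fun=> 0) = 0 /\ forall x y, nc (f x - f y) <= K * d x y * (s x + s y).

Let d_ge0 x y : 0 <= d x y. Proof. by apply: sumr_ge0. Qed.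
Let s_ge0 x : 0 <= s x. Proof. by apply: sumr_ge0. Qed.
Let Q_ge0 x : 0 <= Q x. Proof. by apply: sumr_ge0 => i _; rewrite sqr_ge0. Qed.
Let d0 x : d x (fun=> 0) = s x. Proof. by apply: eq_bigr => i _; rewrite subr0. Qed.
Let s0 : s (fun=> 0) = 0. Proof. by rewrite /s big1// => i _; rewrite normr0. Qed.

Lemma lip1_le f K x : f (fun=> 0) = 0 -> (forall x y, nc (f x - f y) <= K * d x y) ->
  nc (f x) <= K * s x.
Proof. by move=> f0 /(_ x (fun=> 0)); rewrite f0 subr0 d0. Qed.

Lemma lip1_coord i : lip1 (fun x => (x i)%:C).
Proof.
exists 1 => //; split=> // x y; rewrite mul1r -rmorphB nc_real /d (bigD1 i)//= lerDl.
by apply: sumr_ge0.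
Qed.

Lemma lip1D f g : lip1 f -> lip1 g -> lip1 (fun x => f x + g x).
Proof.
move=> [K K0 [f0 hf]] [L L0 [g0 hg]]; exists (K + L); first exact: addr_ge0.
split=> [|x y]; first by rewrite f0 g0 addr0.
rewrite opprD addrACA mulrDl; apply: le_trans (le_normcD _ _) _; exact: lerD.
Qed.

Lemma lip1Z (z : C) f : lip1 f -> lip1 (fun x => z * f x).
Proof.
move=> [K K0 [f0 hf]]; exists (nc z * K); first by rewrite mulr_ge0 ?nc_ge0.
split=> [|x y]; first by rewrite f0 mulr0.
by rewrite -mulrBr Normc.normcM -mulrA ler_wpM2l ?nc_ge0.
Qed.

Lemma lip1_conj f : lip1 f -> lip1 (fun x => (f x)^*).
Proof.
move=> [K K0 [f0 hf]]; exists K => //; split=> [|x y]; first by rewrite f0 conjc0.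
by rewrite -rmorphB /= nc_conj.
Qed.

Lemma lip1_0 : lip1 (fun=> 0).
Proof. by exists 0 => //; split=> // x y; rewrite subrr mul0r Normc.normc0. Qed.

Lemma lip2_0 : lip2 (fun=> 0).
Proof. by exists 0 => //; split=> // x y; rewrite subrr !mul0r Normc.normc0. Qed.

Lemma lip2D f g : lip2 f -> lip2 g -> lip2 (fun x => f x + g x).
Proof.
move=> [K K0 [f0 hf]] [L L0 [g0 hg]]; exists (K + L); first exact: addr_ge0.
split=> [|x y]; first by rewrite f0 g0 addr0.
rewrite opprD addrACA !mulrDl; apply: le_trans (le_normcD _ _) _.
by apply: le_trans (lerD (hf x y) (hg x y)) _; rewrite -!mulrDl.
Qed.

Lemma lip2N f : lip2 f -> lip2 (fun x => - f x).
Proof.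
move=> [K K0 [f0 hf]]; exists K => //; split=> [|x y]; first by rewrite f0 oppr0.
by rewrite -opprD normcN.
Qed.

Lemma lip2_sum (J : Type) (r : seq J) (f : J -> (I -> R) -> C) :
  (forall j, lip2 (f j)) -> lip2 (fun x => \sum_(j <- r) f j x).
Proof.
move=> h; elim: r => [|j r IH].
  by rewrite (_ : (fun _ => _) = fun=> 0); [exact: lip2_0|apply/funext => x; rewrite big_nil].
rewrite (_ : (fun _ => _) = fun x => f j x + \sum_(j <- r) f j x).
  exact: lip2D.
by apply/funext => x; rewrite big_cons.
Qed.

Lemma lip1M f g : lip1 f -> lip1 g -> lip2 (fun x => f x * g x).
Proof.
move=> [K K0 [f0 hf]] [L L0 [g0 hg]]; exists (K * L); first exact: mulr_ge0.
split=> [|x y]; first by rewrite f0 mul0r.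
have -> : f x * g x - f y * g y = (f x - f y) * g x + f y * (g x - g y) by ring.
apply: le_trans (le_normcD _ _) _; rewrite !Normc.normcM.
have h1 := lip1_le x g0 hg; have h2 := lip1_le y f0 hf.
have h3 : nc (f x - f y) * nc (g x) <= (K * d x y) * (L * s x).
  by apply: ler_pM; rewrite ?nc_ge0.
have h4 : nc (f y) * nc (g x - g y) <= (K * s y) * (L * d x y).
  by apply: ler_pM; rewrite ?nc_ge0.
by apply: le_trans (lerD h3 h4) _; rewrite le_eqVlt; apply/orP; left; apply/eqP; ring.
Qed.

Let m : R := #|I|%:R + 1.
Let m0 : 0 <= m. Proof. by rewrite addr_ge0. Qed.

Let s_le x : s x <= m * (1 + Q x).
Proof.
apply: (@le_trans _ _ (\sum_i (1 + x i ^+ 2))).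
  apply: ler_sum => i _; have := sqr_ge0 (`|x i| - 1).
  rewrite -[x i ^+ 2]real_normK ?num_real//.
  by have := normr_ge0 (x i); set z := `|x i|; nra.
rewrite big_split/= sumr_const -/(Q x) /m.
have := Q_ge0 x; have : 0 <= #|I|%:R :> R by []; nra.
Qed.

Let s_sq x : s x ^+ 2 <= m * Q x.
Proof.
have -> : s x ^+ 2 = \sum_i \sum_j `|x i| * `|x j|.
  by rewrite expr2 mulr_suml; apply: eq_bigr => i _; rewrite mulr_sumr.
apply: (@le_trans _ _ (\sum_i \sum_j (2^-1 * x i ^+ 2 + 2^-1 * x j ^+ 2))).
  apply: ler_sum => i _; apply: ler_sum => j _.
  have := sqr_ge0 (`|x i| - `|x j|).
  rewrite -[x i ^+ 2]real_normK ?num_real// -[x j ^+ 2]real_normK ?num_real//; lra.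
have -> : \sum_i \sum_j (2^-1 * x i ^+ 2 + 2^-1 * x j ^+ 2) = #|I|%:R * Q x.
  under eq_bigr do rewrite big_split/= sumr_const -mulr_sumr -/(Q x).
  rewrite big_split/= sumr_const.
  rewrite sumrMnl -mulr_sumr -/(Q x) -mulrnDl [RHS]mulr_natl.
  by congr (_ *+ _); field.
by rewrite ler_wpM2r ?lerDl.
Qed.

Let Q_lip x y : `|Q x - Q y| <= d x y * (s x + s y).
Proof.
rewrite /Q -sumrB; apply: le_trans (ler_norm_sum _ _ _) _.
rewrite /d mulr_suml; apply: ler_sum => i _; rewrite subr_sqr normrM ler_wpM2l//.
apply: le_trans (ler_normD _ _) _; apply: lerD.
  by rewrite /s (bigD1 i)//= lerDl sumr_ge0.
by rewrite /s (bigD1 i)//= lerDl sumr_ge0.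
Qed.

(** With u = 1 + Q x and w = 1 + Q y, split f x / u - f y / w as (f x - f y) / u + f y (1/u - 1/w).
    When Q y <= Q x, both sums of absolute values are at most a multiple of u, and f y is at most a
    multiple of w, so the denominators cancel. The other case is symmetric. *)
Lemma lip2_normalized f : lip2 f -> exists2 K : R, 0 <= K &
  (forall x, nc (f x) / (1 + Q x) <= K) /\
  forall x y, nc (f x * ((1 + Q x)^-1)%:C - f y * ((1 + Q y)^-1)%:C) <= K * d x y.
Proof.
move=> [K K0 [f0 hf]].
have fle x : nc (f x) <= K * (m * Q x).
  have := hf x (fun=> 0); rewrite f0 subr0 d0 s0 addr0 -mulrA -expr2 => h.
  by apply: le_trans h _; rewrite ler_wpM2l ?s_sq.
have q0 x : 0 < 1 + Q x by rewrite ltr_pwDl.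
exists (K * m + 2 * m * K + 2 * K * m * m).
  by rewrite !addr_ge0// !mulr_ge0.
have main x y : Q y <= Q x ->
    nc (f x * ((1 + Q x)^-1)%:C - f y * ((1 + Q y)^-1)%:C) <= (2 * m * K + 2 * K * m * m) * d x y.
  move=> yx; set u := 1 + Q x; set w := 1 + Q y.
  have u0 : 0 < u := q0 x; have w0 : 0 < w := q0 y.
  have -> : f x * (u^-1)%:C - f y * (w^-1)%:C = (f x - f y) * (u^-1)%:C + f y * (u^-1 - w^-1)%:C.
    by rewrite rmorphB; ring.
  have ss : s x + s y <= 2 * m * u.
    have : m * (1 + Q y) <= m * (1 + Q x) by rewrite ler_wpM2l// lerD2l.
    have := s_le x; have := s_le y; rewrite /u; lra.
  apply: le_trans (le_normcD _ _) _; rewrite !Normc.normcM !nc_real mulrDl; apply: lerD.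
    rewrite ger0_norm; last by rewrite invr_ge0 ltW.
    rewrite ler_pdivrMr//.
    apply: le_trans (hf x y) _.
    have -> : 2 * m * K * d x y * u = K * d x y * (2 * m * u) by ring.
    by rewrite ler_wpM2l ?mulr_ge0.
  have -> : `|u^-1 - w^-1| = `|Q x - Q y| / (u * w).
    have -> : u^-1 - w^-1 = (Q y - Q x) / (u * w) by rewrite /u /w; field; rewrite !gt_eqF.
    by rewrite normrM distrC [`|(_)^-1|]ger0_norm// invr_ge0 mulr_ge0// ltW.
  rewrite mulrA ler_pdivrMr ?mulr_gt0//.
  have h1 : nc (f y) * `|Q x - Q y| <= K * (m * w) * (d x y * (2 * m * u)).
    apply: ler_pM; rewrite ?nc_ge0//.
      by apply: le_trans (fle y) _; rewrite !ler_wpM2l// lerDr.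
    by apply: le_trans (Q_lip x y) _; rewrite ler_wpM2l.
  by apply: le_trans h1 _; rewrite le_eqVlt; apply/orP; left; apply/eqP; ring.
split=> [x|x y].
  rewrite ler_pdivrMr//; apply: le_trans (fle x) _.
  have := Q_ge0 x; have := mulr_ge0 K0 m0; have := mulr_ge0 (mulr_ge0 K0 m0) m0.
  move=> h1 h2 h3; have := mulr_ge0 h1 h3; have := mulr_ge0 h2 h3; nra.
apply: (@le_trans _ _ ((2 * m * K + 2 * K * m * m) * d x y)); last first.
  by rewrite ler_wpM2r// -addrA lerDr mulr_ge0.
have [yx|/ltW xy] := leP (Q y) (Q x); first exact: main.
by rewrite -normcN opprB /d; under eq_bigr do rewrite distrC; exact: main.
Qed.

End Quadratic.

Section Existence.
Variables (n : nat) (c0 : int -> V).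
Hypothesis rc0 : rcoefs c0.
Let I : finType := ('I_n.*2.+1 * 'I_3 * bool)%type.
Let idx (k : int) : 'I_n.*2.+1 := inord (absz (k + n%:Z)).
Let vec (x : I -> R) (k : int) : V :=
  if (`|k| <= n)%N then \row_j (x (idx k, j, true) +i* x (idx k, j, false)) else 0.
(** Projection onto the coefficients of real functions. Every point of the real state space then
    yields real coefficients, and reality need not be propagated in time. *)
Let Cx (x : I -> R) (k : int) : V := 2^-1 *: (vec x k + conjv (vec x (- k))).
Let F (x : I -> R) (k : int) : V := cv n (Cx x) (ag (Cx x)) k.
Let Q (x : I -> R) : R := \sum_i x i ^+ 2.
Let x0 : I -> R := fun '(i, j, b) => let z := c0 (i%:Z - n%:Z) 0 j in
  if b then complex.Re z else complex.Im z.
(* Dividing by 1 + |x|^2 makes the quadratic field globally Lipschitz; the flow conserves |x|^2, so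
   after rescaling by its initial value it solves the Galerkin system. *)
Let g (x : I -> R) : I -> R := fun '(i, j, b) =>
  let z := F x (i%:Z - n%:Z) 0 j in
  (1 + Q x0) * (1 + Q x)^-1 * (if b then complex.Re z else complex.Im z).

Let lip1_vec k j : lip1 (fun x => vec x k 0 j).
Proof.
rewrite /vec; case: (leqP `|k| n) => _.
  rewrite (_ : (fun _ => _) = fun x => (x (idx k, j, true))%:C + 'i * (x (idx k, j, false))%:C).
    by apply: lip1D; [exact: lip1_coord|apply: lip1Z; exact: lip1_coord].
  by apply/funext => x; rewrite mxE [LHS]complexE.
by rewrite (_ : (fun _ => _) = fun=> 0); [exact: lip1_0|apply/funext => x; rewrite mxE].
Qed.

Let lip1_Cx k j : lip1 (fun x => Cx x k 0 j).
Proof.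
rewrite (_ : (fun _ => _) = fun x => 2^-1 * (vec x k 0 j + (vec x (- k) 0 j)^*)).
  by apply: lip1Z; apply: lip1D => //; exact: lip1_conj.
by apply/funext => x; rewrite !mxE.
Qed.

Let lip2_F k j : lip2 (fun x => F x k 0 j).
Proof.
rewrite (_ : (fun _ => _) = fun x => \sum_(m <- win n) \sum_(l <- win n)
   (if m + l == k then crossC (Cx x m) (ag (Cx x) l) 0 j else 0)).
  apply: lip2_sum => m; apply: lip2_sum => l; case: (m + l == k); last exact: lip2_0.
  rewrite (_ : (fun _ => _) = fun x => Cx x m 0 (j + 1) * ((az l)%:C * Cx x l 0 (j + 2))
     + - (Cx x m 0 (j + 2) * ((az l)%:C * Cx x l 0 (j + 1)))).
    by apply: lip2D; last apply: lip2N; apply: lip1M => //; apply: lip1Z.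
  by apply/funext => x; rewrite !mxE.
apply/funext => x; rewrite /F /cv summxE; apply: eq_bigr => m _; rewrite summxE.
by apply: eq_bigr => l _; case: ifP => // _; rewrite mxE.
Qed.

Let Q_ge0 x : 0 <= Q x. Proof. by apply: sumr_ge0 => i _; rewrite sqr_ge0. Qed.

Let g_lip : exists2 K : R, 0 <= K & (forall x i, `|g x i| <= K) /\
  (forall x y i, `|g x i - g y i| <= K * \sum_j `|x j - y j|).
Proof.
have : forall i, exists K : R, [/\ 0 <= K, (forall x, `|g x i| <= K) &
    (forall x y, `|g x i - g y i| <= K * \sum_j `|x j - y j|)].
  case=> [[i j] b]; have [K K0 [h1 h2]] := lip2_normalized (lip2_F (i%:Z - n%:Z) j).
  have q0 : 0 <= 1 + Q x0 by rewrite addr_ge0.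
  have gE x : g x (i, j, b) = (1 + Q x0) * (if b then complex.Re
     (F x (i%:Z - n%:Z) 0 j * ((1 + Q x)^-1)%:C) else
     complex.Im (F x (i%:Z - n%:Z) 0 j * ((1 + Q x)^-1)%:C)).
    by rewrite /g -mulrA; congr (_ * _); case: (b); rewrite [_ * _%:C]mulrC ?Re_scale ?Im_scale.
  exists ((1 + Q x0) * K); split; first by rewrite mulr_ge0.
    move=> x; rewrite gE normrM ger0_norm// ler_wpM2l//; apply: le_trans (h1 x).
    have iq : 0 <= (1 + Q x)^-1 by rewrite invr_ge0 addr_ge0.
    have -> : nc (F x (i%:Z - n%:Z) 0 j) / (1 + Q x) =
      nc (F x (i%:Z - n%:Z) 0 j * ((1 + Q x)^-1)%:C).
      by rewrite Normc.normcM nc_real ger0_norm.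
    by case: (b); [exact: Re_le_nc|exact: Im_le_nc].
  move=> x y; rewrite !gE -mulrBr normrM ger0_norm// -mulrA ler_wpM2l//.
  apply: le_trans (h2 x y).
  case: (b); first by rewrite -Re_opp -Re_add; exact: Re_le_nc.
  by rewrite -Im_opp -Im_add; exact: Im_le_nc.
move=> /choice[K hK]; exists (\sum_i K i).
  by apply: sumr_ge0 => i _; have [] := hK i.
have Kle i : K i <= \sum_i K i.
  by rewrite (bigD1 i)//= lerDl sumr_ge0// => j _; have [] := hK j.
split=> [x i|x y i]; have [_ h1 h2] := hK i; first exact: le_trans (h1 x) (Kle i).
by apply: le_trans (h2 x y) _; rewrite ler_wpM2r ?Kle ?sumr_ge0.
Qed.

Let rCx x : rcoefs (Cx x).
Proof.
move=> k; rewrite /Cx opprK; apply/rowP => j; rewrite !mxE halfC.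
case: (vec x k 0 j) => a b; case: (vec x (- k) 0 j) => u v.
by apply/eqP; rewrite eq_complex /=; apply/andP; split; apply/eqP; ring.
Qed.

Let idxK (i : 'I_n.*2.+1) : idx (i%:Z - n%:Z) = i.
Proof. by apply: val_inj; rewrite /= inordK; have := ltn_ord i; lia. Qed.

Let sumI (f : I -> R) : \sum_i f i =
  \sum_(i < n.*2.+1) \sum_(j < 3) (f (i, j, true) + f (i, j, false)).
Proof.
transitivity (\sum_(p : ('I_n.*2.+1 * 'I_3) * bool) f (p.1, p.2)).
  by apply: eq_bigr => -[].
rewrite -(pair_bigA _ (fun p b => f (p, b)))/=.
transitivity (\sum_(p : 'I_n.*2.+1 * 'I_3) \sum_b f (p.1, p.2, b)).
  by apply: eq_bigr => -[].
rewrite -(pair_bigA _ (fun i j => \sum_b f (i, j, b)))/=.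
by apply: eq_bigr => i _; apply: eq_bigr => j _; rewrite big_bool.
Qed.

(** [F x] is the coefficient family of a real function, so pairing it with [vec x] or with its
    projection [Cx x] gives the same value. The latter vanishes because c x |nabla| c is orthogonal
    to c. *)
Let conserved x : \sum_i x i * g x i = 0.
Proof.
rewrite sumI; set th := (1 + Q x0) * (1 + Q x)^-1.
transitivity (th * \sum_(k <- win n) rdot (vec x k) (F x k)).
  rewrite win_ord mulr_sumr; apply: eq_bigr => i _; rewrite /rdot mulr_sumr.
  apply: eq_bigr => j _; rewrite /g -/th /vec.
  have -> : (`|i%:Z - n%:Z| <= n)%N by have := ltn_ord i; lia.
  by rewrite mxE /= idxK; ring.
have rF : rcoefs (F x) by apply: rcoefs_cv => //; exact: rcoefs_ag.
have -> : \sum_(k <- win n) rdot (vec x k) (F x k) = \sum_(k <- win n) rdot (Cx x k) (F x k).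
  have e : \sum_(k <- win n) rdot (conjv (vec x (- k))) (F x k) =
      \sum_(k <- win n) rdot (vec x k) (F x k).
    rewrite -win_opp; apply: eq_bigr => k _; rewrite opprK rF /rdot; apply: eq_bigr => j _.
    by rewrite !mxE; case: (vec x k 0 j) => a b; case: (F x k 0 j) => u v /=; ring.
  have -> : \sum_(k <- win n) rdot (Cx x k) (F x k) =
    \sum_(k <- win n) 2^-1 * (rdot (vec x k) (F x k) + rdot (conjv (vec x (- k))) (F x k)).
    apply: eq_bigr => k _; rewrite /Cx ![rdot _ (F x k)]rdotC -rdotDr !rdotE.
    by rewrite dotvZr halfC Re_scale.
  by rewrite -mulr_sumr big_split/= e; field.
have h : \sum_(k <- win n) 1 * rdot (Cx x k) (F x k) = S3 n (fun p q r => 1 *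
    complex.Re (trip (Cx x p) (Cx x q) (ag (Cx x) r))).
  exact: (@rdot_cv R n (Cx x) (Cx x) (ag (Cx x)) (fun=> 1)).
have {}h : \sum_(k <- win n) rdot (Cx x k) (F x k) = S3 n (fun p q r => 1 *
    complex.Re (trip (Cx x p) (Cx x q) (ag (Cx x) r))).
  by rewrite -h; apply: eq_bigr => k _; rewrite mul1r.
suff -> : \sum_(k <- win n) rdot (Cx x k) (F x k) = 0 by rewrite mulr0.
apply: (etrans h); rewrite -(S3_anti12 n (Cx x) (Cx x) az).
by apply: eq_S3 => p q r _; rewrite mul1r /ag tripZ3 Re_scale.
Qed.

Lemma galerkin_exists : exists c : R -> int -> V,
  [/\ forall k, c 0 k = tr n c0 k,
      forall t, rcoefs (c t),
      forall t (k : int), (n < `|k|)%N -> c t k = 0 &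
      forall T (k : int), (`|k| <= n)%N ->
        DV T (fun t => c t k) (fun t => cv n (c t) (ag (c t)) k)].
Proof.
have [K K0 [gK gL]] := g_lip.
have [x [x00 xD]] := picard x0 K0 gL gK.
have Qx t : 0 <= t -> Q (x t) = Q x0.
  move=> t0; have hD : D1 t (fun t => Q (x t)) (fun t => 2 * \sum_i x t i * g (x t) i).
    have : D1 t (fun t => \sum_i x t i ^+ 2) (fun t => \sum_i 2 * x t i * g (x t) i).
      by apply: D1_sum => i _; apply: D1_sqr.
    apply: D1_ext => // u _; rewrite mulr_sumr; apply: eq_bigr => i _; by rewrite mulrA.
  have h u : 0 < u < t -> `|2 * \sum_i x u i * g (x u) i| <= 0.
    by move=> _; rewrite conserved mulr0 normr0.
  have := D1_lip hD h (lexx 0) t0 (lexx t).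
  rewrite mul0r normr_le0 subr_eq0 => /eqP ->.
  by rewrite /Q; under eq_bigr do rewrite x00.
exists (fun t => Cx (x t)); split => //.
- move=> k; have v0 l : vec (x 0) l = tr n c0 l.
    rewrite /vec /tr; case: ifP => // h; apply/rowP => j; rewrite mxE !x00 /x0.
    have -> : (idx l)%:Z - n%:Z = l by rewrite /idx inordK; lia.
    by case: (c0 l 0 j).
  rewrite /Cx !v0 /tr abszN; case: ifP => h; last by rewrite conjv0 addr0 scaler0.
  have -> : c0 k + conjv (c0 (- k)) = (2 : C) *: c0 k by rewrite rc0 conjvK scaler_nat mulr2n.
  by rewrite scalerA mulVf ?scale1r.
- move=> t k h; rewrite /Cx /vec abszN leqNgt h /= conjv0 addr0 scaler0//.
move=> T k hk j.
have gE t (i : 'I_n.*2.+1) b : 0 <= t -> g (x t) (i, j, b) =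
    if b then complex.Re (F (x t) (i%:Z - n%:Z) 0 j) else complex.Im (F (x t) (i%:Z - n%:Z) 0 j).
  by move=> t0; rewrite /g Qx// mulfV ?mul1r// gt_eqF// ltr_pwDl.
have ik l : (`|l| <= n)%N -> (idx l)%:Z - n%:Z = l by move=> hl; rewrite /idx inordK; lia.
have hk' : (`|- k| <= n)%N by rewrite abszN.
have rF t : F (x t) (- k) = conjv (F (x t) k).
  by apply: rcoefs_cv => //; exact: rcoefs_ag.
have cRe t : complex.Re (Cx (x t) k 0 j) = 2^-1 * (x t (idx k, j, true) + x t (idx (- k), j, true)).
  rewrite /Cx /vec hk hk' !mxE; rewrite halfC.
  by rewrite Re_scale.
have cIm t : complex.Im (Cx (x t) k 0 j) = 2^-1 * (x t (idx k, j, false) - x t (idx (- k), j, false)).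
  rewrite /Cx /vec hk hk' !mxE; rewrite halfC.
  by rewrite Im_scale.
split.
  apply: D1_ext (D1_scale 2^-1 (D1_add (xD T (idx k, j, true)) (xD T (idx (- k), j, true)))) => t.
    by rewrite cRe.
  move=> /andP[/ltW t0 _]; rewrite !gE ?ik// rF mxE.
  by rewrite -/(F (x t) k); case: (F (x t) k 0 j) => a b /=; field.
apply: D1_ext (D1_scale 2^-1 (D1_sub (xD T (idx k, j, false)) (xD T (idx (- k), j, false)))) => t.
  by rewrite cIm.
move=> /andP[/ltW t0 _]; rewrite !gE ?ik// rF mxE.
by rewrite -/(F (x t) k); case: (F (x t) k 0 j) => a b /=; field.
Qed.

End Existence.

End GalerkinODE.

(** * Energy and stability estimates for the Galerkin system *)

Section GalerkinEstimates.
Context {R : realType}.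
Local Notation C := R[i].
Local Notation V := 'rV[R[i]]_3.
Local Notation nc := (@Normc.normc R).
Local Notation az := (@az R).
Local Notation hw := (@hw R).

(** The equation is imposed only for |k| <= n: the convolution reaches up to 2n, and dropping the
    rest is the Galerkin projection. *)
Definition gal n (c : R -> int -> V) : Prop :=
  [/\ forall t, rcoefs (c t),
      forall t (k : int), (n < `|k|)%N -> c t k = 0 &
      forall T (k : int), (`|k| <= n)%N ->
        DV T (fun t => c t k) (fun t => cv n (c t) (ag (c t)) k)].

(** On a window, [yn] is equivalent to the squared H^{5/2} norm and [ln] is the weighted l^1 norm
    that it controls. Bounds for all [n] stand for bounds on the infinite sums. *)
Definition yn n (c : int -> V) : R := \sum_(k <- win n) (1 + az k ^+ 5) * sqv (c k).
Definition ln n (c : int -> V) : R := \sum_(k <- win n) (1 + hw k) * nv (c k).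

Lemma one5_gt0 k : 0 < 1 + az k ^+ 5.
Proof. by rewrite ltr_pwDl// exprn_ge0 ?az_ge0. Qed.

Lemma yn_ge0 n c : 0 <= yn n c.
Proof. by apply: sumr_ge0 => k _; rewrite mulr_ge0 ?sqv_ge0// ltW ?one5_gt0. Qed.

Lemma ln_ge0 n c : 0 <= ln n c.
Proof. by apply: sumr_ge0 => k _; rewrite mulr_ge0 ?nv_ge0// addr_ge0 ?hw_ge0. Qed.

Lemma yn_mono n m c : (n <= m)%N -> yn n c <= yn m c.
Proof.
by move=> nm; apply: win_mono => // k; rewrite mulr_ge0 ?sqv_ge0// ltW ?one5_gt0.
Qed.

Lemma y5_le n c : \sum_(k <- win n) az k ^+ 5 * sqv (c k) <= yn n c.
Proof. by apply: ler_sum => k _; rewrite ler_wpM2r ?sqv_ge0// lerDr. Qed.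

Lemma ysqv_le n c : \sum_(k <- win n) sqv (c k) <= yn n c.
Proof. by apply: ler_sum => k _; rewrite ler_peMl ?sqv_ge0// lerDl exprn_ge0 ?az_ge0. Qed.

Lemma mem_win0 n : 0 \in win n. Proof. by rewrite mem_win. Qed.

Lemma sqv0_le n c : sqv (c 0) <= yn n c.
Proof.
apply: le_trans (ysqv_le n c); rewrite (big_rem 0) ?mem_win0//= lerDl.
by apply: sumr_ge0 => k _; exact: sqv_ge0.
Qed.

Lemma ln_le n c : ln n c <= 6 * (1 + yn n c).
Proof.
apply: (@le_trans _ _ (\sum_(k <- win n) ((if k == 0 then nv (c 0) else 0) + 2 * (hw k * nv (c k))))).
  apply: ler_sum => k _; have [->|k0] := eqVneq k 0.
    by rewrite /hw az0 !mul0r addr0 mul1r mulr0 addr0.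
  have h : 1 <= hw k by apply: le_trans (az_ge1 k0) (az_le_hw _).
  have := ler_wpM2r (nv_ge0 (c k)) h; lra.
rewrite big_split/= -mulr_sumr.
have h1 := @sum_if_eq R (win n) 0 (nv (c 0)) (win_uniq n) (nv_ge0 _).
have h2 := hw_sum n c; have h3 := y5_le n c; have h4 := sqv0_le n c.
have h5 := nv_sqv (c 0); have h6 := sqr_ge0 (nv (c 0) - 1); have h7 := yn_ge0 n c.
apply: (@le_trans _ _ (nv (c 0) + 2 * (2 + 2 * yn n c))); last by lra.
by apply: lerD => //; rewrite ler_wpM2l//; lra.
Qed.

Lemma nv_sum_le n c : \sum_(k <- win n) nv (c k) <= ln n c.
Proof. by apply: ler_sum => k _; rewrite ler_peMl ?nv_ge0// lerDl hw_ge0. Qed.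

Lemma az_sum_le n c : \sum_(k <- win n) az k * nv (c k) <= ln n c.
Proof.
apply: ler_sum => k _; rewrite ler_wpM2r ?nv_ge0//.
by apply: le_trans (az_le_hw _) _; rewrite lerDr.
Qed.

(** Every truncation at frequency n costs this factor: it is the gap between the weight |k|^{3/2} of
    [ln] and the one derivative of the equation. *)
Definition sn (n : nat) : R := (Num.sqrt n.+1%:R)^-1.

Lemma sn_ge0 n : 0 <= sn n. Proof. by rewrite invr_ge0 sqrtr_ge0. Qed.

Lemma sn_sqr n : sn n ^+ 2 = n.+1%:R^-1.
Proof. by rewrite /sn exprVn sqr_sqrtr. Qed.

Lemma sn_cvg0 : sn @ \oo --> 0.
Proof.
apply/cvgrPdist_lt => e e0; near=> n.
rewrite sub0r normrN ger0_norm ?sn_ge0//.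
rewrite -(ltr_pXn2r (n := 2))// ?nnegrE ?sn_ge0 ?ltW// sn_sqr.
near: n; have e2 : 0 < e ^+ 2 by rewrite exprn_gt0.
have : harmonic @ \oo --> (0 : R) by exact: cvg_harmonic.
move=> /cvgrPdist_lt/(_ _ e2); apply: filterS => n /=.
by rewrite sub0r normrN ger0_norm ?invr_ge0.
Unshelve. all: by end_near. Qed.

Lemma tail_nv n m c : (n <= m)%N ->
  \sum_(k <- win m) nv (c k - tr n c k) <= sn n * ln m c.
Proof.
move=> nm; rewrite mulr_sumr; apply: ler_sum => k _; rewrite /tr.
case: leqP => [_|h]; first by rewrite subrr nv0 !mulr_ge0 ?sn_ge0 ?nv_ge0 ?addr_ge0 ?hw_ge0.
rewrite subr0 mulrA ler_peMl ?nv_ge0//; apply: le_trans (one_tail h) _.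
by rewrite ler_wpM2l ?sn_ge0// lerDr.
Qed.

Lemma tail_az n m c : (n <= m)%N ->
  \sum_(k <- win m) nv (ag c k - tr n (ag c) k) <= sn n * ln m c.
Proof.
move=> nm; rewrite mulr_sumr; apply: ler_sum => k _; rewrite /tr.
case: leqP => [_|h]; first by rewrite subrr nv0 !mulr_ge0 ?sn_ge0 ?nv_ge0 ?addr_ge0 ?hw_ge0.
rewrite subr0 nv_ag mulrA ler_wpM2r ?nv_ge0//; apply: le_trans (az_tail h) _.
by rewrite ler_wpM2l ?sn_ge0// lerDr.
Qed.

(** Once the smaller window is expressed by truncated arguments, each term of the difference has a
    purely high-frequency factor, whose l^1 norm is small. *)
Lemma cv_trunc n m c (r : seq int) (G : R) : uniq r -> (n <= m)%N -> ln m c <= G ->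
  \sum_(k <- r) nv (cv m c (ag c) k - cv n c (ag c) k) <= 2 * sn n * G ^+ 2.
Proof.
move=> ur nm hG.
have l0 := ln_ge0 m c.
apply: (@le_trans _ _ (\sum_(k <- r) (nv (cv m (fun k => c k - tr n c k) (ag c) k) +
   nv (cv m (tr n c) (fun k => ag c k - tr n (ag c) k) k)))).
  by apply: ler_sum => k _; rewrite -(cv_tr c (ag c) k nm) cvB nvD.
rewrite big_split/=.
have h1 := cv_sum_le m (fun k => c k - tr n c k) (ag c) ur.
have h2 := cv_sum_le m (tr n c) (fun k => ag c k - tr n (ag c) k) ur.
have t1 := tail_nv c nm; have t2 := tail_az c nm.
have b1 : \sum_(k <- win m) nv (ag c k) <= G.
  by under eq_bigr do rewrite nv_ag; exact: le_trans (az_sum_le m c) hG.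
have b2 : \sum_(k <- win m) nv (tr n c k) <= G.
  apply: le_trans (le_trans _ (nv_sum_le m c)) hG; apply: ler_sum => k _.
  by rewrite /tr; case: ifP => // _; rewrite nv0 nv_ge0.
have s0 := sn_ge0 n.
have t3 : sn n * ln m c <= sn n * G by rewrite ler_wpM2l.
have p0 (F : int -> V) : 0 <= \sum_(k <- win m) nv (F k).
  by apply: sumr_ge0 => k _; exact: nv_ge0.
have q1 : (\sum_(k <- win m) nv (c k - tr n c k)) * (\sum_(k <- win m) nv (ag c k)) <= (sn n * G) * G.
  by apply: ler_pM => //; exact: le_trans t1 t3.
have q2 : (\sum_(k <- win m) nv (tr n c k)) * (\sum_(k <- win m) nv (ag c k - tr n (ag c) k)) <= G * (sn n * G).
  by apply: ler_pM => //; exact: le_trans t2 t3.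
by rewrite expr2; lra.
Qed.

Lemma gal_energy n c (w : int -> R) T : gal n c -> (forall k, w (- k) = w k) ->
  D1 T (fun t => \sum_(k <- win n) w k * sqv (c t k))
    (fun t => 2 * S3 n (fun p q r => w p * az r * complex.Re (trip (c t p) (c t q) (c t r)))).
Proof.
move=> [rc c0 hc] we.
have : D1 T (fun t => \sum_(k <- win n | k \in win n) w k * sqv (c t k))
   (fun t => \sum_(k <- win n | k \in win n) w k * (2 * rdot (c t k) (cv n (c t) (ag (c t)) k))).
  by apply: D1_sum => k; rewrite mem_win => /(hc T)/DV_sqv; exact: D1_scale.
apply: D1_ext => t; first by rewrite -big_seq.
move=> _; rewrite -big_seq.
transitivity (\sum_(k <- win n) 2 * (w k * rdot (c t k) (cv n (c t) (ag (c t)) k))).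
  by apply: eq_bigr => k _; rewrite mulrCA.
rewrite -mulr_sumr rdot_cv//; congr (_ * _); apply: eq_S3 => p q r _.
by rewrite /ag tripZ3 Re_scale mulrA.
Qed.

Lemma S3_1 n (a : int -> V) :
  S3 n (fun p q r => az r * complex.Re (trip (a p) (a q) (a r))) = 0.
Proof. exact: (S3_anti12 n a a az). Qed.

Lemma nv5_le n c : \sum_(k <- win n) az k ^+ 5 * nv (c k) ^+ 2 <= 3 * yn n c.
Proof.
apply: (@le_trans _ _ (\sum_(k <- win n) 3 * (az k ^+ 5 * sqv (c k)))); last first.
  by rewrite -mulr_sumr ler_wpM2l// y5_le.
by apply: ler_sum => k _; rewrite [leRHS]mulrCA ler_wpM2l ?nv_sqv ?exprn_ge0 ?az_ge0.
Qed.

Lemma azhw_le n c : \sum_(k <- win n) az k * nv (c k) <= 2 + 2 * yn n c.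
Proof.
have := hw_sum n c; have := y5_le n c.
have : \sum_(k <- win n) az k * nv (c k) <= \sum_(k <- win n) hw k * nv (c k).
  by apply: ler_sum => k _; rewrite ler_wpM2r ?nv_ge0 ?az_le_hw.
lra.
Qed.

(** 288 is 48 from the flux, times 3 from comparing [nv] with [sqv], times 2 from the weighted l^1
    bound. *)
Lemma flux_le n c (v : int -> R) :
  (forall p r, `|v p - v r| <= `|az p ^+ 4 - az r ^+ 4|) ->
  `|S3 n (fun p q r => az p * v p * az r * complex.Re (trip (c p) (c q) (c r)))| <=
  288 * (1 + yn n c) ^+ 2.
Proof.
move=> hv; apply: le_trans (energy_flux n c hv) _.
have h1 := nv5_le n c; have h2 := azhw_le n c; have y0 := yn_ge0 n c.
have : (\sum_(k <- win n) az k ^+ 5 * nv (c k) ^+ 2) * (\sum_(k <- win n) az k * nv (c k)) <=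
   (3 * yn n c) * (2 + 2 * yn n c).
  by apply: ler_pM => //; apply: sumr_ge0 => k _; rewrite mulr_ge0 ?exprn_ge0 ?nv_ge0 ?az_ge0.
rewrite -mulrA; nra.
Qed.

(* Sealed, so that side conditions never unfold the unary numeral. *)
Fact rate_key : unit. Proof. exact: tt. Qed.
Definition rate : R := locked_with rate_key 1152.
Lemma rateE : rate = 1152. Proof. by rewrite /rate unlock. Qed.
Lemma rate_gt0 : 0 < rate. Proof. by rewrite rateE ltr0n. Qed.

(** The weight 1 contributes nothing by antisymmetry, and |p|^5 = |p| |p|^4 has the form required by
    the flux bound. The energy derivative is twice the flux, hence 576; the Riccati time doubles
    this once more, which gives the value 1152 of [rate]. *)
Lemma gal_yn n c t : gal n c -> 0 <= t -> rate * (1 + yn n (c 0)) * t <= 1 ->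
  1 + yn n (c t) <= 2 * (1 + yn n (c 0)).
Proof.
move=> gc t0 ht.
have we k : 1 + az (- k) ^+ 5 = 1 + az k ^+ 5 by rewrite azN.
have hD := gal_energy t gc we.
have hy0 u : 0 <= u <= t -> 0 <= yn n (c u) by move=> _; exact: yn_ge0.
have hf u : 0 < u < t -> 2 * S3 n (fun p q r => (1 + az p ^+ 5) * az r *
    complex.Re (trip (c u p) (c u q) (c u r))) <= 576 * (1 + yn n (c u)) ^+ 2.
  move=> _.
  have -> : S3 n (fun p q r => (1 + az p ^+ 5) * az r * complex.Re (trip (c u p) (c u q) (c u r))) =
    S3 n (fun p q r => az p * (az p ^+ 4) * az r * complex.Re (trip (c u p) (c u q) (c u r))).
    rewrite -[RHS]add0r -(S3_1 n (c u)) -S3D; apply: eq_S3 => p q r _; ring.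
  have := flux_le n (c u) (v := fun p => az p ^+ 4) (fun p r => lexx _).
  by rewrite ler_norml => /andP[_]; lra.
have tt : 0 <= t <= t by rewrite t0 lexx.
have := riccati (ler0n R 576) hD hy0 hf tt; rewrite -/(yn n (c 0)); apply.
by apply: le_trans ht; rewrite rateE le_eqVlt; apply/orP; left; apply/eqP; ring.
Qed.

(** D = v - u solves D' = v x |nabla| D + D x |nabla| u - e up to projection. The middle term is
    orthogonal to D; in the first, the commutator ||r| - |p|| <= |q| moves the derivative onto v. So
    the growth rate is governed by [v] alone, and [u] may be any approximate solution with defect
    [e]. *)
Lemma gal_stab n v u e (T B eps : R) : gal n v -> (forall t, rcoefs (u t)) ->
  (forall k : int, (`|k| <= n)%N ->
     DV T (fun t => u t k) (fun t => cv n (u t) (ag (u t)) k + e t k)) ->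
  0 <= B -> (forall t : R, 0 < t < T -> \sum_(k <- win n) az k * nv (v t k) <= B) ->
  (forall t : R, 0 < t < T -> \sum_(k <- win n) sqv (e t k) <= eps) -> 0 <= eps ->
  forall t : R, 0 <= t <= T -> \sum_(k <- win n) sqv (v t k - u t k) <=
    (\sum_(k <- win n) sqv (v 0 k - u 0 k) + eps * t) * expR ((3 * B + 1) * t).
Proof.
move=> [rv v0 hv] ru hu B0 hB he e0.
pose D t k := v t k - u t k.
have rD t : rcoefs (D t).
  by move=> k; rewrite /D rv ru -raddfB.
pose F t k := cv n (v t) (ag (D t)) k + cv n (D t) (ag (u t)) k - e t k.
have hD k : (`|k| <= n)%N -> DV T (fun t => D t k) (fun t => F t k).
  move=> hk; have -> : (fun t => F t k) = fun t => cv n (v t) (ag (v t)) k -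
      (cv n (u t) (ag (u t)) k + e t k).
    apply/funext => t; rewrite opprD addrA /F; congr (_ - _).
    have -> : ag (D t) = fun k => ag (v t) k - ag (u t) k.
      by apply/funext => l; rewrite /ag /D scalerBr.
    rewrite cvBr /D cvBl; rewrite addrA; congr (_ - _).
    by rewrite subrK.
  exact: DV_sub (hv _ _ hk) (hu _ hk).
have : D1 T (fun t => \sum_(k <- win n | k \in win n) sqv (D t k))
   (fun t => \sum_(k <- win n | k \in win n) (2 * rdot (D t k) (F t k))).
  by apply: D1_sum => k; rewrite mem_win => /hD/DV_sqv.
move=> hE t tT.
have := gronwall (a := 3 * B + 1) (b := eps) _ e0 hE _ tT; rewrite -!big_seq; apply.
  by rewrite addr_ge0// mulr_ge0.
move=> s sT; rewrite -!big_seq -mulr_sumr.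
have -> : \sum_(k <- win n) rdot (D s k) (F s k) =
    \sum_(k <- win n) rdot (D s k) (cv n (v s) (ag (D s)) k) +
    \sum_(k <- win n) rdot (D s k) (cv n (D s) (ag (u s)) k) -
    \sum_(k <- win n) rdot (D s k) (e s k).
  rewrite -sumrN -!big_split/=; apply: eq_bigr => k _; rewrite /F !rdotDr.
  by congr (_ + _); rewrite !rdotE /dotv -Re_opp -sumrN; congr complex.Re; apply: eq_bigr => j _;
    rewrite !mxE mulrN.
have cvE a b : \sum_(k <- win n) rdot (D s k) (cv n a (ag b) k) =
    S3 n (fun p q r => az r * complex.Re (trip (D s p) (a q) (b r))).
  have h := @rdot_cv R n (D s) a (ag b) (fun=> 1) (rD s) (fun=> erefl).
  transitivity (\sum_(k <- win n) 1 * rdot (D s k) (cv n a (ag b) k)).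
    by apply: eq_bigr => k _; rewrite mul1r.
  by rewrite h; apply: eq_S3 => p q r _; rewrite mul1r /ag tripZ3 Re_scale.
rewrite !cvE (S3_anti12 n (D s) (u s) az) addr0.
have h1 : S3 n (fun p q r => az r * complex.Re (trip (D s p) (v s q) (D s r))) <=
    3 / 2 * B * \sum_(k <- win n) sqv (D s k).
  have -> : S3 n (fun p q r => az r * complex.Re (trip (D s p) (v s q) (D s r))) =
     S3 n (fun p q r => 1 * az r * complex.Re (trip (D s p) (v s q) (D s r))).
    by apply: eq_S3 => p q r _; rewrite mul1r.
  rewrite (S3_anti13 n (D s) (v s) (fun=> 1) az).
  set X := S3 _ _; suff : X <= 3 * B * \sum_(k <- win n) sqv (D s k) by lra.
  apply: (@le_trans _ _ (S3 n (fun p q r => 2^-1 * (nv (D s p) ^+ 2 * (az q * nv (v s q)) +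
      nv (D s r) ^+ 2 * (az q * nv (v s q)))))).
    apply: ler_S3 => p q r pqr; have [a1 a2 a3] := @az_tri R _ _ _ pqr.
    apply: le_trans (ler_norm _) _; rewrite normrM !mul1r.
    have hh : `|az r - az p| <= az q by rewrite ?ler_norml; try (apply/andP; split); lra.
    apply: (@le_trans _ _ (az q * (nv (D s p) * nv (v s q) * nv (D s r)))).
      by apply: ler_pM => //; exact: Re_trip_le.
    have -> : 2^-1 * (nv (D s p) ^+ 2 * (az q * nv (v s q)) +
       nv (D s r) ^+ 2 * (az q * nv (v s q))) =
       2^-1 * (nv (D s p) ^+ 2 + nv (D s r) ^+ 2) * (az q * nv (v s q)) by ring.
    have -> : az q * (nv (D s p) * nv (v s q) * nv (D s r)) =
       nv (D s p) * nv (D s r) * (az q * nv (v s q)) by ring.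
    rewrite ler_wpM2r ?mulr_ge0 ?az_ge0 ?nv_ge0//.
    have := sqr_ge0 (nv (D s p) - nv (D s r)); lra.
  rewrite S3M S3D.
  have f0 k : 0 <= nv (D s k) ^+ 2 by rewrite sqr_ge0.
  have g0 k : 0 <= az k * nv (v s k) by rewrite mulr_ge0 ?az_ge0 ?nv_ge0.
  have i1 := S3_le12 n f0 g0; have i2 := S3_le23 n g0 f0.
  have -> : S3 n (fun p q r => nv (D s r) ^+ 2 * (az q * nv (v s q))) =
     S3 n (fun p q r => az q * nv (v s q) * nv (D s r) ^+ 2).
    by apply: eq_S3 => p q r _; rewrite mulrC.
  set N2 := \sum_(k <- win n) nv (D s k) ^+ 2 in i1 i2.
  set Z := \sum_(k <- win n) az k * nv (v s k) in i1 i2.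
  have N3 : N2 <= 3 * \sum_(k <- win n) sqv (D s k).
    by rewrite mulr_sumr; apply: ler_sum => k _; exact: nv_sqv.
  have N0 : 0 <= N2 by apply: sumr_ge0.
  have Z0 : 0 <= Z by apply: sumr_ge0.
  have ZB : Z <= B := hB _ sT.
  have : N2 * Z <= (3 * \sum_(k <- win n) sqv (D s k)) * B by apply: ler_pM.
  rewrite [Z * N2]mulrC in i2; lra.
have h2 : - (2 * \sum_(k <- win n) rdot (D s k) (e s k)) <=
    \sum_(k <- win n) sqv (D s k) + eps.
  apply: le_trans (lerD (lexx _) (he _ sT)).
  rewrite -big_split/= mulr_sumr -sumrN; apply: ler_sum => k _.
  have := rdot_sqv (D s k) (- e s k).
  have -> : rdot (D s k) (- e s k) = - rdot (D s k) (e s k).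
    rewrite !rdotE /dotv -Re_opp -sumrN; congr complex.Re; apply: eq_bigr => j _;
    by rewrite !mxE mulrN.
  have -> : sqv (- e s k) = sqv (e s k) by apply: eq_bigr => j _; rewrite mxE normcN.
  lra.
lra.
Qed.

(** The finer approximation solves the coarser system up to the change of window in its convolution,
    a defect of size [sn n] in l^1; stability with [u := d] does the rest. *)
Lemma gal_cauchy n m c d (T Y : R) : (n <= m)%N -> gal n c -> gal m d ->
  (forall k, (`|k| <= n)%N -> c 0 k = d 0 k) ->
  (forall t : R, 0 <= t <= T -> yn n (c t) <= Y) ->
  (forall t : R, 0 <= t <= T -> yn m (d t) <= Y) ->
  forall t : R, 0 <= t <= T -> \sum_(k <- win n) sqv (c t k - d t k) <=
    sn n ^+ 2 * (4 * (6 * (1 + Y)) ^+ 4 * T * expR ((18 * (1 + Y) + 1) * T)).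
Proof.
move=> nm gc gd cd0 cY dY t tT.
have T0 : 0 <= T by move: tT => /andP[h1 h2]; exact: le_trans h2.
have Y0 : 0 <= Y by apply: le_trans (yn_ge0 n (c 0)) (cY _ _); rewrite lexx.
set G := 6 * (1 + Y); have G0 : 0 <= G by rewrite mulr_ge0// addr_ge0.
have lY k (a : int -> V) : yn k a <= Y -> ln k a <= G.
  by move=> h; apply: le_trans (ln_le _ _) _; rewrite ler_wpM2l// lerD2l.
pose e t k := cv m (d t) (ag (d t)) k - cv n (d t) (ag (d t)) k.
have oo u : 0 < u < T -> 0 <= u <= T by case/andP => /ltW -> /ltW ->.
have [rc c0 hc] := gc; have [rd d0 hd] := gd.
have hu (k : int) : (`|k| <= n)%N ->
    DV T (fun t => d t k) (fun t => cv n (d t) (ag (d t)) k + e t k).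
  move=> hk; have -> : (fun t => cv n (d t) (ag (d t)) k + e t k) =
      fun t => cv m (d t) (ag (d t)) k.
    by apply/funext => u; rewrite /e addrC subrK.
  by apply: hd; exact: leq_trans nm.
have hB u : 0 < u < T -> \sum_(k <- win n) az k * nv (c u k) <= G.
  by move=> /oo uT; apply: le_trans (az_sum_le n (c u)) (lY _ _ (cY _ uT)).
have he u : 0 < u < T -> \sum_(k <- win n) sqv (e u k) <= (2 * sn n * G ^+ 2) ^+ 2.
  move=> /oo uT; have h := cv_trunc (win_uniq n) nm (lY _ _ (dY _ uT)).
  have h0 : 0 <= \sum_(k <- win n) nv (e u k) by apply: sumr_ge0 => k _; exact: nv_ge0.
  apply: (@le_trans _ _ ((\sum_(k <- win n) nv (e u k)) ^+ 2)); last first.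
    by rewrite !(expr2 (\sum_(k <- _) _)) (expr2 (2 * sn n * _)); exact: (ler_pM h0 h0 h h).
  rewrite expr2 mulr_suml big_seq [leRHS]big_seq; apply: ler_sum => k hk.
  apply: le_trans (sqv_nv _) _; rewrite expr2 ler_wpM2l ?nv_ge0//.
  by rewrite (big_rem k)//= lerDl sumr_ge0// => l _; exact: nv_ge0.
have := gal_stab gc rd hu G0 hB he (sqr_ge0 _) tT.
have -> : \sum_(k <- win n) sqv (c 0 k - d 0 k) = 0.
  rewrite big_seq big1// => k; rewrite mem_win => /cd0 ->; rewrite subrr /sqv big1// => j _.
  by rewrite mxE Normc.normc0 expr0n.
rewrite add0r => /le_trans; apply.
have -> : (2 * sn n * G ^+ 2) ^+ 2 * t = sn n ^+ 2 * (4 * G ^+ 4 * t) by ring.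
rewrite -[leLHS]mulrA ler_wpM2l ?sqr_ge0//; case/andP: tT => t0 tT.
apply: ler_pM.
- by rewrite mulr_ge0// mulr_ge0// exprn_ge0.
- exact: expR_ge0.
- by rewrite ler_wpM2l// mulr_ge0// exprn_ge0.
rewrite ler_expR; have -> : 3 * G + 1 = 18 * (1 + Y) + 1 by rewrite /G; ring.
by rewrite ler_wpM2l// addr_ge0// mulr_ge0// addr_ge0.
Qed.

(* A compactly supported 1-Lipschitz cutoff of the identity: the energy [EA] below involves finitely
   many modes, yet satisfies a flux bound that is uniform in [A]. *)
Definition rho (A s : R) : R := Num.max 0 (Num.min s (2 * A - s)).

Lemma rho_lip A s t : `|rho A s - rho A t| <= `|s - t|.
Proof.
rewrite /rho; case: (leP s (2 * A - s)) => h1; case: (leP t (2 * A - t)) => h2;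
case: (leP 0 _) => h3; case: (leP 0 _) => h4; case: (ler0P (s - t)) => h;
by rewrite ?ler_norml; try (apply/andP; split); lra.
Qed.

Lemma rho_ge0 A s : 0 <= rho A s.
Proof. by rewrite /rho le_max lexx. Qed.

Lemma rho_le A s : 0 <= s -> rho A s <= s.
Proof. by move=> s0; rewrite /rho ge_max s0/= ge_min lexx. Qed.

Lemma rho_id A s : 0 <= s -> s <= A -> rho A s = s.
Proof.
move=> s0 sA; rewrite /rho minEle ifT; last by lra.
by rewrite maxEle s0.
Qed.

Definition EA A n (c : int -> V) : R :=
  \sum_(k <- win n) az k * rho A (az k ^+ 4) * sqv (c k).

Lemma gal_EA A n c (T Y : R) : gal n c ->
  (forall t : R, 0 <= t <= T -> yn n (c t) <= Y) ->
  forall s t : R, 0 <= s -> s <= t -> t <= T ->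
    `|EA A n (c t) - EA A n (c s)| <= rate * (1 + Y) ^+ 2 * (t - s).
Proof.
move=> gc cY s t s0 st tT.
have we k : az (- k) * rho A (az (- k) ^+ 4) = az k * rho A (az k ^+ 4) by rewrite azN.
have hD := gal_energy T gc we.
apply: (D1_lip hD) => // u uT; rewrite normrM ger0_norm//.
have {}uT : 0 <= u <= T by case/andP: uT => /ltW -> /ltW ->.
have := flux_le n (c u) (v := fun p => rho A (az p ^+ 4)) (fun p r => rho_lip _ _ _).
have h : (1 + yn n (c u)) ^+ 2 <= (1 + Y) ^+ 2.
  have Y0 := yn_ge0 n (c u); have := cY _ uT => h.
  by rewrite ler_pXn2r ?nnegrE ?lerD2l//; lra.
have := sqr_ge0 (1 + Y); rewrite rateE; lra.
Qed.

End GalerkinEstimates.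

(** * The limit of the Galerkin approximations *)

Section Limit.
Context {R : realType}.
Local Notation C := R[i].
Local Notation V := 'rV[R[i]]_3.
Local Notation nc := (@Normc.normc R).
Local Notation az := (@az R).
Local Notation hw := (@hw R).
Local Notation sn := (@sn R).

Lemma entryB (a b : V) j : (a - b) 0 j = a 0 j - b 0 j.
Proof. by rewrite !mxE. Qed.

Definition limV (u : nat -> V) : V :=
  \row_j (lim ((fun n => complex.Re (u n 0 j)) @ \oo) +i* lim ((fun n => complex.Im (u n 0 j)) @ \oo)).

Lemma limVP (u : nat -> V) (e : nat -> R) : e @ \oo --> 0 ->
  (forall m n, (m <= n)%N -> nv (u n - u m) <= e m) ->
  forall n, nv (limV u - u n) <= 6 * e n.
Proof.
move=> e0 h n.
have hj j : nc ((limV u - u n) 0 j) <= 2 * e n.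
  apply: le_trans (nc_le_ReIm _) _; rewrite entryB Re_add Im_add Re_opp Im_opp [limV u 0 j]mxE /=.
  have [_ hr] : (fun n => complex.Re (u n 0 j)) @ \oo --> lim ((fun n => complex.Re (u n 0 j)) @ \oo) /\
     forall n, `|lim ((fun n => complex.Re (u n 0 j)) @ \oo) - complex.Re (u n 0 j)| <= e n.
    apply: cauchy_rate => // m k mk; apply: le_trans (h _ _ mk).
    apply: le_trans (nc_le_nv _ j); apply: le_trans (Re_le_nc _).
    by rewrite entryB Re_add Re_opp.
  have [_ hi] : (fun n => complex.Im (u n 0 j)) @ \oo --> lim ((fun n => complex.Im (u n 0 j)) @ \oo) /\
     forall n, `|lim ((fun n => complex.Im (u n 0 j)) @ \oo) - complex.Im (u n 0 j)| <= e n.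
    apply: cauchy_rate => // m k mk; apply: le_trans (h _ _ mk).
    apply: le_trans (nc_le_nv _ j); apply: le_trans (Im_le_nc _).
    by rewrite entryB Im_add Im_opp.
  by have := hr n; have := hi n; lra.
rewrite /nv sum3; have := hj 0; have := hj 1; have := hj 2; lra.
Qed.

(** The finitely many low modes are controlled by [eta], the others by the tail of the weighted l^1
    norm. Since [eta] depends on [G] and [e] only, the conclusion is uniform in the window and in
    time. *)
Lemma l1_unif (G e : R) : 0 <= G -> 0 < e -> exists2 eta : R, 0 < eta &
  forall (a b : int -> V) M, ln M a <= G -> ln M b <= G -> (forall k, nv (a k - b k) <= eta) ->
    \sum_(k <- win M) (1 + az k) * nv (a k - b k) <= e.
Proof.
move=> G0 e0.
have [L hL] : exists L, 4 * G * sn L <= e / 2.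
  have : (fun L => 4 * G * sn L) @ \oo --> 4 * G * 0.
    by apply: cvgM; [exact: cvg_cst|exact: sn_cvg0].
  rewrite mulr0 => /cvgrPdist_lt/(_ (e / 2)); rewrite divr_gt0// => /(_ isT)[L _ /(_ L)].
  rewrite /= leqnn sub0r normrN => /(_ isT)/ltW h; exists L.
  by apply: le_trans h; exact: ler_norm.
pose Z : R := \sum_(k <- win L) (1 + az k).
have Z0 : 0 <= Z by apply: sumr_ge0 => k _; rewrite addr_ge0 ?az_ge0.
exists (e / 2 / (1 + Z)); first by rewrite !divr_gt0// ltr_pwDl.
move=> a b M ha hb hk.
apply: (@le_trans _ _ (\sum_(k <- win M) ((if (`|k| <= L)%N then (1 + az k) * (e / 2 / (1 + Z)) else 0)
   + 2 * sn L * ((1 + hw k) * nv (a k) + (1 + hw k) * nv (b k))))).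
  apply: ler_sum => k _; have p1 : 0 <= 1 + az k by rewrite addr_ge0 ?az_ge0.
  have p2 : 0 <= 1 + hw k by rewrite addr_ge0 ?hw_ge0.
  have na := nv_ge0 (a k); have nb := nv_ge0 (b k); have s0 := sn_ge0 (R := R) L.
  case: leqP => h.
    apply: (@le_trans _ _ ((1 + az k) * (e / 2 / (1 + Z)))); first by rewrite ler_wpM2l.
    by rewrite lerDl !mulr_ge0// addr_ge0// mulr_ge0.
  rewrite add0r -mulrDr mulrA; apply: ler_pM => //; first exact: nv_ge0.
    have := one_tail (R := R) h; have := az_tail (R := R) h; rewrite -/(sn L) => t1 t2.
    have : sn L * hw k <= sn L * (1 + hw k) by rewrite ler_wpM2l// lerDr.
    lra.
  exact: nvB.
rewrite big_split/= -mulr_sumr big_split/= -/(ln M a) -/(ln M b).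
have h1 : \sum_(k <- win M) (if (`|k| <= L)%N then (1 + az k) * (e / 2 / (1 + Z)) else 0) <=
    Z * (e / 2 / (1 + Z)).
  rewrite /Z mulr_suml; have f0 k : 0 <= (1 + az k) * (e / 2 / (1 + Z)).
    by rewrite mulr_ge0 ?addr_ge0 ?az_ge0// !divr_ge0// ?addr_ge0// ltW.
  have [LM|ML] := leqP L M; first by rewrite -big_mkcond win_sub.
  apply: le_trans (win_mono (ltnW ML) f0); apply: ler_sum => k _.
  by case: ifP => //; rewrite f0.
have h2 : Z * (e / 2 / (1 + Z)) <= e / 2.
  rewrite mulrCA ler_piMr ?divr_ge0 ?ltW//.
  by rewrite ltr_pdivrMr ?ltr_pwDl// mul1r ltrDr.
have h3 : 2 * sn L * (ln M a + ln M b) <= 2 * sn L * (G + G).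
  by rewrite ler_wpM2l ?lerD// mulr_ge0 ?sn_ge0.
lra.
Qed.

Lemma nv_seq_le (r : seq int) (F : int -> V) k : uniq r -> k \in r -> nv (F k) <= \sum_(l <- r) nv (F l).
Proof.
move=> ur kr; rewrite (big_rem k)//= lerDl; apply: sumr_ge0 => l _; exact: nv_ge0.
Qed.

(* Fourier coefficients of S x |nabla| S. *)
Definition Gc (a : int -> V) (k : int) : V := limV (fun n => cv n a (ag a) k).

Lemma cvg_sum_seq (I : Type) (r : seq I) (F : nat -> I -> R) (f : I -> R) :
  (forall k, (fun n => F n k) @ \oo --> f k) ->
  (fun n => \sum_(k <- r) F n k) @ \oo --> \sum_(k <- r) f k.
Proof.
move=> h; elim: r => [|k r IH].
  rewrite big_nil (_ : (fun _ => _) = fun=> 0); first exact: cvg_cst.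
  by apply/funext => n; rewrite big_nil.
rewrite big_cons (_ : (fun _ => _) = fun n => F n k + \sum_(k <- r) F n k).
  exact: cvgD.
by apply/funext => n; rewrite big_cons.
Qed.

Lemma lim_sum_le (I : Type) (r : seq I) (F : nat -> I -> R) (f : I -> R) (b : R) :
  (forall k, (fun n => F n k) @ \oo --> f k) ->
  (\forall n \near \oo, \sum_(k <- r) F n k <= b) -> \sum_(k <- r) f k <= b.
Proof. by move=> hF hb; have := cvg_sum_seq (r := r) hF; move=> /cvgr_to_le; apply. Qed.

Lemma dist_cvg (u e : nat -> R) (l : R) : e @ \oo --> 0 -> (forall n, `|l - u n| <= e n) ->
  u @ \oo --> l.
Proof.
move=> e0 h; apply/cvgrPdist_le => eps eps0.
have [N _ hN] : \forall n \near \oo, `|0 - e n| <= eps by move/cvgrPdist_le : e0; exact.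
exists N => // n /hN; rewrite sub0r normrN => hn.
exact: le_trans (h n) (le_trans (ler_norm _) hn).
Qed.

(** Convergence witnessed by a null majorant of the error: such witnesses add and multiply directly
    under the estimates on [nv]. *)
Definition tendsV (u : nat -> V) (l : V) : Prop :=
  exists2 e : nat -> R, e @ \oo --> 0 & forall n, nv (l - u n) <= e n.

Lemma tendsV_nv u l a : tendsV u l -> (fun n => nv (u n - a)) @ \oo --> nv (l - a).
Proof.
move=> [e e0 h]; apply: (dist_cvg e0) => n; apply: le_trans (h n).
have h1 := nvD (l - u n) (u n - a); have h2 := nvD (u n - l) (l - a).
rewrite subrKA in h1; rewrite subrKA in h2; rewrite [nv (u n - l)]nvBC in h2.
by rewrite ler_norml; apply/andP; split; lra.
Qed.

Lemma tendsV_Re u l j : tendsV u l -> (fun n => complex.Re (u n 0 j)) @ \oo --> complex.Re (l 0 j).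
Proof.
move=> [e e0 h]; apply: (dist_cvg e0) => n; apply: le_trans (h n).
apply: le_trans (nc_le_nv _ j); apply: le_trans (Re_le_nc _).
by rewrite entryB Re_add Re_opp.
Qed.

Lemma tendsV_Im u l j : tendsV u l -> (fun n => complex.Im (u n 0 j)) @ \oo --> complex.Im (l 0 j).
Proof.
move=> [e e0 h]; apply: (dist_cvg e0) => n; apply: le_trans (h n).
apply: le_trans (nc_le_nv _ j); apply: le_trans (Im_le_nc _).
by rewrite entryB Im_add Im_opp.
Qed.

Lemma tendsV_sqv u l : tendsV u l -> (fun n => sqv (u n)) @ \oo --> sqv l.
Proof.
move=> h; rewrite /sqv.
rewrite (_ : (fun _ => _) = fun n => \sum_(j < 3) (complex.Re (u n 0 j) ^+ 2 + complex.Im (u n 0 j) ^+ 2)).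
  rewrite (_ : \sum_(j < 3) nc (l 0 j) ^+ 2 = \sum_(j < 3) (complex.Re (l 0 j) ^+ 2 + complex.Im (l 0 j) ^+ 2)).
    apply: cvg_sum_seq => j; apply: cvgD.
      by apply: cvgM; exact: tendsV_Re.
    by apply: cvgM; exact: tendsV_Im.
  by apply: eq_bigr => j _; rewrite nc_sqr.
by apply/funext => n; apply: eq_bigr => j _; rewrite nc_sqr.
Qed.

Lemma tendsV_sub u l a : tendsV u l -> tendsV (fun n => u n - a) (l - a).
Proof.
move=> [e e0 h]; exists e => // n; apply: le_trans (h n).
by rewrite opprB addrA subrK.
Qed.

Lemma tendsV_eq u l l' : tendsV u l -> tendsV u l' -> l = l'.
Proof.
move=> h h'; apply/rowP => j; apply/eqP; rewrite eq_complex; apply/andP; split; apply/eqP.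
  by have /cvg_lim <- // := tendsV_Re (j := j) h; have /cvg_lim <- // := tendsV_Re (j := j) h'.
by have /cvg_lim <- // := tendsV_Im (j := j) h; have /cvg_lim <- // := tendsV_Im (j := j) h'.
Qed.

Lemma limV_tends (u : nat -> V) (e : nat -> R) : e @ \oo --> 0 ->
  (forall m n, (m <= n)%N -> nv (u n - u m) <= e m) -> tendsV u (limV u).
Proof.
move=> e0 h; exists (fun n => 6 * e n); last exact: limVP.
by rewrite -[X in _ --> X](mulr0 6); apply: cvgM => //; exact: cvg_cst.
Qed.

Lemma scale_sn_cvg0 (a : R) : (fun n => a * sn n) @ \oo --> 0.
Proof. by rewrite -[X in _ --> X](mulr0 a); apply: cvgM; [exact: cvg_cst|exact: sn_cvg0]. Qed.

Section Gc.
Variables (G : R) (a : int -> V).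
Hypothesis aG : forall n, ln n a <= G.

Lemma Gc_tends k : tendsV (fun n => cv n a (ag a) k) (Gc a k).
Proof.
apply: (@limV_tends _ (fun n => 2 * sn n * G ^+ 2)).
  rewrite (_ : (fun _ => _) = fun n => 2 * G ^+ 2 * sn n); first exact: scale_sn_cvg0.
  by apply/funext => n; rewrite mulrAC.
move=> m n mn; have := cv_trunc (r := [:: k]) isT mn (aG n).
by rewrite big_seq1.
Qed.

(** The bound between two windows does not depend on the larger one, so the larger one can be sent
    to infinity. *)
Lemma Gc_trunc n (r : seq int) : uniq r ->
  \sum_(k <- r) nv (Gc a k - cv n a (ag a) k) <= 2 * sn n * G ^+ 2.
Proof.
move=> ur; apply: (@lim_sum_le _ _ (fun m k => nv (cv m a (ag a) k - cv n a (ag a) k))).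
  by move=> k; apply: tendsV_nv; exact: Gc_tends.
by near=> m; apply: cv_trunc => //; near: m; exact: nbhs_infty_ge.
Unshelve. all: by end_near. Qed.

End Gc.

Lemma cv_l1_lip n (a b : int -> V) G e (r : seq int) : uniq r -> ln n a <= G -> ln n b <= G ->
  \sum_(k <- win n) (1 + az k) * nv (a k - b k) <= e ->
  \sum_(k <- r) nv (cv n a (ag a) k - cv n b (ag b) k) <= 2 * G * e.
Proof.
move=> ur ha hb he.
apply: (@le_trans _ _ (\sum_(k <- r) (nv (cv n (fun k => a k - b k) (ag a) k) +
    nv (cv n b (fun k => ag a k - ag b k) k)))).
  by apply: ler_sum => k _; rewrite cvB nvD.
rewrite big_split/=.
have h1 := cv_sum_le n (fun k => a k - b k) (ag a) ur.
have h2 := cv_sum_le n b (fun k => ag a k - ag b k) ur.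
have p0 (F : int -> V) : 0 <= \sum_(k <- win n) nv (F k).
  by apply: sumr_ge0 => k _; exact: nv_ge0.
have a1 : \sum_(k <- win n) nv (ag a k) <= G.
  by under eq_bigr do rewrite nv_ag; exact: le_trans (az_sum_le n a) ha.
have b1 : \sum_(k <- win n) nv (b k) <= G by apply: le_trans (nv_sum_le n b) hb.
have d1 : \sum_(k <- win n) nv (a k - b k) <= e.
  by apply: le_trans he; apply: ler_sum => k _; rewrite ler_peMl ?nv_ge0// lerDl az_ge0.
have d2 : \sum_(k <- win n) nv (ag a k - ag b k) <= e.
  apply: le_trans he; apply: ler_sum => k _.
  by rewrite /ag -scalerBr nvZ nc_real ger0_norm ?az_ge0// ler_wpM2r ?nv_ge0// lerDr.
have q1 := ler_pM (p0 _) (p0 _) d1 a1; have q2 := ler_pM (p0 _) (p0 _) b1 d2.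
lra.
Qed.

Lemma Gc_lip (a b : int -> V) G e (r : seq int) : uniq r ->
  (forall n, ln n a <= G) -> (forall n, ln n b <= G) ->
  (forall n, \sum_(k <- win n) (1 + az k) * nv (a k - b k) <= e) ->
  \sum_(k <- r) nv (Gc a k - Gc b k) <= 2 * G * e.
Proof.
move=> ur ha hb he.
have G0 : 0 <= G := le_trans (ln_ge0 0 a) (ha 0).
have h n : \sum_(k <- r) nv (Gc a k - Gc b k) <= 2 * G * e + 4 * G ^+ 2 * sn n.
  have h1 := Gc_trunc ha n ur; have h2 := Gc_trunc hb n ur.
  have h3 := cv_l1_lip ur (ha n) (hb n) (he n).
  have : \sum_(k <- r) nv (Gc a k - Gc b k) <= \sum_(k <- r) nv (Gc a k - cv n a (ag a) k) +
    \sum_(k <- r) nv (cv n a (ag a) k - cv n b (ag b) k) + \sum_(k <- r) nv (Gc b k - cv n b (ag b) k).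
    rewrite -!big_split/=; apply: ler_sum => k _.
    rewrite -[Gc a k - Gc b k](subrKA (cv n b (ag b) k)).
    apply: le_trans (nvD _ _) _; rewrite [nv (_ - Gc b k)]nvBC lerD2r.
    rewrite -[X in nv X <= _](subrKA (cv n a (ag a) k)); exact: nvD.
  lra.
rewrite -subr_le0; apply: (cvg0_le0 (scale_sn_cvg0 (4 * G ^+ 2))) => n.
by have := h n; lra.
Qed.

Lemma D1_lip_in T (f df : R -> R) (L s t : R) : D1 T f df -> 0 <= s -> s <= t -> t <= T ->
  (forall u, s < u < t -> `|df u| <= L) -> `|f t - f s| <= L * (t - s).
Proof.
move=> [cf hf] s0 st tT h.
have hf' u : u \in `]s, t[ -> is_derive u 1 f (df u).
  rewrite in_itv/= => /andP[su ut]; apply: hf; apply/andP; split.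
    exact: le_lt_trans su.
  exact: lt_le_trans tT.
move: st; rewrite le_eqVlt => /predU1P[->|st]; first by rewrite !subrr normr0 mulr0.
have [|c] := MVT st hf'.
  apply: continuous_subspaceW cf => x /=; rewrite !in_itv/= => /andP[h1 h2].
  by rewrite (le_trans s0 h1) (le_trans h2 tT).
have st0 : 0 <= t - s by rewrite subr_ge0 ltW.
by rewrite in_itv/= => /h hc ->; rewrite normrM [`|t - s|]ger0_norm// ler_wpM2r.
Qed.

Lemma D1_key (T : R) (f df : R -> R) :
  (forall t e : R, 0 <= t <= T -> 0 < e -> exists2 d : R, 0 < d & forall s, 0 <= s <= T ->
     `|s - t| < d -> `|f s - f t - df t * (s - t)| <= e * `|s - t|) ->
  D1 T f df.
Proof.
move=> h; split.
  apply/subspace_continuousP => t; rewrite /= in_itv/= => tT.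
  apply/cvgrPdist_le => e e0.
  have [d d0 hd] := h t 1 tT ltr01.
  have A0 : 0 < `|df t| + 1 by rewrite ltr_wpDl.
  pose d' := Num.min d (e / (`|df t| + 1)).
  have d'0 : 0 < d' by rewrite lt_min d0 divr_gt0.
  rewrite /within /=; apply/nbhs_ballP; exists d' => //= s.
  rewrite /ball/= lt_min => /andP[sd se]; rewrite in_itv/= => sT.
  rewrite distrC in sd.
  have h1 := hd s sT sd; rewrite mul1r in h1.
  rewrite distrC; apply: (@le_trans _ _ ((`|df t| + 1) * `|s - t|)).
    rewrite -[f s - f t](subrK (df t * (s - t))); apply: le_trans (ler_normD _ _) _.
    by rewrite normrM mulrDl mul1r addrC lerD2l.
  by rewrite mulrC -ler_pdivlMr// distrC ltW.
move=> t /andP[t0 tT].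
have tT' : 0 <= t <= T by rewrite !ltW.
have cv : h0^-1 *: (f (h0 *: 1 + t) - f t) @[h0 --> 0^'] --> df t.
  apply/cvgrPdist_le => e e0; have [d d0 hd] := h t e tT' e0.
  pose d' := Num.min d (Num.min t (T - t)).
  have d'0 : 0 < d' by rewrite !lt_min d0 t0 subr_gt0.
  rewrite /dnbhs /within /=; apply/nbhs_ballP; exists d' => //= x.
  rewrite /ball/= sub0r normrN !lt_min => /andP[xd /andP[xt xT]] x0.
  have xx : x + t - t = x by rewrite addrK.
  have := hd (x + t); rewrite xx => /(_ _ xd) hx.
  have {}hx : `|f (x + t) - f t - df t * x| <= e * `|x|.
    apply: hx; have := ler_norm x; have := ler_norm (- x); rewrite normrN; lra.
  rewrite [x *: 1]mulr1 distrC.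
  have -> : x^-1 *: (f (x + t) - f t) - df t = x^-1 * (f (x + t) - f t - df t * x).
    have -> : x^-1 *: (f (x + t) - f t) = x^-1 * (f (x + t) - f t) by [].
    by field.
  rewrite normrM normfV mulrC ler_pdivrMr ?normr_gt0//.
by apply: DeriveDef; [apply/cvg_ex; exists (df t)|exact: cvg_lim].
Qed.

(** The mean value bound for F_n(u) - l u on a short interval survives the pointwise limit;
    continuity of [df] allows [l] to be its value at the base point. *)
Lemma D1_limit (T : R) (F dF : nat -> R -> R) (f df : R -> R) :
  (forall n, D1 T (F n) (dF n)) ->
  (forall t : R, 0 <= t <= T -> (fun n => F n t) @ \oo --> f t) ->
  (forall e : R, 0 < e -> exists N, forall n, (N <= n)%N -> forall t : R, 0 <= t <= T -> `|dF n t - df t| <= e) ->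
  (forall (e t : R), 0 < e -> 0 <= t <= T -> exists2 d : R, 0 < d & forall s, 0 <= s <= T ->
     `|s - t| < d -> `|df s - df t| <= e) ->
  D1 T f df.
Proof.
move=> hF hf hdF hdf.
have key (e s t l : R) : 0 < e -> 0 <= s -> s <= t -> t <= T ->
    (forall u, s < u < t -> `|df u - l| <= e) -> `|f t - f s - l * (t - s)| <= (e + e) * (t - s).
  move=> e0 s0 st tT h; have [N hN] := hdF _ e0.
  have : `|F n t - F n s - l * (t - s)| @[n --> \oo] --> `|f t - f s - l * (t - s)|.
    apply: cvg_norm; apply: cvgB; last exact: cvg_cst.
    apply: cvgB; apply: hf; first by rewrite (le_trans s0).
    by rewrite s0 (le_trans st).
  move=> /cvgr_to_le; apply; exists N => // n /= Nn.
  have hD : D1 T (fun u => F n u - l * u) (fun u => dF n u - l * 1).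
    by apply: D1_sub; [exact: hF|apply: D1_scale; exact: D1_id].
  have -> : F n t - F n s - l * (t - s) = F n t - l * t - (F n s - l * s) by ring.
  apply: (D1_lip_in hD s0 st tT) => u /[dup] /andP[su ut] /h hu; rewrite mulr1.
  rewrite -[dF n u - l](subrKA (df u)); apply: le_trans (ler_normD _ _) _; apply: lerD => //.
  by apply: hN; rewrite // (le_trans s0 (ltW su)) (le_trans (ltW ut)).
apply: D1_key => t e tT e0; have e2 : 0 < e / 2 by rewrite divr_gt0.
have [d d0 hd] := hdf _ _ e2 tT; exists d => // s sT sd.
have e2E : e / 2 + e / 2 = e by field.
case/andP: (tT) => t0 tT1; case/andP: (sT) => s0 sT1.
have [st|ts] := leP s t.
  have := @key _ s t (df t) e2 s0 st tT1; rewrite e2E => H.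
  have -> : f s - f t - df t * (s - t) = - (f t - f s - df t * (t - s)) by ring.
  rewrite normrN [`|s - t|]distrC [`|t - s|]ger0_norm ?subr_ge0//; apply: H => u /andP[su ut].
  apply: hd; first by rewrite (le_trans s0 (ltW su)) (le_trans (ltW ut)).
  move: sd; rewrite distrC ger0_norm ?subr_ge0// => sd.
  by rewrite distrC ger0_norm ?subr_ge0 1?ltW//; lra.
have := @key _ t s (df t) e2 t0 (ltW ts) sT1; rewrite e2E => H.
have ts0 : 0 <= s - t by rewrite subr_ge0 ltW.
rewrite [`|s - t|]ger0_norm//; apply: H => u /andP[su ut].
apply: hd; first by rewrite (le_trans t0 (ltW su)) (le_trans (ltW ut)).
move: sd; rewrite ger0_norm// => sd.
have tu0 : 0 <= u - t by rewrite subr_ge0 ltW.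
by rewrite ger0_norm//; lra.
Qed.

Lemma rho_supp (A t : R) : 0 <= A -> 2 * A <= t -> rho A t = 0.
Proof.
move=> A0 h; rewrite /rho; case: (leP t (2 * A - t)) => h1; case: (leP 0 _) => h2 //; lra.
Qed.

(** The cutoff vanishes from |k|^4 = 2A on, so a larger window adds only zeros. *)
Lemma EA_ext A n m (a : int -> V) : 0 <= A -> 2 * A <= n.+1%:R ^+ 4 -> (n <= m)%N -> EA A m a = EA A n a.
Proof.
move=> A0 hA nm; apply: win_supp => // k nk; rewrite rho_supp ?mulr0 ?mul0r//.
by apply: le_trans hA _; rewrite ler_pXn2r ?nnegrE ?az_ge0// /az ler_nat.
Qed.

Lemma conjvB (a b : V) : conjv (a - b) = conjv a - conjv b. Proof. exact: raddfB. Qed.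

Lemma tendsV_conj u l : tendsV u l -> tendsV (fun n => conjv (u n)) (conjv l).
Proof.
by move=> [e e0 h]; exists e => // n; rewrite -conjvB nv_conj.
Qed.

Lemma sqv0 : sqv (0 : V) = 0.
Proof. by rewrite /sqv big1// => j _; rewrite mxE Normc.normc0 expr0n. Qed.

Section Solution.
Variables (c0 : int -> V) (Y0 : R).
Hypotheses (rc0 : rcoefs c0) (hY0 : forall n, yn n c0 <= Y0).

(** The time until which the Riccati bound keeps the energy below [2 * (1 + Y0)]. *)
Definition lifespan (Y0 : R) : R := (rate * (1 + Y0))^-1.
Let T := lifespan Y0.
Let Y := 2 * (1 + Y0).
Let G := 6 * (1 + Y).

Let Y0_ge0 : 0 <= Y0. Proof. exact: le_trans (yn_ge0 0 c0) (hY0 0). Qed.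
Let T_gt0 : 0 < T. Proof. by rewrite invr_gt0 mulr_gt0 ?rate_gt0// ltr_pwDl. Qed.
Let Y_ge0 : 0 <= Y. Proof. by rewrite mulr_ge0// addr_ge0. Qed.
Let G_ge0 : 0 <= G. Proof. by rewrite mulr_ge0// addr_ge0. Qed.

Lemma ln_yn n (a : int -> V) : yn n a <= Y -> ln n a <= G.
Proof. by move=> h; apply: le_trans (ln_le _ _) _; rewrite ler_wpM2l// lerD2l. Qed.

Lemma yn_tr n m (a : int -> V) : yn m (tr n a) <= yn m a.
Proof.
apply: ler_sum => k _; rewrite ler_wpM2l ?(ltW (one5_gt0 _))// /tr.
case: ifP => // _; rewrite {1}/sqv big1 ?sqv_ge0// => j _.
by rewrite mxE Normc.normc0 expr0n.
Qed.

Lemma galerkin_family : exists cn : nat -> R -> int -> V, forall n,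
  [/\ gal n (cn n), forall k, cn n 0 k = tr n c0 k &
    forall (t : R) m, 0 <= t <= T -> yn m (cn n t) <= Y].
Proof.
have [cn hcn] := choice (fun n => galerkin_exists n rc0).
exists cn => n; have [h0 h1 h2 h3] := hcn n; split=> // t m /andP[t0 tT].
have gn : gal n (cn n) by [].
have y0 : yn n (cn n 0) <= Y0.
  apply: le_trans (hY0 n); apply: le_trans (yn_tr n n c0).
  by apply: ler_sum => k _; rewrite h0.
have : yn n (cn n t) <= Y.
  have := gal_yn gn t0 _; have p0 := yn_ge0 n (cn n 0).
  have H : rate * (1 + yn n (cn n 0)) * t <= 1.
    have r0 : 0 < rate * (1 + Y0) by rewrite mulr_gt0 ?rate_gt0// ltr_pwDl.
    apply: (@le_trans _ _ (rate * (1 + Y0) * T)); last by rewrite mulfV// gt_eqF.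
    have rg : 0 <= (rate : R) by rewrite ltW// rate_gt0.
    have q1 : 0 <= rate * (1 + yn n (cn n 0)) by apply: mulr_ge0 => //; apply: addr_ge0.
    have q2 : rate * (1 + yn n (cn n 0)) <= rate * (1 + Y0) by rewrite ler_wpM2l// lerD2l.
    exact: (ler_pM q1 t0 q2 tT).
  by move=> /(_ H); rewrite /Y; lra.
apply: le_trans; have [mn|nm] := leqP m n; first exact: yn_mono.
rewrite /yn (win_supp (ltnW nm))// => k nk; rewrite h2// /sqv big1 ?mulr0// => j _.
by rewrite mxE Normc.normc0 expr0n.
Qed.

(** The approximations [cn] are returned along with their limit [c]: they serve again to propagate
    the sphere constraint and to identify any other strong solution. *)
Lemma coef_solution : exists (c : R -> int -> V) (cn : nat -> R -> int -> V) (K : R),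
  [/\ forall n, [/\ gal n (cn n), forall k, cn n 0 k = tr n c0 k &
        forall (t : R) m, 0 <= t <= T -> yn m (cn n t) <= Y],
      0 <= K /\ forall n (t : R) k, 0 <= t <= T -> nv (c t k - cn n t k) <= K * sn n,
      forall t : R, 0 <= t <= T -> rcoefs (c t) /\ forall n, yn n (c t) <= Y,
      forall k, DV T (fun t => c t k) (fun t => Gc (c t) k) &
      forall A n (s t : R), 0 <= A -> 2 * A <= n.+1%:R ^+ 4 -> 0 <= s -> s <= t -> t <= T ->
        `|EA A n (c t) - EA A n (c s)| <= rate * (1 + Y) ^+ 2 * (t - s)] /\
  forall k, c 0 k = c0 k.
Proof.
have [cn hcn] := galerkin_family.
pose K2 := 4 * (6 * (1 + Y)) ^+ 4 * T * expR ((18 * (1 + Y) + 1) * T).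
pose K1 := 1 + 3 * (K2 + Y).
have K20 : 0 <= K2 by rewrite !mulr_ge0 ?expR_ge0 ?exprn_ge0 ?mulr_ge0 ?addr_ge0 ?(ltW T_gt0).
have K10 : 1 <= K1 by rewrite lerDl mulr_ge0// addr_ge0.
have sn1 n : sn n <= 1.
  rewrite /sn invf_le1 ?sqrtr_gt0// -[X in X <= _]sqrtr1.
  by apply: ler_wsqrtr; rewrite ler1n.
have T00 : 0 <= (0 : R) <= T by rewrite lexx ltW.
(* Modes up to [n] are compared by stability. Higher ones vanish in [cn n], and the fifth power in
   the energy makes them small in [cn m]. *)
have cauchy n m (t : R) k : (n <= m)%N -> 0 <= t <= T -> nv (cn m t k - cn n t k) <= K1 * sn n.
  move=> nm tT; have [gn cn0 yn'] := hcn n; have [gm cm0 ym] := hcn m.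
  suff h : sqv (cn m t k - cn n t k) <= sn n ^+ 2 * (K2 + Y).
    rewrite -(ler_pXn2r (n := 2))// ?nnegrE ?nv_ge0 ?mulr_ge0 ?sn_ge0 ?(le_trans ler01)//.
    apply: le_trans (nv_sqv _) _; rewrite exprMn.
    apply: (@le_trans _ _ (K1 * sn n ^+ 2)); last first.
      by rewrite ler_wpM2r ?sqr_ge0// expr2 ler_peMl// (le_trans ler01).
    have : 0 <= sn n ^+ 2 by exact: sqr_ge0.
    rewrite /K1; nra.
  have [kn|nk] := leqP `|k| n.
    have hcd k' : (`|k'| <= n)%N -> cn n 0 k' = cn m 0 k'.
      by move=> h; rewrite cn0 cm0 /tr h (leq_trans h nm).
    have h := gal_cauchy nm gn gm hcd (fun t => yn' t n) (fun t => ym t m) tT.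
    apply: (@le_trans _ _ (sn n ^+ 2 * K2)); last by rewrite ler_wpM2l ?sqr_ge0// lerDl.
    apply: le_trans h; rewrite (big_rem k) ?mem_win//=.
    apply: ler_wpDr; first by apply: sumr_ge0 => l _; exact: sqv_ge0.
    by rewrite /sqv; apply: ler_sum => j _; rewrite -[nc (_ 0 j)]normcN !mxE opprB.
  have [_ cz _] := gn; rewrite (cz _ _ nk) subr0.
  have [mk|km] := leqP `|k| m; last first.
    have [_ cz' _] := gm; rewrite (cz' _ _ km) sqv0; apply: mulr_ge0; first exact: sqr_ge0.
    exact: addr_ge0.
  have h5 : az k ^+ 5 * sqv (cn m t k) <= Y.
    apply: le_trans (ym t m tT); apply: le_trans (y5_le m _).
    rewrite (big_rem k) ?mem_win//= lerDl; apply: sumr_ge0 => l _.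
    by rewrite mulr_ge0 ?sqv_ge0 ?exprn_ge0 ?az_ge0.
  have nk' : n.+1%:R <= az k by rewrite /az ler_nat.
  have h6 : n.+1%:R * sqv (cn m t k) <= Y.
    apply: le_trans h5; rewrite ler_wpM2r ?sqv_ge0//; apply: le_trans nk' _.
    by rewrite exprS ler_peMr ?az_ge0// exprn_ege1// /az ler1n; lia.
  rewrite sn_sqr mulrC ler_pdivlMr// mulrC; apply: le_trans h6 _.
  by rewrite lerDr.
pose c t k := limV (fun n => cn n t k).
have ctends (t : R) k : 0 <= t <= T -> tendsV (fun n => cn n t k) (c t k).
  by move=> tT; apply: (limV_tends (scale_sn_cvg0 K1)) => m n mn; exact: cauchy.
have clim n (t : R) k : 0 <= t <= T -> nv (c t k - cn n t k) <= 6 * K1 * sn n.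
  move=> tT; rewrite -mulrA; apply: (limVP (scale_sn_cvg0 K1)) => p q pq; exact: cauchy.
have cY n (t : R) : 0 <= t <= T -> yn n (c t) <= Y.
  move=> tT; apply: (@lim_sum_le _ _ (fun m k => (1 + az k ^+ 5) * sqv (cn m t k))).
    by move=> k; apply: cvgM; [exact: cvg_cst|apply: tendsV_sqv; exact: ctends].
  by near=> m; have [_ _ h] := hcn m; exact: h.
have cL n (t : R) : 0 <= t <= T -> ln n (c t) <= G by move=> tT; apply: ln_yn; exact: cY.
have cnL m n (t : R) : 0 <= t <= T -> ln n (cn m t) <= G.
  by move=> tT; apply: ln_yn; have [_ _ h] := hcn m; exact: h.
have rc (t : R) : 0 <= t <= T -> rcoefs (c t).
  move=> tT k; apply: (@tendsV_eq (fun n => cn n t (- k))); first exact: ctends.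
  rewrite (_ : (fun n => _) = fun n => conjv (cn n t k)); first exact/tendsV_conj/ctends.
  by apply/funext => n; have [[h _ _] _ _] := hcn n; exact: h.
(* The approximations are equi-Lipschitz in time, since each coefficient of the right-hand side is
   bounded by a product of two l^1 norms. *)
have clip (s t : R) k : 0 <= s -> s <= t -> t <= T -> nv (c t k - c s k) <= 6 * G ^+ 2 * (t - s).
  move=> s0 st tT.
  have hs : 0 <= s <= T by rewrite s0 (le_trans st).
  have ht : 0 <= t <= T by rewrite tT (le_trans s0).
  have cvb n (u : R) : 0 <= u <= T -> nv (cv n (cn n u) (ag (cn n u)) k) <= G ^+ 2.
    move=> uT; have := cv_sum_le (r := [:: k]) n (cn n u) (ag (cn n u)) isT.
    rewrite big_seq1 => /le_trans; apply; rewrite expr2; apply: ler_pM.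
    - by apply: sumr_ge0 => l _; exact: nv_ge0.
    - by apply: sumr_ge0 => l _; exact: nv_ge0.
    - exact: le_trans (nv_sum_le n _) (cnL _ _ _ uT).
    - by under eq_bigr do rewrite nv_ag; exact: le_trans (az_sum_le n _) (cnL _ _ _ uT).
  have hj j : nc ((c t k - c s k) 0 j) <= 2 * (G ^+ 2 * (t - s)).
    apply: le_trans (nc_le_ReIm _) _; rewrite entryB Re_add Im_add Re_opp Im_opp.
    have dD n : (`|k| <= n)%N -> `|complex.Re (cn n t k 0 j) - complex.Re (cn n s k 0 j)| <= G ^+ 2 * (t - s) /\
       `|complex.Im (cn n t k 0 j) - complex.Im (cn n s k 0 j)| <= G ^+ 2 * (t - s).
      move=> kn; have [[_ _ hd] _ _] := hcn n; have [h1 h2] := hd T k kn j.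
      have oo u : s < u < t -> 0 <= u <= T.
        by move=> /andP[su ut]; rewrite (le_trans s0 (ltW su)) (le_trans (ltW ut)).
      split.
        apply: (D1_lip_in h1) => // u /oo uT; apply: le_trans (cvb n u uT).
        exact: le_trans (Re_le_nc _) (nc_le_nv _ _).
      apply: (D1_lip_in h2) => // u /oo uT; apply: le_trans (cvb n u uT).
      exact: le_trans (Im_le_nc _) (nc_le_nv _ _).
    have l1 : `|complex.Re (cn n t k 0 j) - complex.Re (cn n s k 0 j)| @[n --> \oo] -->
       `|complex.Re (c t k 0 j) - complex.Re (c s k 0 j)|.
      by apply: cvg_norm; apply: cvgB; apply: tendsV_Re; exact: ctends.
    have l2 : `|complex.Im (cn n t k 0 j) - complex.Im (cn n s k 0 j)| @[n --> \oo] -->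
       `|complex.Im (c t k 0 j) - complex.Im (c s k 0 j)|.
      by apply: cvg_norm; apply: cvgB; apply: tendsV_Im; exact: ctends.
    have b1 : `|complex.Re (c t k 0 j) - complex.Re (c s k 0 j)| <= G ^+ 2 * (t - s).
      move: l1 => /cvgr_to_le; apply; exists `|k|%N => // n /= kn; by have [] := dD n kn.
    have b2 : `|complex.Im (c t k 0 j) - complex.Im (c s k 0 j)| <= G ^+ 2 * (t - s).
      move: l2 => /cvgr_to_le; apply; exists `|k|%N => // n /= kn; by have [] := dD n kn.
    lra.
  rewrite /nv sum3; have := hj 0; have := hj 1; have := hj 2; lra.
(* [l1_unif] upgrades the modewise rate to the weighted l^1 norm, in which the convolution is
   Lipschitz; thus the right-hand sides converge uniformly in time. *)
have Fcvg (e : R) : 0 < e -> forall k, exists N, forall n, (N <= n)%N -> forall t : R, 0 <= t <= T ->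
    nv (cv n (cn n t) (ag (cn n t)) k - Gc (c t) k) <= e.
  move=> e0 k; have d0 : 0 < e / 2 / (1 + 2 * G) by rewrite !divr_gt0// ltr_pwDl// mulr_ge0.
  have [eta eta0 heta] := l1_unif G_ge0 d0.
  have : (fun n => 6 * K1 * sn n) @ \oo --> 0 by exact: scale_sn_cvg0.
  move=> /cvgrPdist_le/(_ eta eta0)[N1 _ hN1].
  have : (fun n => 2 * G ^+ 2 * sn n) @ \oo --> 0 by exact: scale_sn_cvg0.
  have e20 : 0 < e / 2 by rewrite divr_gt0.
  move=> /cvgrPdist_le/(_ _ e20)[N2 _ hN2].
  exists (maxn N1 N2) => n; rewrite geq_max => /andP[n1 n2] t tT.
  have a1 := cv_l1_lip (r := [:: k]) isT (cnL n n t tT) (cL n t tT) (e := e / 2 / (1 + 2 * G)).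
  have h1 : forall k, nv (cn n t k - c t k) <= eta.
    move=> l; rewrite nvBC; apply: le_trans (clim n t l tT) _.
    by have := hN1 n n1; rewrite /= sub0r normrN => /(le_trans (ler_norm _)).
  have := a1 (heta _ _ n (cnL n n t tT) (cL n t tT) h1); rewrite big_seq1 => {}a1.
  have a2 := Gc_trunc (a := c t) (fun n => cL n t tT) n (r := [:: k]) isT.
  rewrite big_seq1 in a2.
  have a3 : 2 * G ^+ 2 * sn n <= e / 2.
    by have := hN2 n n2; rewrite /= sub0r normrN => /(le_trans (ler_norm _)).
  have a4 : 2 * G * (e / 2 / (1 + 2 * G)) <= e / 2.
    by rewrite mulrCA ler_piMr ?(ltW e20)// ler_pdivrMr ?mul1r ?lerDr// ltr_pwDl// mulr_ge0.
  rewrite -[X in nv X](subrKA (cv n (c t) (ag (c t)) k)); apply: le_trans (nvD _ _) _.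
  rewrite [nv (_ - Gc _ _)]nvBC; lra.
have Gcont (e t : R) k : 0 < e -> 0 <= t <= T -> exists2 d : R, 0 < d & forall s, 0 <= s <= T ->
     `|s - t| < d -> nv (Gc (c s) k - Gc (c t) k) <= e.
  move=> e0 tT; have d0 : 0 < e / (1 + 2 * G) by rewrite !divr_gt0// ltr_pwDl// mulr_ge0.
  have [eta eta0 heta] := l1_unif G_ge0 d0.
  have A0 : 0 < 1 + 6 * G ^+ 2 by rewrite ltr_pwDl// mulr_ge0// exprn_ge0.
  exists (eta / (1 + 6 * G ^+ 2)); first by rewrite divr_gt0.
  move=> s sT st.
  have h1 k' : nv (c s k' - c t k') <= eta.
    have h2 : 6 * G ^+ 2 * `|s - t| <= eta.
      move: st; rewrite ltr_pdivlMr// => st; apply: le_trans (ltW st).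
      by rewrite mulrC ler_wpM2l// lerDr.
    apply: le_trans h2; case/andP: sT => s0 sT; case/andP: tT => t0 tT.
    have [ts|ts] := leP t s; first by rewrite ger0_norm ?subr_ge0// clip.
    by rewrite nvBC distrC ger0_norm ?subr_ge0 ?(ltW ts)// clip// ltW.
  have := Gc_lip (r := [:: k]) isT (fun n => cL n s sT) (fun n => cL n t tT)
     (fun n => heta _ _ n (cL n s sT) (cL n t tT) h1).
  rewrite big_seq1 => /le_trans; apply.
  by rewrite mulrCA ler_piMr ?(ltW e0)// ler_pdivrMr ?mul1r ?lerDr// ltr_pwDl// mulr_ge0.
exists c, cn, (6 * K1); split; last first.
  move=> k; apply: (@tendsV_eq (fun n => cn n 0 k)); first exact: ctends.
  (* The error vanishes as soon as [n >= |k|]; before that, |k|/(n + 1) is at least 1. *)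
  exists (fun n => (nv (c0 k) * az k) * (sn n * sn n)).
    rewrite -[X in _ --> X](mulr0 (nv (c0 k) * az k)); apply: cvgM; first exact: cvg_cst.
    by rewrite -[X in _ --> X](mulr0 0); apply: cvgM; exact: sn_cvg0.
  move=> n; have [_ -> _] := hcn n; rewrite /tr; case: leqP => h.
    by rewrite subrr nv0 !mulr_ge0 ?nv_ge0 ?az_ge0 ?sn_ge0.
  rewrite subr0 -mulrA ler_peMr ?nv_ge0// -expr2 sn_sqr ler_pdivlMr// mul1r.
  by rewrite /az ler_nat.
split=> //.
- split=> //; by rewrite mulr_ge0// (le_trans ler01).
- by move=> t tT; split; [exact: rc|move=> n; exact: cY].
(* The sequence is shifted by [m], so that mode [k] lies in every window and obeys its equation from
   the first term on. *)
- move=> k j; pose m := `|k|%N.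
  split.
    apply: (@D1_limit T (fun n t => complex.Re (cn (n + m)%N t k 0 j))
      (fun n t => complex.Re (cv (n + m) (cn (n + m)%N t) (ag (cn (n + m)%N t)) k 0 j))).
    + move=> n; have [[_ _ hd] _ _] := hcn (n + m)%N.
      by have [] := hd T k (leq_addl _ _) j.
    + by move=> t tT; have := tendsV_Re (j := j) (ctends t k tT); rewrite -(cvg_shiftn m).
    + move=> e e0; have [N hN] := Fcvg e e0 k; exists N => n Nn t tT.
      apply: le_trans (hN (n + m)%N (leq_trans Nn (leq_addr _ _)) t tT).
      apply: le_trans (nc_le_nv _ j); apply: le_trans (Re_le_nc _).
      by rewrite entryB Re_add Re_opp.
    move=> e t e0 tT; have [d d0 hd] := Gcont e t k e0 tT; exists d => // s sT st.
    apply: le_trans (hd s sT st); apply: le_trans (nc_le_nv _ j); apply: le_trans (Re_le_nc _).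
    by rewrite entryB Re_add Re_opp.
  apply: (@D1_limit T (fun n t => complex.Im (cn (n + m)%N t k 0 j))
      (fun n t => complex.Im (cv (n + m) (cn (n + m)%N t) (ag (cn (n + m)%N t)) k 0 j))).
  + move=> n; have [[_ _ hd] _ _] := hcn (n + m)%N.
    by have [] := hd T k (leq_addl _ _) j.
  + by move=> t tT; have := tendsV_Im (j := j) (ctends t k tT); rewrite -(cvg_shiftn m).
  + move=> e e0; have [N hN] := Fcvg e e0 k; exists N => n Nn t tT.
    apply: le_trans (hN (n + m)%N (leq_trans Nn (leq_addr _ _)) t tT).
    apply: le_trans (nc_le_nv _ j); apply: le_trans (Im_le_nc _).
    by rewrite entryB Im_add Im_opp.
  move=> e t e0 tT; have [d d0 hd] := Gcont e t k e0 tT; exists d => // s sT st.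
  apply: le_trans (hd s sT st); apply: le_trans (nc_le_nv _ j); apply: le_trans (Im_le_nc _).
  by rewrite entryB Im_add Im_opp.
move=> A n s t A0 hA s0 st tT.
have hs : 0 <= s <= T by rewrite s0 (le_trans st).
have ht : 0 <= t <= T by rewrite tT (le_trans s0).
have EAc (u : R) : 0 <= u <= T -> (fun m => EA A n (cn m u)) @ \oo --> EA A n (c u).
  move=> uT; apply: cvg_sum_seq => k; apply: cvgM; first exact: cvg_cst.
  by apply: tendsV_sqv; exact: ctends.
have : `|EA A n (cn m t) - EA A n (cn m s)| @[m --> \oo] --> `|EA A n (c t) - EA A n (c s)|.
  by apply: cvg_norm; apply: cvgB; exact: EAc.
move=> /cvgr_to_le; apply; exists n => // m /= nm.
rewrite -!(EA_ext _ A0 hA nm); have [gm _ hy] := hcn m.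
have hYm (u : R) : 0 <= u <= T -> yn m (cn m u) <= Y by exact: hy.
exact: (gal_EA A gm hYm s0 st tT).
Unshelve. all: by end_near. Qed.

End Solution.
End Limit.

(** * Fourier series on the circle *)

Section CircleFourier.
Context {R : realType}.
Local Notation C := R[i].
Local Notation V := 'rV[R[i]]_3.
Local Notation nc := (@Normc.normc R).
Local Notation mu := (@lebesgue_measure R).
Local Notation D := (`[0%R, (2 * pi)%R]%classic : set R).
Implicit Types (k l : int) (x : R).

Definition ek k x : C := val (expi x) ^ k.

Lemma expi_neq0 x : val (expi x) != 0.
Proof. by rewrite -normr_eq0 (eqP (valP (expi x))) oner_eq0. Qed.

Lemma expi_conj x : (val (expi x))^* = (val (expi x))^-1.
Proof.
apply: (mulfI (expi_neq0 x)); rewrite divff ?expi_neq0 //=.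
by apply/eqP; rewrite eq_complex /= mulrN opprK -!expr2 cos2Dsin2 mulrC; apply/andP; split;
  apply/eqP; lra.
Qed.

Lemma ekD k l x : ek (k + l) x = ek k x * ek l x.
Proof. by rewrite /ek expfzDr // expi_neq0. Qed.

Lemma ek0 x : ek 0 x = 1. Proof. by rewrite /ek expr0z. Qed.

Lemma numconjE (z : C) : Num.conj z = conjc z. Proof. by []. Qed.

Lemma ek_conj k x : Num.conj (val (expi x)) ^ k = ek (- k) x.
Proof.
by rewrite numconjE expi_conj exprz_inv.
Qed.

Lemma ekE k x : ek k x = cos (k%:~R * x) +i* sin (k%:~R * x).
Proof.
have pos : forall n : nat, ek n x = cos (n%:R * x) +i* sin (n%:R * x).
  elim=> [|n IH]; first by rewrite ek0 mul0r cos0 sin0.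
  rewrite -addn1 PoszD ekD IH /ek expr1z natrD mulrDl mul1r cosD sinD.
  by apply/eqP; rewrite eq_complex /=; apply/andP; split; apply/eqP; ring.
case: (intP k) => [|n|n]; first by rewrite ek0 mul0r cos0 sin0.
  exact: pos.
rewrite -ek_conj mulrNz mulNr cosN sinN.
have -> : Num.conj (val (expi x)) ^ n.+1 = Num.conj (ek n.+1 x).
  by rewrite /ek /exprz rmorphXn.
by rewrite pos numconjE.
Qed.

Lemma conj_ek k x : (ek k x)^* = ek (- k) x.
Proof. by rewrite !ekE rmorphN /= mulNr cosN sinN. Qed.

Lemma nc_ek k x : nc (ek k x) = 1.
Proof. by rewrite ekE /Normc.normc cos2Dsin2 sqrtr1. Qed.

Lemma Re_ek k x : complex.Re (ek k x) = cos (k%:~R * x). Proof. by rewrite ekE. Qed.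
Lemma Im_ek k x : complex.Im (ek k x) = sin (k%:~R * x). Proof. by rewrite ekE. Qed.

Lemma expi_surj (z : circle R) : exists2 x, 0 <= x <= 2 * pi & expi x = z.
Proof.
case: z => -[a b] h; have := h; rewrite normc_def /= => /eqP [hs].
have ab : a ^+ 2 + b ^+ 2 = 1.
  by rewrite -[LHS]sqr_sqrtr ?hs ?expr1n // addr_ge0 ?sqr_ge0.
have a1 : -1 <= a <= 1 by apply/andP; split; nra.
have sa : sin (acos a) = `|b|.
  by rewrite sin_acos // -sqrtr_sqr -ab; congr Num.sqrt; ring.
have := acos_ge0 a1; have := acos_lepi a1; have := @pi_gt0 R => p0 p1 p2.
have [b0|b0] := leP 0 b.
- exists (acos a); first by rewrite p2 /=; lra.
  apply: val_inj => /=; rewrite acosK ?in_itv //= sa ger0_norm //.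
- exists (2 * pi - acos a); first by apply/andP; split; lra.
  apply: val_inj => /=; rewrite addrC cosD sinD.
  have -> : 2 * pi = (pi *+ 2 : R) by rewrite mulr_natl.
  rewrite cos2pi sin2pi cosN sinN !mulr0 !mulr1 subr0 addr0.
  by rewrite acosK ?in_itv //= sa ltr0_norm // opprK.
Qed.

Lemma expi_periodic x (m : int) : expi (x + m%:~R * (2 * pi)) = expi x.
Proof.
have per : forall (y : R) (n : nat), expi (y + n%:R * (2 * pi)) = expi y.
  move=> y; elim=> [|n IH]; first by rewrite mul0r addr0.
  rewrite -addn1 natrD mulrDl mul1r addrA -IH; apply: val_inj => /=.
  have -> : 2 * pi = (pi *+ 2 : R) by rewrite mulr_natl.
  by rewrite cosD2pi sinD2pi.
case: (intP m) => [|n|n]; first by rewrite mul0r addr0.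
  exact: per.
by rewrite -(per (x + _) n.+1) -addrA -mulrDl mulrNz addNr mul0r addr0.
Qed.

Lemma cosk_cont k : continuous (fun x : R => cos (k%:~R * x)).
Proof.
move=> x; apply: (@continuous_comp _ _ _ (fun x : R => k%:~R * x) cos); last exact: continuous_cos.
by apply: cvgMr; exact: cvg_id.
Qed.

Lemma sink_cont k : continuous (fun x : R => sin (k%:~R * x)).
Proof.
move=> x; apply: (@continuous_comp _ _ _ (fun x : R => k%:~R * x) sin); last exact: continuous_sin.
by apply: cvgMr; exact: cvg_id.
Qed.

Definition rint (f : R -> R) : Prop := mu.-integrable D (EFin \o f).

Lemma mD : measurable (D : set (measurableTypeR R)). Proof. exact: measurable_itv. Qed.

Lemma rint_cont (f : R -> R) : {within D, continuous f} -> rint f.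
Proof. by move=> fc; apply: continuous_compact_integrable => //; exact: segment_compact. Qed.

Lemma cont_within (A : set R) (f : R -> R) : continuous f -> {within A, continuous f}.
Proof. by move=> fc; apply: continuous_subspaceT. Qed.

Lemma rint_add f g : rint f -> rint g -> rint (fun x => f x + g x).
Proof.
move=> hf hg; apply: (eq_integrable mD _ _ _ (integrableD mD hf hg)) => x _ /=.
by rewrite EFinD.
Qed.

Lemma rint_scale (a : R) f : rint f -> rint (fun x => a * f x).
Proof.
move=> hf; apply: (eq_integrable mD _ _ _ (integrableZl mD a hf)) => x _ /=.
by rewrite EFinM.
Qed.

Lemma rint_mul f g : rint f -> continuous g -> rint (fun x => f x * g x).
Proof.
move=> hf gc; have gw := cont_within (A := D) gc.
have h : mu.-integrable D ((EFin \o f) \* (EFin \o g))%E.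
  apply: (integrableMl mD) => //.
    exact: measurable_realfun.subspace_continuous_measurable_fun mD gw.
  have /compact_bounded[M [_ mrt]] := continuous_compact gw (@segment_compact R 0 (2 * pi)).
  by exists M; split; rewrite ?num_real // => ? ? ? ?; exact: mrt.
by apply: (eq_integrable mD _ _ _ h) => x _ /=; rewrite EFinM.
Qed.

Definition cint (f : R -> C) : Prop :=
  rint (fun x => complex.Re (f x)) /\ rint (fun x => complex.Im (f x)).
Local Notation intC := (integralC D).

Lemma complexP (z w : C) : complex.Re z = complex.Re w -> complex.Im z = complex.Im w -> z = w.
Proof. by case: z w => a b [c d] /= -> ->. Qed.

Lemma intC_add f g : cint f -> cint g -> intC (fun x => f x + g x) = intC f + intC g.
Proof.
move=> [f1 f2] [g1 g2]; apply: complexP; rewrite ?Re_add ?Im_add /=.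
- by rewrite -RintegralD //; apply: eq_Rintegral => x _; rewrite Re_add.
- by rewrite -RintegralD //; apply: eq_Rintegral => x _; rewrite Im_add.
Qed.

Lemma rint_ext f g : (forall x, D x -> f x = g x) -> rint f -> rint g.
Proof. by move=> fg; apply: eq_integrable; [exact: mD|move=> x /set_mem Dx /=; rewrite fg]. Qed.

Lemma cint_ext f g : (forall x, D x -> f x = g x) -> cint f -> cint g.
Proof. by move=> fg [h1 h2]; split; [apply: rint_ext h1|apply: rint_ext h2] => x /fg ->. Qed.

Lemma intC_ext f g : (forall x, D x -> f x = g x) -> intC f = intC g.
Proof.
by move=> fg; congr (_ +i* _); apply: eq_Rintegral => x /set_mem /fg ->.
Qed.

Lemma cint_add f g : cint f -> cint g -> cint (fun x => f x + g x).
Proof.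
move=> [f1 f2] [g1 g2]; split.
- by apply: rint_ext (rint_add f1 g1) => x _; rewrite Re_add.
- by apply: rint_ext (rint_add f2 g2) => x _; rewrite Im_add.
Qed.

Lemma Re_mul (z w : C) : complex.Re (z * w) =
  complex.Re z * complex.Re w - complex.Im z * complex.Im w.
Proof. by case: z; case: w. Qed.

Lemma Im_mul (z w : C) : complex.Im (z * w) =
  complex.Re z * complex.Im w + complex.Im z * complex.Re w.
Proof. by case: z; case: w. Qed.

Lemma cint_scale (z : C) f : cint f -> cint (fun x => z * f x).
Proof.
move=> [f1 f2]; split.
- apply: rint_ext (rint_add (rint_scale (complex.Re z) f1) (rint_scale (- complex.Im z) f2)) => x _.
  by rewrite Re_mul mulNr.
- apply: rint_ext (rint_add (rint_scale (complex.Re z) f2) (rint_scale (complex.Im z) f1)) => x _.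
  by rewrite Im_mul.
Qed.

Lemma intC_scale (z : C) f : cint f -> intC (fun x => z * f x) = z * intC f.
Proof.
move=> [f1 f2]; apply: complexP; rewrite ?Re_mul ?Im_mul /=.
- rewrite -(RintegralZl _ mD f1) -(RintegralZl _ mD f2) -RintegralB //; try exact: rint_scale.
  by apply: eq_Rintegral => x _; rewrite Re_mul.
- rewrite -(RintegralZl _ mD f1) -(RintegralZl _ mD f2) -RintegralD //; try exact: rint_scale.
  by apply: eq_Rintegral => x _; rewrite Im_mul.
Qed.

Lemma intC0 : intC (fun=> 0) = 0.
Proof. by apply: complexP => /=; rewrite Rintegral_cst ?mul0r //. Qed.

Lemma cint0 : cint (fun=> 0).
Proof. by split; apply: rint_cont; apply: cont_within => x; exact: cvg_cst. Qed.

Lemma cint_sum (I : Type) (r : seq I) (f : I -> R -> C) : (forall i, cint (f i)) ->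
  cint (fun x => \sum_(i <- r) f i x).
Proof.
move=> h; elim: r => [|i r IH]; first by apply: cint_ext cint0 => x _; rewrite big_nil.
by apply: cint_ext (cint_add (h i) IH) => x _; rewrite big_cons.
Qed.

Lemma intC_sum (I : Type) (r : seq I) (f : I -> R -> C) : (forall i, cint (f i)) ->
  intC (fun x => \sum_(i <- r) f i x) = \sum_(i <- r) intC (f i).
Proof.
move=> h; elim: r => [|i r IH].
  by rewrite big_nil -[RHS]intC0; apply: intC_ext => x _; rewrite big_nil.
rewrite big_cons -IH -intC_add //; last exact: cint_sum.
by apply: intC_ext => x _; rewrite big_cons.
Qed.

Lemma cint_ek k : cint (ek k).
Proof.
split; apply: rint_cont; apply: cont_within.
- by under eq_fun do rewrite Re_ek; exact: cosk_cont.
- by under eq_fun do rewrite Im_ek; exact: sink_cont.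
Qed.

Lemma cintM_ek f k : cint f -> cint (fun x => f x * ek k x).
Proof.
move=> [f1 f2]; have kc := @cosk_cont k; have ks := @sink_cont k.
have nks : continuous (fun x : R => - sin (k%:~R * x)) by move=> x; apply: cvgN; exact: ks.
split.
- apply: rint_ext (rint_add (rint_mul f1 kc) (rint_mul f2 nks)) => x _.
  by rewrite Re_mul Re_ek Im_ek mulrN.
- apply: rint_ext (rint_add (rint_mul f1 ks) (rint_mul f2 kc)) => x _.
  by rewrite Im_mul Re_ek Im_ek.
Qed.

Lemma sin_per k : sin (k%:~R * (2 * pi)) = 0 :> R.
Proof.
have := congr1 (fun z => complex.Im (val z)) (expi_periodic 0 k).
by rewrite /= add0r sin0.
Qed.

Lemma cos_per k : cos (k%:~R * (2 * pi)) = 1 :> R.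
Proof.
have := congr1 (fun z => complex.Re (val z)) (expi_periodic 0 k).
by rewrite /= add0r cos0.
Qed.

Lemma twopi_gt0 : 0 < 2 * pi :> R. Proof. by rewrite mulr_gt0 // pi_gt0. Qed.

Lemma Rint_FTC (f F : R -> R) (a b : R) : a < b -> continuous f ->
  (forall x : R, is_derive x 1 F (f x)) ->
  \int[mu]_(x in `[a, b]) f x = F b - F a.
Proof.
move=> ab fc dF; have Fc : continuous F.
  by move=> x; apply: differentiable_continuous; apply/derivable1_diffP; case: (dF x).
rewrite /Rintegral (@continuous_FTC2 _ f F a b) //.
- exact: cont_within.
- split; first by move=> x _; case: (dF x).
  + by apply: cvg_at_right_filter; exact: Fc.
  + by apply: cvg_at_left_filter; exact: Fc.
- by move=> x _; rewrite derive1E; case: (dF x).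
Qed.

Lemma int_ek k : intC (ek k) = if k == 0 then (2 * pi)%:C else 0.
Proof.
have p0 := twopi_gt0.
have [->|k0] := eqVneq k 0.
  rewrite (intC_ext (g := fun=> 1)); last by move=> x _; exact: ek0.
  apply: complexP => /=; rewrite Rintegral_cst ?mul0r //.
  by rewrite mul1r [X in fine X](lebesgue_measure_itv `[0, 2 * pi]%R) /= lte_fin p0 /= subr0.
have k0' : k%:~R != 0 :> R by rewrite intr_eq0.
apply: complexP => /=.
- under eq_Rintegral do rewrite Re_ek.
  have dF : forall x : R, is_derive x 1 (fun x => k%:~R^-1 * sin (k%:~R * x)) (cos (k%:~R * x)).
    move=> x; apply: is_derive_eq.
    by rewrite /GRing.scale /= mulr1; field.
  rewrite (Rint_FTC p0 (@cosk_cont k) dF).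
  by rewrite sin_per !mulr0 sin0 mulr0 subrr.
- under eq_Rintegral do rewrite Im_ek.
  have dF : forall x : R, is_derive x 1 (fun x => - k%:~R^-1 * cos (k%:~R * x)) (sin (k%:~R * x)).
    move=> x; apply: is_derive_eq.
    by rewrite /GRing.scale /= mulr1; field.
  rewrite (Rint_FTC p0 (@sink_cont k) dF).
  by rewrite cos_per !mulr0 cos0 subrr.
Qed.

Lemma fourierCE (f : circle R -> V) k j :
  fourierC f k 0 j = ((2 * pi)^-1)%:C * intC (fun x => f (expi x) 0 j * ek (- k) x).
Proof.
rewrite mxE; congr (_ * _); apply: intC_ext => x _.
by rewrite -ek_conj.
Qed.

Definition cintV (f : circle R -> V) : Prop := forall j, cint (fun x => f (expi x) 0 j).

Lemma cint_opp f : cint f -> cint (fun x => - f x).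
Proof. by move=> h; apply: cint_ext (cint_scale (-1) h) => x _; rewrite mulN1r. Qed.

Lemma cintV_sub f g : cintV f -> cintV g -> cintV (fun z => f z - g z).
Proof.
by move=> hf hg j; apply: cint_ext (cint_add (hf j) (cint_opp (hg j))) => x _; rewrite !mxE.
Qed.

Lemma fourierC_ext (f g : circle R -> V) : (forall z, f z = g z) -> fourierC f = fourierC g.
Proof. by move=> fg; congr fourierC; apply/funext. Qed.

Lemma fourierC_sub f g k : cintV f -> cintV g ->
  fourierC (fun z => f z - g z) k = fourierC f k - fourierC g k.
Proof.
move=> hf hg; apply/rowP => j; rewrite entryB !fourierCE -mulrBr; congr (_ * _).
rewrite -mulN1r -intC_scale -?intC_add; last first; try exact: cintM_ek.
- exact/cint_scale/cintM_ek.
by apply: intC_ext => x _; rewrite !mxE mulN1r mulrBl.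
Qed.

Definition trig (r : seq int) (c : int -> V) (z : circle R) : V :=
  \sum_(k <- r) val z ^ k *: c k.

Lemma trigE r c x j : trig r c (expi x) 0 j = \sum_(k <- r) c k 0 j * ek k x.
Proof. by rewrite summxE; apply: eq_bigr => k _; rewrite mxE mulrC. Qed.

Lemma cintV_trig r c : cintV (trig r c).
Proof.
move=> j; apply: (cint_ext (f := fun x => \sum_(k <- r) c k 0 j * ek k x)).
  by move=> x _; rewrite trigE.
by apply: cint_sum => k; apply: cint_scale; exact: cint_ek.
Qed.

Lemma fourierC_trig r c k : uniq r ->
  fourierC (trig r c) k = if k \in r then c k else 0.
Proof.
move=> ur; apply/rowP => j; rewrite fourierCE.
have -> : intC (fun x => trig r c (expi x) 0 j * ek (- k) x) =
    \sum_(l <- r) c l 0 j * (if l == k then (2 * pi)%:C else 0).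
  rewrite (intC_ext (g := fun x => \sum_(l <- r) c l 0 j * ek (l - k) x)); last first.
    by move=> x _; rewrite trigE mulr_suml; apply: eq_bigr => l _; rewrite ekD mulrA.
  rewrite intC_sum; last by move=> l; apply: cint_scale; exact: cint_ek.
  apply: eq_bigr => l _; rewrite intC_scale; last exact: cint_ek.
  by rewrite int_ek subr_eq0.
rewrite (eq_bigr (fun l => if l == k then c l 0 j * (2 * pi)%:C else 0)); last first.
  by move=> l _; case: (l == k); rewrite ?mulr0.
have [kr|kr] := boolP (k \in r).
  rewrite sum_if_eqM // mulrCA -rmorphM /= mulVf ?mulr1 //.
  by rewrite lt0r_neq0 // twopi_gt0.
rewrite mxE big1_seq ?mulr0 // => l /andP[_ lr].
by case: eqP => // lk; rewrite -lk lr in kr.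
Qed.

Lemma rint_bound f (e : R) : rint f -> (forall x, `|f x| <= e) ->
  `|\int[mu]_(x in D) f x| <= 2 * pi * e.
Proof.
move=> hf fe; have ie : rint (fun=> e) by apply: rint_cont; apply: cont_within => x; exact: cvg_cst.
apply: (le_trans (le_normr_Rintegral mD hf)).
have an : rint (fun x => `|f x|).
  by apply: (eq_integrable mD _ _ _ (integrable_abse hf)) => x _.
apply: (le_trans (le_Rintegral mD an ie (fun x _ => fe x))).
rewrite Rintegral_cst // [X in fine X](lebesgue_measure_itv `[0, 2 * pi]%R) /= lte_fin twopi_gt0 /= subr0.
by rewrite mulrC.
Qed.

(** The factor 6 counts the real and imaginary parts of three components. *)
Lemma fourierC_bound f (e : R) k : cintV f -> (forall z, nv (f z) <= e) ->
  nv (fourierC f k) <= 6 * e.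
Proof.
move=> hf fe; have p0 := twopi_gt0; have p1 : 0 <= (2 * pi)^-1 :> R by rewrite invr_ge0 ltW.
have H j : nc (fourierC f k 0 j) <= 2 * e.
  rewrite fourierCE Normc.normcM nc_real ger0_norm //.
  have [h1 h2] := cintM_ek (- k) (hf j).
  have fe' x : nc (f (expi x) 0 j * ek (- k) x) <= e.
    by rewrite Normc.normcM nc_ek mulr1 (le_trans (nc_le_nv _ _)).
  rewrite ler_pdivrMl // (le_trans (nc_le_ReIm _)) //=.
  rewrite [leRHS](_ : _ = 2 * pi * e + 2 * pi * e); last by ring.
  rewrite lerD //; apply: rint_bound => // x; apply: le_trans (fe' x).
    exact: Re_le_nc.
  exact: Im_le_nc.
rewrite /nv sum3; have := H 0; have := H 1; have := H 2; lra.
Qed.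

Section Series.
Variables (G : R) (c : int -> V).
Hypothesis cG : forall n, \sum_(k <- win n) nv (c k) <= G.
Hypothesis cT : forall n m, (n <= m)%N -> \sum_(k <- win m) nv (c k - tr n c k) <= sn n * G.

Lemma nc_circle (z : circle R) k : nc (val z ^ k) = 1.
Proof. by have [x _ <-] := expi_surj z; exact: nc_ek. Qed.

Lemma nv_trig r (a : int -> V) z : nv (trig r a z) <= \sum_(k <- r) nv (a k).
Proof.
apply: (le_trans (nv_sum _ _ _)); apply: ler_sum => k _.
by rewrite nvZ nc_circle mul1r.
Qed.

Lemma trig_tr n m (a : int -> V) z : (n <= m)%N -> trig (win m) (tr n a) z = trig (win n) a z.
Proof.
move=> nm; rewrite /trig (win_supp nm) //.
  apply: eq_big_seq => k; rewrite mem_win /tr => ->; by [].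
by move=> k kn; rewrite /tr leqNgt kn scaler0.
Qed.

Lemma trigB r (a b : int -> V) z : trig r (fun k => a k - b k) z = trig r a z - trig r b z.
Proof.
rewrite /trig -sumrN -big_split /=; apply: eq_bigr => k _.
by rewrite scalerBr.
Qed.

Lemma trig_tail n m z : (n <= m)%N -> nv (trig (win m) c z - trig (win n) c z) <= sn n * G.
Proof.
move=> nm; rewrite -(trig_tr c z nm) -trigB; apply: (le_trans (nv_trig _ _ _)).
exact: cT.
Qed.

Definition ser (c : int -> V) (z : circle R) : V := limV (fun n => trig (win n) c z).

Lemma ser_trunc n z : nv (ser c z - trig (win n) c z) <= 6 * (sn n * G).
Proof.
apply: (limVP (e := fun n => sn n * G)); last by move=> m p mp; exact: trig_tail.
by under eq_fun do rewrite mulrC; exact: scale_sn_cvg0.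
Qed.

Lemma ser_tends z : tendsV (fun n => trig (win n) c z) (ser c z).
Proof.
exists (fun n => (6 * G) * sn n); first exact: scale_sn_cvg0.
by move=> n; apply: (le_trans (ser_trunc n z)); rewrite (mulrC (sn n)) mulrA.
Qed.

Lemma unif_cont (f : R -> R) (F : nat -> R -> R) (e : nat -> R) : e @ \oo --> 0 ->
  (forall n, continuous (F n)) -> (forall n x, `|f x - F n x| <= e n) -> continuous f.
Proof.
move=> e0 Fc fF x; apply/cvgrPdist_le => /= d d0.
have [n _ en] : \forall n \near \oo, e n <= d / 4.
  have /cvgrPdist_le/(_ (d / 4)) : e @ \oo --> 0 by [].
  case=> [|N _ HN]; first by rewrite divr_gt0.
  exists N => // n /HN /=; rewrite sub0r normrN; exact: le_trans (ler_norm _).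
have {}en := en n (leqnn n).
have /cvgrPdist_le/(_ (d / 4)) := Fc n x.
case=> [|r r0 Hr]; first by rewrite divr_gt0.
exists r => // y /Hr /=; have := fF n x; have := fF n y.
rewrite !ler_norml => /andP[? ?] /andP[? ?] /andP[? ?]; apply/andP; split; lra.
Qed.

Lemma cont_sum (I : Type) (r : seq I) (F : I -> R -> R) : (forall i, continuous (F i)) ->
  continuous (fun x : R => \sum_(i <- r) F i x).
Proof.
move=> Fc; elim: r => [|i r IH] x; first by under eq_fun do rewrite big_nil; exact: cvg_cst.
by under eq_fun do rewrite big_cons; apply: cvgD; [exact: Fc|exact: IH].
Qed.

Lemma trig_cont r (a : int -> V) j :
  continuous (fun x : R => complex.Re (trig r a (expi x) 0 j)) /\
  continuous (fun x : R => complex.Im (trig r a (expi x) 0 j)).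
Proof.
split.
- under eq_fun do rewrite trigE Re_sum; apply: cont_sum => k x.
  under eq_fun do rewrite Re_mul Re_ek Im_ek.
  by apply: cvgB; apply: cvgMr; [exact: cosk_cont|exact: sink_cont].
- under eq_fun do rewrite trigE Im_sum; apply: cont_sum => k x.
  under eq_fun do rewrite Im_mul Re_ek Im_ek.
  by apply: cvgD; apply: cvgMr; [exact: sink_cont|exact: cosk_cont].
Qed.

Lemma ser_cont j :
  continuous (fun x : R => complex.Re (ser c (expi x) 0 j)) /\
  continuous (fun x : R => complex.Im (ser c (expi x) 0 j)).
Proof.
have e0 : (fun n => (6 * G) * sn n) @ \oo --> 0 by exact: scale_sn_cvg0.
have B n x : nc (ser c (expi x) 0 j - trig (win n) c (expi x) 0 j) <= 6 * G * sn n.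
  rewrite -entryB (le_trans (nc_le_nv _ _)) // (le_trans (ser_trunc _ _)) //.
  by rewrite (mulrC (sn n)) mulrA.
split; apply: (unif_cont e0).
- by move=> n; exact: (trig_cont (win n) c j).1.
- by move=> n x; apply: le_trans (B n x); rewrite -Re_opp -Re_add; exact: Re_le_nc.
- by move=> n; exact: (trig_cont (win n) c j).2.
- by move=> n x; apply: le_trans (B n x); rewrite -Im_opp -Im_add; exact: Im_le_nc.
Qed.

Lemma cintV_ser : cintV (ser c).
Proof.
by move=> j; split; apply: rint_cont; apply: cont_within; [exact: (ser_cont j).1|exact: (ser_cont j).2].
Qed.

(** The partial sums converge uniformly, and each has exactly the coefficients [c] on its window. *)
Lemma fourier_ser k : fourierC (ser c) k = c k.
Proof.
apply: (@tendsV_eq _ (fun n => fourierC (trig (win n) c) k)).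
- exists (fun n => (36 * G) * sn n); first exact: scale_sn_cvg0.
  move=> n; rewrite -fourierC_sub; [|exact: cintV_ser|exact: cintV_trig].
  rewrite (_ : 36 * G * sn n = 6 * (6 * (sn n * G))); last by ring.
  apply: fourierC_bound; last exact: ser_trunc.
  exact: cintV_sub cintV_ser (cintV_trig _ _).
- exists (fun n => if (`|k| <= n)%N then 0 else nv (c k)).
    apply/cvgrPdist_le => e e0; exists `|k|%N => // n /= kn.
    by rewrite kn subr0 normr0 ltW.
  move=> n; rewrite fourierC_trig ?win_uniq // mem_win; case: ifP => _; last by rewrite subr0.
  by rewrite subrr nv0.
Qed.

Lemma nv_ser z : nv (ser c z) <= 6 * (sn 0 * G) + G.
Proof.
rewrite -[ser c z](subrK (trig (win 0) c z)) (le_trans (nvD _ _)) // lerD ?ser_trunc //.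
exact: le_trans (nv_trig _ _ _) (cG 0).
Qed.
End Series.

Lemma cint_mul_cont (f g : R -> C) : cint f ->
  continuous (fun x => complex.Re (g x)) -> continuous (fun x => complex.Im (g x)) ->
  cint (fun x => f x * g x).
Proof.
move=> [f1 f2] g1 g2.
have g2' : continuous (fun x : R => - complex.Im (g x)) by move=> x; apply: cvgN; exact: g2.
split.
- by apply: rint_ext (rint_add (rint_mul f1 g1) (rint_mul f2 g2')) => x _; rewrite Re_mul mulrN.
- by apply: rint_ext (rint_add (rint_mul f1 g2) (rint_mul f2 g1)) => x _; rewrite Im_mul.
Qed.

Lemma trig_cross r (a b : int -> V) z : crossC (trig r a z) (trig r b z) =
  \sum_(m <- r) \sum_(l <- r) val z ^ (m + l) *: crossC (a m) (b l).
Proof.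
rewrite crossC_suml; apply: eq_bigr => m _; rewrite crossC_sumr; apply: eq_bigr => l _.
have [x _ <-] := expi_surj z.
by rewrite crossCZl crossCZr scalerA -[val (expi x) ^ (m + l)]/(ek (m + l) x) ekD.
Qed.

Lemma cintV_cross (f g : circle R -> V) : cintV f ->
  (forall j, continuous (fun x : R => complex.Re (g (expi x) 0 j)) /\
             continuous (fun x : R => complex.Im (g (expi x) 0 j))) ->
  cintV (fun z => crossC (f z) (g z)).
Proof.
move=> hf hg j.
apply: cint_ext (cint_add (cint_mul_cont (hf (j + 1)) (hg (j + 2)).1 (hg (j + 2)).2)
  (cint_opp (cint_mul_cont (hf (j + 2)) (hg (j + 1)).1 (hg (j + 1)).2))) => x _.
by rewrite mxE.
Qed.

(** The product of two polynomials of degree n has degree 2n, so on the doubled window no term of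
    the convolution is lost. *)
Lemma trig_cv n (a b : int -> V) z :
  crossC (trig (win n) a z) (trig (win n) b z) = trig (win n.*2) (cv n a b) z.
Proof.
rewrite trig_cross /trig /cv.
transitivity (\sum_(m <- win n) \sum_(l <- win n) \sum_(k <- win n.*2)
    (if k == m + l then val z ^ k *: crossC (a m) (b l) else 0)).
  apply: eq_big_seq => m mn; apply: eq_big_seq => l ln.
  rewrite (sum_if_eqM (fun k => val z ^ k *: crossC (a m) (b l))) ?win_uniq //.
  by move: mn ln; rewrite !mem_win; lia.
under eq_bigr do rewrite exchange_big /=.
rewrite exchange_big /=; apply: eq_bigr => k' _.
rewrite scaler_sumr; apply: eq_bigr => m _; rewrite scaler_sumr; apply: eq_bigr => l _.
by rewrite eq_sym; case: eqP; rewrite ?scaler0.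
Qed.

Lemma cv_supp n (a b : int -> V) (k : int) : (n.*2 < `|k|)%N -> cv n a b k = 0.
Proof.
move=> kn; rewrite /cv big1_seq // => m /andP[_ mn]; rewrite big1_seq // => l /andP[_ ln].
by case: eqP => // mlk; move: mn ln; rewrite !mem_win; lia.
Qed.

Lemma fourierC_trig_cross n (a b : int -> V) k :
  fourierC (fun z => crossC (trig (win n) a z) (trig (win n) b z)) k = cv n a b k.
Proof.
rewrite (fourierC_ext (g := trig (win n.*2) (cv n a b))); last exact: trig_cv.
by rewrite fourierC_trig ?win_uniq // mem_win; case: leqP => // kn; rewrite cv_supp.
Qed.

Lemma fourierC_ser_cross G (a b : int -> V) k :
  (forall n, \sum_(k <- win n) nv (a k) <= G) ->
  (forall n m, (n <= m)%N -> \sum_(k <- win m) nv (a k - tr n a k) <= sn n * G) ->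
  (forall n, \sum_(k <- win n) nv (b k) <= G) ->
  (forall n m, (n <= m)%N -> \sum_(k <- win m) nv (b k - tr n b k) <= sn n * G) ->
  tendsV (fun n => cv n a b k) (fourierC (fun z => crossC (ser a z) (ser b z)) k).
Proof.
move=> aG aT bG bT.
have G0 : 0 <= G by apply: le_trans (aG 0%N); apply: sumr_ge0 => l _; exact: nv_ge0.
pose H := 6 * (sn 0 * G) + G.
exists (fun n => (6 * (6 * G * H + G * (6 * G))) * sn n); first exact: scale_sn_cvg0.
move=> n; rewrite -fourierC_trig_cross -fourierC_sub; last first.
- by apply: cintV_cross; [exact: cintV_trig|move=> j; exact: trig_cont].
- by apply: cintV_cross; [exact: (cintV_ser aT)|move=> j; exact: (ser_cont bT)].
rewrite -mulrA; apply: fourierC_bound.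
- apply: cintV_sub; apply: cintV_cross.
  + exact: (cintV_ser aT).
  + by move=> j; exact: (ser_cont bT).
  + exact: cintV_trig.
  + by move=> j; exact: trig_cont.
- move=> z; set A := ser a z; set B := ser b z; set A' := trig _ a z; set B' := trig _ b z.
  have -> : crossC A B - crossC A' B' = crossC (A - A') B + crossC A' (B - B').
    by rewrite crossCDl crossCNl crossCDr crossCNr addrA subrK.
  have hA : nv (A - A') <= 6 * (sn n * G) by exact: ser_trunc.
  have hB : nv (B - B') <= 6 * (sn n * G) by exact: ser_trunc.
  have hB1 : nv B <= H by exact: nv_ser.
  have hA1 : nv A' <= G by apply: le_trans (nv_trig _ _ _) (aG n).
  rewrite (le_trans (nvD _ _)) // [leRHS](_ : _ = (6 * (sn n * G)) * H + G * (6 * (sn n * G))); last by ring.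
  rewrite lerD // (le_trans (nv_cross _ _)) // ler_pM ?nv_ge0 //.
Qed.

(** This justifies the meaning given to [Gc]: the partial sums of both factors converge uniformly,
    and their products have the coefficients [cv]. *)
Lemma fourier_cross_ag G (c : int -> V) k : (forall n, ln n c <= G) ->
  fourierC (fun z => crossC (ser c z) (ser (ag c) z)) k = Gc c k.
Proof.
move=> cG; apply: (@tendsV_eq _ (fun n => cv n c (ag c) k)); last exact: Gc_tends cG k.
have H1 n : \sum_(k <- win n) nv (c k) <= G by apply: le_trans (nv_sum_le _ _) (cG n).
have H2 n : \sum_(k <- win n) nv (ag c k) <= G.
  by under eq_bigr do rewrite nv_ag; apply: le_trans (az_sum_le _ _) (cG n).
apply: (fourierC_ser_cross (G := G)) => // n m nm.
- by apply: (le_trans (tail_nv _ nm)); rewrite ler_wpM2l ?sn_ge0.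
- by apply: (le_trans (tail_az _ nm)); rewrite ler_wpM2l ?sn_ge0.
Qed.
End CircleFourier.

(** * Uniqueness of Fourier coefficients *)

Section Uniqueness.
Context {R : realType}.
Local Notation C := R[i].
Local Notation mu := (@lebesgue_measure R).
Local Notation D := (`[0%R, (2 * pi)%R]%classic : set R).
Local Notation intC := (integralC D).
Local Notation ek := (@ek R).
Local Notation rint := (@rint R).
Local Notation cint := (@cint R).

Lemma cint_real (h : R -> R) : rint h -> cint (fun x => (h x)%:C).
Proof.
move=> hh; split => //=.
by apply: rint_cont; apply: cont_within => x; exact: cvg_cst.
Qed.

Section Orthogonal.
Variable h : R -> R.
Hypothesis hi : rint h.

(** The product of [h] and [g] is orthogonal to all characters. Multiplying [g] by a trigonometric
    polynomial of degree one only mixes the shifts k - 1, k, k + 1, so the class is stable and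
    contains all polynomials in it. *)
Definition orth (g : R -> R) : Prop :=
  continuous g /\ forall k, intC (fun x => (h x * g x)%:C * ek k x) = 0.

Let cg g k : continuous g -> cint (fun x => (h x * g x)%:C * ek k x).
Proof. by move=> gc; apply: cintM_ek; apply: cint_real; exact: rint_mul. Qed.

Lemma orth_trig (a b c : R) g : orth g ->
  orth (fun x => (a + b * cos x + c * sin x) * g x).
Proof.
move=> [gc og]; split.
  move=> x; apply: cvgM; last exact: gc.
  apply: cvgD; first apply: cvgD; first exact: cvg_cst.
    by apply: cvgMr; exact: continuous_cos.
  by apply: cvgMr; exact: continuous_sin.
move=> k; pose F l x := (h x * g x)%:C * ek l x.
rewrite (intC_ext (g := fun x => a%:C * F k x + ((b / 2 +i* - (c / 2)) * F (k + 1) x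
    + (b / 2 +i* (c / 2)) * F (k - 1) x))).
  rewrite !intC_add ?intC_scale ?og ?mulr0 ?addr0 //; try exact: cg; do ?apply: cint_scale; try exact: cg.
  by apply: cint_add; apply: cint_scale; exact: cg.
move=> x _; rewrite /F !ekD /F -[ek (-1) x]conj_ek [ek 1 x]ekE mul1r ekE.
by apply: complexP; rewrite /= ; field.
Qed.

Lemma orth_sub f g : orth f -> orth g -> orth (fun x => f x - g x).
Proof.
move=> [fc fo] [gc go]; split; first by move=> x; apply: cvgB; [exact: fc|exact: gc].
move=> k; rewrite (intC_ext (g := fun x => (h x * f x)%:C * ek k x + (-1) * ((h x * g x)%:C * ek k x))).
  by rewrite intC_add ?intC_scale ?fo ?go ?mulr0 ?addr0 //; [exact: cg|exact: cg|apply/cint_scale/cg].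
by move=> x _; rewrite mulrBr rmorphB /= mulrBl mulN1r.
Qed.

Hypothesis h0 : forall k, intC (fun x => (h x)%:C * ek k x) = 0.

Lemma orth1 : orth (fun=> 1).
Proof.
split; first by move=> x; exact: cvg_cst.
by move=> k; rewrite -[RHS](h0 k); apply: intC_ext => x _; rewrite mulr1.
Qed.

Lemma orth_poly (a b c : R) (n N : nat) :
  orth (fun x => (1 - (a + b * cos x + c * sin x) ^+ n) ^+ N).
Proof.
have ext f g : (forall x, f x = g x) -> orth f -> orth g by move=> /funext ->.
have E g : orth g -> orth (fun x => (a + b * cos x + c * sin x) ^+ n * g x).
  move=> og; elim: n => [|m IH].
    by apply: (ext _ _ _ og) => x; rewrite expr0 mul1r.
  by apply: (ext _ _ _ (orth_trig a b c IH)) => x; rewrite exprS mulrA.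
elim: N => [|N IH].
  by apply: (ext _ _ _ orth1) => x; rewrite expr0.
apply: (ext _ _ _ (orth_sub IH (E _ IH))) => x.
by rewrite exprS mulrBl mul1r.
Qed.

Lemma orth_int g : orth g -> \int[mu]_(x in D) (h x * g x) = 0.
Proof.
move=> [gc /(_ 0)] /(congr1 (@complex.Re R)) /= H; rewrite -[RHS]H.
by apply: eq_Rintegral => x _; rewrite mulr1 mulr0 subr0.
Qed.
End Orthogonal.

(* Tends boundedly on [0, 1] to the indicator of [0, 1/2), so that trigonometric polynomials approximate
   indicators of arcs. *)
Definition bump (n : nat) (x : R) : R := (1 - x ^+ n) ^+ (2 ^ n).

Lemma bernoulli_lt (y : R) N : -1 <= y -> 1 + N%:R * y <= (1 + y) ^+ N.
Proof.
move=> y1; elim: N => [|N IH]; first by rewrite mul0r addr0 expr0.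
rewrite exprS (le_trans _ (ler_wpM2l _ IH)) //; last lra.
rewrite -natr1; have := sqr_ge0 y; have : 0 <= N%:R :> R by [].
by nra.
Qed.

Lemma bump_bounds n (x : R) : 0 <= x <= 1 -> 0 <= bump n x <= 1.
Proof.
move=> /andP[x0 x1]; have x1n : x ^+ n <= 1 by rewrite exprn_ile1.
have x0n : 0 <= x ^+ n by rewrite exprn_ge0.
have a0 : 0 <= 1 - x ^+ n by rewrite subr_ge0.
by rewrite exprn_ge0 //= exprn_ile1 // lerBlDr lerDl.
Qed.

Lemma geo_cvg (y : R) : `|y| < 1 -> (fun n => y ^+ n) @ \oo --> 0.
Proof. exact: cvg_expr. Qed.

(** By Bernoulli's inequality the distance to 1 is at most 2^n x^n. *)
Lemma bump_cvg1 (x : R) : 0 <= x < 2^-1 -> (fun n => bump n x) @ \oo --> (1 : R).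
Proof.
move=> /andP[x0 x1]; apply: (@dist_cvg _ _ (fun n => (2 * x) ^+ n)).
  by apply: geo_cvg; rewrite ger0_norm ?mulr_ge0 //; lra.
move=> n; have xb : 0 <= x <= 1 by apply/andP; split; lra.
have /andP[b0 b1] := bump_bounds n xb.
rewrite ger0_norm ?subr_ge0 // lerBlDr -lerBlDl.
have x1n : x ^+ n <= 1 by rewrite exprn_ile1 //; lra.
have := @bernoulli_lt (- x ^+ n) (2 ^ n); rewrite lerN2 => /(_ x1n).
by rewrite /bump exprMn mulrN -natrX.
Qed.

(** Since (1 - y)(1 + y) <= 1, [bump n x] is at most the inverse of (1 + x^n)^(2^n), which
    Bernoulli's inequality bounds below by (2x)^n. *)
Lemma bump_cvg0 (x : R) : 2^-1 < x <= 1 -> (fun n => bump n x) @ \oo --> 0.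
Proof.
move=> /andP[x0 x1]; apply: (@dist_cvg _ _ (fun n => (2 * x)^-1 ^+ n)).
  have x2 : 1 < 2 * x by lra.
  by apply: geo_cvg; rewrite ger0_norm ?invr_ge0 ?invf_lt1 //; lra.
move=> n; have xb : 0 <= x <= 1 by apply/andP; split; lra.
have /andP[b0 b1] := bump_bounds n xb.
rewrite sub0r normrN ger0_norm // exprVn.
have y0 : 0 <= x ^+ n by rewrite exprn_ge0 //; lra.
have y1 : x ^+ n <= 1 by rewrite exprn_ile1 //; lra.
have z0 : 0 < (2 * x) ^+ n by rewrite exprn_gt0 //; lra.
have := @bernoulli_lt (x ^+ n) (2 ^ n); rewrite natrX -exprMn => /(_ _) H.
have {}H := H ltac:(lra).
rewrite -div1r ler_pdivlMr //.
apply: (@le_trans _ _ (bump n x * (1 + x ^+ n) ^+ (2 ^ n))).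
  by apply: ler_wpM2l => //; lra.
rewrite /bump -exprMn exprn_ile1 //; nra.
Qed.

Lemma finite_negligible (s : seq R) : mu.-negligible [set` s].
Proof.
have cs : countable [set` s] by apply: finite_set_countable; exact: finite_seq.
apply/negligibleP; last exact: countable_lebesgue_measure0.
by apply: countable_measurable cs => t; exact: measurable_set1.
Qed.

Lemma arc_integral (h : R -> R) (a b : R) : rint h ->
  (forall k, intC (fun x => (h x)%:C * ek k x) = 0) -> 0 <= a -> a < b -> b <= 2 * pi ->
  \int[mu]_(x in D) (h x * \1_(`]a, b[%classic : set R) x) = 0.
Proof.
move=> hi h0 a0 ab b2; have p0 := @pi_gt0 R.
(* A trigonometric polynomial of degree one with values in [0, 1]. Inside ]0, 2
   pi[ the product of sines is positive on ]a, b[ and negative outside [a, b], so X lies below 1/2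
   on the arc and above 1/2 off it. *)
pose X x : R := 2^-1 - 2^-1 * (sin ((x - a) / 2) * sin ((b - x) / 2)).
pose m := (a + b) / 2; pose d := (b - a) / 2.
have XE x : X x = (2^-1 + cos d / 4) + (- cos m / 4) * cos x + (- sin m / 4) * sin x.
  have -> : cos d = cos ((x - a) / 2 + (b - x) / 2) by congr cos; rewrite /d; field.
  have e1 : cos x * cos m + sin x * sin m = cos ((x - a) / 2 - (b - x) / 2).
    rewrite -[sin m]opprK mulrN -sinN -[cos m]cosN -cosD; congr cos; by rewrite /m; field.
  by rewrite cosB in e1; rewrite /X cosD; lra.
have X01 x : 0 <= X x <= 1.
  have := sin_max ((x - a) / 2); have := sin_max ((b - x) / 2); rewrite /X.
  set u := sin _; set v := sin _; rewrite !ler_norml => /andP[? ?] /andP[? ?].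
  by apply/andP; split; nra.
pose f n x := (h x * bump n (X x)).
have f0 n : \int[mu]_(x in D) f n x = 0.
  apply: (orth_int (h := h)).
  by have := orth_poly hi h0 (2^-1 + cos d / 4) (- cos m / 4) (- sin m / 4) n (2 ^ n); rewrite /bump; under [X in _ -> orth _ X]eq_fun do rewrite XE.
have bc n : continuous (fun x => bump n (X x)).
  have := orth_poly hi h0 (2^-1 + cos d / 4) (- cos m / 4) (- sin m / 4) n (2 ^ n).
  by case=> + _; rewrite /bump; under [X in _ -> continuous X]eq_fun do rewrite XE.
have ri n : rint (f n) by exact: rint_mul.
have lim1 : (fun n => (\int[mu]_(x in D) (EFin \o f n) x)%E) @ \oo -->
    (\int[mu]_(x in D) (h x * \1_(`]a, b[%classic : set R) x)%:E)%E.
  pose g : measurableTypeR R -> \bar R := fun x => (`|h x|)%:E.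
  pose F n : measurableTypeR R -> \bar R := EFin \o f n.
  pose F' : measurableTypeR R -> \bar R := fun x => (h x * \1_(`]a, b[%classic : set R) x)%:E.
  have [|||||_ _] // := @dominated_convergence _ (measurableTypeR R) R mu D mD F F' g.
  - by move=> n; case/integrableP: (ri n).
  - apply/measurable_EFinP; apply: measurable_funM.
      by case/integrableP: hi => /measurable_EFinP.
    exact: measurable_indic.
  - apply: (negligibleS _ (finite_negligible [:: 0; a; b; 2 * pi])) => x /= nc.
    apply: contrapT => xn; apply: nc => Dx.
      have [xa xb x0 x2] : [/\ x != a, x != b, x != 0 & x != 2 * pi].
        by move/negP: xn; rewrite !inE !negb_or => /and4P[-> -> -> ->].
      have {Dx} [Dx1 Dx2] : 0 < x /\ x < 2 * pi.
        by move: Dx; rewrite /= in_itv /= => /andP[? ?]; rewrite !lt_neqAle eq_sym x0 x2.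
      apply: cvg_EFin; first by apply: nearW.
      rewrite /comp /= /f; apply: cvgMr.
      have hs (u : R) : 0 < u -> u < 2 * pi -> 0 < sin (u / 2).
        by move=> u0 u2; apply: sin_gt0_pi; apply/andP; split; lra.
      have hs' (u : R) : u < 0 -> - (2 * pi) < u -> sin (u / 2) < 0.
        by move=> u0 u2; have := hs (- u); rewrite mulNr sinN => H; have := H ltac:(lra) ltac:(lra); lra.
      have /andP[X0 X1] := X01 x.
      rewrite indicE; case: (boolP (x \in _)) => xab.
      + move: xab; rewrite inE /= in_itv /= => /andP[ax bx].
        apply: bump_cvg1; rewrite X0 /= /X.
        have := hs (x - a) ltac:(lra) ltac:(lra); have := hs (b - x) ltac:(lra) ltac:(lra); nra.
      + have {}xab : x < a \/ b < x.
          case: (ltP x a) => [|ax]; [by left|right].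
          case: (ltP b x) => // bx; move: xab; rewrite notin_setE /= in_itv /= !lt_neqAle.
          by rewrite ax bx xb eq_sym xa.
        apply: bump_cvg0; rewrite X1 andbT /X; case: xab => xab.
        * have := hs' (x - a) ltac:(lra) ltac:(lra); have := hs (b - x) ltac:(lra) ltac:(lra); nra.
        * have := hs (x - a) ltac:(lra) ltac:(lra); have := hs' (b - x) ltac:(lra) ltac:(lra); nra.
  - exact: integrable_abse hi.
  - apply: aeW => x n _ /=; rewrite lee_fin normrM.
    have /andP[? ?] := bump_bounds n (X01 x).
    by rewrite [X in _ * X]ger0_norm // ler_piMr.
rewrite /Rintegral.
have {}lim0 : (fun n => (\int[mu]_(x in D) (EFin \o f n) x)%E) @ \oo --> 0%E.
  apply: cvg_near_cst; apply: nearW => n.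
  have := f0 n; rewrite /Rintegral => fn0; rewrite -[LHS]fineK; first by rewrite fn0.
  exact: integrable_fin_num (ri n).
by rewrite (cvg_unique _ lim1 lim0).
Qed.

(** All integrals over [0, b] vanish, and Lebesgue differentiation recovers [h] from them almost
    everywhere. *)
Lemma zero_ae (h : R -> R) : rint h ->
  (forall k, intC (fun x => (h x)%:C * ek k x) = 0) ->
  mu.-negligible [set x | D x /\ h x != 0].
Proof.
move=> hi h0; pose f := h \_ D; have mT : measurable ([set: R] : set (measurableTypeR R)) by [].
have fi : mu.-integrable [set: R] (EFin \o f).
  by move/(integrable_mkcond _ mD): hi; rewrite restrict_EFin.
have fiS (A : set (measurableTypeR R)) : measurable A -> mu.-integrable A (EFin \o f).
  by move=> mA; apply: (integrableS mT) fi.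
have F0 (b : R) : 0 < b < 2 * pi -> \int[mu]_(x in `[0, b]) f x = 0.
  move=> /andP[b0 b2]; rewrite -Rintegral_itv_bndo_bndc ?fiS // -Rintegral_itv_obnd_cbnd ?fiS //.
  apply: (etrans _ (arc_integral hi h0 (lexx 0) b0 (ltW b2))).
  rewrite Rintegral_mkcond [RHS]Rintegral_mkcond; apply: eq_Rintegral => x _.
  rewrite /f !patchE indicE; case: (boolP (x \in (`]0, b[%classic : set R))) => xb.
    have -> // : x \in D.
      by move: xb; rewrite !inE /= !in_itv /= => /andP[? ?]; rewrite ltW // (le_trans _ (ltW b2)) // ltW.
    by rewrite [RHS]mulr1.
  by case: ifP => // _; rewrite [RHS]mulr0.
have lf : locally_integrable [set: R] f by apply: open_integrable_locally => //; exact: openT.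
have H := @FTC1 R f (BLeft 0) (fun y => fiS _ (measurable_itv _)) lf.
apply: negligibleS (negligibleU H (finite_negligible [:: 0; 2 * pi])) => x /= [Dx hx].
have := Dx; rewrite /= in_itv /= => /andP[x0 x2].
have [xe|xne] := boolP (x \in [:: 0; 2 * pi]); [by right|left].
move: xne; rewrite !inE negb_or => /andP[n0 n2].
have {}x0 : 0 < x by rewrite lt_neqAle eq_sym n0.
have {}x2 : x < 2 * pi by rewrite lt_neqAle n2.
move=> /(_ _) [|_]; first by rewrite lte_fin.
have -> : f x = h x by rewrite /f patchE mem_set.
rewrite derive1E; have -> : 'D_1 (fun x : R => \int[mu]_(t in `[0, x]) f t) x = 'D_1 (fun _ : R => 0 : R) x.
  apply: near_eq_derive; near=> y; apply: F0; apply/andP; split; near: y.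
    exact: lt_nbhsr.
  exact: lt_nbhsl.
by rewrite derive_cst => /esym/eqP; apply/negP.
Unshelve. all: by end_near. Qed.

(** The pushforward under a translation agrees with Lebesgue measure on half-open intervals, hence
    is equal to it. *)
Lemma translate_measure0 (a : R) (A : set (measurableTypeR R)) : measurable A -> mu A = 0%E ->
  mu [set x : R | A (x - a)] = 0%E.
Proof.
move=> mA A0.
have mf : measurable_fun [set: measurableTypeR R] (fun x : R => x - a : measurableTypeR R).
  by apply: measurable_funB => //; exact: measurable_id.
rewrite -A0 [RHS](@lebesgue_measure_unique R
  (measure_function_pushforward__canonical__measure_function_Measure mu mf)) //.
move=> _ /ocitvP[->|[[u v] /= uv ->]]; first by rewrite !measure0.
rewrite /= /pushforward.
have -> : (fun x : R => x - a : measurableTypeR R) @^-1` `]u, v] = `]u + a, v + a]%classic.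
  by apply/seteqP; split => x /=; rewrite !in_itv /= ltrBrDr lerBlDr.
rewrite (lebesgue_measure_itv `]u, v]) [RHS](lebesgue_measure_itv `]u + a, v + a]) /= !lte_fin.
by rewrite ltrD2r uv -!EFinB; congr EFin; ring.
Qed.

(** Countably many translates of the null set in one period cover the exceptional set on the
    line. *)
Lemma negligible_periodic (P : circle R -> Prop) :
  mu.-negligible [set x | D x /\ ~ P (expi x)] -> {ae mu, forall x : R, P (expi x)}.
Proof.
move=> [B [mB B0 sB]].
pose F (m : int) := [set x : R | B (x - m%:~R * (2 * pi))].
have FN m : mu.-negligible (F m).
  exists (F m); split => //; last exact: translate_measure0.
  have mf : measurable_fun [set: measurableTypeR R] (fun x : R => x - m%:~R * (2 * pi) : measurableTypeR R).
    by apply: measurable_funB => //; exact: measurable_id.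
  by have := mf measurableT B mB; rewrite setTI.
have H := @negligible_bigcup _ _ _ mu (fun n : nat => F n%:Z `|` F (- n%:Z)) (fun n => negligibleU (FN _) (FN _)).
apply: negligibleS H => x /= nP.
pose m := Num.floor (x / (2 * pi)).
have p0 := @twopi_gt0 R.
have Bx : F m x.
  apply: sB; split; last by rewrite -mulNr -mulrNz expi_periodic.
  rewrite /= in_itv /=; apply/andP; split.
    by rewrite subr_ge0 -ler_pdivlMr // Num.Theory.floor_le.
  by rewrite lerBlDl -[X in _ + X]mul1r -mulrDl -ler_pdivrMr // -[1]/(1%:~R) -intrD ltW // Num.Theory.floorD1_gt.
exists `|m|%N => //; case: (lerP 0 m) => m0; [left|right].
  by rewrite gez0_abs.
by rewrite ltz0_abs // opprK.
Qed.

Lemma negligible_nonneg_measure (a b : R) : a < b -> ~ mu.-negligible (`]a, b[%classic : set R).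
Proof.
move=> ab /negligibleP H; have := H (measurable_itv _).
rewrite [X in X = _ -> _](lebesgue_measure_itv `]a, b[) /= lte_fin ab -EFinB => -[] /eqP.
by rewrite subr_eq0 gt_eqF.
Qed.

Lemma continuous_ae_eq (f g : R -> R) : continuous f -> continuous g ->
  {ae mu, forall x : R, f x = g x} -> forall x, f x = g x.
Proof.
move=> fc gc fg x; apply/eqP/negPn/negP => fgx.
have e0 : 0 < `|f x - g x| / 2 by rewrite divr_gt0 // normr_gt0 subr_eq0.
have fgc : (fun y => f y - g y) @ x --> f x - g x by apply: cvgB; [exact: fc|exact: gc].
have /cvgrPdist_lt/(_ _ e0) := fgc.
case=> r /= r0 Hr; apply: (@negligible_nonneg_measure (x - r) (x + r)); first lra.
apply: negligibleS fg => y /=; rewrite in_itv /= => /andP[y1 y2] fgy.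
have /Hr : `|x - y| < r by rewrite ltr_norml; apply/andP; split; lra.
rewrite fgy subrr subr0; lra.
Qed.

Definition rintV (f : circle R -> 'rV[R]_3) : Prop := forall j, rint (fun x => f (expi x) 0 j).

Lemma in_L2_rintV f : in_L2 f -> rintV f.
Proof.
move=> hf j; have [mf lf] := hf j.
have mfD : measurable_fun (D : set (measurableTypeR R)) (fun x => f (expi x) 0 j).
  by apply: measurable_funS mf.
have i2 : rint (fun x => f (expi x) 0 j ^+ 2).
  apply/integrableP; split; first by apply/measurable_EFinP; apply: measurable_funX.
  apply: le_lt_trans lf; apply: ge0_le_integral => //; try exact: mD.
  - by apply: measurableT_comp => //; apply/measurable_EFinP; apply: measurable_funX.
  - by apply/measurable_EFinP; apply: measurable_funX.
  - by move=> x _ /=; rewrite ger0_norm ?sqr_ge0.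
have i1 : rint (fun=> 1) by apply: rint_cont; apply: cont_within => x; exact: cvg_cst.
apply: (le_integrable mD _ _ (rint_add i1 i2)); first exact/measurable_EFinP.
move=> x _ /=; rewrite lee_fin [leRHS]ger0_norm ?addr_ge0 ?sqr_ge0 //.
set u := f _ _ _; rewrite ler_norml; apply/andP; split; nra.
Qed.

Lemma cintV_toC f : rintV f -> cintV (fun z => toC (f z)).
Proof.
move=> hf j; apply: (cint_ext (f := fun x => (f (expi x) 0 j)%:C)) (cint_real (hf j)) => x _.
by rewrite mxE.
Qed.

Lemma fourier_ae f g : rintV f -> rintV g -> (forall k, fourier f k = fourier g k) ->
  {ae mu, forall x : R, f (expi x) = g (expi x)}.
Proof.
move=> hf hg fg; apply: (@negligible_periodic (fun z => f z = g z)).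
have H j : mu.-negligible [set x | D x /\ f (expi x) 0 j - g (expi x) 0 j != 0].
  apply: zero_ae.
    by apply: rint_ext (rint_add (hf j) (rint_scale (-1) (hg j))) => x _; rewrite mulN1r.
  move=> k; have := fg (- k) => /(congr1 (fun u : 'rV_3 => u 0 j)) /=.
  rewrite !fourierCE opprK => /mulfI e.
  have p0 : ((2 * pi)^-1)%:C != 0 :> R[i].
    by rewrite fmorph_eq0 invr_eq0 gt_eqF // twopi_gt0.
  have {}e := e p0.
  rewrite (intC_ext (g := fun x => toC (f (expi x)) 0 j * ek k x + (-1) * (toC (g (expi x)) 0 j * ek k x))).
    rewrite intC_add ?intC_scale ?e; last first.
    - by apply: cint_scale; apply: cintM_ek; exact: cintV_toC.
    - by apply: cintM_ek; exact: cintV_toC.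
    - by apply: cintM_ek; exact: cintV_toC.
    by rewrite mulN1r subrr.
  by move=> x _; rewrite !mxE rmorphB /= mulrBl mulN1r.
apply: negligibleS (negligibleU (H 0) (negligibleU (H 1) (H 2))) => x /= [Dx nfg].
apply: contrapT => nP; apply: nfg; apply: rowP3; apply/eqP; rewrite -subr_eq0;
  apply/negPn/negP => h; apply: nP; [left|right; left|right; right] => //.
Qed.

Definition contV (f : circle R -> 'rV[R]_3) : Prop :=
  forall j, continuous (fun x : R => f (expi x) 0 j).

Lemma contV_rintV f : contV f -> rintV f.
Proof. by move=> fc j; apply: rint_cont; apply: cont_within; exact: fc. Qed.

Lemma fourier_inj f g : contV f -> contV g -> (forall k, fourier f k = fourier g k) ->
  forall z, f z = g z.
Proof.
move=> fc gc fg z; have H := fourier_ae (contV_rintV fc) (contV_rintV gc) fg.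
have [x _ <-] := expi_surj z; apply/rowP => j.
apply: (continuous_ae_eq (fc j) (gc j)); by apply: negligibleS H => y /= n e; apply: n; rewrite e.
Qed.

Lemma contVP f : contV f <-> continuous (fun x : R => f (expi x)).
Proof.
split=> fc; last first.
  move=> j x; apply: (@continuous_comp _ _ _ (fun x : R => f (expi x)) (fun u : 'rV[R]_3 => u 0 j)).
    exact: fc.
  exact: coord_continuous.
have -> : (fun x : R => f (expi x)) = (fun x : R => f (expi x) 0 0 *: delta_mx 0 0 +
    f (expi x) 0 1 *: delta_mx 0 1 + f (expi x) 0 2 *: delta_mx 0 2).
  by apply/funext => x; rewrite {1}[f (expi x)]row_sum_delta sum3.
move=> x; apply: cvgD; first apply: cvgD; apply: cvgZr_tmp; exact: fc.
Qed.
End Uniqueness.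

(** * Sobolev norms *)

Section Sobolev.
Context {R : realType}.
Local Notation C := R[i].
Local Notation V := 'rV[R[i]]_3.
Local Notation az := (@az R).
Implicit Types (s : R) (c : int -> V).

Definition wt s (k : int) : R := (1 + k%:~R ^+ 2) `^ s.

Lemma wt_ge0 s k : 0 <= wt s k. Proof. exact: powR_ge0. Qed.

Let az2 (k : int) : (k%:~R : R) ^+ 2 = az k ^+ 2.
Proof. by rewrite az_norm real_normK // num_real. Qed.

(** Half-integer powers are compared through their squares, which are polynomials in |k|. *)
Lemma wt_sqr (m : nat) k : wt (m%:R / 2) k ^+ 2 = (1 + az k ^+ 2) ^+ m.
Proof.
have h0 : 0 <= 1 + az k ^+ 2 by rewrite addr_ge0 ?sqr_ge0.
rewrite /wt az2 -powR_mulrn ?powR_ge0 // -powRrM mulrVK ?unitfE ?pnatr_eq0 //.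
by rewrite powR_mulrn.
Qed.

Let le_sqr (x y : R) : 0 <= y -> x ^+ 2 <= y ^+ 2 -> x <= y.
Proof. by move=> y0 h; apply: (le_trans (ler_norm _)); rewrite -[y]ger0_norm // -ler_sqr ?nnegrE // !real_normK ?num_real. Qed.

Lemma az5_wt k : 1 + az k ^+ 5 <= 2 * wt (5 / 2) k.
Proof.
have a0 := az_ge0 k; have w0 := wt_ge0 (5 / 2) k.
have w5 : wt (5 / 2) k ^+ 2 = (1 + az k ^+ 2) ^+ 5 by rewrite (wt_sqr 5).
have a1 : az k ^+ 5 <= wt (5 / 2) k.
  apply: le_sqr => //; rewrite w5 -exprM mulnC exprM lerXn2r ?nnegrE ?addr_ge0 ?sqr_ge0 //.
  by rewrite lerDr.
have b1 : 1 <= wt (5 / 2) k.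
  apply: le_sqr => //; rewrite w5 expr1n exprn_ege1 // lerDl sqr_ge0 //.
lra.
Qed.

(** For nonzero k one has 1 + k^2 <= 2 k^2, and [a] is any upper bound of 2^{m/2}; at k = 0 the
    weight is 1. *)
Lemma wt_az m (a : R) k : 0 <= a -> 2 ^+ m <= a ^+ 2 -> wt (m%:R / 2) k <= 1 + a * az k ^+ m.
Proof.
move=> a0 am; have z0 := az_ge0 k.
have [->|k0] := eqVneq k 0.
  rewrite /wt expr0n addr0 powR1 lerDl mulr_ge0 // exprn_ge0 //.
have z1 : 1 <= az k by exact: az_ge1.
apply: (@le_trans _ _ (a * az k ^+ m)); last by rewrite lerDr.
apply: le_sqr; first by rewrite mulr_ge0 ?exprn_ge0.
rewrite wt_sqr exprMn -exprM mulnC exprM.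
apply: (@le_trans _ _ ((2 * az k ^+ 2) ^+ m)); last first.
  by rewrite exprMn ler_wpM2r // exprn_ge0 // sqr_ge0.
rewrite lerXn2r ?nnegrE ?addr_ge0 ?sqr_ge0 ?mulr_ge0 //; nra.
Qed.

Lemma wt1_ge1 k : 1 <= wt 2^-1 k /\ wt 2^-1 k <= 1 + 2 * az k.
Proof.
rewrite -[2^-1]div1r; split; last first.
  by have := @wt_az 1 2 k; rewrite expr1; apply; lra.
apply: le_sqr; first exact: wt_ge0.
by rewrite (wt_sqr 1) expr1n expr1 lerDl sqr_ge0.
Qed.

Lemma sum_sub_uniq (I : eqType) (r r' : seq I) (F : I -> R) : uniq r -> uniq r' ->
  {subset r <= r'} -> (forall k, 0 <= F k) -> \sum_(k <- r) F k <= \sum_(k <- r') F k.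
Proof.
move=> ur ur' sr F0; rewrite [leRHS](bigID (fun k => k \in r)) /=.
have -> : \sum_(i <- r' | i \in r) F i = \sum_(i <- r) F i; last by rewrite lerDl sumr_ge0.
rewrite -big_filter; apply: perm_big; apply: uniq_perm => //; first exact: filter_uniq.
by move=> k; rewrite mem_filter; case: (boolP (k \in r)) => // /sr ->.
Qed.

(** Every finite set of integers lies in a window, so bounds on windows control the unordered sum
    that defines the norm. *)
Lemma Hnorm_le s c (M : R) : 0 <= M ->
  (forall n, \sum_(k <- win n) wt s k * sqv (c k) <= M ^+ 2) -> (Hnorm s c <= M%:E)%E.
Proof.
move=> M0 h; rewrite /Hnorm.
have -> : M%:E = ((M ^+ 2)%:E `^ 2^-1)%E.
  by rewrite poweR_EFin powR12_sqrt ?sqr_ge0 // sqrtr_sqr ger0_norm.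
have t0 k : (0 <= ((1 + (k%:~R : R) ^+ 2) `^ s * \sum_(j < 3) Normc.normc (c k 0 j) ^+ 2)%:E)%E.
  by rewrite lee_fin mulr_ge0 ?powR_ge0 // sqv_ge0.
apply: gt0_ler_poweR => //.
- by rewrite in_itv /= leey andbT; apply: esum_ge0 => k _.
- by rewrite in_itv /= leey andbT lee_fin sqr_ge0.
apply: ub_ereal_sup => _ [A [fA _] <-].
rewrite fsbig_finite //= sumEFin lee_fin.
set r := finmap.enum_fset _.
pose n := \max_(k <- r) `|k|%N.
apply: le_trans (h n).
have rn k : k \in r -> k \in win n by move=> kr; rewrite mem_win; exact: leq_bigmax_seq.
have ur : uniq r by exact: finmap.fset_uniq.
apply: sum_sub_uniq ur (win_uniq n) rn (fun k => mulr_ge0 (wt_ge0 s k) (sqv_ge0 (c k))).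
Qed.

Lemma le_Hnorm s c (M : R) n : (Hnorm s c <= M%:E)%E ->
  \sum_(k <- win n) wt s k * sqv (c k) <= M ^+ 2.
Proof.
move=> h; have M0 : 0 <= M by rewrite -lee_fin; apply: le_trans h; exact: poweR_ge0.
rewrite -lee_fin.
have t0 k : (0 <= ((1 + (k%:~R : R) ^+ 2) `^ s * \sum_(j < 3) Normc.normc (c k 0 j) ^+ 2)%:E)%E.
  by rewrite lee_fin mulr_ge0 ?powR_ge0 // sqv_ge0.
set E := \esum_(k in [set: int]) ((1 + (k%:~R : R) ^+ 2) `^ s * \sum_(j < 3) Normc.normc (c k 0 j) ^+ 2)%:E.
have E0 : (0 <= E)%E by apply: esum_ge0 => k _.
apply: (@le_trans _ _ E).
  apply: esum_ge; exists [set` win n]; first by split; [exact: finite_seq|].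
  by rewrite -fsbig_seq ?win_uniq // sumEFin.
have -> : E = ((E `^ 2^-1) `^ 2)%E by rewrite -poweRrM mulVf // poweRe1.
have -> : (M ^+ 2)%:E = (M%:E `^ 2)%E by rewrite poweR_EFin powR_mulrn.
by apply: gt0_ler_poweR => //; rewrite in_itv /= leey andbT ?poweR_ge0 // lee_fin.
Qed.

Lemma le_Hnorm_fine s c n : (Hnorm s c < +oo)%E ->
  \sum_(k <- win n) wt s k * sqv (c k) <= fine (Hnorm s c) ^+ 2.
Proof.
move=> h; apply: le_Hnorm; rewrite fineK // ge0_fin_numE //; exact: poweR_ge0.
Qed.

Lemma Hnorm_ge0 s c : (0 <= Hnorm s c)%E. Proof. exact: poweR_ge0. Qed.

Lemma Hnorm_cvg0 (T : Type) (F : set_system T) s (c : T -> int -> V) : Filter F ->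
  Hnorm s (c x) @[x --> F] --> (0 : \bar R)%E <->
  forall e : R, 0 < e -> \forall x \near F, (Hnorm s (c x) <= e%:E)%E.
Proof.
move=> FF; split.
  move=> /fine_cvgP [fin /cvgrPdist_le h] e e0.
  have := h e e0; apply: filterS2 fin => x xf /=.
  rewrite sub0r normrN ger0_norm ?fine_ge0 ?Hnorm_ge0 // => he.
  by rewrite -[Hnorm _ _]fineK // lee_fin.
move=> h; apply/fine_cvgP; split.
  apply: filterS (h 1 ltr01) => x hx; rewrite ge0_fin_numE ?Hnorm_ge0 //.
  exact: le_lt_trans hx (ltry _).
apply/cvgrPdist_le => e e0; apply: filterS (h e e0) => x hx /=.
rewrite sub0r normrN ger0_norm ?fine_ge0 ?Hnorm_ge0 // -lee_fin fineK //.
by rewrite ge0_fin_numE ?Hnorm_ge0 //; exact: le_lt_trans hx (ltry _).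
Qed.

Lemma yn_Hnorm n c : (Hnorm (5 / 2) c < +oo)%E -> yn n c <= 2 * fine (Hnorm (5 / 2) c) ^+ 2.
Proof.
move=> h; apply: (le_trans _ (ler_wpM2l _ (le_Hnorm_fine n h))) => //.
rewrite mulr_sumr; apply: ler_sum => k _.
by rewrite mulrA ler_wpM2r ?sqv_ge0 ?az5_wt.
Qed.

Lemma wt5_le k : wt (5 / 2) k <= 6 * (1 + az k ^+ 5).
Proof.
have h : wt (5%:R / 2) k <= 1 + 6 * az k ^+ 5 by apply: wt_az => //; lra.
have : 0 <= az k ^+ 5 by rewrite exprn_ge0 // az_ge0.
by move: h; lra.
Qed.

Lemma Hnorm_yn c (Y : R) : 0 <= Y -> (forall n, yn n c <= Y) ->
  (Hnorm (5 / 2) c <= (Num.sqrt (6 * Y))%:E)%E.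
Proof.
move=> Y0 h; apply: Hnorm_le; first exact: sqrtr_ge0.
move=> n; rewrite sqr_sqrtr ?mulr_ge0 //.
apply: (le_trans _ (ler_wpM2l _ (h n))) => //.
rewrite mulr_sumr; apply: ler_sum => k _.
by rewrite mulrA ler_wpM2r ?sqv_ge0 ?wt5_le.
Qed.
End Sobolev.

(** * Continuity in time with values in H^{5/2} *)

Section Convolution.
Context {R : realType}.
Local Notation C := R[i].
Local Notation V := 'rV[R[i]]_3.
Local Notation az := (@az R).
Implicit Types (a b c : int -> V).

Lemma cauchy_schwarz_weighted (I : Type) (r : seq I) (w x : I -> R) : (forall i, 0 <= w i) ->
  (\sum_(i <- r) w i * x i) ^+ 2 <= (\sum_(i <- r) w i) * \sum_(i <- r) w i * x i ^+ 2.
Proof.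
move=> w0; elim: r => [|i r IH]; first by rewrite !big_nil expr0n mul0r.
rewrite !big_cons; move: IH.
have A0 : 0 <= \sum_(j <- r) w j by apply: sumr_ge0 => j _.
have B0 : 0 <= \sum_(j <- r) w j * x j ^+ 2 by apply: sumr_ge0 => j _; rewrite mulr_ge0 ?sqr_ge0.
set A := \sum_(j <- r) w j in A0 *; set B := \sum_(j <- r) w j * x j ^+ 2 in B0 *.
set S := \sum_(j <- r) w j * x j => IH.
have wi := w0 i.
(* w_i (A x_i^2 - 2 x_i S + B) >= 0, since A times the bracket is at least (A x_i - S)^2 *)
suff : 0 <= A * x i ^+ 2 - 2 * x i * S + B by move=> h; have := mulr_ge0 wi h; lra.
have [A1|] := ltP 0 A; last first.
  move=> A1; have AE : A = 0 by apply/eqP; rewrite eq_le A1.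
  move: IH; rewrite AE !mul0r => S0.
  have -> : S = 0 by apply/eqP; rewrite -sqrf_eq0 eq_le S0 sqr_ge0.
  by rewrite mulr0 subr0 add0r.
rewrite -(pmulr_rge0 _ A1); have := sqr_ge0 (A * x i - S); lra.
Qed.

(** Young's inequality for the convolution of l^2 with l^1: Cauchy-Schwarz over the pairs with m + l
    = k, weighted by the l^1 factor. *)
Lemma young n (r : seq int) (x y : int -> R) : uniq r -> (forall k, 0 <= y k) ->
  \sum_(k <- r) (\sum_(m <- win n) \sum_(l <- win n) (if m + l == k then x m * y l else 0)) ^+ 2 <=
  (\sum_(m <- win n) x m ^+ 2) * (\sum_(l <- win n) y l) ^+ 2.
Proof.
move=> ur y0.
pose P := allpairs pair (win n) (win n).
have dbl (F : int -> int -> R) : \sum_(m <- win n) \sum_(l <- win n) F m l =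
    \sum_(p <- P) F p.1 p.2 by rewrite big_allpairs_dep.
pose w k (p : int * int) := if p.1 + p.2 == k then y p.2 else 0.
have w0 k p : 0 <= w k p by rewrite /w; case: ifP.
set Y := \sum_(l <- win n) y l.
have Y0 : 0 <= Y by apply: sumr_ge0.
have wY k : \sum_(p <- P) w k p <= Y.
  rewrite -(dbl (fun m l => w k (m, l))) /w /= exchange_big /=; apply: ler_sum => l _.
  apply: le_trans (sum_if_eq (k - l) (win_uniq n) (y0 l)).
  apply: ler_sum => m _; by have -> : (m + l == k) = (m == k - l) by rewrite [RHS]eq_sym subr_eq eq_sym.
apply: (@le_trans _ _ (\sum_(k <- r) Y * \sum_(p <- P) w k p * x p.1 ^+ 2)).
  apply: ler_sum => k _; rewrite dbl.
  have -> : \sum_(p <- P) (if p.1 + p.2 == k then x p.1 * y p.2 else 0) = \sum_(p <- P) w k p * x p.1.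
    by apply: eq_bigr => p _; rewrite /w; case: ifP; rewrite ?mul0r // mulrC.
  apply: le_trans (cauchy_schwarz_weighted _ _ (w0 k)) _.
  by apply: ler_wpM2r => //; apply: sumr_ge0 => p _; rewrite mulr_ge0 ?sqr_ge0.
rewrite -mulr_sumr exchange_big /= expr2 mulrA [leRHS]mulrC ler_wpM2l //.
rewrite mulr_suml -(dbl (fun m l => \sum_(k <- r) w k (m, l) * x m ^+ 2)).
apply: ler_sum => m _; rewrite mulr_sumr; apply: ler_sum => l _.
rewrite -mulr_suml mulrC ler_wpM2l ?sqr_ge0 // /w /=.
apply: le_trans (sum_if_eq (m + l) ur (y0 l)).
by apply: ler_sum => k _; rewrite eq_sym.
Qed.

Let q (k : int) : R := Num.sqrt (1 + az k) ^+ 3.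

Let q_ge0 k : 0 <= q k. Proof. by rewrite exprn_ge0 ?sqrtr_ge0. Qed.

Let q_sqr k : q k ^+ 2 = (1 + az k) ^+ 3.
Proof. by rewrite -exprM mulnC exprM sqr_sqrtr // addr_ge0 ?az_ge0. Qed.

Let q_add m l : q (m + l) <= 4 * (q m + q l).
Proof.
have s0 k : 0 <= Num.sqrt (1 + az k) by exact: sqrtr_ge0.
have s2 k : Num.sqrt (1 + az k) ^+ 2 = 1 + az k by rewrite sqr_sqrtr // addr_ge0 ?az_ge0.
have h : Num.sqrt (1 + az (m + l)) <= Num.sqrt (1 + az m) + Num.sqrt (1 + az l).
  rewrite -ler_sqr ?nnegrE ?addr_ge0 // s2 sqrrD !s2.
  have := azD m l (R := R); have := mulr_ge0 (s0 m) (s0 l); lra.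
rewrite /q; move: h; have := s0 m; have := s0 l; have := s0 (m + l).
set x := Num.sqrt _; set y := Num.sqrt _; set z := Num.sqrt _ => x0 z0 y0 h.
apply: (@le_trans _ _ ((z + y) ^+ 3)); first by rewrite lerXn2r // nnegrE addr_ge0.
have : 0 <= (y + z) * (y - z) ^+ 2 by rewrite mulr_ge0 ?addr_ge0 ?sqr_ge0.
lra.
Qed.

(** The weight [q] is subadditive up to a constant, so it falls entirely on one factor while the
    other is measured in l^1. *)
Lemma conv_H n (r : seq int) a b : uniq r ->
  \sum_(k <- r) (1 + az k) ^+ 3 * sqv (cv n a b k) <=
  32 * ((\sum_(k <- win n) (1 + az k) ^+ 3 * nv (a k) ^+ 2) * (\sum_(k <- win n) nv (b k)) ^+ 2 +
        (\sum_(k <- win n) (1 + az k) ^+ 3 * nv (b k) ^+ 2) * (\sum_(k <- win n) nv (a k)) ^+ 2).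
Proof.
move=> ur; have n0 c k : 0 <= nv (c k) by exact: nv_ge0.
pose X k := \sum_(m <- win n) \sum_(l <- win n) (if m + l == k then (q m * nv (a m)) * nv (b l) else 0).
pose Z k := \sum_(m <- win n) \sum_(l <- win n) (if m + l == k then (q m * nv (b m)) * nv (a l) else 0).
have X0 k : 0 <= X k.
  by apply: sumr_ge0 => m _; apply: sumr_ge0 => l _; case: ifP => // _; rewrite !mulr_ge0.
have Z0 k : 0 <= Z k.
  by apply: sumr_ge0 => m _; apply: sumr_ge0 => l _; case: ifP => // _; rewrite !mulr_ge0.
have H k : (1 + az k) ^+ 3 * sqv (cv n a b k) <= 32 * (X k ^+ 2 + Z k ^+ 2).
  have h : q k * nv (cv n a b k) <= 4 * (X k + Z k).
    apply: (@le_trans _ _ (\sum_(m <- win n) \sum_(l <- win n)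
      (if m + l == k then 4 * (q m * nv (a m) * nv (b l) + q l * nv (b l) * nv (a m)) else 0))).
      apply: (le_trans (ler_wpM2l (q_ge0 k) (nv_sum _ _ _))); rewrite mulr_sumr; apply: ler_sum => m _.
      apply: (le_trans (ler_wpM2l (q_ge0 k) (nv_sum _ _ _))); rewrite mulr_sumr; apply: ler_sum => l _.
      case: eqP => [<-|_]; last by rewrite nv0 mulr0.
      apply: (le_trans (ler_wpM2l (q_ge0 _) (nv_cross _ _))).
      have := q_add m l; have := mulr_ge0 (n0 a m) (n0 b l); nra.
    rewrite /X /Z [X in 4 * (_ + X)]exchange_big /= mulrDr !mulr_sumr -big_split /= .
    apply: ler_sum => m _; rewrite !mulr_sumr -big_split /=; apply: ler_sum => l _.
    by rewrite [l + m]addrC; case: eqP; rewrite ?mulr0 ?addr0 // mulrDr.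
  have h2 : (q k * nv (cv n a b k)) ^+ 2 <= (4 * (X k + Z k)) ^+ 2.
    by rewrite lerXn2r ?nnegrE ?mulr_ge0 ?nv_ge0 ?addr_ge0 //.
  rewrite exprMn q_sqr in h2.
  apply: (le_trans (ler_wpM2l _ (sqv_nv _))); first by rewrite exprn_ge0 // addr_ge0 ?az_ge0.
  apply: (le_trans h2); have := sqr_ge0 (X k - Z k); lra.
apply: (le_trans (ler_sum _ (fun k _ => H k))); rewrite -mulr_sumr ler_wpM2l // big_split /=.
apply: lerD.
- apply: le_trans (@young n r (fun m => q m * nv (a m)) _ ur (n0 b)) _.
  by rewrite ler_wpM2r ?sqr_ge0 //; apply: ler_sum => k _; rewrite exprMn q_sqr.
- apply: le_trans (@young n r (fun m => q m * nv (b m)) _ ur (n0 a)) _.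
  by rewrite ler_wpM2r ?sqr_ge0 //; apply: ler_sum => k _; rewrite exprMn q_sqr.
Qed.

Lemma sqvZ (z : C) (u : V) : sqv (z *: u) = Normc.normc z ^+ 2 * sqv u.
Proof. by rewrite /sqv mulr_sumr; apply: eq_bigr => j _; rewrite mxE Normc.normcM exprMn. Qed.

(** The bound [ln_le] is inhomogeneous; applied to c/e it becomes linear in [e]. *)
Lemma ln_scale n c e : 0 < e -> yn n c <= e ^+ 2 -> ln n c <= 12 * e.
Proof.
move=> e0 h; pose c' k := (e^-1)%:C *: c k.
have e1 : 0 <= e^-1 by rewrite invr_ge0 ltW.
have ye : yn n c' <= 1.
  rewrite (_ : yn n c' = e^-1 ^+ 2 * yn n c); last first.
    by rewrite mulr_sumr; apply: eq_bigr => k _; rewrite sqvZ nc_real ger0_norm // mulrCA.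
  by rewrite exprVn ler_pdivrMl ?exprn_gt0 // mulr1.
have : ln n c' = e^-1 * ln n c.
  by rewrite mulr_sumr; apply: eq_bigr => k _; rewrite nvZ nc_real ger0_norm // mulrCA.
have := ln_le n c' => h1 h2; move: h1; rewrite h2 ler_pdivrMl // => h1.
by apply: (le_trans h1); rewrite mulrC; have := ler_wpM2r (ltW e0) ye; lra.
Qed.

Lemma nv3_yn n c : \sum_(k <- win n) (1 + az k) ^+ 3 * nv (c k) ^+ 2 <= 48 * yn n c.
Proof.
rewrite mulr_sumr; apply: ler_sum => k _; have a0 := @az_ge0 R k.
have h : (1 + az k) ^+ 3 <= 16 * (1 + az k ^+ 5).
  have h3 : az k ^+ 3 <= 1 + az k ^+ 5.
    have [a1|a1] := lerP (az k) 1.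
      by have := exprn_ile1 3 a0 a1; have := exprn_ge0 5 a0; lra.
    by have := ler_weXn2l (ltW a1) (isT : (3 <= 5)%N); lra.
  have : 0 <= (1 + az k) * (1 - az k) ^+ 2 by rewrite mulr_ge0 ?sqr_ge0 //; lra.
  have : 0 <= az k ^+ 5 by rewrite exprn_ge0.
  by lra.
have s0 := sqv_ge0 (c k).
apply: (le_trans (ler_wpM2l _ (nv_sqv (c k)))); first by rewrite exprn_ge0 //; lra.
by have := ler_wpM2r s0 h; lra.
Qed.

Lemma nv3_ag_yn n c : \sum_(k <- win n) (1 + az k) ^+ 3 * nv (ag c k) ^+ 2 <= 48 * yn n c.
Proof.
rewrite mulr_sumr; apply: ler_sum => k _; have a0 := @az_ge0 R k.
have h : (1 + az k) ^+ 3 * az k ^+ 2 <= 16 * (1 + az k ^+ 5).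
  have [a1|a1] := lerP (az k) 1.
    have h1 : (1 + az k) ^+ 3 <= 2 ^+ 3 by rewrite lerXn2r ?nnegrE //; lra.
    have h2 : az k ^+ 2 <= 1 by rewrite exprn_ile1.
    have h3 : (1 + az k) ^+ 3 * az k ^+ 2 <= 2 ^+ 3 * 1.
      by apply: ler_pM => //; rewrite exprn_ge0 //; lra.
    by have := exprn_ge0 5 a0; lra.
  apply: (@le_trans _ _ ((2 * az k) ^+ 3 * az k ^+ 2)).
    rewrite ler_wpM2r ?exprn_ge0 // lerXn2r ?nnegrE //; lra.
  rewrite exprMn -mulrA -exprD; have := exprn_ge0 5 a0; lra.
have s0 := sqv_ge0 (c k).
have p0 : 0 <= (1 + az k) ^+ 3 * az k ^+ 2 by rewrite mulr_ge0 ?exprn_ge0 //; lra.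
rewrite nv_ag exprMn; have := ler_wpM2l p0 (nv_sqv (c k)).
by have := ler_wpM2r s0 h; lra.
Qed.

Lemma cv_H n (r : seq int) a b (Y G e : R) : uniq r -> 0 < e -> yn n a <= Y -> ln n a <= G ->
  yn n b <= e ^+ 2 ->
  \sum_(k <- r) (1 + az k) ^+ 3 * sqv (cv n a (ag b) k) <= 1536 * (144 * Y + G ^+ 2) * e ^+ 2 /\
  \sum_(k <- r) (1 + az k) ^+ 3 * sqv (cv n b (ag a) k) <= 1536 * (144 * Y + G ^+ 2) * e ^+ 2.
Proof.
move=> ur e0 aY aG be; have bl := ln_scale e0 be.
have S1 c : \sum_(k <- win n) nv (c k) <= ln n c /\ \sum_(k <- win n) nv (ag c k) <= ln n c.
  by split; [exact: nv_sum_le|under eq_bigr do rewrite nv_ag; exact: az_sum_le].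
have P0 (d : int -> V) : 0 <= \sum_(k <- win n) nv (d k) by apply: sumr_ge0 => k _; exact: nv_ge0.
have Q0 (d : int -> V) : 0 <= \sum_(k <- win n) (1 + az k) ^+ 3 * nv (d k) ^+ 2.
  by apply: sumr_ge0 => k _; rewrite mulr_ge0 ?exprn_ge0 ?nv_ge0 // addr_ge0 ?az_ge0.
have G0 : 0 <= G by apply: le_trans aG; exact: ln_ge0.
have Y0 : 0 <= Y by apply: le_trans aY; exact: yn_ge0.
have sq c x : ln n c <= x -> (\sum_(k <- win n) nv (c k)) ^+ 2 <= x ^+ 2 /\
    (\sum_(k <- win n) nv (ag c k)) ^+ 2 <= x ^+ 2.
  move=> cx; have [h1 h2] := S1 c; have x0 : 0 <= x by apply: le_trans cx; exact: ln_ge0.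
  by split; rewrite lerXn2r ?nnegrE ?P0 // (le_trans _ cx).
have [a1 a2] := sq _ _ aG; have [b1 b2] := sq _ _ bl.
have A1 : \sum_(k <- win n) (1 + az k) ^+ 3 * nv (a k) ^+ 2 <= 48 * Y.
  by apply: (le_trans (nv3_yn _ _)); rewrite ler_wpM2l.
have A2 : \sum_(k <- win n) (1 + az k) ^+ 3 * nv (ag a k) ^+ 2 <= 48 * Y.
  by apply: (le_trans (nv3_ag_yn _ _)); rewrite ler_wpM2l.
have B1 : \sum_(k <- win n) (1 + az k) ^+ 3 * nv (b k) ^+ 2 <= 48 * e ^+ 2.
  by apply: (le_trans (nv3_yn _ _)); rewrite ler_wpM2l.
have B2 : \sum_(k <- win n) (1 + az k) ^+ 3 * nv (ag b k) ^+ 2 <= 48 * e ^+ 2.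
  by apply: (le_trans (nv3_ag_yn _ _)); rewrite ler_wpM2l.
have -> : 1536 * (144 * Y + G ^+ 2) * e ^+ 2 =
  32 * ((48 * Y) * (12 * e) ^+ 2 + (48 * e ^+ 2) * G ^+ 2) by ring.
split; apply: (le_trans (conv_H _ _ _ ur)); rewrite ler_wpM2l //.
- by apply: lerD; apply: ler_pM => //; rewrite sqr_ge0.
- by rewrite addrC; apply: lerD; apply: ler_pM => //; rewrite sqr_ge0.
Qed.

Lemma sqvN (u : V) : sqv (- u) = sqv u.
Proof. by apply: eq_bigr => j _; rewrite mxE normcN. Qed.

Lemma sqvD_le (u v : V) : sqv (u + v) <= 2 * (sqv u + sqv v).
Proof.
rewrite /sqv -big_split /= mulr_sumr; apply: ler_sum => j _.
rewrite mxE !nc_sqr Re_add Im_add.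
have := sqr_ge0 (complex.Re (u 0 j) - complex.Re (v 0 j)).
have := sqr_ge0 (complex.Im (u 0 j) - complex.Im (v 0 j)); lra.
Qed.

Lemma tendsV_subV (u v : nat -> V) l m : tendsV u l -> tendsV v m ->
  tendsV (fun n => u n - v n) (l - m).
Proof.
move=> [e e0 ue] [f f0 vf]; exists (fun n => e n + f n).
  by rewrite -[0]addr0; exact: cvgD.
move=> n; rewrite opprB [v n - u n]addrC addrACA [- m + v n]addrC -[v n - m]opprB.
by apply: le_trans (nvB _ _) _; exact: lerD.
Qed.

(** The nonlinearity is locally Lipschitz from H^{5/2} to H^{3/2}, the loss being the one derivative
    in [ag]. *)
Lemma Gc_H a b (Y G e : R) (r : seq int) : uniq r -> 0 < e ->
  (forall n, yn n a <= Y) -> (forall n, yn n b <= Y) ->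
  (forall n, ln n a <= G) -> (forall n, ln n b <= G) ->
  (forall n, yn n (fun k => a k - b k) <= e ^+ 2) ->
  \sum_(k <- r) (1 + az k) ^+ 3 * sqv (Gc a k - Gc b k) <=
  4 * (1536 * (144 * Y + G ^+ 2) * e ^+ 2).
Proof.
move=> ur e0 aY bY aG bG ab.
apply: (@lim_sum_le _ _ _ (fun n k => (1 + az k) ^+ 3 * sqv (cv n a (ag a) k - cv n b (ag b) k))).
  move=> k; apply: cvgMr; apply: tendsV_sqv; apply: tendsV_subV; exact: Gc_tends.
apply: nearW => n; set d := fun k => a k - b k.
have dag : (fun k => ag a k - ag b k) = ag d by apply/funext => k; rewrite /ag /d scalerBr.
have [_ h1] := cv_H ur e0 (aY n) (aG n) (ab n); have [h2 _] := cv_H ur e0 (bY n) (bG n) (ab n).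
apply: (@le_trans _ _ (\sum_(k <- r) 2 * ((1 + az k) ^+ 3 * sqv (cv n d (ag a) k) +
   (1 + az k) ^+ 3 * sqv (cv n b (ag d) k)))).
  apply: ler_sum => k _; rewrite cvB dag -/d -mulrDr mulrCA ler_wpM2l ?sqvD_le //.
  by rewrite exprn_ge0 // addr_ge0 ?az_ge0.
by rewrite -mulr_sumr big_split /=; lra.
Qed.

Lemma nv_Gc a (G : R) k : (forall n, ln n a <= G) -> nv (Gc a k) <= 3 * G ^+ 2.
Proof.
move=> aG; have G0 : 0 <= G by apply: le_trans (aG 0%N); exact: ln_ge0.
have := Gc_trunc aG 0 (r := [:: k]) isT; rewrite big_seq1 => h1.
have h2 : nv (cv 0 a (ag a) k) <= G * G.
  have := @cv_sum_le _ 0 [:: k] a (ag a) isT; rewrite big_seq1 => h; apply: (le_trans h).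
  apply: ler_pM; try by apply: sumr_ge0 => l _; exact: nv_ge0.
    exact: le_trans (nv_sum_le _ _) (aG _).
  under eq_bigr do rewrite nv_ag; exact: le_trans (az_sum_le _ _) (aG _).
have s0 : sn 0 = 1 :> R by rewrite /sn sqrtr1 invr1.
rewrite -[Gc a k](subrK (cv 0 a (ag a) k)); apply: (le_trans (nvD _ _)).
by move: h1; rewrite s0; lra.
Qed.
Lemma entryZ (z : C) (u : V) j : (z *: u) 0 j = z * u 0 j. Proof. by rewrite mxE. Qed.

Lemma rdotZr (u v : V) (x : R) : rdot u (x%:C *: v) = x * rdot u v.
Proof. by rewrite /rdot mulr_sumr; apply: eq_bigr => j _; rewrite mxE Re_scale Im_scale; ring. Qed.

Lemma rdotBr (u v w : V) : rdot u (v - w) = rdot u v - rdot u w.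
Proof.
by rewrite /rdot -sumrB; apply: eq_bigr => j _; rewrite entryB Re_add Im_add Re_opp Im_opp; ring.
Qed.

(* Mean value argument: test the increment against itself. *)
Lemma mean_value_sum (r : seq int) (w : int -> R) (T t h e : R) (f df : int -> R -> V) :
  (forall k, DV T (f k) (df k)) -> (forall k, 0 <= w k) -> 0 <= t <= T -> 0 <= t + h <= T ->
  (forall s, 0 <= s <= T -> `|s - t| <= `|h| -> \sum_(k <- r) w k * sqv (df k s) <= e ^+ 2) ->
  \sum_(k <- r) w k * sqv (f k (t + h) - f k t) <= (h * e) ^+ 2.
Proof.
move=> fD w0 tT hT bd.
have [->|h0] := eqVneq h 0.
  rewrite big1 ?mul0r ?expr0n // => k _; by rewrite addr0 subrr sqv0 mulr0.
pose X k := f k (t + h) - f k t; set Q := \sum_(k <- r) w k * sqv (X k).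
pose phi s := \sum_(k <- r) w k * rdot (X k) (f k s).
have phiD : D1 T phi (fun s => \sum_(k <- r) w k * rdot (X k) (df k s)).
  by apply: D1_sum => k _; apply: D1_scale; exact: DV_rdot.
have phiQ : phi (t + h) - phi t = Q.
  by rewrite -sumrB; apply: eq_bigr => k _; rewrite -mulrBr sqv_rdot -rdotBr.
pose H : R := `|h|; have H0 : 0 < H by rewrite normr_gt0.
have Q0 : 0 <= Q by apply: sumr_ge0 => k _; rewrite mulr_ge0 ?sqv_ge0.
have der s : 0 <= s <= T -> `|s - t| <= H ->
    `|\sum_(k <- r) w k * rdot (X k) (df k s)| <= (Q + (H * e) ^+ 2) / (2 * H).
  move=> sT st; have P (g : R) : g ^+ 2 = H ^+ 2 ->
      g * \sum_(k <- r) w k * rdot (X k) (df k s) <= (Q + (H * e) ^+ 2) / 2.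
    move=> g2; rewrite mulr_sumr.
    apply: (@le_trans _ _ (\sum_(k <- r) 2^-1 * (w k * sqv (X k) + H ^+ 2 * (w k * sqv (df k s))))).
      apply: ler_sum => k _; have := rdot_sqv (X k) (g%:C *: df k s).
      rewrite rdotZr sqvZ nc_real real_normK ?num_real // g2 => hh.
      by have := ler_wpM2l (w0 k) hh; lra.
    have b1 := ler_wpM2l (sqr_ge0 H) (bd s sT st).
    by rewrite -mulr_sumr big_split /= -mulr_sumr -/Q exprMn; lra.
  rewrite ler_pdivlMr; last by rewrite mulr_gt0.
  have := P H erefl; have := P (- H) (sqrrN H); set S := \sum_(k <- _) _ => p1 p2.
  by have [S0|S0] := ger0P S; lra.
have fin : `|phi (t + h) - phi t| <= (Q + (H * e) ^+ 2) / (2 * H) * H.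
  move: tT hT => /andP[t0 tT] /andP[s0 sT].
  have [hp|hn] := leP 0 h.
    have -> : H = (t + h) - t by rewrite /H ger0_norm // addrC addKr.
    apply: (D1_lip_in phiD t0 _ sT) => [|u /andP[u1 u2]]; first by rewrite lerDl.
    rewrite -[t + h - t](_ : H = _); last by rewrite /H ger0_norm // addrC addKr.
    apply: der; first by apply/andP; split; lra.
    by rewrite /H !ger0_norm //; lra.
  have HE : H = t - (t + h) by rewrite /H ltr0_norm //; ring.
  rewrite distrC [X in _ <= _ * X]HE.
  apply: (D1_lip_in phiD s0 _ tT) => [|u /andP[u1 u2]]; first lra.
  apply: der; first by apply/andP; split; lra.
  by rewrite HE ler0_norm //; lra.
have -> : (h * e) ^+ 2 = (H * e) ^+ 2 by rewrite !exprMn real_normK ?num_real.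
move: fin; rewrite phiQ ger0_norm // (_ : _ / _ * H = (Q + (H * e) ^+ 2) / 2); first lra.
by field; rewrite gt_eqF.
Qed.
End Convolution.

(** * Strong continuity in H^{5/2} and differentiability in H^{3/2} *)

Section TimeRegularity.
Context {R : realType}.
Local Notation C := R[i].
Local Notation V := 'rV[R[i]]_3.
Local Notation az := (@az R).
Variables (T Y : R) (c : R -> int -> V).
Let L : R := rate * (1 + Y) ^+ 2.
Let G : R := 6 * (1 + Y).
Hypothesis cY : forall t : R, 0 <= t <= T -> forall n, yn n (c t) <= Y.
Hypothesis cD : forall k, DV T (fun t => c t k) (fun t => Gc (c t) k).
Hypothesis cE : forall A n (s t : R), 0 <= A -> 2 * A <= n.+1%:R ^+ 4 -> 0 <= s -> s <= t -> t <= T ->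
  `|EA A n (c t) - EA A n (c s)| <= L * (t - s).

Let cG (t : R) : 0 <= t <= T -> forall n, ln n (c t) <= G.
Proof.
move=> tT n; apply: (le_trans (ln_le _ _)); rewrite ler_wpM2l // lerD2l; exact: cY.
Qed.

Let K : R := 18 * G ^+ 2.

Lemma coef_lip (s t : R) k : 0 <= s <= T -> 0 <= t <= T -> nv (c s k - c t k) <= K * `|s - t|.
Proof.
wlog st : s t / s <= t.
  move=> H sT tT; have [st|ts] := leP s t; first exact: H.
  by rewrite nvBC distrC; apply: H => //; exact: ltW.
move=> /andP[s0 sT] /andP[t0 tT]; rewrite nvBC distrC ger0_norm ?subr_ge0 //.
have B (u : R) : 0 < u < T -> nv (Gc (c u) k) <= 3 * G ^+ 2.
  by move=> /andP[u0 uT]; apply: nv_Gc => n; apply: cG; rewrite !ltW.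
have H j : Normc.normc ((c t k - c s k) 0 j) <= 6 * G ^+ 2 * (t - s).
  apply: (le_trans (nc_le_ReIm _)); rewrite entryB Re_add Im_add Re_opp Im_opp.
  have h1 := @D1_lip _ T _ _ (3 * G ^+ 2) (cD k j).1 _ s t s0 st tT.
  have h2 := @D1_lip _ T _ _ (3 * G ^+ 2) (cD k j).2 _ s t s0 st tT.
  rewrite (_ : 6 * G ^+ 2 * (t - s) = 3 * G ^+ 2 * (t - s) + 3 * G ^+ 2 * (t - s)); last by ring.
  apply: lerD; [apply: h1|apply: h2] => u uT; apply: le_trans (B u uT).
    exact: le_trans (Re_le_nc _) (nc_le_nv _ _).
  exact: le_trans (Im_le_nc _) (nc_le_nv _ _).
rewrite /nv sum3 /K; have := H 0; have := H 1; have := H 2; lra.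
Qed.

Let E5 m (a : int -> V) : R := \sum_(k <- win m) az k ^+ 5 * sqv (a k).

Let t5 (a : int -> V) k : 0 <= az k ^+ 5 * sqv (a k).
Proof. by rewrite mulr_ge0 ?exprn_ge0 ?az_ge0 ?sqv_ge0. Qed.

(** With A = m^4 the cut-off energy lies between the energies on the windows m and 2m, and it varies
    at rate [L]. This yields the upper bound on the energy at a nearby time that modewise continuity
    cannot give. *)
Let E5_transfer m (s t : R) : 0 <= s <= T -> 0 <= t <= T ->
  E5 m (c s) <= E5 m.*2 (c t) + L * `|s - t|.
Proof.
move=> sT tT; pose A : R := m%:R ^+ 4; have A0 : 0 <= A by rewrite exprn_ge0.
have An : 2 * A <= m.*2.+1%:R ^+ 4.
  apply: (@le_trans _ _ ((2 * m%:R) ^+ 4)).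
    by rewrite exprMn ler_wpM2r //; lra.
  by rewrite lerXn2r ?nnegrE ?mulr_ge0 // -natrM ler_nat mul2n.
have h1 : E5 m (c s) <= EA A m.*2 (c s).
  have r0 k : 0 <= az k * rho A (az k ^+ 4) * sqv (c s k).
    by rewrite !mulr_ge0 ?az_ge0 ?rho_ge0 ?sqv_ge0.
  have mm : (m <= m.*2)%N by rewrite -addnn leq_addr.
  apply: le_trans (win_mono mm r0).
  apply: ler_sum_seq => k; rewrite mem_win => km; rewrite rho_id ?exprn_ge0 ?az_ge0 -?exprS //.
  by rewrite lerXn2r ?nnegrE ?az_ge0 // ler_nat.
have h2 : EA A m.*2 (c t) <= E5 m.*2 (c t).
  apply: ler_sum => k _; rewrite ler_wpM2r ?sqv_ge0 // [az k ^+ 5]exprS ler_wpM2l ?az_ge0 //.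
  by apply: rho_le; rewrite exprn_ge0 ?az_ge0.
have h3 : `|EA A m.*2 (c s) - EA A m.*2 (c t)| <= L * `|s - t|.
  move: sT tT => /andP[s0 sT] /andP[t0 tT].
  have [st|ts] := leP s t.
    by rewrite distrC [X in _ * X]distrC [X in _ * X]ger0_norm ?subr_ge0 //; exact: cE.
  have ts' := ltW ts; by rewrite [X in _ * X]ger0_norm ?subr_ge0 //; apply: cE.
move: h3; rewrite ler_norml => /andP[_ h3]; lra.
Qed.

Let sqv_diff (u v : V) : sqv u - sqv v <= nv (u - v) * (nv u + nv v).
Proof.
rewrite /sqv -sumrB; rewrite [X in X * _]/nv mulr_suml; apply: ler_sum => j _.
have h : Normc.normc (u 0 j) <= Normc.normc ((u - v) 0 j) + Normc.normc (v 0 j).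
  by rewrite -{1}[u 0 j](subrK (v 0 j)) -entryB; exact: le_normcD.
have u0 := nc_ge0 (u 0 j); have v0 := nc_ge0 (v 0 j); have w0 := nc_ge0 ((u - v) 0 j).
have := nc_le_nv u j; have := nc_le_nv v j; nra.
Qed.

(** Low modes move little since each is Lipschitz in time. The tail at time s is the whole energy
    minus the low modes: the former is bounded by the energy at time t through [E5_transfer], the
    latter are close to those at time t, whose tail is small by the choice of [m]. *)
Lemma coef_cont (t e : R) : 0 <= t <= T -> 0 < e -> exists2 d : R, 0 < d &
  forall s : R, 0 <= s <= T -> `|s - t| < d -> forall n, yn n (fun k => c s k - c t k) <= e ^+ 2.
Proof.
move=> tT e0; have e2 : 0 < e ^+ 2 by rewrite exprn_gt0.
have [m Hm] : exists m, forall n, E5 n (c t) <= E5 m (c t) + e ^+ 2 / 32.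
  have nd : nondecreasing_seq (fun n => E5 n (c t)) by move=> p q pq; apply: win_mono.
  have ub : has_ubound (range (fun n => E5 n (c t))).
    by exists Y => _ [n _ <-]; apply: le_trans (cY tT n); exact: y5_le.
  have cv := nondecreasing_cvgn nd ub.
  have /cvgrPdist_lt/(_ (e ^+ 2 / 32)) := cv; case=> [|N _ HN]; first by rewrite divr_gt0.
  exists N => n; have := HN N (leqnn N) => /=.
  have := ub_le_sup ub (imageT (fun n => E5 n (c t)) n) => /= h1.
  by rewrite ltr_norml => /andP[_]; lra.
pose W : R := \sum_(k <- win m) (1 + az k ^+ 5).
have W0 : 0 <= W by apply: sumr_ge0 => k _; rewrite ltW // one5_gt0.
have Y0 : 0 <= Y by apply: le_trans (cY tT 0); exact: yn_ge0.
have G0 : 0 <= G by rewrite mulr_ge0 // addr_ge0.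
have K0 : 0 <= K by rewrite mulr_ge0 ?sqr_ge0.
have L0 : 0 <= L by rewrite mulr_ge0 ?sqr_ge0 // ltW // rate_gt0.
(* Collects the coefficients of |s - t| in the three contributions: motion of the low modes, drift
   of the cut-off energy, and change of the low-mode energy. *)
pose Z : R := W * K ^+ 2 + 4 * L + 8 * (W * G * K).
have Z0 : 0 <= Z.
  by rewrite /Z; have := mulr_ge0 W0 (sqr_ge0 K); have := mulr_ge0 (mulr_ge0 W0 G0) K0; lra.
exists (Num.min 1 (e ^+ 2 / (4 * (Z + 1)))).
  by rewrite lt_min ltr01 divr_gt0 // mulr_gt0 //; lra.
move=> s sT; rewrite lt_min => /andP[x1 xZ] n.
set x : R := `|s - t| in x1 xZ; have x0 : 0 <= x by exact: normr_ge0.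
set d := fun k => c s k - c t k.
have dK k : nv (d k) <= K * x by exact: coef_lip.
wlog mn : n / (m <= n)%N.
  move=> H; have [|nm] := leqP m n; first exact: H.
  by apply: le_trans (yn_mono _ (ltnW nm)) (H m (leqnn m)).
rewrite /yn (win_split _ mn).
have fin : \sum_(k <- win m) (1 + az k ^+ 5) * sqv (d k) <= W * K ^+ 2 * x.
  apply: (@le_trans _ _ (W * (K * x) ^+ 2)).
    rewrite mulr_suml; apply: ler_sum => k _; have w1 := ltW (@one5_gt0 R k); rewrite ler_wpM2l //.
    by apply: (le_trans (sqv_nv _)); rewrite !expr2; apply: ler_pM; rewrite ?nv_ge0 ?dK.
  have xx : x ^+ 2 <= x by rewrite expr2 ler_piMr // ltW.
  by have := ler_wpM2l (mulr_ge0 W0 (sqr_ge0 K)) xx; lra.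
pose tl (a : int -> V) : R := \sum_(k <- win n | (m < `|k|)%N) az k ^+ 5 * sqv (a k).
have tlE a : tl a = E5 n a - E5 m a by rewrite /E5 (win_split _ mn) addrC addKr.
have tail : \sum_(k <- win n | (m < `|k|)%N) (1 + az k ^+ 5) * sqv (d k) <= 4 * (tl (c s) + tl (c t)).
  rewrite -big_split /= mulr_sumr; apply: ler_sum => k mk.
  have k0 : k != 0 by apply: contraTneq mk => ->.
  have z1 : 1 <= az k ^+ 5 by rewrite exprn_ege1 // az_ge1.
  have h : sqv (d k) <= 2 * (sqv (c s k) + sqv (c t k)).
    have -> : sqv (c t k) = sqv (- c t k) by rewrite sqvN.
    exact: sqvD_le.
  have := sqv_ge0 (d k); have := sqv_ge0 (c s k); have := sqv_ge0 (c t k); nra.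
have D : E5 m (c t) - E5 m (c s) <= W * (2 * G) * (K * x).
  rewrite /E5 -sumrB -mulrA mulr_suml; apply: ler_sum => k _.
  rewrite -mulrBr; have a0 : 0 <= az k ^+ 5 by rewrite exprn_ge0 ?az_ge0.
  apply: (@le_trans _ _ (az k ^+ 5 * (2 * G * (K * x)))); last first.
    have g0 : 0 <= 2 * G * (K * x) by apply: mulr_ge0; apply: mulr_ge0.
    by rewrite ler_wpM2r // lerDr.
  rewrite ler_wpM2l //; apply: (le_trans (sqv_diff _ _)).
  rewrite mulrC [nv (c t k - _)]nvBC; apply: ler_pM; rewrite ?addr_ge0 ?nv_ge0 //; last exact: dK.
  have B (u : R) : 0 <= u <= T -> nv (c u k) <= G.
    move=> uT; apply: le_trans (cG uT `|k|%N); apply: le_trans (nv_sum_le _ _).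
    by apply: nv_seq_le; rewrite ?win_uniq ?mem_win.
  by rewrite mulr2n mulrDl mul1r lerD // B.
have Es := E5_transfer n sT tT; have Et := Hm n; have Et2 := Hm n.*2.
move: tail; rewrite !tlE -/x in Es * => tail.
have xz : x * (4 * (Z + 1)) <= e ^+ 2 by rewrite -ler_pdivlMr ?ltW // mulr_gt0 //; lra.
have xZ2 : x * Z <= e ^+ 2 / 4 by lra.
move: xZ2; rewrite /Z; lra.
Qed.

(** Mean value argument for s -> c(s) - s Gc(c(t)), whose derivative Gc(c(s)) - Gc(c(t)) is small by
    [coef_cont] and the Lipschitz bound [Gc_H]. *)
Lemma coef_diff (t e : R) : 0 <= t <= T -> 0 < e -> exists2 d : R, 0 < d &
  forall h : R, 0 <= t + h <= T -> `|h| < d -> forall n,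
    \sum_(k <- win n) (1 + az k) ^+ 3 * sqv (c (t + h) k - c t k - h%:C *: Gc (c t) k) <= (h * e) ^+ 2.
Proof.
move=> tT e0.
have Y0 : 0 <= Y by apply: le_trans (cY tT 0); exact: yn_ge0.
have [Z Z0 ZE] : exists2 Z : R, 0 <= Z & forall x, 4 * (1536 * (144 * Y + G ^+ 2) * x) = Z * x.
  exists (4 * (1536 * (144 * Y + G ^+ 2))); first by have := sqr_ge0 G; lra.
  by move=> x; ring.
have [e1 e10 e1E] : exists2 e1 : R, 0 < e1 & Z * e1 ^+ 2 <= e ^+ 2.
  have z1 : 0 < 1 + Z by lra.
  exists (e / (1 + Z)); first by rewrite divr_gt0.
  rewrite expr_div_n mulrA ler_pdivrMr ?exprn_gt0 // mulrC ler_wpM2l ?sqr_ge0 //.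
  by have := sqr_ge0 Z; lra.
have [d d0 Hd] := coef_cont tT e10; exists d => // h hT hd n.
pose f k s := c s k - s%:C *: Gc (c t) k.
pose df k s := Gc (c s) k - Gc (c t) k.
have fD k : DV T (f k) (df k).
  move=> j; have [h1 h2] := cD k j; split.
  - apply: D1_ext (D1_sub h1 (D1_mul (D1_id T) (D1_cst T (complex.Re (Gc (c t) k 0 j))))) => s.
      by rewrite /f entryB Re_add Re_opp entryZ Re_scale.
    rewrite /df; move: (Gc (c s) k) (Gc (c t) k) => u v _.
    by rewrite entryB Re_add Re_opp; ring.
  - apply: D1_ext (D1_sub h2 (D1_mul (D1_id T) (D1_cst T (complex.Im (Gc (c t) k 0 j))))) => s.
      by rewrite /f entryB Im_add Im_opp entryZ Im_scale.
    rewrite /df; move: (Gc (c s) k) (Gc (c t) k) => u v _.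
    by rewrite entryB Im_add Im_opp; ring.
have w0 k : 0 <= (1 + az k) ^+ 3 by rewrite exprn_ge0 // addr_ge0 ?az_ge0.
rewrite (eq_bigr (fun k => (1 + az k) ^+ 3 * sqv (f k (t + h) - f k t))).
  apply: (mean_value_sum fD w0 tT hT) => s sT st.
  have st' : `|s - t| < d by exact: le_lt_trans hd.
  have := Gc_H (win_uniq n) e10 (cY sT) (cY tT) (cG sT) (cG tT) (Hd s sT st').
  by rewrite ZE => hh; apply: (le_trans hh e1E).
move=> k _; rewrite /f; move: (c (t + h) k) (c t k) (Gc (c t) k) => p q g.
congr (_ * sqv _).
by rewrite rmorphD /= scalerDl; apply/rowP => j; rewrite !mxE; ring.
Qed.
End TimeRegularity.

(** * Real series and strong solutions *)

Section RealSeries.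
Context {R : realType}.
Local Notation C := R[i].
Local Notation V := 'rV[R[i]]_3.
Local Notation mu := (@lebesgue_measure R).
Local Notation D := (`[0%R, (2 * pi)%R]%classic : set R).
Local Notation intC := (integralC D).
Local Notation ek := (@ek R).
Implicit Types (c : int -> V).

Lemma rint_opp (f : R -> R) : rint f -> \int[mu]_(x in D) (- f x) = - \int[mu]_(x in D) f x.
Proof.
move=> hf; rewrite -mulN1r -(RintegralZl (-1) mD hf).
by apply: eq_Rintegral => x _; rewrite mulN1r.
Qed.

Lemma intC_conj f : cint f -> intC (fun x => conjc (f x)) = conjc (intC f).
Proof.
move=> [f1 f2]; apply: complexP => /=.
  by apply: eq_Rintegral => x _; case: (f x).
by rewrite -rint_opp //; apply: eq_Rintegral => x _; case: (f x).
Qed.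

Lemma conj_realM (x : R) (z : C) : conjc (x%:C * z) = x%:C * conjc z.
Proof. by case: z => a b; apply: complexP => /=; ring. Qed.

Lemma rcoefs_fourier (f : circle R -> 'rV[R]_3) : rintV f -> rcoefs (fourier f).
Proof.
move=> hf k; apply/rowP => j; rewrite [RHS]mxE !fourierCE opprK conj_realM; congr (_ * _).
rewrite -intC_conj; last by apply: cintM_ek; exact: cintV_toC.
apply: intC_ext => x _; rewrite mxE conj_realM; congr (_ * _).
by rewrite [RHS]conj_ek opprK.
Qed.

(** Summability with a tail rate: what a bound on [ln] implies both for [c] and for |nabla| c. *)
Definition summ (G : R) c : Prop := (forall n, \sum_(k <- win n) nv (c k) <= G) /\
  forall n m, (n <= m)%N -> \sum_(k <- win m) nv (c k - tr n c k) <= sn n * G.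

Lemma summ_ln G c : (forall n, ln n c <= G) -> summ G c /\ summ G (ag c).
Proof.
move=> cG; split; split.
- by move=> n; apply: le_trans (nv_sum_le _ _) (cG n).
- by move=> n m nm; apply: (le_trans (tail_nv _ nm)); rewrite ler_wpM2l ?sn_ge0.
- by move=> n; under eq_bigr do rewrite nv_ag; apply: le_trans (az_sum_le _ _) (cG n).
- by move=> n m nm; apply: (le_trans (tail_az _ nm)); rewrite ler_wpM2l ?sn_ge0.
Qed.

Lemma conjv_trig n c z : rcoefs c -> conjv (trig (win n) c z) = trig (win n) c z.
Proof.
move=> rc; have [x _ <-] := expi_surj z; apply/rowP => j; rewrite mxE !trigE rmorph_sum /=.
rewrite -[RHS]win_opp; apply: eq_bigr => k _; rewrite rmorphM /= [conjc (ek _ _)]conj_ek; congr (_ * _).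
by rewrite rc mxE.
Qed.

Definition serR c (z : circle R) : 'rV[R]_3 := \row_j complex.Re (ser c z 0 j).

Section Summable.
Variables (G : R) (c : int -> V).
Hypotheses (cS : summ G c) (rc : rcoefs c).

Lemma toC_serR z : toC (serR c z) = ser c z.
Proof.
have t := ser_tends cS.2 z.
have E : conjv (ser c z) = ser c z.
  apply: (@tendsV_eq _ (fun n => trig (win n) c z)) => //.
  have := tendsV_conj t; by under eq_fun do rewrite conjv_trig //.
apply/rowP => j; rewrite [LHS]mxE [serR _ _ _ _]mxE.
have := congr1 (fun u : V => u 0 j) E; rewrite [LHS]mxE.
case: (ser c z 0 j) => a b /= [] ab; congr (_ +i* _).
by lra.
Qed.

Lemma contV_serR : contV (serR c).
Proof. by move=> j; under eq_fun do rewrite mxE; exact: (ser_cont cS.2 j).1. Qed.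

Lemma fourier_serR k : fourier (serR c) k = c k.
Proof.
rewrite /fourier (fourierC_ext (g := ser c)); last exact: toC_serR.
exact: fourier_ser cS.2 k.
Qed.
End Summable.

Lemma contV_in_L2 (f : circle R -> 'rV[R]_3) : contV f -> in_L2 f.
Proof.
move=> fc j; split; first exact: continuous_measurable_fun.
have fc2 : continuous (fun x : R => f (expi x) 0 j ^+ 2).
  by move=> x; apply: (@continuous_comp _ _ _ (fun x : R => f (expi x) 0 j) (fun y : R => y ^+ 2)); [exact: fc|exact: exprn_continuous].
have /integrableP[_] : rint (fun x : R => f (expi x) 0 j ^+ 2) by apply: rint_cont; exact: cont_within.
apply: le_lt_trans; apply: ge0_le_integral => //; try exact: mD.
- by move=> x _; rewrite lee_fin sqr_ge0.
- by apply/measurable_EFinP; apply: measurable_funTS; exact: continuous_measurable_fun.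
- by apply: measurableT_comp => //; apply/measurable_EFinP; apply: measurable_funTS; exact: continuous_measurable_fun.
- by move=> x _ /=; rewrite lee_fin ler_norm.
Qed.

Lemma fourier_ae_eq f g : rintV f -> rintV g ->
  {ae mu, forall x : R, f (expi x) = g (expi x)} -> fourier f = fourier g.
Proof.
move=> hf hg fg; apply/funext => k; apply/rowP => j; rewrite !fourierCE; congr (_ * _).
have H (P : C -> R) (p : R -> C) : {ae mu, forall x : R, D x ->
    (P (toC (f (expi x)) 0 j * p x))%:E = (P (toC (g (expi x)) 0 j * p x))%:E}.
  by apply: negligibleS fg => x /= n e; apply: n => _; rewrite e.
have [f1 f2] := cintM_ek (- k) (cintV_toC hf j); have [g1 g2] := cintM_ek (- k) (cintV_toC hg j).
apply: complexP => /=; rewrite /Rintegral; congr fine.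
- apply: ae_eq_integral; [exact: mD| | |exact: H].
  + by case/integrableP: f1.
  + by case/integrableP: g1.
- apply: ae_eq_integral; [exact: mD| | |exact: H].
  + by case/integrableP: f2.
  + by case/integrableP: g2.
Qed.

Lemma fourier_cross_serR G c k : (forall n, ln n c <= G) -> rcoefs c ->
  fourier (fun z => cross (serR c z) (serR (ag c) z)) k = Gc c k.
Proof.
move=> cG rc; have [s1 s2] := summ_ln cG.
rewrite -(fourier_cross_ag k cG) /fourier (fourierC_ext (g := fun z => crossC (ser c z) (ser (ag c) z))) //.
by move=> z; rewrite toC_cross (toC_serR s1 rc) (toC_serR s2 (rcoefs_ag rc)).
Qed.

Lemma absgrad1 c : absgrad 1 c = ag c.
Proof. by apply/funext => k; rewrite /absgrad powRr1. Qed.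

Lemma serR_fourier G f : contV f -> summ G (fourier f) -> forall z, f z = serR (fourier f) z.
Proof.
move=> fc fS; have rc := rcoefs_fourier (contV_rintV fc).
apply: fourier_inj; [exact: fc|exact: contV_serR fS|].
by move=> k; rewrite (fourier_serR fS rc).
Qed.
End RealSeries.

Section Derivatives.
Context {R : realType}.
Local Notation C := R[i].
Local Notation V := 'rV[R[i]]_3.

Lemma DV_scale T (z : C) (f df : R -> V) : DV T f df -> DV T (fun t => z *: f t) (fun t => z *: df t).
Proof.
move=> fD j; have [h1 h2] := fD j; split.
- apply: D1_ext (D1_sub (D1_scale (complex.Re z) h1) (D1_scale (complex.Im z) h2)) => t *;
  by rewrite entryZ Re_mul.
- apply: D1_ext (D1_add (D1_scale (complex.Re z) h2) (D1_scale (complex.Im z) h1)) => t *;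
  by rewrite entryZ Im_mul.
Qed.

Lemma DV_sum T (r : seq int) (f df : int -> R -> V) : (forall k, k \in r -> DV T (f k) (df k)) ->
  DV T (fun t => \sum_(k <- r) f k t) (fun t => \sum_(k <- r) df k t).
Proof.
elim: r => [|k r IH] fD j.
  split; [apply: D1_ext (D1_cst T 0) => t *|apply: D1_ext (D1_cst T 0) => t *]; by rewrite !big_nil mxE.
have [h1 h2] := fD k (mem_head _ _) j.
have [|g1 g2] := IH _ j; first by move=> l lr; apply: fD; rewrite in_cons lr orbT.
split; [apply: D1_ext (D1_add h1 g1) => t *|apply: D1_ext (D1_add h2 g2) => t *];
  by rewrite !big_cons [in RHS]mxE ?Re_add ?Im_add.
Qed.

Lemma sqv_toC (u : 'rV[R]_3) : sqv (toC u) = \sum_(j < 3) u 0 j ^+ 2.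
Proof. by apply: eq_bigr => j _; rewrite mxE nc_real real_normK ?num_real. Qed.

Lemma rdot_cross_self (u v : V) : conjv u = u -> rdot u (crossC u v) = 0.
Proof.
move=> uu; rewrite rdotE uu.
have := trip_swap12 u u v; rewrite /trip => /(congr1 (@complex.Re R)); rewrite Re_opp; lra.
Qed.

Lemma sn_half n : sn n./2 <= 2 * sn n :> R.
Proof.
have h : n.+1%:R <= 4 * n./2.+1%:R :> R.
  by rewrite -natrM ler_nat -{1}(odd_double_half n); case: (odd n); lia.
rewrite -ler_sqr ?nnegrE ?mulr_ge0 ?sn_ge0 // exprMn !sn_sqr.
rewrite -div1r ler_pdivrMr ?ltr0n // mulrAC ler_pdivlMr ?ltr0n // mul1r.
by move: h; lra.
Qed.

Lemma yn_le_Hnorm n (a : int -> V) (M : R) : (Hnorm (5 / 2) a <= M%:E)%E -> yn n a <= 2 * M ^+ 2.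
Proof.
move=> h; apply: (le_trans _ (ler_wpM2l _ (le_Hnorm n h))) => //.
by rewrite mulr_sumr; apply: ler_sum => k _; rewrite mulrA ler_wpM2r ?sqv_ge0 ?az5_wt.
Qed.

Lemma mode_le_Hnorm (s : R) (a : int -> V) (M : R) k j : 0 <= s -> (Hnorm s a <= M%:E)%E ->
  Normc.normc (a k 0 j) <= M.
Proof.
move=> s0 h; have M0 : 0 <= M by rewrite -lee_fin; apply: le_trans h; exact: Hnorm_ge0.
rewrite -ler_sqr ?nnegrE ?nc_ge0 //; apply: (le_trans _ (le_Hnorm `|k|%N h)).
have w1 : 1 <= wt s k.
  by rewrite -(powRr0 (1 + k%:~R ^+ 2)) ler_powR // lerDl sqr_ge0.
have w0 l : 0 <= wt s l * sqv (a l) by rewrite mulr_ge0 ?wt_ge0 ?sqv_ge0.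
have kw : k \in win `|k|%N by rewrite mem_win.
apply: (@le_trans _ _ (wt s k * sqv (a k))).
  apply: (@le_trans _ _ (sqv (a k))); last by rewrite ler_peMl ?sqv_ge0.
  by rewrite /sqv (bigD1 j) //= lerDl sumr_ge0 // => i _; rewrite sqr_ge0.
by rewrite (bigD1_seq k) ?win_uniq //= lerDl sumr_ge0.
Qed.

Lemma sum_sqv_le (r : seq int) (a : int -> V) : \sum_(k <- r) sqv (a k) <= (\sum_(k <- r) nv (a k)) ^+ 2.
Proof.
elim: r => [|k r IH]; first by rewrite !big_nil expr0n.
rewrite !big_cons sqrrD; have := sqv_nv (a k).
have : 0 <= nv (a k) * \sum_(l <- r) nv (a l).
  by rewrite mulr_ge0 ?nv_ge0 // sumr_ge0 // => l _; exact: nv_ge0.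
by move: IH; lra.
Qed.

Lemma ag_tr n (a : int -> V) : ag (tr n a) = tr n (ag a).
Proof. by apply/funext => k; rewrite /ag /tr; case: ifP => // _; rewrite scaler0. Qed.
End Derivatives.

(** * Existence and uniqueness of the strong solution *)

Section StrongSolution.
Context {R : realType}.
Local Notation C := R[i].
Local Notation V := 'rV[R[i]]_3.
Local Notation az := (@az R).
Variables (S0 : circle R -> 'rV[R]_3) (T Y K : R) (c : R -> int -> V) (cn : nat -> R -> int -> V).
Let G : R := 6 * (1 + Y).
Hypothesis cS0 : contV S0.
Hypothesis sS0 : forall z, sphere (S0 z).
Hypothesis T0 : 0 < T.
Hypothesis Hcn : forall n, [/\ gal n (cn n), forall k, cn n 0 k = tr n (fourier S0) k &
  forall (t : R) m, 0 <= t <= T -> yn m (cn n t) <= Y].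
Hypothesis HK : forall n (t : R) k, 0 <= t <= T -> nv (c t k - cn n t k) <= K * sn n.
Hypothesis Hc : forall t : R, 0 <= t <= T -> rcoefs (c t) /\ forall n, yn n (c t) <= Y.
Hypothesis HD : forall k, DV T (fun t => c t k) (fun t => Gc (c t) k).
Hypothesis HE : forall A n (s t : R), 0 <= A -> 2 * A <= n.+1%:R ^+ 4 -> 0 <= s -> s <= t -> t <= T ->
  `|EA A n (c t) - EA A n (c s)| <= rate * (1 + Y) ^+ 2 * (t - s).
Hypothesis Hc0 : forall k, c 0 k = fourier S0 k.

Let ln_of_yn (a : int -> V) : (forall n, yn n a <= Y) -> forall n, ln n a <= G.
Proof. by move=> aY n; apply: (le_trans (ln_le _ _)); rewrite ler_wpM2l // lerD2l. Qed.

Let cG (t : R) : 0 <= t <= T -> forall n, ln n (c t) <= G.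
Proof. by move=> tT; apply: ln_of_yn; exact: (Hc tT).2. Qed.

Let cnG n (t : R) : 0 <= t <= T -> forall m, ln m (cn n t) <= G.
Proof. by move=> tT; apply: ln_of_yn => m; have [_ _ h] := Hcn n; exact: h. Qed.

Lemma galerkin_l1 (t : R) : 0 <= t <= T ->
  (fun n => \sum_(k <- win n) (1 + az k) * nv (c t k - cn n t k)) @ \oo --> (0 : R).
Proof.
move=> tT; have G0 : 0 <= G by apply: le_trans (cG tT 0); exact: ln_ge0.
apply/cvgrPdist_le => e e0; have [eta eta0 H] := l1_unif G0 e0.
have /cvgrPdist_le/(_ eta eta0) := scale_sn_cvg0 K.
apply: filterS => n /= hn; rewrite sub0r normrN ger0_norm; last first.
  by apply: sumr_ge0 => k _; rewrite mulr_ge0 ?nv_ge0 // addr_ge0 ?az_ge0.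
apply: H; [exact: cG|exact: cnG|move=> k; apply: (le_trans (HK n k tT))].
by apply: le_trans hn; rewrite sub0r normrN ler_norm.
Qed.

Lemma galerkin_tends (t : R) z : 0 <= t <= T ->
  tendsV (fun n => trig (win n) (cn n t) z) (ser (c t) z).
Proof.
move=> tT; have [s1 _] := summ_ln (cG tT).
exists (fun n => 6 * G * sn n + \sum_(k <- win n) (1 + az k) * nv (c t k - cn n t k)).
  by rewrite -[X in _ --> X]addr0; apply: cvgD; [exact: scale_sn_cvg0|exact: galerkin_l1].
move=> n; rewrite -[ser _ _](subrK (trig (win n) (c t) z)) -addrA.
apply: (le_trans (nvD _ _)); apply: lerD.
  by apply: (le_trans (ser_trunc s1.2 n z)); rewrite (mulrC (sn n)) mulrA.
rewrite -trigB; apply: (le_trans (nv_trig _ _ _)); apply: ler_sum => k _.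
by rewrite mulrDl mul1r lerDl mulr_ge0 ?az_ge0 ?nv_ge0.
Qed.

(** The full product u x |nabla| u is pointwise orthogonal to u, so |u|^2 changes only through the
    part removed by the projection. Two modes add up beyond n only if one of them exceeds n/2,
    whence the rate. *)
Lemma galerkin_sphere n (t : R) z : 0 <= t <= T ->
  `|sqv (trig (win n) (cn n t) z) - sqv (trig (win n) (cn n 0) z)| <= 4 * G ^+ 3 * T * sn n./2.
Proof.
move=> tT; have [gn _ _] := Hcn n; have [rcn supp dcn] := gn.
have G0 : 0 <= G by apply: le_trans (cG tT 0); exact: ln_ge0.
pose a s := cn n s; pose d s := cv n (a s) (ag (a s)).
have uD : DV T (fun s => trig (win n) (a s) z) (fun s => trig (win n) (d s) z).
  apply: DV_sum => k; rewrite mem_win => kn; apply: DV_scale; exact: dcn.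
have bd (s : R) : 0 < s < T -> `|2 * rdot (trig (win n) (a s) z) (trig (win n) (d s) z)| <= 4 * G ^+ 3 * sn n./2.
  move=> /andP[s0 sT]; have sT' : 0 <= s <= T by rewrite !ltW.
  have nn : (n <= n.*2)%N by rewrite -addnn leq_addr.
  have hn : (n./2 <= n)%N by rewrite leq_half_double; lia.
  have E : trig (win n) (d s) z = crossC (trig (win n) (a s) z) (trig (win n) (ag (a s)) z)
      - (trig (win n.*2) (d s) z - trig (win n) (d s) z).
    by rewrite trig_cv opprB addrC subrK.
  set u := trig (win n) (a s) z in E *.
  have uG : nv u <= G by apply: (le_trans (nv_trig _ _ _)); apply: le_trans (nv_sum_le _ _) (cnG n sT' n).
  rewrite E rdotBr rdot_cross_self ?conjv_trig ?rcn // sub0r mulrN normrN.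
  have tl : nv (trig (win n.*2) (d s) z - trig (win n) (d s) z) <= 2 * sn n./2 * G ^+ 2.
    rewrite -(trig_tr _ z nn) -trigB; apply: (le_trans (nv_trig _ _ _)).
    apply: le_trans (cv_trunc (win_uniq n.*2) hn (cnG n sT' n)).
    apply: ler_sum => k _; rewrite /tr; case: leqP => kn; first by rewrite subrr nv0 nv_ge0.
    by rewrite subr0 [X in nv (_ - X)]cv_supp ?subr0 //; move: kn; lia.
  rewrite normrM ger0_norm //.
  have := rdot_le u (trig (win n.*2) (d s) z - trig (win n) (d s) z).
  set x := rdot _ _; set y := nv (_ - _) in tl *.
  have := ler_pM (nv_ge0 u) (nv_ge0 (trig (win n.*2) (d s) z - trig (win n) (d s) z)) uG tl.
  rewrite -/y; lra.
have := D1_lip (DV_sqv uD) bd (lexx 0); move: tT => /andP[t0 tT] /(_ t t0 tT) h.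
apply: (le_trans h); rewrite subr0.
have p := mulr_ge0 (mulr_ge0 (ler0n R 4) (exprn_ge0 3 G0)) (sn_ge0 n./2).
by have := ler_wpM2l p tT; lra.
Qed.

Lemma sphere_ser (t : R) z : 0 <= t <= T -> sqv (ser (c t) z) = sqv (ser (c 0) z).
Proof.
move=> tT; have z0 : 0 <= (0 : R) <= T by rewrite lexx ltW.
apply/eqP; rewrite -subr_eq0; apply/eqP.
have l1 : (fun n => sqv (trig (win n) (cn n t) z) - sqv (trig (win n) (cn n 0) z)) @ \oo -->
    sqv (ser (c t) z) - sqv (ser (c 0) z).
  exact: cvgB (tendsV_sqv (galerkin_tends z tT)) (tendsV_sqv (galerkin_tends z z0)).
have l2 : (fun n => sqv (trig (win n) (cn n t) z) - sqv (trig (win n) (cn n 0) z)) @ \oo --> (0 : R).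
  apply: (@dist_cvg _ _ (fun n => 4 * G ^+ 3 * T * 2 * sn n)); first exact: scale_sn_cvg0.
  move=> n; rewrite sub0r normrN; apply: (le_trans (galerkin_sphere n z tT)).
  have G0 : 0 <= G by apply: le_trans (cG tT 0); exact: ln_ge0.
  have T0' := ltW T0.
  by have := ler_wpM2l (mulr_ge0 (mulr_ge0 (ler0n R 4) (exprn_ge0 3 G0)) T0') (sn_half n); lra.
exact: (cvg_unique _ l1 l2).
Qed.

Let z0 : 0 <= (0 : R) <= T. Proof. by rewrite lexx ltW. Qed.

Lemma c_init : c 0 = fourier S0. Proof. exact/funext. Qed.

Lemma S0_ser z : S0 z = serR (fourier S0) z.
Proof.
apply: (@serR_fourier _ G) => //; rewrite -c_init.
by have [s1 _] := summ_ln (cG z0).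
Qed.

Lemma sphere_serR (t : R) z : 0 <= t <= T -> sphere (serR (c t) z).
Proof.
move=> tT; have [s1 _] := summ_ln (cG tT); have [s2 _] := summ_ln (cG z0).
rewrite /sphere -sqv_toC (toC_serR s1 (Hc tT).1) sphere_ser // -(toC_serR s2 (Hc z0).1).
by rewrite c_init -S0_ser sqv_toC sS0.
Qed.

Lemma strong_serR : strong_solution T S0 (fun t => serR (c t)).
Proof.
have tT' (t : R) : 0 <= t < T -> 0 <= t <= T by move=> /andP[-> /ltW].
have fE (t : R) : 0 <= t <= T -> fourier (serR (c t)) = c t.
  move=> tT; apply/funext => k; have [s1 _] := summ_ln (cG tT).
  exact: fourier_serR s1 (Hc tT).1 k.
split.
- move=> t /tT' tT; have [s1 _] := summ_ln (cG tT); have ct := contV_serR s1; split.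
  + exact/contVP.
  + by move=> z; exact: sphere_serR.
  + split; first exact: contV_in_L2.
    rewrite (fE t tT); have Y0 : 0 <= Y by apply: le_trans ((Hc tT).2 0%N); exact: yn_ge0.
    exact: le_lt_trans (Hnorm_yn Y0 (Hc tT).2) (ltry _).
- move=> t /tT' tT; apply/Hnorm_cvg0 => e e0.
  have e3 : 0 < e / 3 by rewrite divr_gt0.
  have [d d0 Hd] := coef_cont (fun s sT => (Hc sT).2) HD HE tT e3.
  rewrite near_withinE; exists d => // s /= hs.
  rewrite in_itv /= => /tT' sT; rewrite distrC in hs.
  have -> : (fun k => fourier (serR (c s)) k - fourier (serR (c t)) k) = (fun k => c s k - c t k).
    by apply/funext => k; exact: (congr2 (fun u v : int -> V => u k - v k) (fE s sT) (fE t tT)).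
  apply: le_trans (Hnorm_yn (sqr_ge0 _) (Hd s sT hs)) _; rewrite lee_fin.
  apply: (@le_trans _ _ (Num.sqrt (e ^+ 2))); last by rewrite sqrtr_sqr gtr0_norm.
  by rewrite ler_sqrt ?sqr_ge0 //; have := sqr_ge0 e; lra.
- move=> t /tT' tT; have [s1 s2] := summ_ln (cG tT); have ra := rcoefs_ag (Hc tT).1.
  exists (serR (ag (c t))); split.
  + by apply: contV_in_L2; exact: contV_serR s2.
  + rewrite (fE t tT) absgrad1; apply/funext => k; exact: fourier_serR s2 ra k.
  + apply/Hnorm_cvg0 => e e0; have e2 : 0 < e / 2 by rewrite divr_gt0.
    have [d d0 Hd] := coef_diff (fun s sT => (Hc sT).2) HD HE tT e2.
    rewrite near_withinE; exists d => // h /= hs h0 /tT' hT; rewrite sub0r normrN in hs.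
    apply: Hnorm_le; first exact: ltW.
    move=> n; have h2 : 0 < h ^+ 2 by rewrite exprn_even_gt0.
    rewrite -(ler_pM2l h2) mulr_sumr.
    apply: (@le_trans _ _ (3 * (h * (e / 2)) ^+ 2)); last by have := sqr_ge0 (h * e); lra.
    apply: le_trans (ler_wpM2l _ (Hd h hT hs n)) => //; rewrite mulr_sumr; apply: ler_sum => k _.
    have E1 := congr1 (fun u : int -> V => u k) (fE _ hT).
    have E2 := congr1 (fun u : int -> V => u k) (fE _ tT).
    have E3 := fourier_cross_serR k (cG tT) (Hc tT).1.
    have EE := congr2 (fun a b : V => (h^-1)%:C *: a - b) (congr2 (fun a b : V => a - b) E1 E2) E3.
    apply: (eq_ind_r (fun u : V => h ^+ 2 * (wt (3 / 2) k * sqv u) <= _) _ EE).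
    set x := sqv (_ - _ - _).
    have -> : sqv ((h^-1)%:C *: (c (t + h) k - c t k) - Gc (c t) k) = h ^- 2 * x.
      rewrite /x; move: (c (t + h) k - c t k) (Gc (c t) k) => u v.
      have -> : (h^-1)%:C *: u - v = (h^-1)%:C *: (u - h%:C *: v).
        by rewrite scalerBr scalerA -rmorphM /= mulVf // scale1r.
      by rewrite sqvZ nc_real real_normK ?num_real // exprVn.
    have x0 : 0 <= x by exact: sqv_ge0.
    have -> : h ^+ 2 * (wt (3 / 2) k * (h ^- 2 * x)) = wt (3 / 2) k * x.
      by rewrite mulrCA [h ^+ 2 * _]mulrA mulfV ?mul1r // expf_neq0.
    rewrite [leRHS]mulrA ler_wpM2r //.
    have h3 : wt (3%:R / 2) k <= 1 + 3 * az k ^+ 3 by apply: wt_az => //; lra.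
    have a0 := @az_ge0 R k; have := exprn_ge0 3 a0; have := exprn_ge0 2 a0; move: h3; lra.
- by move=> z; rewrite c_init -S0_ser.
Qed.

Section Comparison.
Variable S' : R -> circle R -> 'rV[R]_3.
Hypothesis hS' : strong_solution T S0 S'.

Let c' (t : R) := fourier (S' t).

Let cont' (t : R) : 0 <= t < T -> contV (S' t).
Proof. by case: hS' => h _ _ _ /h [/contVP]. Qed.

Let yn' (t : R) n : 0 <= t < T -> yn n (c' t) <= 2 * fine (Hnorm (5 / 2) (c' t)) ^+ 2.
Proof. by case: hS' => h _ _ _ /h [_ _ [_ hh]]; exact: yn_Hnorm. Qed.

(** Continuity in time bounds the norm near each time, and compactness of [0, t1] makes the bound
    uniform; on the half-open interval a strong solution need not be bounded. *)
Lemma strong_bounded (t1 : R) : 0 <= t1 < T -> exists M : R, forall t n, 0 <= t <= t1 -> yn n (c' t) <= M.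
Proof.
move=> /andP[t10 t1T].
pose P (M s : R) : Prop := 0 <= s < T -> forall n, yn n (c' s) <= M.
have cov (t : R) : `[0, t1]%classic t -> \forall s \near t & M \near +oo, P M s.
  rewrite /= in_itv /= => /andP[t0 tt1].
  have tT : 0 <= t < T by rewrite t0 (le_lt_trans tt1).
  have [_ hc _ _] := hS'; have /Hnorm_cvg0/(_ 1 ltr01) := hc t tT.
  rewrite near_withinE => -[d /= d0 Hd].
  pose M0 := 2 * (2 + 2 * fine (Hnorm (5 / 2) (c' t)) ^+ 2).
  exists (ball t d, [set M | M0 <= M]) => [/=|[s M] /= [hs MM] sT n].
    by split; [exists d|exists M0; split; [rewrite num_real|move=> x /ltW]].
  apply: le_trans MM.
  have hb : (Hnorm (5 / 2) (fun k => (fourier (S' s) k - fourier (S' t) k)%R) <= 1%:E)%E.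
    by apply: Hd; rewrite //= in_itv /=.
  have y1 := yn_le_Hnorm n hb; have y2 := yn' n tT.
  have : yn n (c' s) <= 2 * (yn n (fun k => fourier (S' s) k - fourier (S' t) k) + yn n (c' t)).
    rewrite -big_split /= mulr_sumr; apply: ler_sum => k _; rewrite -mulrDr mulrCA.
    rewrite ler_wpM2l ?(ltW (one5_gt0 k)) //.
    by rewrite -{1}(subrK (c' t k) (c' s k)); exact: sqvD_le.
  move=> h; apply: (le_trans h); rewrite expr1n mulr1 in y1.
  by rewrite /M0 ler_wpM2l // lerD.
have [A [_ HA]] := (compact_near_coveringP _).1 (@segment_compact R 0 t1) _ _ _ _ cov.
exists (A + 1) => t n tt1; have a1 : A < A + 1 by rewrite ltrDl.
have tI : `[0, t1]%classic t by rewrite /= in_itv.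
have tT : 0 <= t < T by case/andP: tt1 => -> h; exact: le_lt_trans t1T.
exact: (HA _ a1 t tI tT n).
Qed.

(** The function [g] in the definition of a strong solution is determined by its coefficients only
    up to a null set, which the integrals defining the coefficients of the product ignore. *)
Let Gc' (t : R) k : 0 <= t < T -> forall g, in_L2 g -> fourier g = absgrad 1 (c' t) ->
  fourier (fun z => cross (S' t z) (g z)) k = Gc (c' t) k.
Proof.
move=> tT g g2 ga; pose Y' := 2 * fine (Hnorm (5 / 2) (c' t)) ^+ 2.
have lG n : ln n (c' t) <= 6 * (1 + Y').
  by apply: (le_trans (ln_le _ _)); rewrite ler_wpM2l // lerD2l; exact: yn'.
have [s1 s2] := summ_ln lG.
have rc := rcoefs_fourier (contV_rintV (cont' tT)).
have ra := rcoefs_ag rc.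
have gE : {ae (@lebesgue_measure R), forall x : R, g (expi x) = serR (ag (c' t)) (expi x)}.
  apply: fourier_ae; first exact: in_L2_rintV.
    by apply: contV_rintV; exact: contV_serR s2.
  by move=> l; rewrite ga absgrad1 (fourier_serR s2 ra).
rewrite -(fourier_cross_serR k lG rc).
have -> : (fun z => cross (serR (c' t) z) (serR (ag (c' t)) z)) = (fun z => cross (S' t z) (serR (ag (c' t)) z)).
  by apply/funext => z; rewrite [in RHS](serR_fourier (cont' tT) s1).
have cS := contV_serR s2.
have rint_cross (f : circle R -> 'rV[R]_3) : rintV f -> rintV (fun z => cross (S' t z) (f z)).
  move=> hf j; have ct : contV (S' t) by exact: cont'.
  have h1 := rint_mul (hf (j + 2)) (ct (j + 1)); have h2 := rint_mul (hf (j + 1)) (ct (j + 2)).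
  apply: rint_ext (rint_add h1 (rint_scale (-1) h2)) => x _.
  by rewrite mxE mulN1r [_ * S' _ _ _ _]mulrC [X in _ - X]mulrC.
have := fourier_ae_eq (rint_cross _ (in_L2_rintV g2)) (rint_cross _ (contV_rintV cS)).
move=> /(_ _) E; rewrite E //.
by apply: negligibleS gE => x /= n e; apply: n; rewrite e.
Qed.

(** Extension by zero outside [0, t1] makes the coefficients real at all times, as the stability
    estimate asks. *)
Lemma strong_coef (t1 : R) k : 0 <= t1 < T ->
  let u t := if (0 <= t <= t1) then c' t else (fun=> 0) in
  DV t1 (fun t => u t k) (fun t => Gc (u t) k).
Proof.
move=> /andP[t10 t1T] u.
have key (t e : R) : 0 <= t <= t1 -> 0 < e -> exists2 d : R, 0 < d & forall s, 0 <= s <= t1 ->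
    `|s - t| < d -> forall j, Normc.normc ((u s k - u t k - (s - t)%:C *: Gc (u t) k) 0 j) <= e * `|s - t|.
  move=> tt1 e0; have tT : 0 <= t < T by case/andP: tt1 => -> h; exact: le_lt_trans t1T.
  have [_ _ /(_ t tT) [g [g2 ga hg]] _] := hS'.
  have /Hnorm_cvg0/(_ e e0) := hg; rewrite near_withinE => -[d /= d0 Hd].
  exists d => // s st1 sd j; have [->|st] := eqVneq s t.
    by rewrite !subrr scale0r subrr mxE normr0 mulr0 Normc.normc0.
  have sT : 0 <= s < T by case/andP: st1 => -> h; exact: le_lt_trans t1T.
  have h0 : s - t != 0 by rewrite subr_eq0.
  have ts : t + (s - t) = s by rewrite addrC subrK.
  have := Hd (s - t); rewrite /= sub0r normrN ts => /(_ sd h0 sT) hN.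
  have := mode_le_Hnorm k j _ hN; rewrite (Gc' k tT g2 ga) divr_ge0 // => /(_ isT).
  rewrite /u st1 tt1 /c'.
  move: (fourier (S' s) k) (fourier (S' t) k) (Gc (fourier (S' t)) k) => p q w.
  have -> : p - q - (s - t)%:C *: w = (s - t)%:C *: (((s - t)^-1)%:C *: (p - q) - w).
    by rewrite scalerBr scalerA -rmorphM /= mulfV // scale1r.
  by rewrite entryZ Normc.normcM nc_real mulrC; apply: ler_wpM2r.
move=> j; split; apply: D1_key => t e tt1 e0; have [d d0 Hd] := key t e tt1 e0; exists d => // s st1 sd.
- apply: le_trans (Hd s st1 sd j); rewrite !entryB entryZ; apply: le_trans (Re_le_nc _).
  by rewrite !Re_add !Re_opp Re_scale mulrC.
- apply: le_trans (Hd s st1 sd j); rewrite !entryB entryZ; apply: le_trans (Im_le_nc _).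
  by rewrite !Im_add !Im_opp Im_scale mulrC.
Qed.

(** The truncation of a strong solution solves the Galerkin system up to the truncation error of its
    nonlinearity. Stability, with the regularity bound resting on the approximations [cn], makes
    these converge to it. *)
Lemma strong_unique (t : R) z : 0 <= t < T -> S' t z = serR (c t) z.
Proof.
move=> tT; have /andP[t0 tT'] := tT.
have [M HM] := strong_bounded tT; have tt : 0 <= t <= t by rewrite t0 lexx.
pose u s := if (0 <= s <= t) then c' s else (fun=> 0).
have uE : u t = c' t by rewrite /u tt.
have ur s : rcoefs (u s).
  rewrite /u; case: ifP => [/andP[s0 st]|_]; last by move=> k; rewrite conjv0.
  by apply: rcoefs_fourier; apply: contV_rintV; apply: cont'; rewrite s0 (le_lt_trans st).
pose G' := 6 * (1 + M).
have M0 : 0 <= M by apply: le_trans (HM t 0%N tt); exact: yn_ge0.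
have uG s n : 0 <= s <= t -> ln n (u s) <= G'.
  move=> st; rewrite /u st; apply: (le_trans (ln_le _ _)).
  by rewrite ler_wpM2l // lerD2l; exact: HM.
pose e n s k := Gc (u s) k - cv n (u s) (ag (u s)) k.
pose B := (2 * G' ^+ 2) ^+ 2 * t * expR ((3 * G + 1) * t).
have G0 : 0 <= G by apply: le_trans (cG z0 0); exact: ln_ge0.
have B0 : 0 <= B := mulr_ge0 (mulr_ge0 (sqr_ge0 _) t0) (expR_ge0 _).
have stab n : \sum_(k <- win n) sqv (cn n t k - tr n (c' t) k) <= sn n ^+ 2 * B.
  have [gn init _] := Hcn n.
  have D k : (`|k| <= n)%N -> DV t (fun s => tr n (u s) k)
      (fun s => cv n (tr n (u s)) (ag (tr n (u s))) k + e n s k).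
    move=> kn; have := strong_coef k tT; rewrite -/u => uD.
    have -> : (fun s => tr n (u s) k) = (fun s => u s k) by apply/funext => s; rewrite /tr kn.
    have -> // : (fun s => cv n (tr n (u s)) (ag (tr n (u s))) k + e n s k) = (fun s => Gc (u s) k).
    by apply/funext => s; rewrite ag_tr cv_tr // /e addrC subrK.
  have utr s : rcoefs (tr n (u s)).
    by move=> k; rewrite /tr abszN; case: ifP => _; [exact: ur|rewrite conjv0].
  have e0 : 0 <= (2 * sn n * G' ^+ 2) ^+ 2 by exact: sqr_ge0.
  have hB s : 0 < s < t -> \sum_(k <- win n) az k * nv (cn n s k) <= G.
    move=> /andP[s0 st]; apply: le_trans (az_sum_le _ _) (cnG n _ n).
    by rewrite (ltW s0) (le_trans (ltW st)) // ltW.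
  have he s : 0 < s < t -> \sum_(k <- win n) sqv (e n s k) <= (2 * sn n * G' ^+ 2) ^+ 2.
    move=> /andP[s0 st]; have sst : 0 <= s <= t by rewrite !ltW.
    apply: (le_trans (sum_sqv_le _ _)); rewrite lerXn2r ?nnegrE //.
    - by apply: sumr_ge0 => k _; exact: nv_ge0.
    - exact: (mulr_ge0 (mulr_ge0 (ler0n R 2) (sn_ge0 n)) (sqr_ge0 _)).
    - exact: (Gc_trunc (fun m => uG s m sst) n (win_uniq n)).
  have := gal_stab gn utr D G0 hB he e0 tt; rewrite uE.
  have -> : \sum_(k <- win n) sqv (cn n 0 k - tr n (u 0) k) = 0.
    rewrite big1 // => k _; have [_ _ _ i0] := hS'.
    have -> : u 0 = fourier S0 by rewrite /u lexx t0 /c'; congr fourier; apply/funext => w; exact: i0.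
    by rewrite init subrr sqv0.
  rewrite add0r => h; apply: (le_trans h).
  by rewrite /B !exprMn; move: (expR _) => x; lra.
have cc k : c t k = c' t k.
  have tT2 : 0 <= t <= T by rewrite t0 ltW.
  apply: (@tendsV_eq _ (fun n => cn n t k)).
    by exists (fun n => K * sn n); [exact: scale_sn_cvg0|move=> n; exact: HK].
  exists (fun n => if (`|k| <= n)%N then Num.sqrt (3 * B) * sn n else nv (c' t k - cn n t k)).
    have := scale_sn_cvg0 (Num.sqrt (3 * B)) => /cvgrPdist_le h.
    apply/cvgrPdist_le => d d0; have [N _ HN] := h d d0.
    exists (maxn N `|k|%N) => // n /=; rewrite geq_max => /andP[Nn kn].
    by rewrite kn; exact: HN.
  move=> n; case: ifP => // kn.
  rewrite -ler_sqr ?nnegrE ?nv_ge0 ?mulr_ge0 ?sqrtr_ge0 ?sn_ge0 //.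
  have b3 : 0 <= 3 * B by rewrite mulr_ge0.
  have s0 l : 0 <= sqv (cn n t l - tr n (c' t) l) by exact: sqv_ge0.
  have h1 : sqv (cn n t k - c' t k) <= sn n ^+ 2 * B.
    apply: le_trans (stab n).
    rewrite (bigD1_seq k) ?win_uniq ?mem_win //= {1}/tr kn lerDl sumr_ge0 //.
  apply: (le_trans (nv_sqv _)); rewrite -sqvN opprB exprMn (sqr_sqrtr b3).
  by move: h1; lra.
have lG n : ln n (c' t) <= G' by rewrite -uE; exact: uG.
have [s1 _] := summ_ln lG.
rewrite (serR_fourier (cont' tT) s1); congr (serR _ z).
by apply/funext => k; rewrite cc.
Qed.
End Comparison.
End StrongSolution.

(** * Harmonic analysis on the lattice *)

Section Lattice.
Context {R : realType}.
Local Notation C := R[i].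
Local Notation V := 'rV[R[i]]_3.
Local Notation nc := (@Normc.normc R).
Local Notation az := (@az R).
Variable n : nat.
Let N := n.*2.+1.
Local Notation I := 'I_n.*2.+1.
Let rN : R := N%:R.

Let rN_gt0 : 0 < rN. Proof. by rewrite ltr0n. Qed.
Let rN_neq0 : rN != 0. Proof. by rewrite gt_eqF. Qed.

Definition om (i : int) : C := ek i (2 * pi / N%:R).
Arguments om : simpl never.
Definition en (j : int) (k : I) : C := val (node k) ^ j.

Lemma om0 : om 0 = 1. Proof. exact: ek0. Qed.
Lemma omD i j : om (i + j) = om i * om j. Proof. exact: ekD. Qed.
Lemma nc_om i : nc (om i) = 1. Proof. exact: nc_ek. Qed.
Lemma om_conj i : conjc (om i) = om (- i). Proof. exact: conj_ek. Qed.

Lemma en_om j (k : I) : en j k = om (j * k%:Z).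
Proof.
rewrite /en /om -[LHS]/(ek j (2 * pi * k%:R / N%:R)) !ekE.
by congr (cos _ +i* sin _); rewrite intrM -pmulrn; field.
Qed.

Lemma omN (t : int) : om (t * N%:Z) = 1.
Proof.
rewrite /om ekE intrM -pmulrn -mulrA.
have -> : N%:R * (2 * pi / N%:R) = 2 * pi :> R by field.
by rewrite cos_per sin_per.
Qed.

Lemma om_neq1 (i : int) : i != 0 -> (`|i| < N)%N -> om i != 1.
Proof.
have pos m : (0 < m < N)%N -> om m%:Z != 1.
  move=> /andP[m0 mN]; rewrite /om ekE; apply/eqP => /(congr1 (@complex.Re R)) /= h.
  pose x : R := pi * m%:R / rN.
  have x1 : 0 < sin x.
    apply: sin_gt0_pi; have p0 := @pi_gt0 R.
    rewrite divr_gt0 ?mulr_gt0 ?ltr0n //= ltr_pdivrMr // ltr_pM2l // ltr_nat //.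
  have e : m%:~R * (2 * pi / N%:R) = x + x :> R by rewrite /x -pmulrn; field.
  have := cos2Dsin2 x; move: h; rewrite e cosD; have := mulr_gt0 x1 x1; lra.
case: (intP i) => [|m|m] //; first by move=> _ h; apply: pos; rewrite /= h.
move=> _ h; apply/eqP => /(congr1 conjc); rewrite om_conj opprK => h1.
have : om m.+1%:Z != 1 by apply: pos; move: h; rewrite abszN.
by rewrite h1 conjc1 eqxx.
Qed.

Lemma geo_sum0 (z : C) (m : nat) : z ^+ m = 1 -> z != 1 -> \sum_(i < m) z ^+ i = 0.
Proof.
move=> zm z1; have := subrX1 z m; rewrite zm subrr => /esym/eqP.
by rewrite mulf_eq0 subr_eq0 (negPf z1) /= => /eqP.
Qed.

Lemma en0 k : en 0 k = 1. Proof. by rewrite en_om mul0r om0. Qed.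

Lemma om_exp i (m : nat) : om (i * m%:Z) = om i ^+ m.
Proof.
elim: m => [|m IH]; first by rewrite mulr0 om0 expr0.
by rewrite exprS -IH -omD; congr om; lia.
Qed.

Lemma sum_en (j : int) : (`|j| < N)%N -> \sum_(k < N) en j k = if j == 0 then N%:R else 0.
Proof.
move=> jN; under eq_bigr do rewrite en_om om_exp.
case: eqP => [->|/eqP j0].
  by rewrite om0; under eq_bigr do rewrite expr1n; rewrite sumr_const card_ord.
by apply: geo_sum0; [rewrite -om_exp omN|exact: om_neq1].
Qed.

Lemma sum_win_om (i : int) : (`|i| < N)%N -> \sum_(q <- win n) om (q * i) = if i == 0 then N%:R else 0.
Proof.
move=> iN; rewrite win_ord.
rewrite (eq_bigr (fun m : 'I_N => om (- (n%:Z * i)) * om i ^+ m)); last first.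
  by move=> m _; rewrite -om_exp -omD; congr om; ring.
rewrite -mulr_sumr; case: eqP => [->|/eqP i0].
  by rewrite mulr0 oppr0 om0 mul1r; under eq_bigr do rewrite expr1n; rewrite sumr_const card_ord.
by rewrite geo_sum0 ?mulr0 //; [rewrite -om_exp omN|exact: om_neq1].
Qed.

Definition KN (k l : I) : R := 2 / N%:R * nc (val (node k) - val (node l)) ^- 2.

Lemma KN_ge0 k l : 0 <= KN k l.
Proof. by rewrite mulr_ge0 ?divr_ge0 ?invr_ge0 ?sqr_ge0. Qed.

Lemma KN_sym k l : KN k l = KN l k.
Proof. by rewrite /KN -[val _ - _]opprB normcN. Qed.

Lemma om_shift j (k m : I) : om (j * (nat_of_ord (k + m)%R)%:Z) = om (j * k%:Z) * om (j * m%:Z).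
Proof.
rewrite -omD -mulrDr /=.
have -> : k%:Z + m%:Z = ((k + m) %/ N)%N%:Z * N%:Z + ((k + m) %% N)%N%:Z.
  by rewrite -PoszD -PoszM -PoszD -divn_eq.
by rewrite mulrDr omD mulrA omN mul1r.
Qed.

Definition Lam (j : int) : C :=
  (2 / N%:R)%:C * \sum_(m < N) (nc (1 - om m%:Z) ^- 2)%:C * (1 - om (j * m%:Z)).

(** The kernel depends only on the difference of the nodes, and cyclic addition on the index type
    makes the shift by [k] a bijection. *)
Lemma eigen_aux j k : \sum_(l < N) (KN k l)%:C * (en j k - en j l) = Lam j * en j k.
Proof.
rewrite (reindex_inj (addrI k)) /= /Lam mulrAC mulr_sumr.
rewrite [RHS](eq_bigr (fun m : 'I_N => (2 / N%:R)%:C * en j k * ((nc (1 - om m%:Z) ^- 2)%:C * (1 - om (j * m%:Z))))) //.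
apply: eq_bigr => m _.
have -> : KN k (k + m) = 2 / N%:R * nc (1 - om m%:Z) ^- 2.
  rewrite /KN; have -> : val (node k) - val (node (k + m)) = val (node k) * (1 - om m%:Z).
    have e1 (l : I) : val (node l) = om (1 * l%:Z) by rewrite -en_om /en expr1z.
    by rewrite !e1 om_shift mulrBr mulr1 !mul1r.
  have n1 : nc (val (node k)) = 1 by rewrite -[val _](expr1z) nc_circle.
  by rewrite Normc.normcM n1 mul1r.
by rewrite !en_om om_shift rmorphM /=; ring.
Qed.

Lemma Lam0 : Lam 0 = 0.
Proof. by rewrite /Lam big1 ?mulr0 // => m _; rewrite mul0r om0 subrr mulr0. Qed.

Lemma Lam_per j t : Lam (j + t * N%:Z) = Lam j.
Proof.
congr (_ * _); apply: eq_bigr => m _; congr (_ * (1 - _)).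
by rewrite mulrDl omD [t * _ * _]mulrAC omN mulr1.
Qed.

Lemma nc_one_sub (u : C) : nc u = 1 -> (nc (1 - u) ^+ 2)%:C = 2 - u - conjc u.
Proof.
move=> h; have := nc_sqr u; rewrite h expr1n nc_sqr.
by case: u h => a b _ /= ab; apply: complexP => /=; nra.
Qed.

(** The factor 2 - om(m) - om(-m) is |1 - om(m)|^2 and cancels the kernel for nonzero m. What
    remains is the sum of om(jm) over m <> 0, equal to -1 because the full sum vanishes. *)
Lemma Lam_second j : (0 < j < N)%N -> Lam (j%:Z + 1) - 2 * Lam j + Lam (j%:Z - 1) = - (2 / N%:R)%:C.
Proof.
move=> /andP[j0 jN].
have -> : Lam (j%:Z + 1) - 2 * Lam j + Lam (j%:Z - 1) = (2 / N%:R)%:C *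
   \sum_(m < N) (nc (1 - om m%:Z) ^- 2)%:C * (om (j%:Z * m%:Z) * (2 - om m%:Z - om (- m%:Z))).
  rewrite /Lam mulrCA -mulrBr -mulrDr; congr (_ * _).
  rewrite mulr_sumr -sumrB -big_split /=; apply: eq_bigr => m _.
  rewrite [(j%:Z + 1) * _]mulrDl [(j%:Z - 1) * _]mulrDl !omD mulNr mul1r.
  by move: (om _) (om _) (om _) (_%:C) => x y z w; ring.
rewrite (eq_bigr (fun m : 'I_N => if m == ord0 then 0 else om (j%:Z * m%:Z))); last first.
  move=> m _; case: eqP => [->|/eqP m0].
    rewrite -[Posz (@ord0 _)]/(0 : int) oppr0 om0.
    have -> : (2 - 1 - 1 : C) = 0 by ring.
    by rewrite !mulr0.
  rewrite -om_conj -nc_one_sub ?nc_om // mulrCA -[X in _ * X](rmorphM (real_complex R)).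
  rewrite mulVf ?rmorph1 ?mulr1 //.
  rewrite expf_eq0 /=; apply/eqP => /Normc.eq0_normc /eqP; rewrite subr_eq0 eq_sym.
  by apply/negP; apply: om_neq1; [rewrite eqz_nat; exact: m0|rewrite absz_nat; exact: ltn_ord].
have := @sum_en j%:Z; rewrite absz_nat => /(_ jN); rewrite eqz_nat (gtn_eqF j0).
rewrite (eq_bigr (fun m : 'I_N => om (j%:Z * m%:Z))); last by move=> m _; rewrite en_om.
rewrite (bigD1 ord0) //= mulr0 om0 => h.
rewrite (bigD1 ord0) //= add0r.
rewrite (eq_bigr (fun m : 'I_N => om (j%:Z * m%:Z))); last by move=> m /negPf ->.
have -> : \sum_(m < N | m != ord0) om (j%:Z * m%:Z) = -1 by apply/eqP; rewrite -addr_eq0 addrC; apply/eqP.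
by rewrite mulrN1.
Qed.

(* A sequence with constant second difference is quadratic; [Lam N = 0] then fixes the slope. *)
Lemma Lam_nat_aux (j : nat) : (j <= N)%N ->
  Lam j%:Z = j%:R * Lam 1 - (j%:R * (j%:R - 1) / N%:R)%:C.
Proof.
elim/ltn_ind: j => -[|[|j]] IH jN.
- by rewrite Lam0 !mul0r subr0.
- by rewrite mul1r subrr mulr0 mul0r subr0.
have := @Lam_second j.+1; rewrite (IH j.+1) // ?(ltnW jN) //.
have -> : j.+1%:Z - 1 = j%:Z by lia.
have -> : j.+1%:Z + 1 = j.+2%:Z by lia.
rewrite (IH j) //; last lia.
move=> /(_ jN) e.
have -> : Lam j.+2%:Z = - (2 / N%:R)%:C + 2 * (j.+1%:R * Lam 1 - (j.+1%:R * (j.+1%:R - 1) / N%:R)%:C)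
   - (j%:R * Lam 1 - (j%:R * (j%:R - 1) / N%:R)%:C) by rewrite -e; ring.
move: (Lam 1) => z; rewrite -[j.+2%:R]natr1 -[j.+1%:R]natr1 -[j.+2%:R]natr1 -[j.+1%:R]natr1.
have -> : (2 / N%:R)%:C = 2 * (N%:R^-1)%:C :> C by rewrite rmorphM rmorph_nat.
rewrite !(rmorphM, rmorphB, rmorphD, rmorph_nat, rmorph1) /=.
by move: (_%:C) (j%:R) => x y; ring.
Qed.

Lemma Lam_nat (j : nat) : (j <= N)%N -> Lam j%:Z = (j%:R - j%:R ^+ 2 / N%:R)%:C.
Proof.
move=> jN; have := Lam_nat_aux (leqnn N).
have := Lam_per 0 1; rewrite mul1r add0r Lam0 => -> e.
have e1 : Lam 1 = ((N%:R - 1) / N%:R)%:C.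
  have NC : (N%:R : C) != 0 by rewrite pnatr_eq0.
  apply: (mulfI NC); apply/eqP; rewrite -subr_eq0 [X in _ == X]e; apply/eqP; congr (_ - _).
  by rewrite -[N%:R in LHS](rmorph_nat (real_complex R)) -rmorphM mulrA.
rewrite Lam_nat_aux // e1 -(rmorph_nat (real_complex R)) -rmorphM -rmorphB /=; congr _%:C.
by field.
Qed.

Lemma Lam_opp j : Lam (- j) = Lam j.
Proof.
have pos (m : nat) : (m <= N)%N -> Lam (- m%:Z) = Lam m%:Z.
  move=> mN; rewrite -(Lam_per _ 1) mul1r addrC subzn // !Lam_nat ?leq_subr //.
  by congr _%:C; rewrite natrB //; field.
have e i : i = (i %% N%:Z)%Z + (i %/ N%:Z)%Z * N%:Z by rewrite addrC -divz_eq.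
have m0 : 0 <= (j %% N%:Z)%Z by rewrite modz_ge0.
have m1 : (j %% N%:Z)%Z < N%:Z by rewrite ltz_pmod.
rewrite [in LHS](e j) opprD -mulNr Lam_per [in RHS](e j) Lam_per.
by case: (j %% N%:Z)%Z m0 m1 => // m _ mN; rewrite pos //; apply: ltnW.
Qed.

Definition lamR (j : int) : R := complex.Re (Lam j).

Lemma lamR_win (q : int) : (`|q| <= n)%N -> Lam q = (lamR q)%:C /\ lamR q = az q - az q ^+ 2 / N%:R.
Proof.
move=> qn; suff e : Lam q = (az q - az q ^+ 2 / N%:R)%:C by rewrite /lamR e.
have [->|->] : q = `|q|%N%:Z \/ q = - `|q|%N%:Z by lia.
  by rewrite Lam_nat //; rewrite /N; lia.
by rewrite Lam_opp azN Lam_nat //; rewrite /N; lia.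
Qed.

Lemma fold_int (j : int) : exists q t : int, j = q + t * N%:Z /\ (`|q| <= n)%N.
Proof.
exists (((j + n%:Z) %% N%:Z)%Z - n%:Z), ((j + n%:Z) %/ N%:Z)%Z.
have m0 : 0 <= ((j + n%:Z) %% N%:Z)%Z by rewrite modz_ge0.
have m1 : ((j + n%:Z) %% N%:Z)%Z < N%:Z by rewrite ltz_pmod.
by split; [have := divz_eq (j + n%:Z) N%:Z|]; rewrite /N in m1 *; lia.
Qed.

Lemma fold_le (q t : int) : (`|q| <= n)%N -> (`|q| <= `|(q + t * N%:Z)%R|)%N.
Proof.
move=> qn; case: (intP t) => [|m|m]; first by rewrite mul0r addr0.
  have : m.+1%:Z * N%:Z = m%:Z * N%:Z + N%:Z by rewrite -add1n PoszD; ring.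
  have : 0 <= m%:Z * N%:Z by [].
  by move: (m%:Z * _) (m.+1%:Z * _) => x y; rewrite /N; lia.
have : - m.+1%:Z * N%:Z = - (m%:Z * N%:Z) - N%:Z by rewrite -add1n PoszD; ring.
have : 0 <= m%:Z * N%:Z by [].
by move: (m%:Z * _) (- m.+1%:Z * _) => x y; rewrite /N; lia.
Qed.

Lemma lam_real j : Lam j = (lamR j)%:C.
Proof.
by have [q [t [-> qn]]] := fold_int j; rewrite /lamR Lam_per; have [] := lamR_win qn.
Qed.

(** The eigenvalues are periodic, and the representative in the window is the smallest of its
    residue class, so the upper bound extends to all modes. *)
Lemma lamR_bounds j : 0 <= lamR j <= az j.
Proof.
have [q [t [-> qn]]] := fold_int j; rewrite /lamR Lam_per -/(lamR q) (lamR_win qn).2.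
have a0 := @az_ge0 R q.
have aN : az q <= N%:R by rewrite ler_nat /N; lia.
have qq : 0 <= az q - az q ^+ 2 / N%:R.
  by rewrite subr_ge0 ler_pdivrMr // expr2 ler_wpM2l.
rewrite qq /=; apply: (@le_trans _ _ (az q)).
  by rewrite gerBl divr_ge0 ?exprn_ge0.
by rewrite ler_nat fold_le.
Qed.

(** On the window |q| <= N/2, so the correction q^2/N takes away at most half. Hence the discrete
    energy controls the true H^{1/2} norm. *)
Lemma lamR_lower (q : int) : (`|q| <= n)%N -> az q <= 2 * lamR q.
Proof.
move=> qn; rewrite (lamR_win qn).2; have a0 := @az_ge0 R q.
have aN : 2 * az q <= N%:R by rewrite -natrM ler_nat /N; lia.
have : az q ^+ 2 / N%:R <= az q / 2 by rewrite ler_pdivrMr // expr2; nra.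
lra.
Qed.

Implicit Types f g : I -> V.

Definition lam f (k : I) : V := \sum_(l < N) (KN k l)%:C *: (f k - f l).
Definition ltrig (r : seq int) (b : int -> V) (k : I) : V := \sum_(j <- r) en j k *: b j.
Definition dft f (q : int) : V := (N%:R^-1)%:C *: \sum_(l < N) en (- q) l *: f l.
(* The Dirichlet form of |nabla|_N. *)
Definition Bform f g : R :=
  2^-1 * \sum_(k < N) \sum_(l < N) KN k l * rdot (f k - f l) (g k - g l).

Lemma toC_lattice_absgrad (F : I -> 'rV[R]_3) k :
  toC (lattice_absgrad F k) = lam (fun l => toC (F l)) k.
Proof.
rewrite /lattice_absgrad /lam /toC map_mxZ map_mx_sum scaler_sumr.
rewrite [RHS](bigD1 k) //= subrr scaler0 add0r.
by apply: eq_bigr => l _; rewrite map_mxZ map_mxB scalerA -rmorphM.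
Qed.

Lemma lam_ltrig r b k : lam (ltrig r b) k = ltrig r (fun j => Lam j *: b j) k.
Proof.
rewrite /lam /ltrig.
under eq_bigr => l _ do rewrite -sumrB scaler_sumr.
rewrite exchange_big /=; apply: eq_bigr => j _.
under eq_bigr => l _ do rewrite -scalerBl scalerA.
by rewrite -scaler_suml eigen_aux scalerA mulrC.
Qed.

Lemma Bform_lam f g : Bform f g = \sum_(k < N) rdot (f k) (lam g k).
Proof.
have e : \sum_(k < N) rdot (f k) (lam g k) =
    \sum_(k < N) \sum_(l < N) KN k l * rdot (f k) (g k - g l).
  apply: eq_bigr => k _; rewrite /lam rdot_sumr; apply: eq_bigr => l _.
  by rewrite rdotZr.
have e' : \sum_(k < N) rdot (f k) (lam g k) =
    - \sum_(k < N) \sum_(l < N) KN k l * rdot (f l) (g k - g l).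
  rewrite e exchange_big -sumrN /=; apply: eq_bigr => k _; rewrite -sumrN; apply: eq_bigr => l _.
  by rewrite KN_sym !rdotBr; ring.
suff : \sum_(k < N) rdot (f k) (lam g k) + \sum_(k < N) rdot (f k) (lam g k) = 2 * Bform f g by lra.
rewrite {1}e e' /Bform mulrA mulfV ?mul1r // -sumrB; apply: eq_bigr => k _; rewrite -sumrB.
apply: eq_bigr => l _; rewrite -mulrBr; congr (_ * _).
by rewrite ![rdot _ (g k - g l)]rdotC rdotBr.
Qed.

Lemma Bform_sym f g : Bform f g = Bform g f.
Proof.
by congr (_ * _); apply: eq_bigr => k _; apply: eq_bigr => l _; rewrite rdotC.
Qed.

Lemma Bform_ge0 f : 0 <= Bform f f.
Proof.
rewrite mulr_ge0 ?invr_ge0 //; apply: sumr_ge0 => k _; apply: sumr_ge0 => l _.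
by rewrite mulr_ge0 ?KN_ge0 // -sqv_rdot sqv_ge0.
Qed.

(** N times a discrete squared H^{1/2} norm: the sums over the nodes are not normalised. *)
Definition Enorm f : R := \sum_(k < N) sqv (f k) + Bform f f.

Lemma Enorm_add f g : Enorm (fun k => f k + g k) <= 2 * (Enorm f + Enorm g).
Proof.
rewrite /Enorm /Bform.
have e1 : \sum_(k < N) sqv (f k + g k) <= 2 * (\sum_(k < N) sqv (f k) + \sum_(k < N) sqv (g k)).
  by rewrite -big_split mulr_sumr; apply: ler_sum => k _; apply: sqvD_le.
have e2 : \sum_(k < N) \sum_(l < N) KN k l * rdot (f k + g k - (f l + g l)) (f k + g k - (f l + g l)) <=
  2 * (\sum_(k < N) \sum_(l < N) KN k l * rdot (f k - f l) (f k - f l) +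
       \sum_(k < N) \sum_(l < N) KN k l * rdot (g k - g l) (g k - g l)).
  rewrite -big_split mulr_sumr; apply: ler_sum => k _.
  rewrite -big_split mulr_sumr; apply: ler_sum => l _ /=.
  rewrite -mulrDr mulrCA ler_wpM2l ?KN_ge0 // -!sqv_rdot opprD addrACA.
  exact: sqvD_le.
move: e1 e2; lra.
Qed.

Lemma sum_enM (p q : int) : p \in win n -> q \in win n ->
  \sum_(k < N) en (p - q) k = if p == q then N%:R else 0.
Proof.
rewrite !mem_win => pn qn; rewrite sum_en ?subr_eq0 //.
by rewrite /N; lia.
Qed.

Lemma en_conj j k : conjc (en j k) = en (- j) k.
Proof. by rewrite !en_om om_conj mulNr. Qed.

Lemma en_D i j k : en (i + j) k = en i k * en j k.
Proof. by rewrite !en_om mulrDl omD. Qed.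

Lemma en_per (q t : int) k : en (q + t * N%:Z) k = en q k.
Proof. by rewrite !en_om mulrDl omD [t * _ * _]mulrAC omN mulr1. Qed.

Lemma rdot_scale (z w : C) (a b : V) :
  rdot (z *: a) (w *: b) = complex.Re (conjc z * w * dotv (conjv a) b).
Proof.
rewrite rdotE dotvZr; congr complex.Re; rewrite /dotv !mulr_sumr.
apply: eq_bigr => j _.
have -> : conjv (z *: a) 0 j = conjc z * conjv a 0 j by rewrite !mxE; exact: rmorphM.
by rewrite -!mulrA mulrCA.
Qed.

Lemma parseval (a b : int -> V) :
  \sum_(k < N) rdot (ltrig (win n) a k) (ltrig (win n) b k) =
  N%:R * \sum_(q <- win n) rdot (a q) (b q).
Proof.
have e k : rdot (ltrig (win n) a k) (ltrig (win n) b k) =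
   complex.Re (\sum_(p <- win n) \sum_(q <- win n) en (q - p) k * dotv (conjv (a p)) (b q)).
  rewrite /ltrig rdotC rdot_sumr Re_sum; apply: eq_bigr => p _.
  rewrite rdotC rdot_sumr Re_sum; apply: eq_bigr => q _.
  by rewrite rdot_scale en_conj mulrC en_D mulrC [en _ _ * _]mulrC.
under eq_bigr do rewrite e.
rewrite -Re_sum exchange_big Re_sum mulr_sumr; apply: eq_big_seq => p pn.
rewrite exchange_big rdotE -Re_scale; congr complex.Re.
rewrite (eq_big_seq (fun q => if q == p then N%:R%:C * dotv (conjv (a p)) (b q) else 0)); last first.
  by move=> q qn /=; rewrite -mulr_suml sum_enM //; case: eqP; rewrite ?mul0r ?rmorph_nat.
by rewrite sum_if_eqM ?win_uniq.
Qed.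

Lemma ltrig_dft f k : ltrig (win n) (dft f) k = f k.
Proof.
rewrite /ltrig /dft.
under eq_bigr => q _ do rewrite scalerA mulrC -scalerA scaler_sumr.
rewrite -scaler_sumr exchange_big /= (eq_bigr (fun l => if l == k then N%:R *: f k else 0)); last first.
  move=> l _; under eq_bigr => q _ do rewrite scalerA !en_om -omD mulNr -mulrBr.
  rewrite -scaler_suml sum_win_om; last by have := ltn_ord k; have := ltn_ord l; rewrite /N; lia.
  rewrite subr_eq0 eqz_nat eq_sym (inj_eq val_inj).
  by case: eqP => [->|]; rewrite ?scale0r.
rewrite -big_mkcond big_pred1_eq scalerA -(rmorph_nat (real_complex R)) -rmorphM mulVf //.
by rewrite rmorph1 scale1r.
Qed.

Lemma Enorm_ltrig b : Enorm (ltrig (win n) b) = N%:R * \sum_(q <- win n) (1 + lamR q) * sqv (b q).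
Proof.
rewrite /Enorm Bform_lam.
under eq_bigr do rewrite sqv_rdot.
under [X in _ + X]eq_bigr do rewrite lam_ltrig.
rewrite !parseval -mulrDr -big_split /=; congr (_ * _); apply: eq_bigr => q _.
by rewrite lam_real rdotZr -sqv_rdot mulrDl mul1r.
Qed.

Lemma dft_Enorm f : \sum_(q <- win n) (1 + az q) * sqv (dft f q) <= 2 / N%:R * Enorm f.
Proof.
have -> : Enorm f = Enorm (ltrig (win n) (dft f)).
  by congr Enorm; apply/funext => k; rewrite ltrig_dft.
rewrite Enorm_ltrig mulrA divfK // mulr_sumr; apply: ler_sum_seq => q.
rewrite mem_win => qn; rewrite mulrA ler_wpM2r ?sqv_ge0 //.
by have := lamR_lower qn; lra.
Qed.

Lemma dft_ltrig b q : q \in win n -> dft (ltrig (win n) b) q = b q.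
Proof.
move=> qn; rewrite /dft /ltrig.
under eq_bigr => l _ do rewrite scaler_sumr.
rewrite exchange_big /= (eq_big_seq (fun p => if p == q then N%:R *: b p else 0)); last first.
  move=> p pn; under eq_bigr => l _ do rewrite scalerA -en_D addrC.
  by rewrite -scaler_suml sum_enM //; case: eqP; rewrite ?scale0r.
rewrite sum_if_eqM ?win_uniq // scalerA -(rmorph_nat (real_complex R)) -rmorphM mulVf //.
by rewrite rmorph1 scale1r.
Qed.

Lemma interp_trig (F : I -> 'rV[R]_3) z : interp F z = trig (win n) (dft (fun k => toC (F k))) z.
Proof.
rewrite /interp /trig win_ord; apply: eq_bigr => i _; congr (_ *: _).
rewrite /dft fmorphV rmorph_nat; congr (_ *: _); apply: eq_bigr => l _; congr (_ *: _).
exact: (ek_conj (i%:Z - n%:Z) (2 * pi * l%:R / N%:R)).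
Qed.

Lemma fourierC_interp (F : I -> 'rV[R]_3) q :
  fourierC (interp F) q = if (`|q| <= n)%N then dft (fun k => toC (F k)) q else 0.
Proof.
by rewrite (fourierC_ext (interp_trig F)) fourierC_trig ?win_uniq // mem_win.
Qed.

Lemma en_dist j k l : nc (en j k - en j l) ^+ 2 = 2 * complex.Re (en (- j) k * (en j k - en j l)).
Proof.
have e : en (- j) k * (en j k - en j l) = 1 - en (- j) k * en j l.
  have e0 : en (- j) k * en j k = 1 by rewrite -en_D addNr en0.
  by rewrite mulrBr; apply: (congr1 (fun x => x - _)); exact: e0.
have n1 : nc (en (- j) k * en j l) = 1.
  by rewrite Normc.normcM !nc_circle mulr1.
have -> : nc (en j k - en j l) = nc (1 - en (- j) k * en j l).
  by rewrite -e Normc.normcM nc_circle mul1r.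
move: (nc_one_sub n1) => /(congr1 (@complex.Re R)); rewrite e => /= ->.
by case: (_ * _) => a b /=; ring.
Qed.

(** By translation invariance the local Dirichlet energy of a mode is the same at every node; this
    gives oscillation bounds uniform in [k]. *)
Lemma KN_dist j k : \sum_(l < N) KN k l * nc (en j k - en j l) ^+ 2 = 2 * lamR j.
Proof.
under eq_bigr do rewrite en_dist mulrCA -Re_scale.
rewrite -mulr_sumr -Re_sum; congr (_ * _); rewrite /lamR; congr complex.Re.
under eq_bigr do rewrite mulrCA.
by rewrite -mulr_sumr eigen_aux mulrCA -en_D addNr en0 mulr1.
Qed.

(* Cauchy-Schwarz with weights |j|^{1/2}, the square root of the bound on the eigenvalue of [en j]. *)
Lemma ltrig_oscillation r b k (G : R) :
  \sum_(j <- r) Num.sqrt (az j) * nv (b j) <= G ->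
  \sum_(l < N) KN k l * nv (ltrig r b k - ltrig r b l) ^+ 2 <= 2 * G ^+ 2.
Proof.
move=> bG; pose th j : R := Num.sqrt (az j); pose d j l : R := nc (en j k - en j l).
have th0 j : 0 <= th j by apply: sqrtr_ge0.
have b0 j : 0 <= nv (b j) by apply: nv_ge0.
have d0 l : d 0 l = 0 by rewrite /d !en0 subrr Normc.normc0.
have G0 : 0 <= G by apply: le_trans bG; apply: sumr_ge0 => j _; rewrite mulr_ge0.
have one l : nv (ltrig r b k - ltrig r b l) ^+ 2 <=
    G * \sum_(j <- r) nv (b j) * ((th j)^-1 * d j l ^+ 2).
  have h1 : nv (ltrig r b k - ltrig r b l) <= \sum_(j <- r) th j * nv (b j) * ((th j)^-1 * d j l).
    rewrite /ltrig -sumrB; apply: le_trans (nv_sum _ _ _) _; apply: ler_sum => j _.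
    rewrite -scalerBl nvZ; have [->|j0] := eqVneq j 0; first by rewrite -/(d 0 l) d0 mul0r !mulr0.
    have t0 : th j != 0 by rewrite /th sqrtr_eq0 -ltNge (lt_le_trans ltr01) // az_ge1.
    by rewrite -/(d j l) mulrACA mulfV // mul1r mulrC.
  have h2 := @cauchy_schwarz_weighted R _ r (fun j => th j * nv (b j)) (fun j => (th j)^-1 * d j l)
    (fun j => mulr_ge0 (th0 j) (b0 j)).
  have h3 : nv (ltrig r b k - ltrig r b l) ^+ 2 <=
     (\sum_(j <- r) th j * nv (b j) * ((th j)^-1 * d j l)) ^+ 2.
    by rewrite ler_sqr // nnegrE ?nv_ge0 // (le_trans _ h1) ?nv_ge0.
  apply: le_trans h3 _; apply: le_trans h2 _.
  have -> : \sum_(j <- r) th j * nv (b j) * ((th j)^-1 * d j l) ^+ 2 =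
            \sum_(j <- r) nv (b j) * ((th j)^-1 * d j l ^+ 2).
    apply: eq_bigr => j _; have [->|j0] := eqVneq j 0; first by rewrite d0 !(mulr0, expr0n).
    have t0 : th j != 0 by rewrite /th sqrtr_eq0 -ltNge (lt_le_trans ltr01) // az_ge1.
    by field.
  apply: ler_wpM2r bG; apply: sumr_ge0 => j _.
  by rewrite mulr_ge0 // mulr_ge0 ?invr_ge0 ?sqr_ge0.
apply: (@le_trans _ _ (\sum_(l < N) KN k l * (G * \sum_(j <- r) nv (b j) * ((th j)^-1 * d j l ^+ 2)))).
  by apply: ler_sum => l _; rewrite ler_wpM2l ?KN_ge0.
have -> : \sum_(l < N) KN k l * (G * \sum_(j <- r) nv (b j) * ((th j)^-1 * d j l ^+ 2)) =
   G * \sum_(j <- r) nv (b j) * ((th j)^-1 * (2 * lamR j)).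
  under eq_bigr do rewrite mulrCA mulr_sumr.
  rewrite -mulr_sumr exchange_big /=; congr (_ * _); apply: eq_bigr => j _.
  rewrite -(KN_dist j k) !mulr_sumr; apply: eq_bigr => l _; rewrite -/(d j l).
  by ring.
rewrite expr2 mulrCA ler_wpM2l //; apply: le_trans (ler_wpM2l _ bG); last by [].
rewrite mulr_sumr; apply: ler_sum => j _.
have [l0 l1] := andP (lamR_bounds j).
have e : az j = th j ^+ 2 by rewrite sqr_sqrtr ?az_ge0.
rewrite -[X in _ <= X]/(2 * (th j * nv (b j))).
have -> : 2 * (th j * nv (b j)) = nv (b j) * (2 * th j) by ring.
apply: ler_wpM2l => //.
have [->|j0] := eqVneq j 0; first by rewrite /th az0 sqrtr0 invr0 mul0r mulr0.
have t0 : 0 < th j by rewrite /th sqrtr_gt0 (lt_le_trans ltr01) // az_ge1.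
by rewrite mulrC ler_pdivrMr // -mulrA ler_pM2l // -expr2 -e.
Qed.

Lemma trip_sym (a b v w : V) : trip a v (a - b) + trip b w (b - a) = trip a (v - w) (a - b).
Proof. by rewrite /trip /dotv !sum3 !mxE !I3D; ring. Qed.

(* Antisymmetry moves the difference quotient from [f] to [v]. *)
Lemma flux_lattice f v (M : R) : (forall k, \sum_(l < N) KN k l * nv (v k - v l) ^+ 2 <= M) ->
  `|\sum_(k < N) complex.Re (trip (f k) (v k) (lam f k))| <=
  3 / 4 * (M * \sum_(k < N) sqv (f k) + 2 * Bform f f).
Proof.
move=> vM; set S := \sum_(k < N) _.
have e : S = \sum_(k < N) \sum_(l < N) KN k l * complex.Re (trip (f k) (v k) (f k - f l)).
  apply: eq_bigr => k _; rewrite /trip /lam crossC_sumr dotv_sumr Re_sum; apply: eq_bigr => l _.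
  by rewrite crossCZr dotvZr Re_scale.
have e2 : 2 * S = \sum_(k < N) \sum_(l < N) KN k l * complex.Re (trip (f k) (v k - v l) (f k - f l)).
  have -> : 2 * S = S + S by ring.
  rewrite {1}e e [X in _ + X]exchange_big -big_split; apply: eq_bigr => k _ /=.
  rewrite -big_split; apply: eq_bigr => l _ /=.
  by rewrite [KN l k]KN_sym -mulrDr -Re_add trip_sym.
have h : `|2 * S| <= \sum_(k < N) \sum_(l < N) KN k l *
    (2^-1 * (nv (f k) ^+ 2 * nv (v k - v l) ^+ 2 + 3 * sqv (f k - f l))).
  rewrite e2; apply: le_trans (ler_norm_sum _ _ _) _; apply: ler_sum => k _.
  apply: le_trans (ler_norm_sum _ _ _) _; apply: ler_sum => l _.
  rewrite normrM ger0_norm ?KN_ge0 //; apply: ler_wpM2l; first exact: KN_ge0.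
  apply: le_trans (Re_trip_le _ _ _) _; have := nv_sqv (f k - f l).
  move: (nv (f k)) (nv (v k - v l)) (nv (f k - f l)) (sqv _) => x y z w zw.
  have := sqr_ge0 (x * y - z); nra.
have e3 : \sum_(k < N) \sum_(l < N) KN k l *
    (2^-1 * (nv (f k) ^+ 2 * nv (v k - v l) ^+ 2 + 3 * sqv (f k - f l))) =
    2^-1 * (\sum_(k < N) nv (f k) ^+ 2 * \sum_(l < N) KN k l * nv (v k - v l) ^+ 2) + 3 * Bform f f.
  rewrite /Bform mulrCA -mulrDr mulr_sumr -big_split mulr_sumr; apply: eq_bigr => k _ /=.
  rewrite !mulr_sumr -big_split mulr_sumr; apply: eq_bigr => l _ /=.
  by rewrite -sqv_rdot; ring.
have h2 : \sum_(k < N) nv (f k) ^+ 2 * (\sum_(l < N) KN k l * nv (v k - v l) ^+ 2) <=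
    3 * (M * \sum_(k < N) sqv (f k)).
  rewrite !mulr_sumr; apply: ler_sum => k _.
  have x0 : 0 <= \sum_(l < N) KN k l * nv (v k - v l) ^+ 2.
    by apply: sumr_ge0 => l _; rewrite mulr_ge0 ?KN_ge0 ?sqr_ge0.
  have := vM k; move: (\sum_(l < N) _) x0 => x x0 xM.
  have -> : 3 * (M * sqv (f k)) = 3 * sqv (f k) * M by ring.
  by apply: ler_pM => //; [exact: sqr_ge0|exact: nv_sqv].
move: h; rewrite e3 normrM ger0_norm //; lra.
Qed.

(** Leibniz rule for differences: increments of [v] are paid for by its local oscillation [M],
    increments of [f] by the sup bound [G]. *)
Lemma Enorm_cross (v f : I -> V) (M G : R) : (forall k, nv (v k) <= G) ->
  (forall k, \sum_(l < N) KN k l * nv (v k - v l) ^+ 2 <= M) ->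
  Enorm (fun k => crossC (v k) (f k)) <= (6 * G ^+ 2 + 3 * M) * Enorm f.
Proof.
move=> vG vM.
have sc (a b : V) : sqv (crossC a b) <= 3 * (nv a ^+ 2 * sqv b).
  apply: le_trans (sqv_nv _) _; apply: (@le_trans _ _ (nv a ^+ 2 * nv b ^+ 2)).
    by rewrite -exprMn ler_sqr ?nnegrE ?mulr_ge0 ?nv_ge0 // nv_cross.
  have -> : 3 * (nv a ^+ 2 * sqv b) = nv a ^+ 2 * (3 * sqv b) by ring.
  by apply: ler_wpM2l; [exact: sqr_ge0|exact: nv_sqv].
have G2 k : nv (v k) ^+ 2 <= G ^+ 2 by rewrite ler_sqr ?nnegrE ?nv_ge0 ?(le_trans (nv_ge0 _) (vG k)).
have h1 : \sum_(k < N) sqv (crossC (v k) (f k)) <= 3 * G ^+ 2 * \sum_(k < N) sqv (f k).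
  rewrite mulr_sumr; apply: ler_sum => k _; apply: le_trans (sc _ _) _.
  by rewrite -mulrA ler_wpM2l // ler_wpM2r ?sqv_ge0.
have h2 : Bform (fun k => crossC (v k) (f k)) (fun k => crossC (v k) (f k)) <=
    3 * \sum_(k < N) (\sum_(l < N) KN k l * nv (v k - v l) ^+ 2) * sqv (f k) + 6 * G ^+ 2 * Bform f f.
  have -> : 3 * (\sum_(k < N) (\sum_(l < N) KN k l * nv (v k - v l) ^+ 2) * sqv (f k)) +
     6 * G ^+ 2 * Bform f f = 2^-1 * \sum_(k < N) \sum_(l < N) KN k l *
       (2 * (3 * (nv (v k - v l) ^+ 2 * sqv (f k)) + 3 * (G ^+ 2 * sqv (f k - f l)))).
    rewrite /Bform mulrCA !mulr_sumr -big_split; apply: eq_bigr => k _ /=.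
    rewrite mulr_suml !mulr_sumr -big_split; apply: eq_bigr => l _ /=.
    by rewrite -sqv_rdot; field.
  apply: ler_wpM2l; first by rewrite invr_ge0.
  apply: ler_sum => k _; apply: ler_sum => l _; apply: ler_wpM2l; first exact: KN_ge0.
  have -> : crossC (v k) (f k) - crossC (v l) (f l) =
     crossC (v k - v l) (f k) + crossC (v l) (f k - f l).
    by rewrite crossCDl crossCDr crossCNl crossCNr addrA subrK.
  rewrite -sqv_rdot; apply: le_trans (sqvD_le _ _) _; apply: ler_wpM2l => //.
  apply: lerD; first exact: sc.
  by apply: le_trans (sc _ _) _; rewrite ler_wpM2l // ler_wpM2r ?sqv_ge0.
have h3 : \sum_(k < N) (\sum_(l < N) KN k l * nv (v k - v l) ^+ 2) * sqv (f k) <=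
    M * \sum_(k < N) sqv (f k).
  by rewrite mulr_sumr; apply: ler_sum => k _; rewrite ler_wpM2r ?sqv_ge0.
have M0 : 0 <= M.
  by apply: le_trans (vM ord0); apply: sumr_ge0 => l _; rewrite mulr_ge0 ?KN_ge0 ?sqr_ge0.
have s0 : 0 <= \sum_(k < N) sqv (f k) by apply: sumr_ge0 => k _; apply: sqv_ge0.
have b0 := Bform_ge0 f; have g0 := sqr_ge0 G.
rewrite /Enorm; move: (\sum_(k < N) sqv (crossC _ _)) (Bform _ _) (\sum_(k < N) sqv (f k)) (Bform f f)
  (\sum_(k < N) _ * _) (G ^+ 2) h1 h2 h3 s0 b0 g0 => A B x y z w; nra.
Qed.

Lemma sum_blocks (M : nmodType) (K : nat) (H : nat -> M) :
  \sum_(i < K * N) H i = \sum_(t < K) \sum_(q < N) H (t * N + q)%N.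
Proof.
elim: K => [|K IH]; first by rewrite mul0n !big_ord0.
rewrite [RHS]big_ord_recr -IH /= -(big_mkord xpredT H) (@big_cat_nat _ _ _ (K * N)) ?leq_mul //=.
rewrite big_mkord; congr (_ + _).
rewrite -{1}[(K * N)%N]add0n big_addn mulSn addnK big_mkord.
by apply: eq_bigr => i _; rewrite addnC.
Qed.

(** The radius n + M N is chosen so that the window splits into 2M + 1 complete residue systems: 2(n
    + M N) + 1 = (2M + 1) N. *)
Lemma win_fold (A : nmodType) (M : nat) (F : int -> A) :
  \sum_(j <- win (n + M * N)) F j = \sum_(t <- win M) \sum_(q <- win n) F (q + t * N%:Z).
Proof.
rewrite win_ord -(big_mkord xpredT (fun i => F (i%:Z - (n + M * N)%N%:Z))).
have -> : ((n + M * N).*2.+1 = M.*2.+1 * N)%N by rewrite /N; lia.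
rewrite big_mkord (sum_blocks _ (fun i => F (i%:Z - (n + M * N)%N%:Z))) win_ord; apply: eq_bigr => t _.
rewrite win_ord; apply: eq_bigr => q _; congr F.
by rewrite !PoszD !PoszM; ring.
Qed.

Definition alias (M : nat) (a : int -> V) (q : int) : V :=
  \sum_(t <- win M | t != 0) a (q + t * N%:Z).

Lemma ltrig_fold M b k :
  ltrig (win (n + M * N)) b k = ltrig (win n) (fun q => b q + alias M b q) k.
Proof.
rewrite /ltrig win_fold exchange_big; apply: eq_bigr => q _ /=.
under eq_bigr => t _ do rewrite en_per.
rewrite -scaler_sumr; congr (_ *: _).
by rewrite (bigD1_seq 0) ?mem_win0 ?win_uniq //= mul0r addr0.
Qed.

(** A frequency j = q + t N with t <> 0 satisfies |t| N <= 2 |j|, which gains N^{-2} at the price of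
    two derivatives; 1 + |q| is at most 2 |j|. *)
Lemma alias_weight (q t : int) : (`|q| <= n)%N -> t != 0 ->
  (1 + az q) * az t ^+ 2 <= 8 / N%:R ^+ 2 * az (q + t * N%:Z) ^+ 3.
Proof.
move=> qn t0; set j := q + _.
have qj : az q <= az j by rewrite ler_nat fold_le.
have t1 : 1 <= az t by apply: az_ge1.
have q0 := @az_ge0 R q.
have aN : 2 * az q <= N%:R by rewrite -natrM ler_nat /N; lia.
have tj : az t * N%:R <= 2 * az j.
  have : az t * N%:R <= az j + az q.
    have -> : az t * N%:R = az (t * N%:Z) by rewrite /az -natrM abszM.
    have -> : t * N%:Z = j - q by rewrite /j; ring.
    by apply: le_trans (azD _ _) _; rewrite azN.
  have : N%:R <= az t * N%:R by rewrite ler_peMl // ltW.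
  lra.
have j1 : 1 <= az j.
  apply: az_ge1; apply/negP => /eqP j0; move: tj; rewrite j0 az0 mulr0 => h.
  by have := lt_le_trans (mulr_gt0 (lt_le_trans ltr01 t1) rN_gt0) h; rewrite ltxx.
have N2 : 0 < (N%:R : R) ^+ 2 by rewrite exprn_gt0.
rewrite -(ler_pM2r N2) [8 / _ * _]mulrAC divfK ?gt_eqF // -mulrA -exprMn.
have h : (az t * N%:R) ^+ 2 <= 4 * az j ^+ 2.
  have -> : 4 * az j ^+ 2 = (2 * az j) ^+ 2 by ring.
  by rewrite ler_sqr ?nnegrE ?mulr_ge0 // (le_trans ler01).
have -> : 8 * az j ^+ 3 = (2 * az j) * (4 * az j ^+ 2) by ring.
apply: ler_pM => //; [lra|exact: sqr_ge0|lra].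
Qed.

(** Cauchy-Schwarz over [t] with weights t^{-2}, whose sum is at most 4; then 32 = 4 * 8 by
    [alias_weight]. *)
Lemma alias_le M a : \sum_(q <- win n) (1 + az q) * sqv (alias M a q) <=
  32 / N%:R ^+ 2 * \sum_(j <- win (n + M * N)) az j ^+ 3 * sqv (a j).
Proof.
rewrite win_fold exchange_big mulr_sumr; apply: ler_sum_seq => q; rewrite mem_win => qn.
have h : sqv (alias M a q) <= 4 * \sum_(t <- win M | t != 0) az t ^+ 2 * sqv (a (q + t * N%:Z)).
  have i4 : \sum_(t <- win M | t != 0) az t ^- 2 <= (4 : R).
    apply: le_trans (sum_invsq M); rewrite big_mkcond; apply: ler_sum => t _.
    by case: ifP => // _; rewrite invr_ge0 sqr_ge0.
  have -> : 4 * (\sum_(t <- win M | t != 0) az t ^+ 2 * sqv (a (q + t * N%:Z))) =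
    \sum_(j < 3) 4 * \sum_(t <- win M | t != 0) az t ^+ 2 * nc (a (q + t * N%:Z) 0 j) ^+ 2.
    rewrite -mulr_sumr exchange_big; congr (_ * _); apply: eq_bigr => t _ /=.
    by rewrite -mulr_sumr.
  apply: ler_sum => j _.
  have h1 : nc (alias M a q 0 j) <= \sum_(t <- win M | t != 0) nc (a (q + t * N%:Z) 0 j).
    by rewrite /alias summxE nc_sum.
  have h2 : \sum_(t <- win M | t != 0) nc (a (q + t * N%:Z) 0 j) =
    \sum_(t <- [seq t <- win M | t != 0]) az t ^- 2 * (az t ^+ 2 * nc (a (q + t * N%:Z) 0 j)).
    rewrite big_filter; apply: eq_bigr => t t0.
    by rewrite mulKf // expf_neq0 // gt_eqF // (lt_le_trans ltr01) // az_ge1.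
  have w0 (t : int) : 0 <= (az t : R) ^- 2 by rewrite invr_ge0 sqr_ge0.
  have h3 := @cauchy_schwarz_weighted R _ [seq t <- win M | t != 0] (fun t => az t ^- 2)
    (fun t => az t ^+ 2 * nc (a (q + t * N%:Z) 0 j)) w0.
  have h4 : nc (alias M a q 0 j) ^+ 2 <= (\sum_(t <- [seq t <- win M | t != 0])
      az t ^- 2 * (az t ^+ 2 * nc (a (q + t * N%:Z) 0 j))) ^+ 2.
    by rewrite -h2 ler_sqr ?nnegrE ?nc_ge0 // (le_trans _ h1) ?nc_ge0.
  apply: le_trans h4 _; apply: le_trans h3 _; rewrite !big_filter.
  have -> : \sum_(t <- win M | t != 0) az t ^- 2 * (az t ^+ 2 * nc (a (q + t * N%:Z) 0 j)) ^+ 2 =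
    \sum_(t <- win M | t != 0) az t ^+ 2 * nc (a (q + t * N%:Z) 0 j) ^+ 2.
    apply: eq_bigr => t t0; have : (az t : R) != 0 by rewrite gt_eqF // (lt_le_trans ltr01) // az_ge1.
    by move: (az t) (nc _) => x y x0; field.
  by apply: ler_wpM2r i4; apply: sumr_ge0 => t _; rewrite mulr_ge0 ?sqr_ge0.
apply: (@le_trans _ _ ((1 + az q) * (4 * \sum_(t <- win M | t != 0) az t ^+ 2 * sqv (a (q + t * N%:Z))))).
  by apply: ler_wpM2l h; rewrite addr_ge0 ?az_ge0.
rewrite !mulr_sumr big_mkcond; apply: ler_sum => t _; case: ifP => [t0|_]; last first.
  by rewrite mulr_ge0 ?divr_ge0 ?sqr_ge0 // mulr_ge0 ?sqv_ge0 // exprn_ge0 ?az_ge0.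
have -> : (1 + az q) * (4 * (az t ^+ 2 * sqv (a (q + t * N%:Z)))) =
   4 * ((1 + az q) * az t ^+ 2) * sqv (a (q + t * N%:Z)) by ring.
rewrite [X in _ <= X]mulrA; apply: ler_wpM2r; first exact: sqv_ge0.
have := alias_weight qn t0; move: (_ * az t ^+ 2) => y h1.
have -> : 32 / N%:R ^+ 2 * az (q + t * N%:Z) ^+ 3 = 4 * (8 / N%:R ^+ 2 * az (q + t * N%:Z) ^+ 3) by field.
by apply: ler_wpM2l h1.
Qed.

Lemma Enorm_lim (p : nat -> I -> V) (p' : I -> V) (b : R) : (forall k, tendsV (fun M => p M k) (p' k)) ->
  (forall M, Enorm (p M) <= b) -> Enorm p' <= b.
Proof.
move=> pp pb.
have h : (fun M => Enorm (p M)) @ \oo --> Enorm p'.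
  apply: cvgD; first by apply: cvg_sum_seq => k; apply: tendsV_sqv.
  apply: cvgM; first exact: cvg_cst.
  apply: cvg_sum_seq => k; apply: cvg_sum_seq => l; apply: cvgM; first exact: cvg_cst.
  under eq_fun do rewrite -sqv_rdot; rewrite -sqv_rdot.
  by apply: tendsV_sqv; apply: tendsV_subV.
by move: h => /cvgr_to_le; apply; near=> m; apply: pb.
Unshelve. all: by end_near. Qed.

Lemma tendsV_add (u v : nat -> V) a b : tendsV u a -> tendsV v b -> tendsV (fun m => u m + v m) (a + b).
Proof.
move=> [e e0 eu] [d d0 dv]; exists (fun m => e m + d m).
  by rewrite -[0]addr0; apply: cvgD.
by move=> m; rewrite opprD addrACA; apply: le_trans (nvD _ _) _; apply: lerD.
Qed.

Lemma tendsV_cst a : tendsV (fun=> a) (a : V).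
Proof. by exists (fun=> 0); [exact: cvg_cst|move=> m; rewrite subrr nv0]. Qed.

Lemma tendsV_scale (z : C) (u : nat -> V) a : tendsV u a -> tendsV (fun m => z *: u m) (z *: a).
Proof.
move=> [e e0 eu]; exists (fun m => nc z * e m).
  by rewrite -[0](mulr0 (nc z)); apply: cvgM => //; exact: cvg_cst.
by move=> m; rewrite -scalerBr nvZ ler_wpM2l ?nc_ge0.
Qed.

Lemma tendsV_sum (J : Type) (r : seq J) (u : J -> nat -> V) (a : J -> V) : (forall j, tendsV (u j) (a j)) ->
  tendsV (fun m => \sum_(j <- r) u j m) (\sum_(j <- r) a j).
Proof.
move=> ua; elim: r => [|j r IH].
  by under eq_fun do rewrite big_nil; rewrite big_nil; exact: tendsV_cst.
by under eq_fun do rewrite big_cons; rewrite big_cons; apply: tendsV_add.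
Qed.

Lemma tendsV_lam (p : nat -> I -> V) (p' : I -> V) k : (forall k, tendsV (fun m => p m k) (p' k)) ->
  tendsV (fun m => lam (p m) k) (lam p' k).
Proof.
by move=> pp; apply: tendsV_sum => l; apply: tendsV_scale; apply: tendsV_subV.
Qed.

Lemma tendsV_comp (u : nat -> V) a (h : nat -> nat) : (forall m, (m <= h m)%N) -> tendsV u a ->
  tendsV (fun m => u (h m)) a.
Proof.
move=> hm [e e0 eu]; exists (fun m => e (h m)) => //.
apply/cvgrPdist_le => d d0; have [K _ hK] : \forall m \near \oo, `|0 - e m| <= d.
  by move/cvgrPdist_le : e0; exact.
by exists K => // m /= Km; apply: hK; apply: leq_trans (hm m).
Qed.

Section Sampling.
Variables (Y : R) (c : int -> V).
Hypothesis cY : forall m, yn m c <= Y.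
Let G : R := 6 * (1 + Y).
Let cG m : ln m c <= G.
Proof. by apply: le_trans (ln_le _ _) _; rewrite /G ler_pM2l // lerD2l. Qed.
Let s (k : I) : V := ser c (node k).
Let g (k : I) : V := ser (ag c) (node k).
Let Y0 : 0 <= Y. Proof. exact: le_trans (yn_ge0 0 c) (cY 0). Qed.
Let G0 : 0 <= G. Proof. by rewrite mulr_ge0 // addr_ge0. Qed.

Let s_tends k : tendsV (fun m => ltrig (win m) c k) (s k).
Proof. by have [[_ h] _] := summ_ln cG; exact: (ser_tends h). Qed.

Let g_tends k : tendsV (fun m => ltrig (win m) (ag c) k) (g k).
Proof. by have [_ [_ h]] := summ_ln cG; exact: (ser_tends h). Qed.

Let w_tends k : tendsV (fun m => ltrig (win m) (fun j => Lam j *: c j) k) (lam s k).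
Proof.
have := tendsV_lam k s_tends.
by under eq_fun do rewrite lam_ltrig.
Qed.

Lemma nv_sample k : nv (s k) <= 7 * G.
Proof.
have [[h1 h2] _] := summ_ln cG; apply: le_trans (nv_ser h1 h2 _) _.
by rewrite /sn sqrtr1 invr1; lra.
Qed.

Let osc_lim (b : int -> V) (p : I -> V) k : (forall k, tendsV (fun m => ltrig (win m) b k) (p k)) ->
  (forall m, \sum_(j <- win m) Num.sqrt (az j) * nv (b j) <= G) ->
  \sum_(l < N) KN k l * nv (p k - p l) ^+ 2 <= 2 * G ^+ 2.
Proof.
move=> bp bG.
apply: (@lim_sum_le _ _ _ (fun m l => KN k l * nv (ltrig (win m) b k - ltrig (win m) b l) ^+ 2)).
  move=> l; apply: cvgM; first exact: cvg_cst.
  have h : (fun m => nv (ltrig (win m) b k - ltrig (win m) b l)) @ \oo --> nv (p k - p l).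
    have := tendsV_nv (a := 0) (tendsV_subV (bp k) (bp l)); rewrite subr0.
    by under eq_fun do rewrite subr0.
  by under eq_fun do rewrite expr2; rewrite expr2; apply: cvgM.
by near=> m; apply: ltrig_oscillation.
Unshelve. all: by end_near. Qed.

Lemma sample_osc k : \sum_(l < N) KN k l * nv (s k - s l) ^+ 2 <= 2 * G ^+ 2.
Proof.
apply: osc_lim s_tends _ => m; apply: le_trans (cG m); apply: ler_sum => j _.
rewrite ler_wpM2r ?nv_ge0 //; have [->|j0] := eqVneq j 0.
  by rewrite az0 sqrtr0 addr_ge0 ?hw_ge0.
have a1 := @az_ge1 R _ j0; have s1 : 1 <= Num.sqrt (az j) :> R by rewrite -[X in X <= _]sqrtr1 ler_sqrt ?(lt_le_trans ltr01 a1).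
by rewrite /hw; nra.
Qed.

(** As the eigenvalues are at most |j|, the weight |j|^{1/2} of the oscillation bound becomes
    |j|^{3/2}, which is that of [ln]. *)
Lemma lam_sample_osc k : \sum_(l < N) KN k l * nv (lam s k - lam s l) ^+ 2 <= 2 * G ^+ 2.
Proof.
apply: osc_lim w_tends _ => m; apply: le_trans (cG m); apply: ler_sum => j _.
rewrite nvZ mulrA ler_wpM2r ?nv_ge0 //.
have [l0 l1] := andP (lamR_bounds j); rewrite lam_real nc_real ger0_norm //.
have s0 : 0 <= Num.sqrt (az j) :> R by apply: sqrtr_ge0.
by rewrite /hw; nra.
Qed.

Let block M := (n + M * N)%N.
Let blockM M : (M <= block M)%N. Proof. by rewrite /block /N; nia. Qed.

Let Enorm_folded (b : int -> V) : Enorm (ltrig (win n) b) <= N%:R * \sum_(q <- win n) (1 + az q) * sqv (b q).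
Proof.
rewrite Enorm_ltrig ler_wpM2l ?ler0n //; apply: ler_sum => q _; rewrite ler_wpM2r ?sqv_ge0 // lerD2l.
by have /andP[] := lamR_bounds q.
Qed.

(** On the window the two symbols differ by q^2/N; the remaining modes enter by aliasing. Both
    contribute order N^{-2} to the energy of the coefficients, and the sum over the nodes multiplies
    by N. The constant is 68 = 2 * (2 + 32). *)
Lemma consistency : Enorm (fun k => lam s k - g k) <= 68 * Y / N%:R.
Proof.
pose r j : V := (lamR j - az j)%:C *: c j.
apply: (@Enorm_lim (fun M => ltrig (win (block M)) r)) => [k|M].
  apply: (tendsV_comp (u := fun m => ltrig (win m) r k)) blockM _.
  have := tendsV_subV (w_tends k) (g_tends k).
  congr (tendsV _ _); apply/funext => m; rewrite /ltrig -sumrB; apply: eq_bigr => j _.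
  by rewrite -scalerBr /r /ag lam_real -scalerBl -rmorphB.
have -> : ltrig (win (block M)) r = ltrig (win n) (fun q => r q + alias M r q).
  by apply/funext => k; rewrite ltrig_fold.
apply: le_trans (Enorm_folded _) _.
have N0 : 0 < (N%:R : R) by exact: rN_gt0.
have h1 : \sum_(q <- win n) (1 + az q) * sqv (r q) <= 2 / N%:R ^+ 2 * Y.
  apply: (@le_trans _ _ (2 / N%:R ^+ 2 * yn n c)); last by rewrite ler_wpM2l ?divr_ge0 ?sqr_ge0.
  rewrite /yn mulr_sumr; apply: ler_sum_seq => q; rewrite mem_win => qn.
  rewrite /r sqvZ nc_real real_normK ?num_real // (lamR_win qn).2 mulrA [X in _ <= X]mulrA.
  apply: ler_wpM2r; first exact: sqv_ge0.
  have -> : (1 + az q) * (az q - az q ^+ 2 / N%:R - az q) ^+ 2 = ((1 + az q) * az q ^+ 4) / N%:R ^+ 2 :> R.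
    by field.
  rewrite [X in _ <= X]mulrAC ler_pM2r ?invr_gt0 ?exprn_gt0 //.
  have a0 := @az_ge0 R q; have [->|q0] := eqVneq q 0.
    by rewrite az0 !expr0n /= mulr0 addr0 mulr1.
  have a1 : 1 <= (az q : R) by apply: az_ge1.
  have : 0 <= (az q : R) ^+ 4 by apply: exprn_ge0.
  by rewrite exprS; move: (az q ^+ 4) => x x0; nra.
have h2 : \sum_(q <- win n) (1 + az q) * sqv (alias M r q) <= 32 / N%:R ^+ 2 * Y.
  apply: le_trans (alias_le _ _) _; apply: ler_wpM2l; first by rewrite divr_ge0 ?sqr_ge0.
  apply: le_trans (cY (block M)); apply: le_trans (y5_le _ _); apply: ler_sum => j _.
  rewrite /r sqvZ nc_real real_normK ?num_real // mulrA; apply: ler_wpM2r; first exact: sqv_ge0.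
  have [l0 l1] := andP (lamR_bounds j).
  have -> : az j ^+ 5 = az j ^+ 3 * az j ^+ 2 by rewrite -exprD.
  apply: ler_wpM2l; first exact: exprn_ge0 (az_ge0 j).
  by move: (az j) (lamR j) l0 l1 => x y x0 xy; nra.
have h3 : \sum_(q <- win n) (1 + az q) * sqv (r q + alias M r q) <=
    2 * (\sum_(q <- win n) (1 + az q) * sqv (r q) + \sum_(q <- win n) (1 + az q) * sqv (alias M r q)).
  rewrite -big_split mulr_sumr; apply: ler_sum => q _ /=; rewrite -mulrDr mulrCA.
  by rewrite ler_wpM2l ?addr_ge0 ?az_ge0 // sqvD_le.
apply: (@le_trans _ _ (N%:R * (2 * (2 / N%:R ^+ 2 * Y + 32 / N%:R ^+ 2 * Y)))).
  by rewrite ler_pM2l // (le_trans h3) // ler_wpM2l // lerD.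
by rewrite le_eqVlt; apply/orP; left; apply/eqP; field.
Qed.

Lemma aliasing : Enorm (fun k => s k - ltrig (win n) c k) <= 32 * Y / N%:R.
Proof.
apply: (@Enorm_lim (fun M k => ltrig (win (block M)) c k - ltrig (win n) c k)) => [k|M].
  apply: (tendsV_sub (u := fun M => ltrig (win (block M)) c k)).
  exact: (tendsV_comp (u := fun m => ltrig (win m) c k) blockM (s_tends k)).
have -> : (fun k => ltrig (win (block M)) c k - ltrig (win n) c k) = ltrig (win n) (alias M c).
  apply/funext => k; rewrite ltrig_fold /ltrig -sumrB; apply: eq_bigr => q _.
  by rewrite scalerDr addrAC subrr add0r.
apply: le_trans (Enorm_folded _) _; have N0 : 0 < (N%:R : R) by exact: rN_gt0.
apply: (@le_trans _ _ (N%:R * (32 / N%:R ^+ 2 * Y))); last first.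
  by rewrite le_eqVlt; apply/orP; left; apply/eqP; field.
rewrite ler_pM2l //; apply: le_trans (alias_le _ _) _; apply: ler_wpM2l; first by rewrite divr_ge0 ?sqr_ge0.
apply: le_trans (cY (block M)); apply: le_trans (y5_le _ _); apply: ler_sum => j _.
apply: ler_wpM2r; first exact: sqv_ge0.
have [->|j0] := eqVneq j 0; first by rewrite az0 !expr0n.
by rewrite ler_weXn2l // az_ge1.
Qed.

End Sampling.
End Lattice.

(** * Energy estimate for the lattice error *)

Section Energy.
Context {R : realType}.
Local Notation C := R[i].
Local Notation V := 'rV[R[i]]_3.
Local Notation nc := (@Normc.normc R).
Local Notation az := (@az R).

Lemma tendsV_cross (u v : nat -> V) a b : tendsV u a -> tendsV v b ->
  tendsV (fun m => crossC (u m) (v m)) (crossC a b).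
Proof.
move=> [e e0 eu] [d d0 dv]; exists (fun m => e m * nv b + (nv a + e m) * d m).
  rewrite -[0](_ : 0 * nv b + (nv a + 0) * 0 = 0); last by rewrite mul0r mulr0 addr0.
  apply: cvgD; first by apply: cvgM => //; exact: cvg_cst.
  by apply: cvgM => //; apply: cvgD => //; exact: cvg_cst.
move=> m; have -> : crossC a b - crossC (u m) (v m) = crossC (a - u m) b + crossC (u m) (b - v m).
  by rewrite crossCDl crossCDr crossCNl crossCNr addrA subrK.
apply: le_trans (nvD _ _) _; apply: lerD.
  by apply: le_trans (nv_cross _ _) _; rewrite ler_wpM2r ?nv_ge0.
apply: le_trans (nv_cross _ _) _; apply: ler_pM; rewrite ?nv_ge0 //.
have -> : u m = a - (a - u m) by rewrite subKr.
by apply: le_trans (nvB _ _) _; rewrite lerD2l.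
Qed.

(** The weight (1 + |k|)^3 exceeds the threshold for summability: Cauchy-Schwarz with the sum of (1
    + |k|)^{-2}, at most 5, and 3 * 5 <= 4^2. *)
Lemma nv_sum_weighted M (x : int -> V) (b : R) : 0 <= b ->
  \sum_(k <- win M) (1 + az k) ^+ 3 * sqv (x k) <= b ^+ 2 -> \sum_(k <- win M) nv (x k) <= 4 * b.
Proof.
move=> b0 h.
have p1 k : 1 <= 1 + (az k : R) by rewrite lerDl az_ge0.
have p0 k : 0 < 1 + (az k : R) by apply: lt_le_trans (p1 k).
have w4 : \sum_(k <- win M) (1 + az k) ^- 2 <= (5 : R).
  apply: (@le_trans _ _ (\sum_(k <- win M) (az k ^- 2 + (if k == 0 then 1 else 0)))).
    apply: ler_sum => k _; have [->|k0] := eqVneq k 0.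
      by rewrite az0 addr0 expr1n invr1 expr0n invr0 add0r.
    have a0 := lt_le_trans ltr01 (@az_ge1 R _ k0).
    rewrite addr0 lef_pV2 ?posrE ?exprn_gt0 //.
    by rewrite ler_sqr ?nnegrE ?(ltW a0) ?(ltW (p0 k)) // lerDr.
  rewrite big_split /=; have := @sum_invsq R M; have := @sum_if_eq R (win M) 0 1 (win_uniq M) ler01.
  lra.
have w0 k : 0 <= (1 + az k : R) ^- 2 by rewrite invr_ge0 sqr_ge0.
have e k : nv (x k) = (1 + az k) ^- 2 * ((1 + az k) ^+ 2 * nv (x k)).
  by rewrite mulKf // expf_neq0 // gt_eqF.
have := @cauchy_schwarz_weighted R _ (win M) _ (fun k => (1 + az k) ^+ 2 * nv (x k)) w0.
rewrite -(eq_bigr _ (fun k _ => e k)) => h1.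
have h2 : \sum_(k <- win M) (1 + az k) ^- 2 * ((1 + az k) ^+ 2 * nv (x k)) ^+ 2 <= 3 * b ^+ 2.
  apply: (@le_trans _ _ (3 * \sum_(k <- win M) (1 + az k) ^+ 3 * sqv (x k))); last by rewrite ler_wpM2l.
  rewrite mulr_sumr; apply: ler_sum => k _.
  have -> : (1 + az k) ^- 2 * ((1 + az k) ^+ 2 * nv (x k)) ^+ 2 = (1 + az k) ^+ 2 * nv (x k) ^+ 2.
    have : 1 + az k != 0 :> R by rewrite gt_eqF.
    by move: (1 + az k) (nv _) => u v u0; field.
  have -> : 3 * ((1 + az k) ^+ 3 * sqv (x k)) = (1 + az k) ^+ 3 * (3 * sqv (x k)) by ring.
  apply: ler_pM; rewrite ?sqr_ge0 ?nv_sqv //.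
  by rewrite ler_weXn2l.
have s0 : 0 <= \sum_(k <- win M) nv (x k) by apply: sumr_ge0 => k _; apply: nv_ge0.
rewrite -ler_sqr ?nnegrE ?mulr_ge0 //; apply: le_trans h1 _.
have z0 : 0 <= \sum_(k <- win M) (1 + az k) ^- 2 * ((1 + az k) ^+ 2 * nv (x k)) ^+ 2.
  by apply: sumr_ge0 => k _; rewrite mulr_ge0 ?sqr_ge0.
have i0 : 0 <= \sum_(k <- win M) (1 + az k : R) ^- 2 by apply: sumr_ge0.
apply: (@le_trans _ _ (5 * (3 * b ^+ 2))); first exact: ler_pM.
by rewrite exprMn; have := sqr_ge0 b; lra.
Qed.

Lemma D1_diff (T : R) (f df : R -> R) :
  (forall t e : R, 0 <= t <= T -> 0 < e -> exists2 d : R, 0 < d & forall h : R, 0 <= t + h <= T ->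
     `|h| < d -> `|f (t + h) - f t - df t * h| <= e * `|h|) -> D1 T f df.
Proof.
move=> H; apply: D1_key => t e tT e0; have [d d0 h] := H t e tT e0.
by exists d => // s sT sd; have := h (s - t); rewrite addrC subrK; apply.
Qed.

Lemma DV_diff (T : R) (f df : R -> V) :
  (forall t e : R, 0 <= t <= T -> 0 < e -> exists2 d : R, 0 < d & forall h : R, 0 <= t + h <= T ->
     `|h| < d -> nv (f (t + h) - f t - h%:C *: df t) <= e * `|h|) -> DV T f df.
Proof.
move=> H j; split; apply: D1_diff => t e tT e0; have [d d0 h] := H t e tT e0; exists d => // u uT ud;
  apply: le_trans (h u uT ud); apply: le_trans (nc_le_nv _ j); rewrite !entryB entryZ.
- by apply: le_trans (Re_le_nc _); rewrite !(Re_add, Re_opp) Re_scale mulrC.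
- by apply: le_trans (Im_le_nc _); rewrite !(Im_add, Im_opp) Im_scale mulrC.
Qed.

Lemma has_deriv_DV (T : R) (f df : R -> 'rV[R]_3) :
  (forall t, 0 <= t <= T -> has_deriv_on `[0, +oo[ f t (df t)) ->
  DV T (fun t => toC (f t)) (fun t => toC (df t)).
Proof.
move=> H; have D j : D1 T (fun t => f t 0 j) (fun t => df t 0 j).
  apply: D1_diff => t e tT e0.
  have h : (h^-1 *: (f (t + h) - f t)) 0 j @[h --> within [set h | `[0, +oo[%classic (t + h)] 0^'] --> df t 0 j.
    exact: (cvg_comp _ _ (H t tT) (@coord_continuous _ _ _ 0 j (df t))).
  move/cvgrPdist_le : h => /(_ e e0); rewrite near_withinE near_withinE => -[d /= d0 hd].
  exists d => // u uT ud; have [->|u0] := eqVneq u 0.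
    by rewrite addr0 subrr mulr0 subrr normr0 mulr0.
  have := hd u; rewrite /= sub0r normrN => /(_ ud u0); rewrite in_itv /= andbT.
  move=> /(_ (proj1 (andP uT))) h.
  have -> : f (t + u) 0 j - f t 0 j - df t 0 j * u =
     - ((df t 0 j - (u^-1 *: (f (t + u) - f t)) 0 j) * u).
    by rewrite !mxE; field.
  by rewrite normrN normrM ler_wpM2r.
move=> j; split; first by apply: D1_ext (D j) => [t|t _]; rewrite mxE.
by apply: D1_ext (D1_cst T 0) => [t|t _]; rewrite mxE.
Qed.

Section Sampled.
Variables (T Y : R) (c : R -> int -> V).
Hypothesis cY : forall t : R, 0 <= t <= T -> forall n, yn n (c t) <= Y.
Hypothesis cD : forall k, DV T (fun t => c t k) (fun t => Gc (c t) k).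
Hypothesis cE : forall A n (s t : R), 0 <= A -> 2 * A <= n.+1%:R ^+ 4 -> 0 <= s -> s <= t -> t <= T ->
  `|EA A n (c t) - EA A n (c s)| <= rate * (1 + Y) ^+ 2 * (t - s).
Let G : R := 6 * (1 + Y).

Let cG (t : R) : 0 <= t <= T -> forall n, ln n (c t) <= G.
Proof.
by move=> tT n; apply: le_trans (ln_le _ _) _; rewrite /G ler_pM2l // lerD2l cY.
Qed.

(** Differentiability in H^{3/2} is inherited at each point of the circle, because that norm
    controls the l^1 norm of the coefficients. *)
Lemma ser_DV z : DV T (fun t => ser (c t) z) (fun t => crossC (ser (c t) z) (ser (ag (c t)) z)).
Proof.
apply: DV_diff => t e tT e0.
have e4 : 0 < e / 4 by rewrite divr_gt0.
have [d d0 hd] := coef_diff cY cD cE tT e4.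
exists d => // h hT hd'; have {hd} hs := hd h hT hd'.
(* The linear terms are taken on the window 2m to match the product of two polynomials of degree
   m. *)
pose q m := trig (win m.*2) (c (t + h)) z - trig (win m.*2) (c t) z -
  h%:C *: crossC (trig (win m) (c t) z) (trig (win m) (ag (c t)) z).
have mm m : (m <= m.*2)%N by rewrite -addnn leq_addr.
have [[_ s1] _] := summ_ln (cG hT); have [[_ s2] [_ s3]] := summ_ln (cG tT).
have ql : tendsV q (ser (c (t + h)) z - ser (c t) z - h%:C *: crossC (ser (c t) z) (ser (ag (c t)) z)).
  apply: tendsV_subV; first apply: tendsV_subV.
  - exact: (tendsV_comp (u := fun m => trig (win m) (c (t + h)) z) mm (ser_tends s1 z)).
  - exact: (tendsV_comp (u := fun m => trig (win m) (c t) z) mm (ser_tends s2 z)).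
  - by apply: tendsV_scale; apply: tendsV_cross; [exact: (ser_tends s2 z)|exact: (ser_tends s3 z)].
have qb m : nv (q m) <= e * `|h| + (2 * G ^+ 2 * `|h|) * sn m.
  have -> : q m = trig (win m.*2) (fun k => c (t + h) k - c t k - h%:C *: Gc (c t) k) z +
      h%:C *: trig (win m.*2) (fun k => Gc (c t) k - cv m (c t) (ag (c t)) k) z.
    rewrite /q trig_cv /trig scaler_sumr -sumrB scaler_sumr -sumrB -big_split; apply: eq_bigr => k _ /=.
    rewrite !scalerBr !scalerA [h%:C * _]mulrC.
    move: (_ *: c _ _) (_ *: c t k) (_ *: Gc _ _) (_ *: cv _ _ _ _) => x y u v.
    by rewrite addrA subrK.
  apply: le_trans (nvD _ _) _; apply: lerD.
    apply: le_trans (nv_trig _ _ _) _.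
    have -> : e * `|h| = 4 * (`|h| * (e / 4)) by field.
    apply: nv_sum_weighted; first by rewrite mulr_ge0 // ltW.
    by have := hs m.*2; rewrite [X in _ -> _ <= X]exprMn real_normK ?num_real // -exprMn.
  rewrite nvZ nc_real; have -> : 2 * G ^+ 2 * `|h| * sn m = `|h| * (2 * sn m * G ^+ 2) by ring.
  apply: ler_wpM2l => //; apply: le_trans (nv_trig _ _ _) _.
  exact: (Gc_trunc (cG tT) m (win_uniq _)).
have l1 := tendsV_nv (a := 0) ql; move: l1; rewrite subr0 => l1.
apply: (ler_cvg_to l1 (_ : (fun m => e * `|h| + (2 * G ^+ 2 * `|h|) * sn m) @ \oo --> e * `|h|)).
  by rewrite -[X in _ --> X]addr0; apply: cvgD; [exact: cvg_cst|exact: scale_sn_cvg0].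
by near=> m; rewrite subr0.
Unshelve. all: by end_near. Qed.

Section Comparison.
Variables (n : nat) (X : R -> 'I_n.*2.+1 -> V).
Local Notation N := n.*2.+1.
Hypothesis rc : forall t : R, 0 <= t <= T -> rcoefs (c t).
Hypothesis X_DV : forall k, DV T (fun t => X t k) (fun t => crossC (X t k) (lam (X t) k)).
Hypothesis X_real : forall t k, 0 <= t -> conjv (X t k) = X t k.
Hypothesis X_init : forall k, X 0 k = ser (c 0) (node k).
Let s (t : R) (k : 'I_N) := ser (c t) (node k).
Let g (t : R) (k : 'I_N) := ser (ag (c t)) (node k).
Let D (t : R) (k : 'I_N) := X t k - s t k.
Let w (t : R) := lam (s t).
Let rho (t : R) (k : 'I_N) := w t k - g t k.
Let dD (t : R) (k : 'I_N) : V :=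
  crossC (X t k) (lam (D t) k) + crossC (D t k) (w t k) + crossC (s t k) (rho t k).

Lemma lamB (f h : 'I_N -> V) k : lam (fun l => f l - h l) k = lam f k - lam h k.
Proof.
rewrite /lam -sumrB; apply: eq_bigr => l _; rewrite -scalerBr; congr (_ *: _).
by rewrite !opprB [h l - f l]addrC addrACA [- h k + _]addrC.
Qed.

Lemma D_DV k : DV T (fun t => D t k) (fun t => dD t k).
Proof.
have := DV_sub (X_DV k) (ser_DV (node k)); congr (DV _ _ _); apply/funext => t.
rewrite /dD /rho lamB -/(w t) -/(s t k) -/(g t k) /D.
move: (X t k) (lam (X t) k) (s t k) (w t k) (g t k) => x a b d e.
rewrite !(crossCDl, crossCDr, crossCNl, crossCNr).
move: (crossC x a) (crossC x d) (crossC b d) (crossC b e) => p q u z.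
by rewrite [RHS]addrA [p - q + _]addrA !subrK.
Qed.

Lemma Enorm_D1 : D1 T (fun t => Enorm (D t))
  (fun t => 2 * (\sum_(k < N) rdot (D t k) (dD t k) + \sum_(k < N) rdot (dD t k) (lam (D t) k))).
Proof.
have h1 := D1_sum (index_enum 'I_N) (P := xpredT) (fun k _ => DV_sqv (D_DV k)).
have h2 k l : D1 T (fun t => KN k l * rdot (D t k - D t l) (D t k - D t l))
    (fun t => KN k l * (2 * rdot (D t k - D t l) (dD t k - dD t l))).
  apply: D1_scale; apply: D1_ext (DV_sqv (DV_sub (D_DV k) (D_DV l))) => // t.
  by rewrite sqv_rdot.
have h3 := D1_sum (index_enum 'I_N) (P := xpredT)
  (fun k _ => D1_sum (index_enum 'I_N) (P := xpredT) (fun l _ => h2 k l)).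
apply: D1_ext (D1_add h1 (D1_scale 2^-1 h3)) => // t _.
rewrite mulrDr -Bform_lam Bform_sym /Bform; congr (_ + _).
  by rewrite mulr_sumr.
rewrite !mulr_sumr; apply: eq_bigr => k _; rewrite !mulr_sumr; apply: eq_bigr => l _.
by ring.
Qed.

Lemma trip_rot (a b d : V) : trip a b d = trip d a b.
Proof. by rewrite /trip /dotv !sum3 !mxE !I3D; ring. Qed.

Lemma rdot_cross_real (u a b : V) : conjv u = u -> rdot u (crossC a b) = complex.Re (trip u a b).
Proof. by move=> ru; rewrite rdotE ru. Qed.

Lemma lam_conj (f : 'I_N -> V) k : (forall k, conjv (f k) = f k) -> conjv (lam f k) = lam f k.
Proof.
move=> rf; apply/rowP => j; rewrite /lam mxE !summxE rmorph_sum; apply: eq_bigr => l _ /=.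
have e i : conjc (f i 0 j) = f i 0 j by rewrite -{2}(rf i) mxE.
by rewrite entryZ entryB; transitivity ((KN k l)%:C * (conjc (f k 0 j) - conjc (f l 0 j)));
  [rewrite conj_realM rmorphB|rewrite !e].
Qed.

Let sreal (t : R) k : 0 <= t <= T -> conjv (s t k) = s t k.
Proof.
move=> tT; have [hs _] := summ_ln (cG tT); rewrite /s -(toC_serR hs (rc tT)).
by apply/rowP => j; rewrite !mxE; exact: conjc_real.
Qed.

Let Dreal (t : R) k : 0 <= t <= T -> conjv (D t k) = D t k.
Proof. by move=> tT; rewrite /D conjvB sreal ?X_real //; case/andP: tT. Qed.

(** Testing with D kills every product having D as first factor; testing with |nabla|_N D kills X x
    |nabla|_N D. Two fluxes of [flux_lattice] remain, with [v] equal to s and to |nabla|_N s,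
    besides the source s x rho. The rate 3 M + 7 adds up both fluxes and Young's inequality for the
    source. *)
Lemma energy_bound (t : R) : 0 <= t <= T -> Enorm (D t) <=
  ((6 * (7 * G) ^+ 2 + 3 * (2 * G ^+ 2)) * (68 * Y / N%:R) * t) * expR ((3 * (2 * G ^+ 2) + 7) * t).
Proof.
move=> tT; have [t0 tT'] := andP tT; have T0 : 0 <= T := le_trans t0 tT'.
have Y0 : 0 <= Y by apply: le_trans (yn_ge0 0 (c t)) (cY tT 0).
have G0 : 0 <= G ^+ 2 by apply: sqr_ge0.
pose M := 2 * G ^+ 2; have M0 : 0 <= M by rewrite /M mulr_ge0.
have D0 : Enorm (D 0) = 0.
  have -> : D 0 = fun=> 0 by apply/funext => k; rewrite /D X_init subrr.
  rewrite /Enorm /Bform big1 ?add0r; last by move=> k _; rewrite sqv0.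
  rewrite big1 ?mulr0 // => k _; rewrite big1 // => l _.
  by rewrite !(subr0, sub0r, oppr0) -sqv_rdot sqv0 mulr0.
set b := (6 * (7 * G) ^+ 2 + 3 * (2 * G ^+ 2)) * (68 * Y / N%:R).
have b1 : 0 <= 6 * (7 * G) ^+ 2 + 3 * (2 * G ^+ 2).
  apply: addr_ge0; apply: mulr_ge0 => //; exact: sqr_ge0.
have b0 : 0 <= b by apply: mulr_ge0 b1 _; apply: divr_ge0 => //; apply: mulr_ge0.
rewrite -[X in X * _]add0r -{1}D0 -/M.
have a0 : 0 <= 3 * M + 7 by apply: addr_ge0 => //; apply: mulr_ge0.
apply: (gronwall a0 b0 Enorm_D1 _ tT) => u /andP[u0 uT]; have uI : 0 <= u <= T by rewrite !ltW.
have m1 := flux_lattice (D u) (fun k => sample_osc (cY uI) k).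
have m2 := flux_lattice (D u) (fun k => lam_sample_osc (cY uI) k).
have m3 := Enorm_cross (rho u) (fun k => nv_sample (cY uI) k) (fun k => sample_osc (cY uI) k).
have m4 := consistency n (cY uI).
pose Gf k := crossC (s u k) (rho u k).
have e1 : \sum_(k < N) rdot (D u k) (dD u k) =
    \sum_(k < N) complex.Re (trip (D u k) (s u k) (lam (D u) k)) + \sum_(k < N) rdot (D u k) (Gf k).
  rewrite -big_split; apply: eq_bigr => k _ /=; rewrite /dD !rdotDr rdot_cross_self ?Dreal // addr0.
  congr (_ + _); have -> : X u k = D u k + s u k by rewrite subrK.
  by rewrite crossCDl rdotDr rdot_cross_self ?Dreal // add0r rdot_cross_real ?Dreal.
have e2 : \sum_(k < N) rdot (dD u k) (lam (D u) k) =
    \sum_(k < N) complex.Re (trip (D u k) (w u k) (lam (D u) k)) + Bform Gf (D u).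
  rewrite Bform_lam -big_split; apply: eq_bigr => k _ /=.
  have rl : conjv (lam (D u) k) = lam (D u) k by apply: lam_conj => l; apply: Dreal.
  rewrite rdotC /dD !rdotDr -[rdot (Gf k) _]rdotC; congr (_ + _).
  rewrite !rdot_cross_real // -[trip (lam _ _) (D u k) _]trip_rot.
  have -> : trip (lam (D u) k) (X u k) (lam (D u) k) = 0.
    by rewrite /trip /dotv !sum3 !mxE !I3D; ring.
  by rewrite add0r.
have e3 : 2 * \sum_(k < N) rdot (D u k) (Gf k) <= \sum_(k < N) sqv (D u k) + \sum_(k < N) sqv (Gf k).
  by rewrite mulr_sumr -big_split; apply: ler_sum => k _; apply: rdot_sqv.
have e4 : 2 * Bform Gf (D u) <= Bform Gf Gf + Bform (D u) (D u).
  rewrite /Bform mulrA mulfV // mul1r -mulrDr -big_split mulr_sumr; apply: ler_sum => k _ /=.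
  rewrite -big_split mulr_sumr; apply: ler_sum => l _ /=.
  rewrite -mulrDr mulrCA; apply: ler_wpM2l; first exact: KN_ge0.
  by rewrite ler_pdivlMl // -!sqv_rdot; apply: rdot_sqv.
have e5 : Enorm Gf <= b.
  by apply: le_trans m3 _; rewrite /b; apply: ler_wpM2l m4.
have p1 : 0 <= \sum_(k < N) sqv (D u k) by apply: sumr_ge0 => k _; apply: sqv_ge0.
have p2 := Bform_ge0 (D u).
rewrite e1 e2; move: m1 m2 e3 e4 e5; rewrite /Enorm -/M.
move: (\sum_(k < N) complex.Re _) (\sum_(k < N) complex.Re _) (\sum_(k < N) rdot _ _)
  (Bform Gf _) (Bform Gf Gf) (\sum_(k < N) sqv (Gf k)) (\sum_(k < N) sqv (D u k)) (Bform (D u) (D u)) p1 p2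
  => a1 a2 a3 a4 a5 a6 a7 a8 p1 p2.
rewrite !ler_norml => /andP[_ h1] /andP[_ h2] h3 h4 h5.
have q1 := mulr_ge0 M0 p1; have q2 := mulr_ge0 M0 p2; clear - h1 h2 h3 h4 h5 q1 q2 p1 p2; lra.
Qed.

Let A (t : R) : R := (6 * (7 * G) ^+ 2 + 3 * (2 * G ^+ 2)) * (68 * Y) * t * expR ((3 * (2 * G ^+ 2) + 7) * t).

(** The energy of the nodal error is of order 1/N, and the normalisation of the transform divides by
    N once more. *)
Lemma dft_error (t : R) : 0 <= t <= T ->
  \sum_(q <- win n) (1 + az q) * sqv (dft (X t) q - c t q) <= 4 * (A t + 32 * Y) / N%:R ^+ 2.
Proof.
move=> tT; have N0 : 0 < (N%:R : R) by rewrite ltr0n.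
pose e k := X t k - ltrig (win n) (c t) k.
have h1 : \sum_(q <- win n) (1 + az q) * sqv (dft (X t) q - c t q) =
    \sum_(q <- win n) (1 + az q) * sqv (dft e q).
  apply: eq_big_seq => q qn; congr (_ * sqv _).
  rewrite -[c t q](dft_ltrig (c t) qn) /dft -scalerBr -sumrB; congr (_ *: _).
  by apply: eq_bigr => l _; rewrite -scalerBr.
rewrite h1; apply: le_trans (dft_Enorm e) _.
have h2 : Enorm e <= 2 * (Enorm (D t) + Enorm (fun k => s t k - ltrig (win n) (c t) k)).
  have -> : e = fun k => D t k + (s t k - ltrig (win n) (c t) k).
    by apply/funext => k; rewrite /e /D addrA subrK.
  exact: Enorm_add.
have h3 := energy_bound tT; have h4 := aliasing n (cY tT).
have h5 : Enorm e <= 2 * ((A t + 32 * Y) / N%:R).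
  apply: le_trans h2 _; apply: ler_wpM2l => //; rewrite mulrDl; apply: lerD h4.
  apply: le_trans h3 _; rewrite /A le_eqVlt; apply/orP; left; apply/eqP.
  by move: (expR _) (6 * _ + _) => x y; field.
apply: le_trans (ler_wpM2l _ h5) _; first by rewrite divr_ge0 // ltW.
by rewrite le_eqVlt; apply/orP; left; apply/eqP; move: (A t) => x; field.
Qed.

(** The interpolant has no modes above n, where 2 |k| >= N; the missing tail of the solution is paid
    for by its H^{5/2} energy. *)
Lemma high_mode (k : int) : (n < `|k|)%N -> wt 2^-1 k <= 12 / N%:R ^+ 2 * az k ^+ 5.
Proof.
move=> kn; have [_ h] := @wt1_ge1 R k; apply: le_trans h _.
have N0 : 0 < (N%:R : R) ^+ 2 by rewrite exprn_gt0 // ltr0n.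
have a1 : 1 <= az k by apply: az_ge1; lia.
have aN : N%:R <= 2 * az k by rewrite -natrM ler_nat; lia.
have h2 : N%:R ^+ 2 <= 4 * az k ^+ 2.
  have -> : 4 * az k ^+ 2 = (2 * az k) ^+ 2 by ring.
  by rewrite ler_sqr ?nnegrE // mulr_ge0 // (le_trans ler01).
rewrite mulrAC ler_pdivlMr //.
have h3 : 1 + 2 * az k <= 3 * az k by lra.
have -> : 12 * az k ^+ 5 = (3 * az k) * (4 * az k ^+ 4) by ring.
apply: ler_pM => //; [by rewrite addr_ge0 // mulr_ge0 // (le_trans ler01)|].
by apply: le_trans h2 _; rewrite ler_wpM2l // ler_weXn2l.
Qed.

Lemma interp_error (t : R) (SN : 'I_N -> 'rV[R]_3) : 0 <= t <= T -> (forall k, X t k = toC (SN k)) ->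
  (Hnorm 2^-1 (fun k => (fourierC (interp SN) k - c t k)%R)
    <= (Num.sqrt (8 * (A t + 32 * Y) + 12 * Y) / N%:R)%:E)%E.
Proof.
move=> tT XS; have N0 : 0 < (N%:R : R) by rewrite ltr0n.
apply: Hnorm_le => [|m]; first by rewrite divr_ge0 ?sqrtr_ge0 // ltW.
have Y0 : 0 <= Y by apply: le_trans (yn_ge0 0 (c t)) (cY tT 0).
have A0 : 0 <= A t.
  have [t0 _] := andP tT; apply: mulr_ge0 (expR_ge0 _); apply: mulr_ge0 t0.
  apply: mulr_ge0; last exact: mulr_ge0.
  by apply: addr_ge0; apply: mulr_ge0 => //; [exact: sqr_ge0|apply: mulr_ge0 => //; exact: sqr_ge0].
have w0 k : 0 <= wt 2^-1 k * sqv (fourierC (interp SN) k - c t k).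
  by apply: mulr_ge0 (wt_ge0 _ _) (sqv_ge0 _).
apply: le_trans (win_mono (leq_addl n m) w0) _.
rewrite (win_split _ (leq_addr m n)).
have h1 : \sum_(k <- win n) wt 2^-1 k * sqv (fourierC (interp SN) k - c t k) <=
    8 * (A t + 32 * Y) / N%:R ^+ 2.
  have -> : 8 * (A t + 32 * Y) / N%:R ^+ 2 = 2 * (4 * (A t + 32 * Y) / N%:R ^+ 2).
    by move: (A t) => x; field.
  apply: le_trans (ler_wpM2l _ (dft_error tT)); last by [].
  rewrite mulr_sumr; apply: ler_sum_seq => k; rewrite mem_win => kn.
  rewrite fourierC_interp kn; have -> : (fun l => toC (SN l)) = X t by apply/funext => l; rewrite XS.
  rewrite mulrA; apply: ler_wpM2r; first exact: sqv_ge0.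
  by have [_ h] := @wt1_ge1 R k; apply: le_trans h _; rewrite mulrDr mulr1 lerD2r ler1n.
have h2 : \sum_(k <- win (n + m) | (n < `|k|)%N) wt 2^-1 k * sqv (fourierC (interp SN) k - c t k) <=
    12 * Y / N%:R ^+ 2.
  apply: (@le_trans _ _ (12 / N%:R ^+ 2 * \sum_(k <- win (n + m)) az k ^+ 5 * sqv (c t k))).
    rewrite mulr_sumr big_mkcond; apply: ler_sum => k _; case: ifP => kn; last first.
      by apply: mulr_ge0; [rewrite divr_ge0 ?sqr_ge0|apply: mulr_ge0 (sqv_ge0 _); exact: exprn_ge0 (az_ge0 k)].
    rewrite fourierC_interp leqNgt kn /= sub0r sqvN mulrA; apply: ler_wpM2r; first exact: sqv_ge0.
    exact: high_mode.
  rewrite [12 * Y / _]mulrAC; apply: ler_wpM2l; first by rewrite divr_ge0 ?sqr_ge0.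
  by apply: le_trans (y5_le _ _) (cY tT _).
apply: le_trans (lerD h1 h2) _; rewrite -mulrDl expr_div_n sqr_sqrtr //.
by apply: addr_ge0; apply: mulr_ge0 => //; apply: addr_ge0 => //; apply: mulr_ge0.
Qed.

End Comparison.
End Sampled.
End Energy.

(** * Weak limits *)

Section WeakLimit.
Context {R : realType}.
Local Notation C := R[i].
Local Notation V := 'rV[R[i]]_3.
Local Notation nc := (@Normc.normc R).
Local Notation mu := (@lebesgue_measure R).

Lemma mitv (a b : R) : measurable ([set` `[a, b]] : set (measurableTypeR R)).
Proof. exact: measurable_itv. Qed.

(* The real-valued test function 2 Re (z e^{ikx}) in direction j. *)
Definition tmode (k : int) (j : 'I_3) (z : C) : coefs R := fun m =>
  ((if m == k then z else 0) + (if m == - k then conjc z else 0)) *: delta_mx 0 j.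

Lemma tmode_real k j z : real_coefs (tmode k j z).
Proof.
move=> m i; rewrite /tmode !mxE eqr_oppLR eqr_opp addrC rmorphM rmorphD /=.
have -> : ((i == j)%:R : C)^*%C = (i == j)%:R by case: (i == j); rewrite ?rmorph1 ?rmorph0.
by congr (_ * _); congr (_ + _); case: ifP; rewrite ?rmorph0 ?conjcK.
Qed.

Lemma pairing_tmode k j z (a : coefs R) :
  pairing (tmode k j z) a = complex.Re (conjc z * a k 0 j) + complex.Re (z * a (- k) 0 j).
Proof.
rewrite /pairing; apply: (@lim_near_cst R) => //; near=> n.
have kn : k \in win n by rewrite mem_win; near: n; exact: nbhs_infty_ge.
have kn' : - k \in win n by move: kn; rewrite !mem_win abszN.
rewrite -(win_ord _ (fun m => \sum_(i < 3) complex.Re ((tmode k j z m 0 i)^* * a m 0 i))).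
rewrite (eq_bigr (fun m => (if m == k then complex.Re (conjc z * a m 0 j) else 0) +
                           (if m == - k then complex.Re (z * a m 0 j) else 0))); last first.
  move=> m _; rewrite (bigD1 j) //= [X in _ + X]big1 ?addr0 => [|i ij]; last first.
    by rewrite /tmode !mxE (negPf ij) andbF mulr0 rmorph0 mul0r.
  rewrite /tmode !mxE !eqxx mulr1 rmorphD mulrDl Re_add.
  by congr (_ + _); case: ifP => _ /=; rewrite ?numconjE ?conjcK ?conjc0 ?mul0r.
by rewrite big_split /= !(sum_if_eqM _ (win_uniq n)).
Unshelve. all: by end_near. Qed.

Lemma pairing0 (a : coefs R) : pairing (fun=> 0) a = 0.
Proof.
rewrite /pairing; apply: (@lim_near_cst R) => //; near=> n.
by rewrite big1 // => i _; rewrite big1 // => j _; rewrite mxE rmorph0 mul0r.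
Unshelve. all: by end_near. Qed.

Lemma Hnorm_tmode s k j z : (Hnorm s (tmode k j z) < +oo)%E.
Proof.
pose F m := wt s m * sqv (tmode k j z m).
have F0 m : 0 <= F m by apply: mulr_ge0 (wt_ge0 _ _) (sqv_ge0 _).
pose B := \sum_(m <- win `|k|%N) F m.
have B0 : 0 <= B by apply: sumr_ge0.
apply: (@le_lt_trans _ _ (1 + B)%:E); last exact: ltry.
apply: Hnorm_le => [|n]; first by rewrite addr_ge0.
apply: (@le_trans _ _ B); last by nra.
apply: le_trans (win_mono (leq_addr `|k|%N n) F0) _.
rewrite (win_supp (leq_addl n `|k|%N)) // => m km.
rewrite /F /tmode; case: eqP => [e|_]; first by move: km; rewrite e ltnn.
case: eqP => [e|_]; first by move: km; rewrite e abszN ltnn.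
by rewrite addr0 scale0r sqv0 mulr0.
Qed.

Lemma Hnorm_0 s : Hnorm s (fun=> 0 : V) = 0%E.
Proof.
apply/eqP; rewrite eq_le Hnorm_ge0 andbT; apply: Hnorm_le => // n.
by rewrite big1 ?sqr_ge0 // => k _; rewrite sqv0 mulr0.
Qed.

Section Test.
Variables (T tau : R) (k : int) (j : 'I_3) (z : C).
Hypothesis tauT : 0 <= tau <= T.

(** Switched off after [tau], so that integration against a time derivative yields the increment
    between 0 and [tau]. *)
Definition test (t : R) : coefs R := if (t \in `[0, tau]) then tmode k j z else (fun=> 0).

Let A : set (measurableTypeR R) := [set` `[0, tau]].

Let ind (v : R) : measurable_fun ([set` `[0, T]] : set (measurableTypeR R)) (fun t => if (t \in `[0, tau]) then v else 0).
Proof.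
apply: (@measurable_funS _ _ _ _ setT) => //.
apply: measurable_fun_ifT => //; apply: (measurable_fun_bool true); rewrite setTI.
exact: (mitv 0 tau).
Qed.

Let re_test m i (f : C -> R) : f 0 = 0 -> measurable_fun ([set` `[0, T]] : set (measurableTypeR R)) (fun t => f (test t m 0 i)).
Proof.
move=> f0; rewrite (_ : (fun t => _) = fun t => if (t \in `[0, tau]) then f (tmode k j z m 0 i) else 0); first exact: ind.
by apply/funext => t; rewrite /test; case: ifP => // _; rewrite mxE.
Qed.

Lemma test_in_L1 s : in_L1 T s test.
Proof.
have h s' t : Hnorm s' (test t) = (if (t \in `[0, tau]) then fine (Hnorm s' (tmode k j z)) else 0)%:E.
  rewrite /test; case: ifP => _; last exact: Hnorm_0.
  by rewrite fineK // ge0_fin_numE ?Hnorm_ge0 ?Hnorm_tmode.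
split.
- by move=> m i; split; apply: re_test.
- move=> t _; split; last by rewrite h ltry.
  rewrite /test; case: ifP => _; first exact: tmode_real.
  by move=> m i; rewrite !mxE rmorph0.
- under eq_integral => t _ do rewrite h.
  set v := fine _; have v0 : 0 <= v by rewrite /v fine_ge0 ?Hnorm_ge0.
  apply: (@le_lt_trans _ _ (\int[mu]_(t in [set` `[0%R, T]]) (cst v%:E t))%E).
    apply: ge0_le_integral => //.
    - by move=> t _; rewrite lee_fin; case: ifP.
    - by apply/measurable_EFinP; exact: ind.
    - by move=> t _; rewrite lee_fin; case: ifP.
  rewrite integral_cst //= lebesgue_measure_itv /= lte_fin; case: ifP => _; last by rewrite mule0 ltry.
  by rewrite -EFinB -EFinM ltry.
Qed.

Section Bounded.
Variables (s : R) (d : R -> coefs R).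
Hypothesis hd : in_Linfty T s d.

(** A single mode is bounded by the H^s norm up to its weight, hence essentially bounded on
    [0, T]. *)
Lemma coef_integrable (m : int) i (f : C -> R) : (forall w, `|f w| <= nc w) ->
  measurable_fun ([set` `[0, T]] : set (measurableTypeR R)) (fun t => f (d t m 0 i)) ->
  mu.-integrable [set` `[0, tau]] (EFin \o (fun t => f (d t m 0 i))).
Proof.
move=> fn mf; apply: (@integrableS _ _ _ mu ([set` `[0, T]] : set (measurableTypeR R))) => //.
  by apply: subset_itvl; rewrite bnd_simp; case/andP: tauT.
have [_ [M hM]] := hd.
have w0 : 0 < wt s m by rewrite /wt powR_gt0 // ltr_pwDl ?sqr_ge0.
pose B := Num.sqrt (M ^+ 2 / wt s m).
apply/integrableP; split; first exact/measurable_EFinP.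
apply: (@le_lt_trans _ _ (\int[mu]_(t in [set` `[0%R, T]]) (cst B%:E t))%E).
  apply: ae_ge0_le_integral => //.
  - by apply/measurable_EFinP; apply: measurableT_comp.
  - by move=> t _; rewrite lee_fin sqrtr_ge0.
  - apply: negligibleS hM => t /= h1 h2; apply: h1 => tT; rewrite lee_fin.
    have [_ hn] := h2 tT; apply: le_trans (fn _) _.
    have p0 : 0 <= M ^+ 2 / wt s m by rewrite divr_ge0 ?sqr_ge0 // ltW.
    rewrite -ler_sqr ?nnegrE ?nc_ge0 ?sqrtr_ge0 // /B sqr_sqrtr // ler_pdivlMr // mulrC.
    apply: le_trans (le_Hnorm `|m|%N hn).
    rewrite (bigD1_seq m) ?win_uniq ?mem_win //=.
    apply: (@le_trans _ _ (wt s m * sqv (d t m))).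
      rewrite ler_pM2l // /sqv (bigD1 i) //= lerDl sumr_ge0 // => i' _; exact: sqr_ge0.
    by rewrite lerDl sumr_ge0 // => m' _; apply: mulr_ge0 (wt_ge0 _ _) (sqv_ge0 _).
rewrite integral_cst //= lebesgue_measure_itv /= lte_fin; case: ifP => _; last by rewrite mule0 ltry.
by rewrite -EFinB -EFinM ltry.
Qed.

Lemma pairing_test (u : R -> coefs R) : time_derivative T u d ->
  \int[mu]_(t in `[0, T]) pairing (test t) (d t) =
  complex.Re (conjc z * (u tau k 0 j - u 0 k 0 j)) + complex.Re (z * (u tau (- k) 0 j - u 0 (- k) 0 j)).
Proof.
move=> ud; have tI : tau \in `[0, T] by rewrite in_itv.
pose P t := complex.Re (conjc z * d t k 0 j) + complex.Re (z * d t (- k) 0 j).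
have -> : \int[mu]_(t in `[0, T]) pairing (test t) (d t) = \int[mu]_(t in [set` `[0, tau]]) P t.
  have -> : ([set` `[0, tau]] : set R) = [set` `[0, T]] `&` [set` `[0, tau]].
    rewrite setIidr //; apply: subset_itvl; rewrite bnd_simp; by case/andP: tauT.
  rewrite Rintegral_mkcondr; apply: eq_Rintegral => t _; rewrite patchE /test.
  have -> : (t \in ([set` `[0, tau]] : set R)) = (t \in `[0, tau]).
    by rewrite mem_setE.
  by case: ifP => _; [rewrite pairing_tmode|rewrite pairing0].
have [md _] := hd.
have iR m i : mu.-integrable [set` `[0, tau]] (EFin \o (fun t => complex.Re (d t m 0 i))).
  by apply: coef_integrable => [w|]; [exact: Re_le_nc|exact: (md m i).1].
have iI m i : mu.-integrable [set` `[0, tau]] (EFin \o (fun t => complex.Im (d t m 0 i))).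
  by apply: coef_integrable => [w|]; [exact: Im_le_nc|exact: (md m i).2].
have inc m i : u tau m 0 i - u 0 m 0 i = integralC `[0, tau] (fun t => d t m 0 i).
  by rewrite (ud tau tI m i) addrAC subrr add0r.
have Rc : complex.Re (conjc z) = complex.Re z by case: z.
have Ic : complex.Im (conjc z) = - complex.Im z by case: z.
rewrite !inc /integralC.
have iZ (v : R) (f : R -> R) : mu.-integrable [set` `[0, tau]] (EFin \o f) ->
    mu.-integrable [set` `[0, tau]] (EFin \o (fun t => v * f t)).
  by move=> hf; apply: (integrableZl (mitv 0 tau) v hf).
have iD (f f' : R -> R) : mu.-integrable [set` `[0, tau]] (EFin \o f) -> mu.-integrable [set` `[0, tau]] (EFin \o f') ->
    mu.-integrable [set` `[0, tau]] (EFin \o (fun t => f t + f' t)).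
  by move=> hf hf'; apply: (integrableD (mitv 0 tau) hf hf').
have -> : P = fun t => (complex.Re z * complex.Re (d t k 0 j) + complex.Im z * complex.Im (d t k 0 j)) +
     (complex.Re z * complex.Re (d t (- k) 0 j) + (- complex.Im z) * complex.Im (d t (- k) 0 j)).
  by apply/funext => t; rewrite /P !Re_mul Rc Ic; ring.
rewrite !RintegralD ?RintegralZl //; first by rewrite !Re_mul Rc Ic /=; ring.
all: by [exact: mitv|apply: iZ|apply: iD; apply: iZ].
Qed.

End Bounded.
End Test.

(* Testing the time derivatives against the modes on [0, tau] recovers the increments of the
   coefficients at each fixed time. *)
Lemma weak_limit_coef (T tau s : R) (u_ : nat -> R -> coefs R) (u : R -> coefs R) (c0 ct : coefs R) :
  0 <= tau <= T -> weakstar_W1infty T s u_ u ->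
  (forall k j, (fun i => complex.Re (u_ i 0 k 0 j)) @ \oo --> complex.Re (c0 k 0 j)) ->
  (forall k j, (fun i => complex.Im (u_ i 0 k 0 j)) @ \oo --> complex.Im (c0 k 0 j)) ->
  (forall k j, (fun i => complex.Re (u_ i tau k 0 j)) @ \oo --> complex.Re (ct k 0 j)) ->
  (forall k j, (fun i => complex.Im (u_ i tau k 0 j)) @ \oo --> complex.Im (ct k 0 j)) ->
  u 0 = c0 -> rcoefs (u tau) -> rcoefs ct -> forall k, u tau k = ct k.
Proof.
move=> tauT [_ [du_ [du [hu_ hu [i1 i2 hw]]]]] r0 m0 rt mt u0 rcu rcc.
have key k j (z : C) :
    complex.Re (conjc z * (u tau k 0 j - u 0 k 0 j)) + complex.Re (z * (u tau (- k) 0 j - u 0 (- k) 0 j)) =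
    complex.Re (conjc z * (ct k 0 j - c0 k 0 j)) + complex.Re (z * (ct (- k) 0 j - c0 (- k) 0 j)).
  have := hw _ (test_in_L1 T tau k j z (- s)).
  rewrite (pairing_test k j z tauT i2 hu).
  under eq_fun => i do rewrite (pairing_test k j z tauT (i1 i) (hu_ i)).
  move=> h1; apply: (cvg_unique _ h1) => //.
  have h z' k' : (fun i => complex.Re (z' * (u_ i tau k' 0 j - u_ i 0 k' 0 j))) @ \oo -->
      complex.Re (z' * (ct k' 0 j - c0 k' 0 j)).
    under eq_fun => i do rewrite Re_mul !(Re_add, Im_add, Re_opp, Im_opp).
    rewrite Re_mul !(Re_add, Im_add, Re_opp, Im_opp).
    by apply: cvgB; apply: cvgM; try exact: cvg_cst; apply: cvgB.
  by apply: cvgD; apply: h.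
move=> k; apply/rowP => j.
have cj (a : coefs R) : rcoefs a -> a (- k) 0 j = conjc (a k 0 j) by move=> ->; rewrite mxE.
(* The choices z = 1 and z = i isolate real and imaginary parts: by reality of the limits, the modes
   k and -k contribute equally to their difference. *)
have := key k j 1; have := key k j (0 +i* 1); rewrite u0 !(cj (u tau)) // !(cj ct) //.
case: (u tau k 0 j) (ct k 0 j) (c0 k 0 j) (c0 (- k) 0 j) => [a1 a2] [b1 b2] [d1 d2] [e1 e2].
rewrite !Re_mul /= => h1 h2; congr (_ +i* _); lra.
Qed.

End WeakLimit.

(** * Conclusion *)

Section Convergence.
Context {R : realType}.
Local Notation C := R[i].
Local Notation V := 'rV[R[i]]_3.
Local Notation mu := (@lebesgue_measure R).

(** The bound of [interp_error] taken at the final time, where it is largest; the added 1 makes it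
    positive. *)
Definition error_const (Y T : R) : R :=
  Num.sqrt (8 * ((6 * (7 * (6 * (1 + Y))) ^+ 2 + 3 * (2 * (6 * (1 + Y)) ^+ 2)) * (68 * Y) * T *
     expR ((3 * (2 * (6 * (1 + Y)) ^+ 2) + 7) * T) + 32 * Y) + 12 * Y) + 1.

Lemma error_const_gt0 Y T : 0 < error_const Y T.
Proof. by rewrite ltr_wpDl ?sqrtr_ge0. Qed.

Variables (S0 : circle R -> 'rV[R]_3) (T Y : R) (c : R -> int -> V).
Let G : R := 6 * (1 + Y).
Hypothesis cS0 : contV S0.
Hypothesis T0 : 0 < T.
Hypothesis Hc : forall t : R, 0 <= t <= T -> rcoefs (c t) /\ forall n, yn n (c t) <= Y.
Hypothesis HD : forall k, DV T (fun t => c t k) (fun t => Gc (c t) k).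
Hypothesis HE : forall A n (s t : R), 0 <= A -> 2 * A <= n.+1%:R ^+ 4 -> 0 <= s -> s <= t -> t <= T ->
  `|EA A n (c t) - EA A n (c s)| <= rate * (1 + Y) ^+ 2 * (t - s).
Hypothesis Hc0 : forall k, c 0 k = fourier S0 k.

Let cG (t : R) : 0 <= t <= T -> forall n, ln n (c t) <= G.
Proof.
move=> tT n; apply: le_trans (ln_le _ _) _; rewrite /G ler_pM2l // lerD2l.
by have [_ h] := Hc tT.
Qed.

Let sum0 : summ G (c 0).
Proof. by have [] := summ_ln (cG (t := 0) _); rewrite // lexx ltW. Qed.

Let S0_ser0 z : S0 z = serR (c 0) z.
Proof.
have -> : c 0 = fourier S0 by apply/funext.
apply: (serR_fourier cS0); have -> : fourier S0 = c 0 by apply/funext => k; rewrite Hc0.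
exact: sum0.
Qed.

Lemma lattice_error n (SN : R -> 'I_n.*2.+1 -> 'rV[R]_3) (t : R) :
  lattice_solution (fun k => S0 (node k)) SN -> 0 <= t <= T ->
  (Hnorm 2^-1 (fun k => (fourierC (interp (SN t)) k - c t k)%R) <= (error_const Y T / n.*2.+1%:R)%:E)%E.
Proof.
move=> [sph ini der] tT; have cY t' : 0 <= t' <= T -> forall m, yn m (c t') <= Y.
  by move=> h; have [] := Hc h.
have rc t' : 0 <= t' <= T -> rcoefs (c t') by move=> h; have [] := Hc h.
have t00 : 0 <= (0 : R) <= T by rewrite lexx ltW.
pose X t' k := toC (SN t' k).
have X_DV k : DV T (fun t => X t k) (fun t => crossC (X t k) (lam (X t) k)).
  have := has_deriv_DV (T := T) (f := fun t => SN t k)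
    (df := fun t => cross (SN t k) (lattice_absgrad (SN t) k)).
  move=> h; have {}h := h (fun t' tT' => der t' k (proj1 (andP tT'))).
  congr (DV _ _ _): h; apply/funext => t'.
  by rewrite toC_cross toC_lattice_absgrad.
have X_real t' k : 0 <= t' -> conjv (X t' k) = X t' k.
  by move=> _; apply/rowP => j; rewrite !mxE; exact: conjc_real.
have X_init k : X 0 k = ser (c 0) (node k).
  by rewrite /X ini S0_ser0 (toC_serR sum0 (rc _ t00)).
apply: le_trans (interp_error cY HD HE rc X_DV X_real X_init tT (fun k => erefl)) _.
have Y0 : 0 <= Y by apply: le_trans (yn_ge0 0 (c t)) (cY t tT 0).
rewrite lee_fin ler_pM2r ?invr_gt0 ?ltr0n // /error_const.
set a := 3 * _ + 7; set b := _ * (68 * Y).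
have a0 : 0 <= a by apply: addr_ge0 => //; apply: mulr_ge0 => //; apply: mulr_ge0 => //; exact: sqr_ge0.
have b0 : 0 <= b.
  apply: mulr_ge0; last exact: mulr_ge0.
  by apply: addr_ge0; apply: mulr_ge0 => //; [exact: sqr_ge0|apply: mulr_ge0 => //; exact: sqr_ge0].
move: tT => /andP[t0 tT].
have h : b * t * expR (a * t) <= b * T * expR (a * T).
  apply: ler_pM; [exact: mulr_ge0|exact: expR_ge0|exact: ler_wpM2l|].
  by rewrite ler_expR ler_wpM2l.
have b1 : 0 <= b * t * expR (a * t) by apply: mulr_ge0 (expR_ge0 _); exact: mulr_ge0.
move: (b * t * _) (b * T * _) h b1 => x y xy x0.
apply: (@le_trans _ _ (Num.sqrt (8 * (y + 32 * Y) + 12 * Y))); last by rewrite lerDl.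
by rewrite ler_sqrt; lra.
Qed.

Lemma weak_limit_unique (SN : forall n : nat, R -> 'I_n.*2.+1 -> 'rV[R]_3) (T1 eps : R)
    (W : R -> circle R -> 'rV[R]_3) (sigma : nat -> nat) (t : R) :
  (forall n, lattice_solution (fun k => S0 (node k)) (SN n)) ->
  weak_solution T1 S0 W -> {homo sigma : m n / (m < n)%N} ->
  weakstar_W1infty T1 (- 2^-1 - eps) (fun i t => fourierC (interp (SN (sigma i) t)))
    (fun t => fourier (W t)) ->
  0 <= t <= T1 -> t <= T -> {ae mu, forall x : R, W t (expi x) = serR (c t) (expi x)}.
Proof.
move=> hSN [Wb _ _ W0] hs hw tT1 tT; have [t0 tT1'] := andP tT1.
have tI : 0 <= t <= T by rewrite t0.
have I0 : 0 <= (0 : R) <= T by rewrite lexx ltW.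
have L2 t' : 0 <= t' <= T1 -> rintV (W t').
  by move=> h; apply: in_L2_rintV; have [] := Wb t' _; rewrite ?in_itv.
have L20 : rintV (W 0) by apply: L2; rewrite lexx (le_trans t0).
(* A strictly increasing sequence dominates the identity, so 1/N along the subsequence is at most
   [harmonic i]. *)
have si i : (i <= sigma i)%N.
  by elim: i => // i IH; apply: leq_ltn_trans IH (hs _ _ (ltnSn i)).
have dist t' k j i : 0 <= t' <= T ->
    Normc.normc ((fourierC (interp (SN (sigma i) t')) k - c t' k) 0 j) <= error_const Y T * harmonic i.
  move=> h; apply: le_trans (mode_le_Hnorm k j _ (lattice_error (hSN (sigma i)) h)) _.
    by rewrite invr_ge0.
  rewrite ler_pM2l ?error_const_gt0 // lef_pV2 ?posrE ?ltr0n // ler_nat ltnS.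
  by apply: leq_trans (si i) _; rewrite -addnn leq_addr.
have e0 : (fun i => error_const Y T * harmonic i) @ \oo --> (0 : R).
  by rewrite -[0](mulr0 (error_const Y T)); apply: cvgM; [exact: cvg_cst|exact: cvg_harmonic].
have cRe t' k j : 0 <= t' <= T ->
    (fun i => complex.Re (fourierC (interp (SN (sigma i) t')) k 0 j)) @ \oo --> complex.Re (c t' k 0 j).
  move=> h; apply: (dist_cvg e0) => i; apply: le_trans (dist t' k j i h).
  by rewrite entryB distrC -Re_opp -Re_add; exact: Re_le_nc.
have cIm t' k j : 0 <= t' <= T ->
    (fun i => complex.Im (fourierC (interp (SN (sigma i) t')) k 0 j)) @ \oo --> complex.Im (c t' k 0 j).
  move=> h; apply: (dist_cvg e0) => i; apply: le_trans (dist t' k j i h).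
  by rewrite entryB distrC -Im_opp -Im_add; exact: Im_le_nc.
have W00 : fourier (W 0) = c 0.
  by rewrite (fourier_ae_eq L20 (contV_rintV cS0) W0); apply/funext => k; rewrite Hc0.
have [rct _] := Hc tI; have [hsum _] := summ_ln (cG tI).
have e := weak_limit_coef tT1 hw (fun k j => cRe 0 k j I0) (fun k j => cIm 0 k j I0)
  (fun k j => cRe t k j tI) (fun k j => cIm t k j tI) W00 (rcoefs_fourier (L2 t tT1)) rct.
apply: fourier_ae (L2 t tT1) (contV_rintV (contV_serR hsum)) _ => k.
by rewrite e (fourier_serR hsum rct).
Qed.

End Convergence.

Local Close Scope complex_scope.

Theorem theorem2 (R : realType) :
  exists (Tstar : R -> R) (C : R -> R -> R -> R),
    (forall r, 0 < Tstar r) /\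
    (forall a b r, 0 < C a b r) /\
    forall S0 : circle R -> 'rV[R]_3, in_HS2 (5 / 2) S0 ->
    let r := fine (Hnorm (5 / 2) (fourier S0)) in
    exists S : R -> circle R -> 'rV[R]_3,
      strong_solution (Tstar r) S0 S /\
      (forall S' : R -> circle R -> 'rV[R]_3,
         strong_solution (Tstar r) S0 S' ->
         forall t z, 0 <= t < Tstar r -> S' t z = S t z) /\
      forall SN : forall n : nat, R -> 'I_n.*2.+1 -> 'rV[R]_3,
        (forall n, lattice_solution (fun k => S0 (node k)) (SN n)) ->
        (forall (T eps : R) (W : R -> circle R -> 'rV[R]_3)
                (sigma : nat -> nat),
           0 < T -> 0 < eps ->
           weak_solution T S0 W ->
           {homo sigma : m n / (m < n)%N} ->
           weakstar_Linfty T 2^-1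
             (fun i t => fourierC (interp (SN (sigma i) t)))
             (fun t => fourier (W t)) ->
           weakstar_W1infty T (- 2^-1 - eps)
             (fun i t => fourierC (interp (SN (sigma i) t)))
             (fun t => fourier (W t)) ->
           forall t, 0 <= t <= T -> t < Tstar r ->
             {ae lebesgue_measure, forall x : R,
                W t (expi x) = S t (expi x)}) /\
        (forall (n : nat) (a b : R),
           0 <= a -> a <= b -> b < Tstar r ->
           (ereal_sup [set Hnorm 2^-1 (fun k =>
                         (fourierC (interp (SN n t)) k
                          - fourier (S t) k)%R) | t in `[a, b]]
              <= (C a b r / (n.*2.+1)%:R)%:E)%E).
Proof.
have r2 (r : R) : 0 <= 2 * r ^+ 2 by apply: mulr_ge0 => //; exact: sqr_ge0.
have Tpos (r : R) : 0 < lifespan (2 * r ^+ 2).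
  rewrite /lifespan invr_gt0; apply: mulr_gt0; first exact: rate_gt0.
  exact: ltr_pwDl.
(* 2 r^2 bounds [yn] of the datum, since 1 + |k|^5 <= 2 (1 + k^2)^{5/2}. *)
exists (fun r => lifespan (2 * r ^+ 2)).
(* The energy bounds hold up to and including the lifespan, so one constant serves every compact
   interval before it. *)
exists (fun _ _ r => error_const (2 * (1 + 2 * r ^+ 2)) (lifespan (2 * r ^+ 2))).
split=> //; split=> [_ _ r|S0 [cS0 sS0 [L2 fin]] r]; first exact: error_const_gt0.
have {}cS0 : contV S0 by apply/contVP.
have rc0 := rcoefs_fourier (contV_rintV cS0).
have hY0 n : yn n (fourier S0) <= 2 * r ^+ 2 by apply: yn_Hnorm.
have [c [cn [K [[Hcn HK Hc HD HE] Hc0]]]] := coef_solution rc0 hY0.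
have T0 := Tpos r; set T := lifespan _ in T0 HK Hcn Hc HD HE *.
set Y := 2 * (1 + _) in Hcn Hc HE *.
have [K0 HK'] := HK.
have cG (t : R) : 0 <= t <= T -> summ (6 * (1 + Y)) (c t).
  move=> tT; suff /summ_ln[] : forall n, ln n (c t) <= 6 * (1 + Y) by [].
  by move=> n; apply: le_trans (ln_le _ _) _; rewrite ler_pM2l // lerD2l; have [_] := Hc t tT.
exists (fun t => serR (c t)); split.
  exact: (strong_serR cS0 sS0 T0 Hcn HK' Hc HD HE Hc0).
split=> [S' hS' t z|SN hSN].
  exact: (strong_unique T0 Hcn HK' Hc hS').
split=> [T1 eps W sigma _ _ hW hs _ hw t tT1 tT|n a b a0 ab bT].
  exact: (weak_limit_unique cS0 T0 Hc HD HE Hc0 hSN hW hs hw tT1 (ltW tT)).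
apply: ge_ereal_sup => _ [t /= tab <-]; move: tab; rewrite in_itv /= => /andP[at_ tb].
have tT : 0 <= t <= T by rewrite (le_trans a0 at_) (le_trans tb (ltW bT)).
have [rct _] := Hc t tT.
have -> : fourier (serR (c t)) = c t by apply/funext => k; rewrite (fourier_serR (cG t tT) rct).
exact: (lattice_error cS0 T0 Hc HD HE Hc0 (hSN n) tT).
Qed.
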